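(* Let $q=r^f>3$, where $r$ is a prime and $f$ is a positive integer. Suppose that $G$ is a finite group with $\mathrm{cod}(G)=\mathrm{cod}(\mathrm{PSL}(2,q))$. Then $G\cong \mathrm{PSL}(2,q)$.
   Context: For a finite group $G$, $\mathrm{Irr}(G)$ denotes the set of irreducible complex characters of $G$. For $\chi\in\mathrm{Irr}(G)$, the codegree of $\chi$ is $\mathrm{cod}(\chi)=|G:\ker\chi|/\chi(1)$, and $\mathrm{cod}(G)=\{\mathrm{cod}(\chi)\mid \chi\in\mathrm{Irr}(G)\}$. *)

(* Defs.v *)
From HB Require Import structures.
From mathcomp Require Import all_boot all_order all_algebra all_fingroup all_solvable all_field all_character.
Set Implicit Arguments. Unset Strict Implicit. Unset Printing Implicit Defensive.
Import GRing.Theory Num.Theory.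
Local Open Scope ring_scope.

Definition cod (gT : finGroupType) (G : {group gT}) (i : Iirr G) : algC :=
  (#|G : cfker 'chi[G]_i|%g)%:R / 'chi[G]_i 1%g.

Definition codset (gT : finGroupType) (G : {group gT}) : pred algC :=
  [pred x | [exists i : Iirr G, cod i == x]].

Section SL2.
Variable F : finFieldType.

Definition SL2_set : {set {'GL_2[F]}} :=
  [set g : {'GL_2[F]} | \det (GLval g) == 1].

Lemma SL2_group_set : group_set SL2_set.
Proof.
apply/group_setP; split.
  by rewrite inE GL_1E det1.
move=> x y; rewrite !inE => /eqP dx /eqP dy.
by rewrite GL_MxE det_mulmx dx dy mulr1.
Qed.

Canonical SL2_group := Group SL2_group_set.

Definition PSL2 : {group coset_of 'Z(SL2_group)} := (SL2_group / 'Z(SL2_group))%G.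
End SL2.

(* Main.v *)
(** Write q(q^2-1)/d for the order of PSL(2,q). A group whose codegrees are those of PSL(2,q) is shown to be
    simple, of the same order, with irreducible degrees q, q - e, (q + e)/d or q + e, where e = 1 or -1.
    In such a simple group the block structure at r, and Galois twists of characters, produce a character of
    degree q behaving like the Steinberg character; 1 plus it is the permutation character on the q + 1 Sylow
    r-subgroups. The action is 2-transitive with an abelian regular point stabilizer P and a torus T inverted
    by every element swapping two points; T acts irreducibly on P, so P becomes the additive group of F_q, and
    an involution swapping two points is forced to be x -> -b^2/x. The group is thus a group of Moebius maps.
    A minimal normal subgroup N of a non-simple example would be a small central p-group, which is impossible
    by comparing sums of squares of degrees. The degrees of PSL(2,q) itself come from the partition of the
    noncentral elements of SL(2,q) by centralizers: subtracting a multiple of a character induced from the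
    centre, the restrictions to the two tori have squared norms whose sum is at most 2. *)
From HB Require Import structures.
From mathcomp Require Import all_boot all_order all_algebra all_fingroup all_solvable all_field all_character zify ring lra.
Require Import Defs.
Set Implicit Arguments. Unset Strict Implicit. Unset Printing Implicit Defensive.
Import Order.TTheory GRing.Theory Num.Theory.
Local Open Scope ring_scope.

(** Only one inclusion of codegrees is used: [cod_ok] asks that nonprincipal codegrees lie in the
    list, not that the list be attained, so no character table of PSL(2,q) is needed. With k = q - e
    and h = (q + e)/d, the numbers q, k, h are pairwise coprime. Hence each nonprincipal degree q,
    k, h or dh contains the full part of the order qkh at the primes of one factor; the character
    has defect zero there and vanishes on elements of order divisible by such a prime. A column of
    the character table of the unknown group thus becomes an integer equation 1 + qt + kB + hM = 0
    in which whole terms drop out, and Cauchy-Schwarz against the centralizer order leaves one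
    solution. Vanishing is proved with ordinary characters only, by counting factorizations of x
    into p^m factors up to a twisted rotation; integrality of t, B, M is Galois invariance. The
    obstacle is d = 2: the torus then has two nontrivial orbits on P, so squares and nonsquares need
    separate treatment, and e decides whether -1 is a square. *)

(** * Divisibility of algebraic integers and twisted rotations of tuples *)

(** The constant term of the minimal polynomial is, up to sign, the product of the conjugates. If
    a/N is integral, so is every conjugate divided by N, so a nonzero constant term is at least N in
    absolute value; N = p^M is unbounded. *)
Lemma Aint_divn_all_eq0 (p : nat) (a : algC) :
  (1 < p)%N -> (forall M : nat, a / (p ^ M)%:R \in Aint) -> a = 0.
Proof.
move=> p_gt1 aM; apply/eqP/negPn/negP=> nz_a.
have [P [DP monP dvP]] := minCpolyP a.
have [r Dr] := closed_field_poly_normal (minCpoly a).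
rewrite (monicP (minCpoly_monic a)) scale1r in Dr.
have Aa: a \in Aint by have := aM 0; rewrite expn0 divr1.
have Zc: (minCpoly a)`_0 \in Num.int by move/polyOverP: Aa; apply.
have nzc: (minCpoly a)`_0 != 0.
  apply: contra nz_a => c0; have: root (minCpoly a) 0 by rewrite rootE horner_coef0.
  rewrite DP => rP0.
  have: 'X %| P by rewrite -['X]subr0 -polyC0 dvdp_XsubCl -(fmorph_root (ratr : rat -> algC)) rmorph0.
  case/dvdpP=> Q DQ.
  have Qn0: Q != 0 by apply: contraTneq (monic_neq0 monP) => Q0; rewrite DQ Q0 mul0r eqxx.
  apply: contraTT (root_minCpoly a) => nza.
  have: ~~ root (map_poly (ratr : rat -> algC) Q) a.
    rewrite dvP DQ; apply/negP=> /dvdp_leq -/(_ Qn0).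
    by rewrite size_mulX // ltnn.
  rewrite DP DQ rmorphM /= rootM map_polyX => nrQ.
  by rewrite negb_or nrQ /root hornerX.
have sz_r: (0 < size r)%N.
  have := size_minCpoly a; rewrite Dr size_prod_XsubC; by case: (size r).
(* Substituting X/N in the minimal polynomial of a/N gives a rational polynomial vanishing at a,
   hence at each conjugate z; so z/N is a root of the integral minimal polynomial of a/N. *)
have rt: forall M, all (fun z => z / (p ^ M)%:R \in Aint) r.
  move=> M; apply/allP=> z zr; set N : algC := _%:R.
  have nzN: N != 0 by rewrite pnatr_eq0 -lt0n expn_gt0 ltnW.
  have [Q [DQ monQ dvQ]] := minCpolyP (a / N).
  have := aM M; rewrite -/N => /polyOverP ZQ.
  have := root_minCpoly (a / N); rewrite DQ => rQ.
  pose Nr : rat := (p ^ M)%:R.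
  have NNr : ratr Nr = N by rewrite /Nr rmorph_nat.
  have Ecomp y: (map_poly (ratr : rat -> algC) (Q \Po (Nr^-1 *: 'X))).[y] = (map_poly (ratr : rat -> algC) Q).[y / N].
    rewrite map_comp_poly horner_comp /= map_polyZ /= map_polyX hornerZ hornerX.
    have ->: ratr Nr^-1 = N^-1 :> algC by rewrite fmorphV /= /Nr rmorph_nat.
    by rewrite mulrC.
  have ra: root (map_poly (ratr : rat -> algC) (Q \Po (Nr^-1 *: 'X))) a by rewrite rootE Ecomp; apply/eqP/rootP.
  rewrite dvP in ra; have rz: root (minCpoly a) z by rewrite Dr root_prod_XsubC.
  have: root (map_poly (ratr : rat -> algC) (Q \Po (Nr^-1 *: 'X))) z.
    by case/dvdpP: ra => S ->; rewrite rmorphM /= rootM -DP rz orbT.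
  rewrite rootE Ecomp => rzN.
  apply: (@root_monic_Aint (minCpoly (a / N))) => //.
  - by rewrite DQ rootE.
  - exact: minCpoly_monic.
  - exact/polyOverP.
have cprod: `|(minCpoly a)`_0| = `|\prod_(z <- r) z|.
  rewrite -horner_coef0 Dr horner_prod.
  under eq_bigr do rewrite hornerXsubC sub0r.
  by rewrite !normr_prod; apply: eq_bigr => z _; rewrite normrN.
have big M: `|(minCpoly a)`_0| >= (p ^ M)%:R.
  set N : algC := _%:R.
  have N1: 1 <= N by rewrite ler1n expn_gt0 ltnW.
  have nzN: N != 0 by rewrite gt_eqF // (lt_le_trans ltr01).
  have Ez: (\prod_(z <- r) (z / N)) = (\prod_(z <- r) z) / N ^+ size r.
    by rewrite big_split /= big_const_seq count_predT iter_mulr_1 exprVn.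
  have Aq: (minCpoly a)`_0 / N ^+ size r \in Aint.
    have Aq: \prod_(z <- r) (z / N) \in Aint.
      by rewrite big_seq; apply: rpred_prod => z zr; apply: (allP (rt M)).
    have: (minCpoly a)`_0 = (-1) ^+ size r * \prod_(z <- r) z.
      rewrite -horner_coef0 Dr horner_prod.
      under eq_bigr do rewrite hornerXsubC sub0r -mulN1r.
      by rewrite big_split /= big_const_seq count_predT iter_mulr_1.
    move=> ->; rewrite -mulrA -Ez; apply: rpredM => //.
    by rewrite rpredX // rpredN rpred1.
  have Zq: (minCpoly a)`_0 / N ^+ size r \in Num.int.
    apply: Cint_rat_Aint => //; rewrite rpred_div //; last by rewrite rpredX // rpred_nat.
    by rewrite rpred_Crat // ; move: Zc; case/intrP=> z ->; rewrite rpred_int.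
  have := norm_intr_ge1 Zq; rewrite mulf_eq0 (negPf nzc) /= invr_eq0 expf_eq0 (negPf nzN) andbF /=.
  move/(_ isT); rewrite normrM normfV ler_pdivlMr ?normr_gt0 ?expf_neq0 // mul1r normrX.
  apply: le_trans; rewrite ger0_norm; last exact: le_trans ler01 N1.
  by rewrite -{1}[N]expr1 ler_weXn2l.
have [m Dm] : exists m : nat, `|(minCpoly a)`_0| = m%:R by apply/natrP; rewrite natr_norm_int.
have := big m; rewrite Dm ler_nat leqNgt; apply/negP/negPn; exact: ltn_expl.
Qed.

(** [F] is constant on each orbit of [s], so an orbit contributes its length, a multiple of [d],
    times an algebraic integer. *)
Lemma sum_perm_orbits_Aint (T : finType) (s : {perm T}) (P : pred T) (F : T -> algC) (d : nat) :
    (forall x, P (s x) = P x) -> (forall x, F (s x) = F x) ->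
    (forall x, P x -> F x \in Aint) ->
    (forall x, P x -> (d %| #|porbit s x|)%N) ->
  (\sum_(x | P x) F x) / d%:R \in Aint.
Proof.
move=> Ps Fs AF dP; have [-> | d_gt0] := posnP d; first by rewrite invr0 mulr0 rpred0.
have orb x y : y \in porbit s x -> P y = P x /\ F y = F x.
  case/porbitP=> i ->; elim: i => [|i [IP IF]]; first by rewrite expg0 perm1.
  by rewrite expgSr permM Ps Fs.
rewrite (partition_big (porbit s) [in porbits s]) /=; last first.
  by move=> x _; apply: imset_f.
rewrite mulr_suml rpred_sum // => O /imsetP[x _ ->].
rewrite (eq_bigl (fun y => P x && (y \in porbit s x))); last first.
  move=> y; rewrite -eq_porbit_mem eq_sym; apply: andb_id2r => /eqP yx.
  by have [|-> //] := orb x y; rewrite -eq_porbit_mem yx.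
have [Px | nPx] := boolP (P x); last by rewrite big_pred0 ?mul0r ?rpred0.
under eq_bigr => y /orb[_ ->] do [].
rewrite sumr_const; have /dvdnP[e ->] := dP x Px.
rewrite mulrnA -[_ *+ d]mulr_natr mulfK ?pnatr_eq0 -?lt0n //.
by rewrite rpredMn // AF.
Qed.

Section TwistedRotation.
Variables (gT : finGroupType) (k : nat).
Implicit Type x : gT.

(** Sends (a, t) to (t, a^x). It preserves the property of having product x, and k + 1 iterations
    conjugate every entry by x; it plays for factorizations of x the part of cyclic rotation for
    factorizations of 1. *)
Definition twist x (t : (k.+1).-tuple gT) : (k.+1).-tuple gT :=
  [tuple of rcons (behead t) (thead t ^ x)%g].

Lemma twist_inj x : injective (twist x).
Proof.
case/tupleP=> a t; case/tupleP=> b u /(congr1 val) /=.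
rewrite !theadE => /rcons_inj[tu ab]; apply/val_inj => /=.
by rewrite tu; move/conjg_inj: ab => ->.
Qed.

Definition twistp x := perm (@twist_inj x).

Lemma twist_iter x n (t : (k.+1).-tuple gT) : (n <= k.+1)%N ->
  iter n (twist x) t = drop n t ++ map (conjg^~ x) (take n t) :> seq gT.
Proof.
elim: n => [|n IHn] lenk; first by rewrite drop0 take0 cats0.
rewrite iterS /=; have := IHn (ltnW lenk).
set u := iter _ _ _; move: u => u; case/tupleP: u => a u /=; rewrite theadE => Du.
have szt: (n < size t)%N by rewrite size_tuple.
move: Du; rewrite (drop_nth a szt) /= => -[-> ->].
by rewrite rcons_cat (take_nth a szt) map_rcons.
Qed.

Lemma twist_iter_full x (t : (k.+1).-tuple gT) :
  iter k.+1 (twist x) t = map (conjg^~ x) t :> seq gT.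
Proof. by rewrite twist_iter // drop_oversize ?take_oversize ?size_tuple. Qed.

Lemma twist_iter_fulln x n (t : (k.+1).-tuple gT) :
  iter (n * k.+1) (twist x) t = map (conjg^~ (x ^+ n)%g) t :> seq gT.
Proof.
elim: n t => [|n IHn] t; first by rewrite expg0 map_id_in // => y _; rewrite conjg1.
rewrite mulSn iterD twist_iter_full IHn -map_comp; apply: eq_map => y /=.
by rewrite expgSr conjgM.
Qed.

End TwistedRotation.

(** Block number i is the conjugate by y^i of the first block Y, and the product of the Y^(y^i)
    telescopes. *)
Lemma prod_quasi_periodic (gT : finGroupType) (u : nat -> gT) (d e : nat) (y : gT) :
    (forall l, (l + d < e * d)%N -> u (l + d)%N = (u l ^ y)%g) ->
  (\prod_(0 <= l < e * d) u l = (\prod_(0 <= l < d) u l * y^-1) ^+ e * y ^+ e)%g.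
Proof.
move=> Du; set Y := (\prod_(0 <= l < d) u l)%g.
have shift i l : (i < e)%N -> (l < d)%N -> u (i * d + l)%N = (u l ^ (y ^+ i))%g.
  elim: i => [|i IHi] lti ltl; first by rewrite expg0 conjg1.
  have -> : (i.+1 * d + l)%N = (i * d + l + d)%N by lia.
  rewrite Du; last by nia.
  by rewrite IHi ?(ltnW lti) // -conjgM -expgSr.
suffices: forall i, (i <= e)%N ->
  (\prod_(0 <= l < i * d) u l = (Y * y^-1) ^+ i * y ^+ i)%g by apply.
elim=> [|i IHi] lti; first by rewrite mul0n big_nil !expg0 mulg1.
rewrite (@big_cat_nat _ _ _ (i * d)) //=; last by nia.
rewrite IHi ?(ltnW lti) //.
have -> : (\prod_(i * d <= l < i.+1 * d) u l = Y ^ (y ^+ i))%g.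
  rewrite /Y -{1}[(i * d)%N]add0n big_addn.
  have -> : (i.+1 * d - i * d = d)%N by rewrite mulSn addnK.
  rewrite (big_morph (conjg^~ (y ^+ i)%g) (fun a b => conjMg a b _) (conj1g _)).
  rewrite big_nat [RHS]big_nat; apply: eq_bigr => l /andP[_ ltl].
  by rewrite addnC shift.
rewrite [X in _ = (X * _)%g]expgSr [X in _ = (_ * X)%g]expgS.
by rewrite conjgE !mulgA mulgK mulgKV.
Qed.

(** * Vanishing of characters of defect zero, and rational character sums *)

Section DefectZero.
Variables (gT : finGroupType) (G : {group gT}) (i : Iirr G).
Local Notation chi := ('chi[G]_i).

Lemma irr_convolution x : x \in G ->
  \sum_(g in G) chi g * chi (g^-1 * x)%g = #|G|%:R / chi 1%g * chi x.
Proof.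
move=> Gx; have := generalized_orthogonality_relation x i i.
rewrite eqxx mul1r => /(canRL (mulVKf (neq0CG G))) E.
rewrite -mulrA [_^-1 * chi x]mulrC -E (reindex_inj invg_inj) /=.
by apply: eq_big => [g|g _]; rewrite ?groupV ?invgK 1?mulrC.
Qed.

Lemma big_tupleS (n : nat) (T : finType) (P : pred (n.+1.-tuple T)) (F : n.+1.-tuple T -> algC) :
  \sum_(t | P t) F t = \sum_(a : T) \sum_(t : n.-tuple T | P [tuple of a :: t]) F [tuple of a :: t].
Proof.
rewrite pair_big_dep /= (reindex (fun p : T * n.-tuple T => [tuple of p.1 :: p.2])) //=.
exists (fun t => (thead t, [tuple of behead t])) => [[a t] _ | t _] /=.
  by rewrite theadE; congr (_, _); apply: val_inj.
by case/tupleP: t => a t; apply: val_inj.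
Qed.

Definition prod_tuples n x : pred (n.-tuple gT) :=
  fun t => all (fun z => z \in G) t && ((\prod_(z <- t) z)%g == x).

(** Convolving chi with itself multiplies it by |G|/chi(1); n such convolutions, expanded, run over
    the tuples of n + 1 elements with product x. *)
Lemma irr_convolution_power n x : x \in G ->
  \sum_(t : n.+1.-tuple gT | prod_tuples x t) \prod_(z <- t) chi z
    = (#|G|%:R / chi 1%g) ^+ n * chi x.
Proof.
elim: n x => [|n IHn] x Gx.
  rewrite expr0 mul1r big_tupleS (bigD1 x) //= [X in _ + X]big1 => [|a /negPf nax].
    rewrite (big_pred1 [tuple]) => [|t]; first by rewrite big_seq1 addr0.
    by rewrite tuple0 /prod_tuples /= Gx big_seq1 !eqxx.
  by rewrite big_pred0 // => t; rewrite tuple0 /prod_tuples /= big_seq1 nax andbF.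
rewrite exprS -mulrA mulrCA -irr_convolution // mulr_sumr big_tupleS.
rewrite [RHS]big_mkcond; apply: eq_bigr => a _; have [Ga | nGa] := ifPn; last first.
  by rewrite big_pred0 // => t; rewrite /prod_tuples /= (negPf nGa).
rewrite mulrCA -IHn ?groupM ?groupV // mulr_sumr; apply: eq_big => [t|t _]; last by rewrite big_cons.
by rewrite /prod_tuples /= Ga big_cons /= -[in RHS](inj_eq (mulgI a)) mulKVg.
Qed.

(* Orbits of the twisted rotation on factorisations of [x] into [p ^ m] factors. *)
Lemma twist_orbit_dvd (p m e : nat) (x : gT) (k := (p ^ m).-1) (t : k.+1.-tuple gT) :
    prime p -> (logn p #|G| <= e)%N -> (e <= m)%N -> x \in G -> (p %| #[x]%g)%N ->
    prod_tuples x t ->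
  (p ^ (m - e).+1 %| #|porbit (twistp k x) t|)%N.
Proof.
move=> p_pr le_e le_em Gx p_x /andP[/allP Gt /eqP Pt].
have k1 : k.+1 = (p ^ m)%N by rewrite prednK // expn_gt0 prime_gt0.
set s := twistp k x; set j := #|_|.
have j_gt0 : (0 < j)%N by apply/card_gt0P; exists t; apply: porbit_id.
have sE n (u : k.+1.-tuple gT) : iter n s u = iter n (twist x) u.
  by elim: n => //= n ->; rewrite permE.
have fixj n : iter (n * j) (twist x) t = t.
  by rewrite -sE; elim: n => // n IHn; rewrite mulSn iterD IHn iter_porbit.
have e_gt0 : (0 < e)%N.
  apply: leq_trans le_e; rewrite logn_gt0 mem_primes p_pr cardG_gt0 /=.
  exact: dvdn_trans p_x (order_dvdG Gx).
(* If the orbit length j were not divisible by p^(m - e + 1), a Bezout relation between j and p^m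
   would make t invariant under a shift by d = p^v, with v at most m - e, up to conjugation by a
   power of x. Then [prod_quasi_periodic] applies to the product x of t. *)
apply/negPn/negP=> ndv.
have [v le_v Dd] : exists2 v, (v <= m - e)%N & gcdn j (p ^ m) = (p ^ v)%N.
  have /(dvdn_pfactor _ _ p_pr)[v _ Dv] := dvdn_gcdr j (p ^ m).
  exists v => //; rewrite leqNgt; apply: contra ndv => lt_v.
  by apply: dvdn_trans (dvdn_gcdl j (p ^ m)); rewrite Dv dvdn_exp2l.
have le_ev : (e + v <= m)%N by rewrite -leq_subRL.
have le_vm : (v <= m)%N by apply: leq_trans le_ev; apply: leq_addl.
have [a b Dab _] := egcdnP (p ^ m) j_gt0.
rewrite Dd in Dab; set d := (p ^ v)%N in Dab Dd.
have d_gt0: (0 < d)%N by rewrite expn_gt0 prime_gt0.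
have le_dk : (d <= k.+1)%N by rewrite k1 leq_exp2l ?prime_gt1.
set f := (p ^ (m - v))%N.
have Df : k.+1 = (f * d)%N by rewrite k1 -expnD subnK.
have Dt : map (conjg^~ (x ^+ b)%g) (drop d t ++ map (conjg^~ x) (take d t)) = t.
  rewrite -twist_iter // -twist_iter_fulln -iterD.
  have -> : (b * k.+1 + d = a * j)%N by rewrite k1 Dab.
  by rewrite fixj.
set y := (x ^- b)%g.
have cxy : commute x y by apply/commuteV/commuteX.
have szt: size t = (f * d)%N by rewrite size_tuple Df.
have Dper l : (l + d < f * d)%N -> nth 1%g t (l + d) = (nth 1%g t l ^ y)%g.
  move=> ltl; rewrite -{2}Dt (nth_map 1%g); last first.
    rewrite size_cat size_map addnC -size_cat cat_take_drop szt.
    by apply: leq_ltn_trans ltl; apply: leq_addr.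
  rewrite nth_cat size_drop szt ltn_subRL [(d + l)%N]addnC ltl nth_drop.
  by rewrite -conjgM mulgV conjg1 addnC.
have := prod_quasi_periodic Dper.
set Y := (\prod_(0 <= l < d) _)%g.
rewrite -szt -(big_nth _ predT id) Pt => Dx.
have GY : Y \in G.
  rewrite /Y big_nat group_prod // => l /andP[_ ltl].
  by apply/Gt/mem_nth; rewrite szt -Df; apply: leq_trans ltl le_dk.
have Gz : (Y * y^-1)%g \in G by rewrite groupM // groupV groupV groupX.
have Dz : ((Y * y^-1) ^+ f = x ^+ (1 + b * f))%g.
  by move/(canLR (mulgK _)): Dx => <-; rewrite /y expVgn invgK -expgM expgD expg1.
have f_e : (e <= m - v)%N by rewrite leq_subRL // addnC.
have p_f : (p %| f)%N by rewrite Euclid_dvdX // dvdnn; apply: leq_trans e_gt0 f_e.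
(* Since p divides f and the order of x, it is prime to 1 + bf and divides the order of z^f = x^(1 +
   bf), where z = Y y^-1. But p^e divides f, which kills the p-part of z. *)
have : (p %| #[((Y * y^-1) ^+ f)]%g)%N.
  have: (p %| (1 + b * f) * #[(x ^+ (1 + b * f))]%g)%N.
    by apply: dvdn_trans p_x _; rewrite order_dvdn expgM expg_order.
  rewrite Dz Euclid_dvdM // => /orP[|//].
  by rewrite dvdn_addl ?dvdn_mull // dvdn1 => /eqP p1; move: p_pr; rewrite p1.
move: (Y * y^-1)%g Gz => z Gz p_zf.
have dvf : (#[z]%g`_p %| f)%N.
  rewrite p_part dvdn_exp2l //; apply: leq_trans f_e; apply: leq_trans le_e.
  by rewrite dvdn_leq_log // order_dvdG.
have: (#[z ^+ f]%g %| #[z]%g`_p^')%N.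
  by rewrite order_dvdn -expgM -order_dvdn -{1}(partnC p (order_gt0 z)) dvdn_mul.
move/(dvdn_trans p_zf); apply/negP; rewrite -prime_coprime //.
by rewrite (pnat_coprime (pnat_id p_pr)) ?part_pnat.
Qed.

(** By [irr_convolution_power], c^k chi(x) with k + 1 = p^m is a sum over factorizations of x. The
    orbits of the twisted rotation make it divisible by any given power of p for m large, and c is
    prime to p, so chi(x) is divisible by every p^M. *)
Theorem irr_defect0_vanish (p c : nat) x :
    prime p -> #|G|%:R / chi 1%g = c%:R -> coprime p c ->
    x \in G -> (p %| #[x]%g)%N -> chi x = 0.
Proof.
move=> p_pr Dc cop Gx p_x; apply: (Aint_divn_all_eq0 (prime_gt1 p_pr)) => M.
(* [twist_orbit_dvd] loses p^e, at most the p-part of |G|; the exponent M + e compensates for it. *)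
set e := logn p #|G|; set m := (M + e)%N; set k := (p ^ m).-1.
have k1 : k.+1 = (p ^ m)%N by rewrite prednK // expn_gt0 prime_gt0.
have nzp n : (p ^ n)%:R != 0 :> algC by rewrite pnatr_eq0 -lt0n expn_gt0 prime_gt0.
have A1 : c%:R ^+ k * chi x / (p ^ M.+1)%:R \in Aint.
  rewrite -Dc -irr_convolution_power //.
  apply: (@sum_perm_orbits_Aint _ (twistp k x)) => [t|t|t _|t Pt].
  - rewrite permE; case/tupleP: t => a t; rewrite /prod_tuples /= theadE /=.
    rewrite all_rcons /= groupJr //; congr (_ && _).
    rewrite -cats1 big_cat big_seq1 big_cons /=.
    apply/eqP/eqP=> [/(canRL (mulgK _)) -> | <-].
      by rewrite conjgE !invMg invgK !mulgA mulgK mulgV mul1g.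
    by rewrite conjgE !invMg !mulgA mulgV mul1g mulVg mul1g.
  - rewrite permE; case/tupleP: t => a t /=; rewrite theadE -cats1 big_cat big_seq1 big_cons /=.
    by rewrite cfunJ // mulrC.
  - by apply: rpred_prod => z _; apply: Aint_irr.
  have -> : M.+1 = (m - e).+1 by rewrite /m addnK.
  by apply: twist_orbit_dvd => //; rewrite leq_addl.
have cop' : coprime (p ^ M) (c ^ k) by rewrite coprimeXl // coprimeXr.
have A2 : c%:R ^+ k * chi x / (p ^ M)%:R \in Aint.
  have -> : c%:R ^+ k * chi x / (p ^ M)%:R = c%:R ^+ k * chi x / (p ^ M.+1)%:R * p%:R.
    by rewrite expnSr natrM invfM -!mulrA mulVf ?mulr1 // -[p in p%:R]expn1.
  by rewrite rpredM // rpred_nat.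
have c_gt0 : (0 < c ^ k)%N.
  by rewrite expn_gt0 lt0n; case: eqP cop => // ->; rewrite /coprime gcdn0 => /eqP p1; move: p_pr; rewrite p1.
have [u v Duv _] := egcdnP (p ^ M) c_gt0.
have := Duv; rewrite gcdnC (eqP cop') => /(congr1 (fun n => n%:R : algC)).
rewrite natrD !natrM natrX => D1.
have -> : chi x / (p ^ M)%:R = u%:R * (c%:R ^+ k * chi x / (p ^ M)%:R) - v%:R * chi x.
  rewrite !mulrA D1 !mulrDl mul1r mulrAC mulfK ?nzp // [v%:R * chi x + _]addrC addrK //.
by rewrite rpredB // rpredM ?Aint_irr // rpred_nat.
Qed.
End DefectZero.

(** Galois conjugation only permutes the terms, so the sum is rational, and it is an algebraic
    integer. *)
Lemma Cint_sum_aut_irr (gT : finGroupType) (G : {group gT}) (f : Iirr G -> algC) g :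
    (forall (u : {rmorphism algC -> algC}) i, f (aut_Iirr u i) = f i) ->
    (forall i, f i \in Num.int) ->
  \sum_i f i * 'chi_i g \in Num.int.
Proof.
move=> fu Zf; have [Gg|nGg] := boolP (g \in G); last first.
  by rewrite big1 ?rpred0 // => i _; rewrite cfun0 ?mulr0.
apply: Cint_rat_Aint; last first.
  by apply: rpred_sum => i _; rewrite rpredM ?Aint_irr ?Aint_Cint.
have [Qn galQn [QnC gQnC [w _ QnG]]] := group_num_field_exists G.
have /fin_all_exists[a Da] i : exists a, QnC a = 'chi[G]_i g.
  by have [a Da] := QnG _ G _ (irr_char i) g (order_dvdG Gg); exists a.
have /fin_all_exists[b Db] i : exists b : rat, f i = ratr b.
  by have /intrP[z ->] := Zf i; exists z%:~R; rewrite rmorph_int.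
have DS : \sum_i f i * 'chi_i g = QnC (\sum_i b i *: a i).
  rewrite rmorph_sum; apply: eq_bigr => i _ /=.
  by rewrite rmorphZ_num Da Db.
set s := \sum_i b i *: a i in DS.
have fix_s : s \in fixedField 'Gal({:Qn} / 1)%g.
  apply/fixedFieldP; rewrite ?memvf // => nu Gnu; apply: (fmorph_inj QnC).
  have [nuC DnuC] := gQnC nu; rewrite DnuC -DS rmorph_sum /=.
  rewrite [RHS](reindex_inj (aut_Iirr_inj nuC)); apply: eq_bigr => i _ /=.
  rewrite fu rmorphM aut_IirrE cfunE; congr (_ * _).
  by have /intrP[z ->] := Zf i; rewrite rmorph_int.
rewrite (galois_fixedField galQn) in fix_s.
have /vlineP[c Dc] := fix_s.
by rewrite DS Dc rmorphZ_num rmorph1 mulr1 Crat_rat.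
Qed.

(** * Parameters of PSL(2,q), character degrees and Cauchy-Schwarz *)

(** The sign e unifies q = 1 and q = 3 modulo 4: for odd q, k is the one of q - 1 and q + 1
    divisible by 4, so h = (q + e)/2 is odd and q, k, h are pairwise coprime. For even q the
    convention is e = 1. In all cases |PSL(2,q)| = qkh. *)
Record psl_params (r q k h d : nat) (e : int) : Prop := PslParams {
  par_prime : prime r;
  par_qE : exists2 f, (0 < f)%N & q = (r ^ f)%N;
  par_q_gt3 : (3 < q)%N;
  par_kE : k%:Z = q%:Z - e;
  par_hE : (d * h)%:Z = q%:Z + e;
  par_caseE : [/\ d = 1%N, r = 2%N & e = 1]
    \/ [/\ d = 2%N, odd r, (4 %| k)%N & e = 1 \/ e = -1] }.

Section Params.
Variables (r q k h d : nat) (e : int).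
Hypothesis par : psl_params r q k h d e.

Lemma par_e1 : e = 1 \/ e = -1.
Proof. by case: (par_caseE par) => [[_ _ ->] | []]; [left|]. Qed.

Lemma par_ge3 : (2 < k)%N /\ (2 < h)%N.
Proof.
have := par_q_gt3 par; have := par_kE par; have := par_hE par.
case: (par_caseE par) => [[-> _ ->] | [-> _ /dvdnP[j ->] [] ->]]; lia.
Qed.

Lemma par_r_q : (r %| q)%N.
Proof. by have [f f0 ->] := par_qE par; rewrite dvdn_exp. Qed.

Lemma par_pq p : prime p -> (p %| q)%N -> p = r.
Proof.
move=> pp; have [f f0 ->] := par_qE par; rewrite Euclid_dvdX // => /andP[pr _].
by apply/eqP; rewrite -(dvdn_prime2 pp (par_prime par)).
Qed.

Lemma par_coprime_qk : coprime q k.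
Proof.
have := par_kE par; have := par_q_gt3 par; case: par_e1 => -> q3 E.
  by have -> : q = k.+1 by [lia]; rewrite coprimeSn.
by have -> : k = q.+1 by [lia]; rewrite coprimenS.
Qed.

Lemma par_coprime_qh : coprime q h.
Proof.
suffices : coprime q (d * h) by rewrite coprimeMr => /andP[].
have := par_hE par; have := par_q_gt3 par; case: par_e1 => -> q3 E.
  by have -> : (d * h = q.+1)%N by [lia]; rewrite coprimenS.
by have {1}-> : q = (d * h).+1 by [lia]; rewrite coprimeSn.
Qed.

Lemma par_odd_h : d = 2%N -> odd h.
Proof.
move=> d2; have := par_hE par; have := par_kE par; rewrite d2.
case: (par_caseE par) => [[D _ _] | [_ _ /dvdnP[j ->] [] ->]]; first by rewrite d2 in D.
  by lia.
by lia.
Qed.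

Lemma par_even_q : d = 1%N -> ~~ odd q.
Proof.
move=> d1; have [f f0 ->] := par_qE par.
case: (par_caseE par) => [[_ -> _] | [D]]; last by rewrite d1 in D.
by rewrite oddX /= orbF -lt0n f0.
Qed.

Lemma par_coprime_kh : coprime k h.
Proof.
have kE := par_kE par; have hE := par_hE par.
case: (par_caseE par) => [[d1 _ De] | [d2 _ d4 De]].
  have oq := par_even_q d1; have q3 := par_q_gt3 par.
  rewrite d1 De mul1n in kE hE; have -> : h = (k + 2)%N by lia.
  rewrite /coprime gcdnDl -/(coprime _ _) coprimen2; lia.
have oh := par_odd_h d2; rewrite d2 in hE; have [_ h3] := par_ge3.
case: De => De; rewrite De in kE hE.
  have -> : k = (2 * h.-1)%N by lia.
  rewrite coprimeMl coprime2n oh /=.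
  by rewrite -{2}(prednK (ltnW (ltnW h3))) coprimenS.
have -> : k = (2 * h.+1)%N by lia.
by rewrite coprimeMl coprime2n oh /= coprimeSn.
Qed.

Lemma par_coprime_mu mu : (0 < mu <= d)%N -> [/\ coprime q mu & coprime h mu].
Proof.
case: (par_caseE par) => [[-> _ _] | [d2 or _ _]].
  by move=> mu1; have -> : mu = 1%N by [lia]; rewrite !coprimen1.
rewrite d2 => mu1; have oh := par_odd_h d2.
have oq : odd q by have [f f0 ->] := par_qE par; rewrite oddX or orbT.
have [->|->] : mu = 1%N \/ mu = 2%N by lia.
  by rewrite !coprimen1.
by rewrite !coprimen2.
Qed.

Lemma par_d_gt0 : (0 < d <= 2)%N.
Proof. by case: (par_caseE par) => [[->] | [->]]. Qed.

Lemma par_dkh : (d * (k * h) + 1 = q * q)%N.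
Proof.
have X : (k * (d * h))%:Z = (q%:Z - e) * (q%:Z + e).
  by rewrite PoszM (par_kE par) (par_hE par).
rewrite mulnCA; move: (k * (d * h))%N X => n; case: par_e1 => ->; lia.
Qed.
End Params.

Section Degrees.
Variables (gT : finGroupType) (G : {group gT}).

Definition degn (i : Iirr G) : nat := Num.truncn ('chi_i 1%g).

Lemma degnE i : 'chi_i 1%g = (degn i)%:R.
Proof. by rewrite /degn irr1_degree natrK. Qed.

Lemma degn_gt0 i : (0 < degn i)%N.
Proof. by have := irr1_gt0 i; rewrite degnE ltr0n. Qed.

Lemma sum_degn_sqr : (\sum_i degn i ^ 2 = #|G|)%N.
Proof.
apply/eqP; rewrite -(eqr_nat algC) -[X in _ == X]mulr1n.
have := cfRegE G 1%g; rewrite eqxx => <-; rewrite cfReg_sum sum_cfunE natr_sum.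
by apply/eqP/eq_bigr => i _; rewrite cfunE degnE -natrM.
Qed.

Lemma degn0 : degn 0 = 1%N.
Proof. by apply/eqP; rewrite -(eqr_nat algC) -degnE irr0 cfun11. Qed.

Lemma sum_degn_irr g : g != 1%g -> \sum_i (degn i)%:R * 'chi[G]_i g = 0.
Proof.
move=> ng1; have := cfRegE G g; rewrite (negPf ng1) mulr0n => E; rewrite -[RHS]E.
by rewrite cfReg_sum sum_cfunE; apply: eq_bigr => i _; rewrite cfunE degnE.
Qed.

(** |G| is 1 plus the squares of the nonprincipal degrees, so m divides 1. *)
Lemma common_degn_dvd1 m : (m %| #|G|)%N -> (forall i, i != 0 -> (m %| degn i)%N) -> m = 1%N.
Proof.
move=> mG md; apply/eqP; rewrite -dvdn1.
move: mG; rewrite -sum_degn_sqr (bigD1 0) //= degn0 dvdn_addl //.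
by apply: dvdn_sum => i /md mi; rewrite expnS dvdn_mulr.
Qed.

Lemma degn_dvd i : (degn i %| #|G|)%N.
Proof. by rewrite -dvdC_nat; have := dvd_irr1_cardG i; rewrite degnE. Qed.

Lemma degn_sqr_le i : (degn i ^ 2 <= #|G|)%N.
Proof. by rewrite -sum_degn_sqr (bigD1 i) //= leq_addr. Qed.

Lemma irr_vanish (p c : nat) i x : prime p -> (c * degn i)%N = #|G| -> coprime p c ->
  x \in G -> (p %| #[x]%g)%N -> 'chi[G]_i x = 0.
Proof.
move=> pp Dc; apply: irr_defect0_vanish => //.
by rewrite degnE -Dc natrM mulfK // pnatr_eq0 -lt0n degn_gt0.
Qed.

Lemma sum_irr_norm g : g \in G -> \sum_i `|'chi[G]_i g| ^+ 2 = #|'C_G[g]%g|%:R.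
Proof.
move=> Gg; have := second_orthogonality_relation g Gg.
rewrite class_refl mulr1n => <-; apply: eq_bigr => i _; exact: normCK.
Qed.

Lemma lin_nat_eq1 i : degn i = 1%N -> 'chi_i \is a linear_char.
Proof. by move=> d1; rewrite qualifE /= irr_char degnE d1 eqxx. Qed.
End Degrees.

(** Cauchy-Schwarz, from the squared distance of z to its projection t w, where t = S/W is real.
    Only the support of w enters the last sum, so that the bounds for disjoint supports can be
    added. *)
Lemma sum_weighted_sqr_le (I : finType) (w : I -> nat) (z : I -> algC) (S : algC) :
    S \is Num.real -> \sum_i (w i)%:R * z i = S ->
  S ^+ 2 <= (\sum_i w i ^ 2)%:R * \sum_(i | w i != 0%N) `|z i| ^+ 2.
Proof.
move=> rS DS; have [W0 | W_gt0] := posnP (\sum_i w i ^ 2)%N.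
  have w0 i : w i = 0%N.
    have /eqP := W0; rewrite sum_nat_eq0 => /forallP/(_ i)/=.
    by rewrite expn_eq0 andbT => /eqP.
  by rewrite -DS big1 ?expr0n ?W0 ?mul0r // => i _; rewrite w0 mul0r.
set W := (\sum_i _)%N in W_gt0 *.
have W0 : 0 < W%:R :> algC by rewrite ltr0n.
have [t Dt] : exists t, t = S / W%:R by exists (S / W%:R).
have cS : S^* = S by apply/CrealP.
have ct : t^* = t by rewrite Dt rmorphM fmorphV /= cS rmorph_nat.
have : 0 <= \sum_(i | w i != 0%N) `|z i - t * (w i)%:R| ^+ 2.
  by apply: sumr_ge0 => i _; rewrite exprn_ge0.
have -> : \sum_(i | w i != 0%N) `|z i - t * (w i)%:R| ^+ 2 =
  \sum_(i | w i != 0%N) `|z i| ^+ 2 - S ^+ 2 / W%:R.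
  transitivity (\sum_(i | w i != 0%N) (`|z i| ^+ 2 - t * ((w i)%:R * z i)
     - t * ((w i)%:R * z i)^* + t ^+ 2 * (w i ^ 2)%:R)).
    apply: eq_bigr => i _; rewrite !normCK !rmorphB !rmorphM /= ct !conjC_nat; ring.
  rewrite !big_split /= !sumrN -!mulr_sumr -natr_sum.
  have e1 : \sum_(i | w i != 0%N) (w i)%:R * z i = S.
    by rewrite -DS [RHS]big_mkcond /= big_mkcond; apply: eq_bigr => i _; case: eqP => // ->; rewrite mul0r.
  have e2 : (\sum_(i | w i != 0%N) w i ^ 2 = W)%N.
    by rewrite big_mkcond; apply: eq_bigr => i _; case: eqP => // ->.
  rewrite e1 -rmorph_sum e1 e2 /= cS Dt; field; exact: lt0r_neq0.
by rewrite subr_ge0 ler_pdivrMr // mulrC.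
Qed.

(** * Integer solutions of the degree and column equations *)

Section Arith.
Implicit Types q e c b a B M t : int.

Lemma sqr_ge_abs (m x : int) : 0 <= m -> m <= x \/ x <= - m -> m * m <= x * x.
Proof.
move=> m0 [h | h].
  have : 0 <= (x - m) * (x + m) by rewrite mulr_ge0; lia.
  by lia.
have : 0 <= (- x - m) * (- x + m) by rewrite mulr_ge0; lia.
by lia.
Qed.

Lemma mul_ge_abs (p Y X : int) : 0 <= p -> Y <> 0 -> X = p * Y -> p <= X \/ X <= - p.
Proof.
move=> p0 Y0 ->; have [Y1 | Y1] : 1 <= Y \/ Y <= -1 by lia.
  have : 0 <= p * (Y - 1) by rewrite mulr_ge0; lia.
  by lia.
have : 0 <= p * (- 1 - Y) by rewrite mulr_ge0; lia.
by lia.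
Qed.

(** Modulo q the degree equation gives 1 + a + b = uq; size alone yields u = 1 and c at most 2. For
    c = 2 one gets 4a = q - 4, and the column relation makes |M| too large for the bound [CS]. *)
Lemma arith_even q c b a B M :
    4 <= q -> 1 <= c -> 0 <= b -> 0 <= a ->
    1 + q * q * c + (q - 1) * (q - 1) * b + (q + 1) * (q + 1) * a = q * (q - 1) * (q + 1) ->
    1 + (q - 1) * B + (q + 1) * M = 0 -> M * M <= a * (q - 1) ->
  [/\ c = 1, 2 * b = q & 2 * a = q - 2].
Proof.
move=> q4 c1 b0 a0 E R CS.
pose u : int := q * q - 1 - c * q - (q - 2) * b - (q + 2) * a.
have E1 : 1 + a + b = u * q by rewrite /u; lia.
have E2 : (u - 1) * (q * q) + (c - 1) * q + 2 * (a - b) + u + 1 = 0.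
  have: q * ((u - 1) * (q * q) + (c - 1) * q + 2 * (a - b) + u + 1) = 0.
    have -> : q * ((u - 1) * (q * q) + (c - 1) * q + 2 * (a - b) + u + 1)
      = (u * q) * (q * q) - q * q * q + (c - 1) * (q * q) + 2 * q * (a - b) + u * q + q by ring.
    by rewrite -E1; lia.
  by nia.
clearbody u.
have u_gt0 : 0 < u by have: 0 < u * q by [lia]; rewrite pmulr_lgt0; lia.
have u1 : u = 1.
  have: u <= 1; last by lia.
  rewrite leNgt; apply/negP => u2.
  have h1 : 0 <= (u - 2) * ((q - 1) * (q - 1)) by rewrite !mulr_ge0; lia.
  have h2 : 0 <= (c - 1) * q by rewrite mulr_ge0; lia.
  have h3 : 0 <= q * (q - 4) by rewrite mulr_ge0; lia.
  lia.
rewrite u1 in E1 E2.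
have c2 : c < 3.
  rewrite ltNge; apply/negP=> c3.
  have h1 : 0 <= (c - 3) * q by rewrite mulr_ge0; lia.
  lia.
have [c1'|c2'] : c = 1 \/ c = 2 by lia.
  by rewrite c1' in E2 *; split; lia.
rewrite c2' in E2.
have Ea : 4 * a = q - 4 by lia.
have Y : (q - 1) * (B + M) = - (2 * M + 1) by lia.
have Y0 : B + M <> 0 by move=> Y0; rewrite Y0 in Y; lia.
have MM : (q - 2) * (q - 2) <= (2 * M) * (2 * M).
  apply: sqr_ge_abs; first by lia.
  have [|h|h] := mul_ge_abs _ Y0 (esym Y); lia.
have : 4 * (a * (q - 1)) = (q - 4) * (q - 1) by rewrite mulrA Ea.
by lia.
Qed.

(** Reduction modulo q now gives 4 + a + 4b = uq with u = 1 or 2, and u = 2 yields the answer. For u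
    = 1, q = e modulo 4 forces q - 4(c - 1) = e, hence 16b = q - 8 + 3e, which is too small for the
    bound on B. *)
Lemma arith_odd q e c b a B M :
    5 <= q -> (e = 1 \/ e = -1) -> 1 <= c -> 0 <= b -> 0 <= a ->
    (exists j, q - e = 4 * j) ->
    4 + 4 * (q * q * c) + 4 * ((q - e) * (q - e) * b) + (q + e) * (q + e) * a
      = 2 * (q * (q - e) * (q + e)) ->
    2 + 2 * ((q - e) * B) + (q + e) * M = 0 -> B * B <= b * (q - 1) ->
  [/\ c = 1, 4 * b = q - 2 + e & a = q - 2 - e].
Proof.
move=> q5 e1 c1 b0 a0 [j Dj] E R CS.
have ee : e * e = 1 by case: e1 => ->.
pose u : int := 2 * (q * q) - 2 - 4 * (c * q) - 4 * ((q - 2 * e) * b) - (q + 2 * e) * a.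
have E1 : 4 + a + 4 * b = u * q by rewrite /u; nia.
have E2 : (u - 2) * (q * q) + 4 * (c - 1) * q + 2 * e * (a - 4 * b) + u + 2 = 0.
  have: q * ((u - 2) * (q * q) + 4 * (c - 1) * q + 2 * e * (a - 4 * b) + u + 2) = 0.
    have -> : q * ((u - 2) * (q * q) + 4 * (c - 1) * q + 2 * e * (a - 4 * b) + u + 2)
      = (u * q) * (q * q) - 2 * (q * q * q) + 4 * (c - 1) * (q * q)
        + 2 * e * q * (a - 4 * b) + u * q + 2 * q by ring.
    rewrite -E1; by case: e1 => De; rewrite De in E *; lia.
  by nia.
clearbody u.
have De : (e * (a - 4 * b) <= u * q - 4) /\ (-(e * (a - 4 * b)) <= u * q - 4).
  by case: e1 => ->; lia.
have u_gt0 : 0 < u by have: 0 < u * q by [lia]; rewrite pmulr_lgt0; lia.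
have u12 : u = 1 \/ u = 2.
  have: u <= 2; last by lia.
  rewrite leNgt; apply/negP => u2.
  have h1 : 0 <= (u - 3) * ((q - 1) * (q - 1)) by rewrite !mulr_ge0; lia.
  have h2 : 0 <= (c - 1) * q by rewrite mulr_ge0; lia.
  have h3 : 0 <= (q - 3) * (q - 3) by rewrite mulr_ge0; lia.
  lia.
case: u12 => Du; rewrite Du in E1 E2 De; last first.
  have h : c < 2.
    rewrite ltNge; apply/negP=> c3.
    have h1 : 0 <= (c - 2) * q by rewrite mulr_ge0; lia.
    lia.
  have c1' : c = 1 by lia.
  by rewrite c1' in E2; case: e1 => De1; rewrite De1 in E2 *; split; lia.
exfalso.
pose i : int := q - 4 * (c - 1).
have Ei : 2 * (e * (a - 4 * b)) + 3 = q * i by rewrite /i; lia.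
have i1 : i = e.
  have il : -2 < i.
    rewrite ltNge; apply/negP=> ?.
    have : 0 <= q * (- 2 - i) by rewrite mulr_ge0; lia.
    lia.
  have ir: i < 2.
    rewrite ltNge; apply/negP=> ?.
    have : 0 <= q * (i - 2) by rewrite mulr_ge0; lia.
    lia.
  by rewrite /i in il ir *; case: e1 => De1; rewrite De1 in Dj *; lia.
rewrite i1 in Ei.
have Eb : 16 * b = q - 8 + 3 * e by case: e1 => De1; rewrite De1 in Ei *; lia.
pose W := M + 2 * B.
have EW : 4 * (e * B) - 2 = (q + e) * W by rewrite /W; lia.
clearbody W.
have W0 : W <> 0 by move=> W0; rewrite W0 in EW; case: e1 => De1; rewrite De1 in EW; lia.
have BB : (q + e - 2) * (q + e - 2) <= (4 * B) * (4 * B).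
  apply: sqr_ge_abs; first by case: e1 => ->; lia.
  have q_e : 0 <= q + e by case: e1 => ->; lia.
  by case: e1 => De1; rewrite De1 in q_e EW *; have [h|h] := mul_ge_abs q_e W0 EW; lia.
have : 16 * (b * (q - 1)) = (q - 8 + 3 * e) * (q - 1) by rewrite mulrA Eb.
by case: e1 => De1; rewrite De1 in BB *; lia.
Qed.

(** With Y = t + B the relation reads (q - 1)Y = -(t + 1). Y = 0 is the claim; otherwise |B| is at
    least q - 1, which the norm bound excludes. The next three lemmas follow this pattern;
    [theta_odd_k] also needs a lower bound on |t| when e = -1. *)
Lemma theta_even_h q b t B C :
  4 <= q -> 2 * b = q -> C <= q + 1 -> 1 + q * t + (q - 1) * B = 0 ->
  B * B + b * (t * t) <= b * (C - 1) -> t = -1.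
Proof.
move=> q4 Db DC E CS.
pose Y := t + B; have E2 : (q - 1) * Y = - (t + 1) by rewrite /Y; lia.
have DB : B = 1 + q * Y by rewrite /Y in E2 *; lia.
clearbody Y; have [Y0 | Y0] := eqVneq Y 0; first by rewrite Y0 in E2; lia.
have BB : (q - 1) * (q - 1) <= B * B.
  apply: sqr_ge_abs; first by lia.
  by have [||h|h] := @mul_ge_abs q Y (B - 1) _ (elimN eqP Y0); lia.
have h1 : 0 <= b * (t * t) by rewrite mulr_ge0 -?expr2 ?sqr_ge0 //; lia.
have h2 : 0 <= b * (q + 1 - C) by rewrite mulr_ge0; lia.
have h3 : b * (q + 1 - 1) * 2 = q * q by rewrite -Db; ring.
have h4 : 0 <= q * (q - 4) by rewrite mulr_ge0; lia.
lia.
Qed.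

Lemma theta_even_k q a t M C :
  4 <= q -> 2 * a = q - 2 -> C <= q - 1 -> 1 + q * t + (q + 1) * M = 0 ->
  M * M + a * (t * t) <= a * (C - 1) -> t = 1.
Proof.
move=> q4 Db DC E CS.
pose Y := t + M; have E2 : (q + 1) * Y = t - 1 by rewrite /Y; lia.
have DB : M = - 1 - q * Y by rewrite /Y in E2 *; lia.
clearbody Y; have [Y0 | Y0] := eqVneq Y 0; first by rewrite Y0 in E2; lia.
have BB : (q - 1) * (q - 1) <= M * M.
  apply: sqr_ge_abs; first by lia.
  by have [||h|h] := @mul_ge_abs q Y (- 1 - M) _ (elimN eqP Y0); lia.
have h1 : 0 <= a * (t * t) by rewrite mulr_ge0 -?expr2 ?sqr_ge0 //; lia.
have h2 : 0 <= a * (q - 1 - C) by rewrite mulr_ge0; lia.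
have h3 : a * (q - 2) * 2 = (q - 2) * (q - 2) by rewrite -Db; ring.
have h4 : 0 <= q * (q - 4) by rewrite mulr_ge0; lia.
lia.
Qed.

Lemma theta_odd_h q e b t B C :
  5 <= q -> (e = 1 \/ e = -1) -> 4 * b = q - 2 + e -> 2 * C <= q + e ->
  1 + q * t + (q - e) * B = 0 ->
  B * B + b * (t * t) <= b * (C - 1) -> t = - e.
Proof.
move=> q5 e1 Db DC E CS.
have ee : e * e = 1 by case: e1 => ->.
pose Y := t + B; have E2 : (q - e) * Y = - (e * t + 1) by rewrite /Y; lia.
have DB : B = e + e * (q * Y) by rewrite /Y in E2 *; case: e1 => De; rewrite De in E2 E *; lia.
clearbody Y; have [Y0 | Y0] := eqVneq Y 0.
  by rewrite Y0 in E2; case: e1 => De; rewrite De in E2 *; lia.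
have BB : (q - 1) * (q - 1) <= B * B.
  apply: sqr_ge_abs; first by lia.
  have q0 : 0 <= q by lia.
  by case: e1 => De; rewrite De in DB; [have [|h|h] := @mul_ge_abs q Y (B - 1) q0 (elimN eqP Y0)
    | have [|h|h] := @mul_ge_abs q Y (- B - 1) q0 (elimN eqP Y0)]; lia.
have b0 : 0 <= b by case: e1 => De; rewrite De in Db; lia.
have h1 : 0 <= b * (t * t) by rewrite mulr_ge0 -?expr2 ?sqr_ge0 //; lia.
have h2 : 0 <= b * (q + e - 2 * C) by rewrite mulr_ge0; lia.
have h3 : 4 * (b * (q + e - 2)) = (q - 2 + e) * (q + e - 2) by rewrite mulrA Db.
have h4 : 0 <= q * (q - 5) by rewrite mulr_ge0; lia.
by case: e1 => De; rewrite De in Db DC h2 h3 *; lia.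
Qed.

Lemma theta_odd_k q e a t M C :
  5 <= q -> (e = 1 \/ e = -1) -> (exists j, q - e = 4 * j) ->
  a = q - 2 - e -> C <= q - e -> 2 + 2 * (q * t) + (q + e) * M = 0 ->
  M * M + a * (t * t) <= a * (C - 1) -> t = e.
Proof.
move=> q5 e1 [j Dj] Da DC E CS.
have ee : e * e = 1 by case: e1 => ->.
pose Y := M + 2 * t; have E2 : (q + e) * Y = 2 * (e * t) - 2 by rewrite /Y; lia.
have DB : M = - 2 * e - e * (q * Y) by rewrite /Y in E2 *; case: e1 => De; rewrite De in E2 E *; lia.
clearbody Y; have [Y0 | Y0] := eqVneq Y 0.
  by rewrite Y0 in E2; case: e1 => De; rewrite De in E2 *; lia.
have q0 : 0 <= q by lia.
have BB : (q - 2) * (q - 2) <= M * M.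
  apply: sqr_ge_abs; first by lia.
  by case: e1 => De; rewrite De in DB; [have [|h|h] := @mul_ge_abs q Y (- M - 2) q0 (elimN eqP Y0)
    | have [|h|h] := @mul_ge_abs q Y (M - 2) q0 (elimN eqP Y0)]; lia.
have a0 : 0 <= a by case: e1 => De; rewrite De in Da; lia.
have h1 : 0 <= a * (t * t) by rewrite mulr_ge0 -?expr2 ?sqr_ge0 //; lia.
have h2 : 0 <= a * (q - e - C) by rewrite mulr_ge0; lia.
case: e1 => De; rewrite De in Da DC E2 Dj h2 *; first by rewrite Da in h1 h2 CS; lia.
have q7 : 7 <= q by lia.
have tt : 4 * 4 <= (2 * t) * (2 * t).
  apply: sqr_ge_abs => //.
  by have [||h|h] := @mul_ge_abs (q - 1) Y (- 2 * t - 2) _ (elimN eqP Y0); lia.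
have h3 : 0 <= a * (t * t - 4) by rewrite mulr_ge0; lia.
rewrite Da in h2 h3 CS; lia.
Qed.
End Arith.

(** * Order and degrees of a simple group with the prescribed codegrees *)

(** The listed values are qkh divided by q, by k and by mu h with mu at most d. Being a mere
    inclusion, the condition passes to quotients. *)
Definition cod_ok (q k h d : nat) (gT : finGroupType) (G : {group gT}) : Prop :=
  forall i : Iirr G, i != 0 -> exists2 c : nat, cod i = c%:R &
    [\/ c = (k * h)%N, c = (q * h)%N | exists2 mu, (0 < mu <= d)%N & (c * mu = q * k)%N].

Definition degree_ok (q k h d : nat) (gT : finGroupType) (G : {group gT}) : Prop :=
  forall i : Iirr G, i != 0 ->
    [\/ degn i = q, degn i = k | exists2 mu, (0 < mu <= d)%N & degn i = (mu * h)%N].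

Lemma cfker_irr_eqG gT (G : {group gT}) (i : Iirr G) : (cfker 'chi_i == G :> {set gT}) = (i == 0).
Proof. by rewrite eqEsubset cfker_sub /= subGcfker. Qed.

Lemma simple_cfker gT (G : {group gT}) (i : Iirr G) :
  simple G -> i != 0 -> cfker 'chi_i = 1%g.
Proof.
move=> sG i0; case/simpleP: sG => _ /(_ _ (cfker_normal 'chi_i))[//|kG].
by case/negP: i0; rewrite -cfker_irr_eqG kG.
Qed.

Lemma faithful_cod gT (G : {group gT}) (i : Iirr G) c :
  cfker 'chi_i = 1%g -> cod i = c%:R -> (c * degn i)%N = #|G|.
Proof.
move=> k1; rewrite /cod k1 indexg1 degnE => E; apply/eqP.
rewrite -(eqr_nat algC) natrM -E divfK // pnatr_eq0 -lt0n; exact: degn_gt0.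
Qed.

Lemma inv_Aint_nat (m : nat) (B : algC) : B \in Aint -> 1 + m%:R * B = 0 -> m = 1%N.
Proof.
move=> AB E; have m0 : m%:R != 0 :> algC.
  by apply: contra_eqN E => /eqP->; rewrite mul0r addr0 oner_neq0.
have DB : B = - m%:R^-1.
  by apply: (mulfI m0); rewrite mulrN mulfV // -[LHS](addKr 1) E addr0.
have: B \in Num.int by rewrite Cint_rat_Aint // DB rpredN rpredV rpred_nat.
rewrite DB rpredN => Zm; have mr : (0 : algC) < m%:R by rewrite lt_def m0 ler0n.
have := norm_intr_ge1 Zm; rewrite invr_eq0 m0 => /(_ isT).
rewrite normfV normr_nat invf_ge1 // lern1 => m1.
by apply/eqP; rewrite eqn_leq m1 lt0n -(pnatr_eq0 algC) m0.
Qed.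

Section SimpleOrder.
Variables (r q k h d : nat) (e : int).
Hypothesis par : psl_params r q k h d e.
Variables (gT : finGroupType) (G : {group gT}).
Hypotheses (simG : simple G) (codG : cod_ok q k h d G).

Lemma simple_codP (i : Iirr G) : i != 0 -> exists2 c : nat, (c * degn i)%N = #|G| &
    [\/ c = (k * h)%N, c = (q * h)%N | exists2 mu, (0 < mu <= d)%N & (c * mu = q * k)%N].
Proof.
move=> i0; have [c /(faithful_cod (simple_cfker simG i0)) Dc ?] := codG i0.
by exists c.
Qed.

Lemma prime_mulN a b : (1 < a)%N -> (1 < b)%N -> ~ prime (a * b).
Proof.
move=> a1 b1 /primeP[_ /(_ a (dvdn_mulr b (dvdnn a)))] /orP[/eqP Da | /eqP Da].
  by rewrite Da in a1.
by have := ltn_Pmulr b1 (ltnW a1); rewrite -Da ltnn.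
Qed.

(** A nonprincipal linear character is faithful, so G would be abelian of prime order; this order
    would be a codegree, and all listed codegrees are composite. *)
Lemma simple_nonlinear (i : Iirr G) : i != 0 -> degn i != 1%N.
Proof.
move=> i0; apply/eqP=> d1; have linG := lin_nat_eq1 d1.
have [k3 h3] := par_ge3 par; have q3 := par_q_gt3 par.
have abG : abelian G.
  have := lin_char_der1 linG; rewrite (simple_cfker simG i0) => /trivgP.
  by move/derG1P.
have pG : prime #|G| by apply: simple_sol_prime (abelian_sol abG) simG.
have [c Dc Hc] := simple_codP i0; rewrite d1 muln1 in Dc.
rewrite -Dc in pG; case: Hc => [E|E|[mu mu1 E]].
- by rewrite E in pG; apply: prime_mulN pG; lia.
- by rewrite E in pG; apply: prime_mulN pG; lia.
have mu12 : mu = 1%N \/ mu = 2%N by have := par_d_gt0 par; lia.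
case: mu12 => Dmu; rewrite Dmu ?muln1 in E.
  by rewrite E in pG; apply: prime_mulN pG; lia.
have d2 : d = 2%N by have := par_d_gt0 par; rewrite Dmu in mu1; lia.
case: (par_caseE par) => [[D _ _]|[_ _ /dvdnP[k' Dk] _]]; first by rewrite d2 in D.
have E' : c = (q * (2 * k'))%N by lia.
by rewrite E' in pG; apply: prime_mulN pG; lia.
Qed.

Lemma nonprincipal_nondvd (i : Iirr G) : i != 0 -> ~ (forall j : Iirr G, j != 0 -> (degn i %| degn j)%N).
Proof. by move=> i0 /(common_degn_dvd1 (degn_dvd i)) /eqP; apply/negP/simple_nonlinear. Qed.

(** By faithfulness |G| = c chi(1) with c a divisor of n0 = qkh, so |G|/gcd(|G|, n0) divides every
    nonprincipal degree and is 1. The degrees are then the expected ones divided by m = n0/|G|.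
    Coprimality, and the fact that no nonprincipal degree divides all others, reduce m > 1 to m = d
    = 2, which a column of the character table excludes. *)
Lemma simple_order_degrees : #|G| = (q * k * h)%N /\ degree_ok q k h d G.
Proof.
have [k3 h3] := par_ge3 par; have q3 := par_q_gt3 par.
set n := #|G|; set n0 := (q * k * h)%N.
have n0_gt0 : (0 < n0)%N by rewrite !muln_gt0; lia.
have n_gt0 : (0 < n)%N := cardG_gt0 G.
have dvc (i : Iirr G) : i != 0 -> exists c e' : nat, [/\ (c * degn i)%N = n, (c * e')%N = n0 &
    [\/ e' = q, e' = k | exists2 mu, (0 < mu <= d)%N & e' = (mu * h)%N]].
  move=> i0; have [c Dc Hc] := simple_codP i0; exists c.
  case: Hc => [Ec|Ec|[mu mu1 E]].
  - by exists q; split=> //; [rewrite Ec /n0; ring | constructor].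
  - by exists k; split=> //; [rewrite Ec /n0; ring | constructor].
  by exists (mu * h)%N; split=> //; [rewrite mulnA E | constructor 3; exists mu].
have n_n0 : (n %| n0)%N.
  have [E|] := eqVneq (n %/ gcdn n n0)%N 1%N.
    by rewrite -(divnK (dvdn_gcdl n n0)) E mul1n dvdn_gcdr.
  case/eqP; apply: common_degn_dvd1.
    by apply/dvdnP; exists (gcdn n n0); rewrite mulnC divnK ?dvdn_gcdl.
  move=> i /dvc[c [e' [Dc De' _]]].
  have c_gt0 : (0 < c)%N by rewrite lt0n; apply: contraTneq n_gt0 => c0; rewrite -Dc c0.
  have /dvdnP[x Dx] : (c %| gcdn n n0)%N by rewrite dvdn_gcd -Dc -De' !dvdn_mulr.
  have Dn : n = ((n %/ gcdn n n0) * gcdn n n0)%N by rewrite divnK ?dvdn_gcdl.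
  move: (n %/ gcdn n n0)%N Dn => y Dn; apply/dvdnP; exists x; apply/eqP.
  by rewrite -(eqn_pmul2l c_gt0) Dc Dn Dx; apply/eqP; ring.
case/dvdnP: n_n0 => m Dn0.
have Hd (i : Iirr G) : i != 0 -> [\/ (m * degn i)%N = q, (m * degn i)%N = k |
    exists2 mu, (0 < mu <= d)%N & (m * degn i)%N = (mu * h)%N].
  move=> /dvc[c [e' [Dc De' H]]].
  suffices -> : (m * degn i)%N = e' by [].
  have c_gt0 : (0 < c)%N by rewrite lt0n; apply: contraTneq n_gt0 => c0; rewrite -Dc c0.
  by apply/eqP; rewrite -(eqn_pmul2l c_gt0) De' Dn0 -Dc; apply/eqP; ring.
suffices m1 : m = 1%N.
  by split=> [|i /Hd]; [rewrite -/n -/n0 Dn0 m1 mul1n | rewrite m1 mul1n].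
have m_gt0 : (0 < m)%N by rewrite lt0n; apply: contraTneq n0_gt0 => m0; rewrite Dn0 m0.
have samedvd (i j : Iirr G) : (m * degn i = m * degn j)%N -> (degn i %| degn j)%N.
  by move/eqP; rewrite eqn_pmul2l // => /eqP->.
have [i1 i10] : {i1 : Iirr G | i1 != 0}.
  by apply: has_nonprincipal_irr; case/simpleP: simG.
pose tq (i : Iirr G) := (i != 0) && (m * degn i == q)%N.
pose tk (i : Iirr G) := (i != 0) && (m * degn i == k)%N.
have Hd' (i : Iirr G) : i != 0 -> ~~ tq i -> ~~ tk i -> exists2 mu, (0 < mu <= d)%N & (m * degn i)%N = (mu * h)%N.
  by move=> i0; rewrite /tq /tk i0 /=; case: (Hd i i0) => [->|->|//]; rewrite eqxx.
have [i /andP[i0 /eqP Di]|ntq] := pickP tq.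
  have mq : (m %| q)%N by rewrite -Di dvdn_mulr.
  have [j /andP[j0 nDj] | allq] := pickP (fun j : Iirr G => (j != 0) && (m * degn j != q)%N).
    apply/eqP; rewrite -dvdn1; case: (Hd j j0) => [E|E|[mu mu1 E]].
    - by rewrite E eqxx in nDj.
    - by rewrite -(eqP (par_coprime_qk par)) dvdn_gcd mq -E dvdn_mulr.
    have [c1 _] := par_coprime_mu par mu1.
    have cq : coprime q (mu * h) by rewrite coprimeMr c1 (par_coprime_qh par).
    by rewrite -(eqP cq) dvdn_gcd mq -E dvdn_mulr.
  case: (nonprincipal_nondvd i0) => j j0; apply: samedvd; rewrite Di.
  by have := allq j; rewrite j0 /= => /negbFE/eqP->.
have [i /andP[i0 /eqP Di]|ntk] := pickP tk; last first.
  pose th1 (i : Iirr G) := (i != 0) && (m * degn i == h)%N.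
  have [i /andP[i0 /eqP Di]|nth1] := pickP th1.
    case: (nonprincipal_nondvd i0) => j j0.
    have [||mu mu1 E] := Hd' j j0; rewrite ?ntq ?ntk //.
    by rewrite -(dvdn_pmul2l m_gt0) Di E dvdn_mull.
  have th2 (j : Iirr G) : j != 0 -> (m * degn j = 2 * h)%N.
    move=> j0; have [||mu mu1 E] := Hd' j j0; rewrite ?ntq ?ntk //.
    have [Dmu|<- //] : mu = 1%N \/ mu = 2%N by have := par_d_gt0 par; lia.
    by have := nth1 j; rewrite /th1 j0 E Dmu mul1n eqxx.
  by case: (nonprincipal_nondvd i10) => j j0; apply: samedvd; rewrite !th2.
have mk : (m %| k)%N by rewrite -Di dvdn_mulr.
have [j /andP[j0 nDj] | allk] := pickP (fun j : Iirr G => (j != 0) && (m * degn j != k)%N); last first.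
  case: (nonprincipal_nondvd i0) => j j0; apply: samedvd; rewrite Di.
  by have := allk j; rewrite j0 /= => /negbFE/eqP->.
have [||mu mu1 Ej] := Hd' j j0; rewrite ?ntq /tk ?j0 //.
have mmu : (m %| mu)%N.
  have cmh : coprime m h := coprime_dvdl mk (par_coprime_kh par).
  by rewrite -(Gauss_dvdl _ cmh) -Ej dvdn_mulr.
apply/eqP/negPn/negP=> m1.
have [Dm Dd] : m = 2%N /\ d = 2%N.
  have := dvdn_leq _ mmu; have := par_d_gt0 par; case/andP: mu1 => -> mud dd /(_ isT) mm.
  by move: m1 => /eqP; lia.
have oh := par_odd_h par Dd.
have mu2 mu' : (0 < mu' <= d)%N -> (2 %| mu')%N -> mu' = 2%N by rewrite Dd; case: mu' => [|[|[|]]].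
have Dh (l : Iirr G) : l != 0 -> ~~ tk l -> degn l = h.
  move=> l0 nl; have [||mu' mu'1 El] := Hd' l l0; rewrite ?ntq //.
  have : (m %| mu')%N.
    have cmh : coprime m h := coprime_dvdl mk (par_coprime_kh par).
    by rewrite -(Gauss_dvdl _ cmh) -El dvdn_mulr.
  rewrite Dm => /(mu2 _ mu'1) E; move: El; rewrite Dm E; lia.
(* The remaining degrees are k/2 and h. At an element of prime order p dividing h the characters of
   degree h vanish, leaving 1 + (k/2)B = 0 with B an algebraic integer, so k/2 = 1. *)
have [p pp ph] := pdivP (ltnW h3).
have pn : (p %| n)%N.
  have : (p %| n0)%N by rewrite dvdn_mull.
  rewrite Dn0 Dm Euclid_dvdM // => /orP[p2|//].
  have := dvdn_trans p2 (dvdnn 2); rewrite dvdn_prime2 // => /eqP p2'.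
  by move: ph; rewrite p2' dvdn2 oh.
have [x Gx ox] := Cauchy pp pn.
have x1 : x != 1%g by rewrite -order_eq1 ox; apply: contraTneq pp => ->.
have := sum_degn_irr G x1; rewrite (bigD1 0) //= degn0 irr0 cfun1E Gx mulr1.
rewrite (bigID tk) /= [X in _ + (_ + X)]big1 => [|l /andP[l0 nl]]; last first.
  rewrite (@irr_vanish _ _ p (k %/ 2 * q)%N l) ?mulr0 ?ox //.
  - rewrite Dh // -/n; have : (2 * n = q * k * h)%N by rewrite -/n0 Dn0 Dm.
    have : k = (2 * (k %/ 2))%N by rewrite mulnC divnK // -Dm.
    by move: (k %/ 2)%N (n) => y n' -> E2; clear -E2; lia.
  have c1 : coprime h (q * k).
    by rewrite coprimeMr coprime_sym (par_coprime_qh par) coprime_sym (par_coprime_kh par).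
  apply: coprime_dvdl ph _; apply: coprime_dvdr c1.
  by rewrite mulnC dvdn_mul // -{2}(divnK (_ : 2 %| k)%N) ?dvdn_mulr // -Dm.
rewrite addr0 => E.
have k2 : (k %/ 2 = 1)%N.
  apply: (@inv_Aint_nat _ (\sum_(i0 | (i0 != 0) && tk i0) 'chi[G]_i0 x)).
    by apply: rpred_sum => l _; apply: Aint_irr.
  rewrite -[RHS]E mulr_sumr; congr (_ + _); apply: eq_bigr => l /and3P[_ _ /eqP Dl].
  by congr (_ * _); rewrite -Dl Dm mulKn.
case: (par_caseE par) => [[D _ _]|[_ _ /dvdnP[k' Dk] _]]; first by rewrite Dd in D.
by move: k2 q3 k3; rewrite Dk; clear; lia.
Qed.
End SimpleOrder.

(** * Column equations and the Steinberg-like character *)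

Section Steinberg.
Variables (r q k h d : nat) (e : int).
Hypothesis par : psl_params r q k h d e.
Variables (gT : finGroupType) (G : {group gT}).
Hypotheses (cardG : #|G| = (q * k * h)%N) (degG : degree_ok q k h d G).
Implicit Types (i : Iirr G) (g x : gT).

(** Exactly one of the three weights is nonzero at a nonprincipal character, and the degree is
    [q * wtQ + k * wtK + h * wtH]; thus [wtH] is the factor mu of a degree mu h. *)
Definition wtQ i : nat := (degn i == q).
Definition wtK i : nat := (degn i == k).
Definition wtH i : nat :=
  if [|| i == 0, degn i == q | degn i == k] then 0%N else (degn i %/ h)%N.

Lemma neq_qk : q != k.
Proof.
apply: contraTneq (par_coprime_qk par) => <-.
by rewrite /coprime gcdnn; have := par_q_gt3 par; case: (q) => [|[|]].
Qed.

Lemma degn_wt i : degn i = ((i == 0%R) + q * wtQ i + k * wtK i + h * wtH i)%N.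
Proof.
have q3 := par_q_gt3 par; have [k3 h3] := par_ge3 par; have nqk := neq_qk.
rewrite /wtQ /wtK /wtH; have [->|i0] := eqVneq i 0.
  rewrite degn0; have -> : (1 == q)%N = false by lia.
  by have -> : (1 == k)%N = false by [lia]; rewrite !muln0.
have [->|nq] := eqVneq (degn i) q.
  by rewrite (negPf nqk) /= !muln0 !addn0 muln1.
have [->|nk] := eqVneq (degn i) k; first by rewrite !muln0 addn0 muln1.
case: (degG i0) => [E|E|[mu mu1 ->]]; rewrite ?E ?eqxx // in nq nk.
by rewrite mulnK ?muln0 1?mulnC // ltnW // ltnW.
Qed.

Lemma wt_disjoint i :
  [|| (i == 0) && (wtQ i + wtK i + wtH i == 0)%N,
      (i != 0) && (wtQ i != 0) && (wtK i + wtH i == 0)%N,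
      (i != 0) && (wtK i != 0) && (wtQ i + wtH i == 0)%N |
      (i != 0) && (wtH i != 0) && (wtQ i + wtK i == 0)%N].
Proof.
have q3 := par_q_gt3 par; have [k3 h3] := par_ge3 par; have nqk := neq_qk.
have := degn_wt i; rewrite /wtQ /wtK /wtH; have [->|i0] := eqVneq i 0.
  rewrite degn0; have -> : (1 == q)%N = false by lia.
  by have -> : (1 == k)%N = false by lia.
have [->|nq] := eqVneq (degn i) q; first by rewrite (negPf nqk).
have [->|nk] := eqVneq (degn i) k; first by [].
by move=> /=; case: (_ %/ _)%N => // E; have := degn_gt0 i; rewrite E; lia.
Qed.

Lemma wtH_le i : wtH i != 0%N -> exists2 mu, (0 < mu <= d)%N & degn i = (mu * h)%N.
Proof.
rewrite /wtH; case: ifPn => //; rewrite !negb_or => /and3P[i0 nq nk] _.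
by case: (degG i0) => [E|E|//]; rewrite E ?eqxx // in nq nk.
Qed.

Lemma degn_aut (u : {rmorphism algC -> algC}) i : degn (aut_Iirr u i) = degn i.
Proof. by apply/eqP; rewrite -(eqr_nat algC) -!degnE aut_IirrE cfAut_irr1. Qed.

(** A priori a sum of all characters of degree q; [steinberg_exists] shows that there is just one.
    Weights depending only on degrees make the three sums Galois invariant, hence integers. *)
Definition theta g := \sum_i (wtQ i)%:R * 'chi_i g.
Definition sumK g := \sum_i (wtK i)%:R * 'chi_i g.
Definition sumH g := \sum_i (wtH i)%:R * 'chi_i g.

Lemma Cint_theta g : theta g \in Num.int.
Proof.
apply: Cint_sum_aut_irr => [u i|i]; last exact: rpred_nat.
by rewrite /wtQ degn_aut.
Qed.
Lemma Cint_sumK g : sumK g \in Num.int.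
Proof.
apply: Cint_sum_aut_irr => [u i|i]; last exact: rpred_nat.
by rewrite /wtK degn_aut.
Qed.
Lemma Cint_sumH g : sumH g \in Num.int.
Proof.
apply: Cint_sum_aut_irr => [u i|i]; last exact: rpred_nat.
by rewrite /wtH degn_aut aut_Iirr_eq0.
Qed.

Lemma column_relation g : g \in G -> g != 1%g ->
  1 + q%:R * theta g + k%:R * sumK g + h%:R * sumH g = 0.
Proof.
move=> Gg g1; rewrite -(sum_degn_irr G g1) !mulr_sumr.
have E1 : 1 = \sum_i (i == 0 :> Iirr G)%:R * 'chi_i g.
  by rewrite (bigD1 0) //= mul1r irr0 cfun1E Gg big1 ?addr0 // => i /negPf->; rewrite mul0r.
rewrite [X in X + _ + _ + _]E1 -!big_split /=; apply: eq_bigr => i _.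
by rewrite [in RHS]degn_wt !natrD !natrM; ring.
Qed.

Definition numQ := (\sum_i wtQ i ^ 2)%N.
Definition numK := (\sum_i wtK i ^ 2)%N.
Definition numH := (\sum_i wtH i ^ 2)%N.

Lemma degree_equation : (1 + q * q * numQ + k * k * numK + h * h * numH = q * k * h)%N.
Proof.
rewrite -cardG -sum_degn_sqr !big_distrr /=.
have E1 : 1%N = (\sum_i (i == 0%R :> Iirr G))%N.
  by rewrite (bigD1 0%R) //= big1 // => i /negPf->.
rewrite [X in (X + _ + _ + _)%N]E1 -!big_split /=; apply: eq_bigr => i _; rewrite (degn_wt i).
by case/or4P: (wt_disjoint i) => /andP[]; [| case/andP.. ]; move: (wtQ i) (wtK i) (wtH i);
  case: (i == 0) => // -[|?] [|?] [|?] //= *; rewrite ?muln0 ?addn0 ?add0n //; ring.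
Qed.

Lemma vanish_r p g i : g \in G -> prime p -> (p %| q)%N -> (p %| #[g]%g)%N -> wtQ i != 0%N -> 'chi_i g = 0.
Proof.
move=> Gg pp pq pg; rewrite /wtQ eqb0 negbK => /eqP Di.
apply: (irr_vanish (c := (k * h)%N) pp _ _ Gg pg); first by rewrite Di cardG; ring.
apply: coprime_dvdl pq _.
by rewrite coprimeMr (par_coprime_qk par) (par_coprime_qh par).
Qed.

Lemma vanish_k p g i : g \in G -> prime p -> (p %| k)%N -> (p %| #[g]%g)%N -> wtK i != 0%N -> 'chi_i g = 0.
Proof.
move=> Gg pp pq pg; rewrite /wtK eqb0 negbK => /eqP Di.
apply: (irr_vanish (c := (q * h)%N) pp _ _ Gg pg); first by rewrite Di cardG; ring.
apply: coprime_dvdl pq _.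
by rewrite coprimeMr coprime_sym (par_coprime_qk par) (par_coprime_kh par).
Qed.

Lemma vanish_h p g i : g \in G -> prime p -> (p %| h)%N -> (p %| #[g]%g)%N -> wtH i != 0%N -> 'chi_i g = 0.
Proof.
move=> Gg pp pq pg /wtH_le[mu mu1 Di].
have /dvdnP[c Dc] := degn_dvd i.
apply: (irr_vanish (c := c) pp _ _ Gg pg); first by [].
apply: coprime_dvdl pq _.
have h_gt0 : (0 < h)%N by have [_ h3] := par_ge3 par; lia.
have cqk : (c * mu = q * k)%N.
  by apply/eqP; rewrite -(eqn_pmul2r h_gt0) -mulnA -Di -Dc cardG.
apply: (@coprime_dvdr _ (q * k)); first by rewrite -cqk dvdn_mulr.
by rewrite coprimeMr coprime_sym (par_coprime_qh par) coprime_sym (par_coprime_kh par).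
Qed.

Lemma sum_vanish (w : Iirr G -> nat) g : (forall i, w i != 0%N -> 'chi_i g = 0) ->
  \sum_i (w i)%:R * 'chi_i g = 0.
Proof.
move=> w0; apply: big1 => i _; have [->|/w0->] := eqVneq (w i) 0%N; by rewrite ?mul0r ?mulr0.
Qed.

(** Column orthogonality splits |C(g)| - 1 among the three kinds of degrees, and Cauchy-Schwarz
    bounds each integer sum by its own share. The inequalities are multiplied by the counts to avoid
    divisions. *)
Lemma column_bounds g : g \in G -> let C : algC := #|'C_G[g]%g|%:R in
  numQ%:R * sumK g ^+ 2 + numK%:R * theta g ^+ 2 <= (numQ * numK)%:R * (C - 1) /\
  numQ%:R * sumH g ^+ 2 + numH%:R * theta g ^+ 2 <= (numQ * numH)%:R * (C - 1).
Proof.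
move=> Gg C; pose s (w : Iirr G -> nat) := \sum_(i | w i != 0%N) `|'chi[G]_i g| ^+ 2.
have s0 w : 0 <= s w by apply: sumr_ge0 => i _; rewrite exprn_ge0.
have Dc : 1 + s wtQ + s wtK + s wtH = C.
  rewrite /C -(sum_irr_norm Gg) (bigD1 0) //= irr0 cfun1E Gg normr1 expr1n -!addrA.
  congr (1 + _); rewrite /s (big_mkcond (fun i => wtQ i != 0%N)) (big_mkcond (fun i => wtK i != 0%N)).
  rewrite (big_mkcond (fun i => wtH i != 0%N)) [RHS]big_mkcond -!big_split /=.
  apply: eq_bigr => i _; case/or4P: (wt_disjoint i) => /andP[]; [| case/andP.. ];
   by move: (wtQ i) (wtK i) (wtH i); case: (i == 0) => // -[|?] [|?] [|?] //= *; rewrite ?addr0 ?add0r.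
have bQ : theta g ^+ 2 <= numQ%:R * s wtQ.
  by apply: sum_weighted_sqr_le => //; rewrite Rreal_int ?Cint_theta.
have bK : sumK g ^+ 2 <= numK%:R * s wtK.
  by apply: sum_weighted_sqr_le => //; rewrite Rreal_int ?Cint_sumK.
have bH : sumH g ^+ 2 <= numH%:R * s wtH.
  by apply: sum_weighted_sqr_le => //; rewrite Rreal_int ?Cint_sumH.
have DC1 : C - 1 = s wtQ + s wtK + s wtH by rewrite -Dc; ring.
rewrite DC1; split; rewrite natrM.
  apply: (@le_trans _ _ (numQ%:R * (numK%:R * s wtK) + numK%:R * (numQ%:R * s wtQ))).
    by rewrite lerD // ler_wpM2l ?ler0n.
  rewrite -subr_ge0 (_ : _ - _ = numQ%:R * numK%:R * s wtH); last by ring.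
  by rewrite !mulr_ge0 ?ler0n.
apply: (@le_trans _ _ (numQ%:R * (numH%:R * s wtH) + numH%:R * (numQ%:R * s wtQ))).
  by rewrite lerD // ler_wpM2l ?ler0n.
rewrite -subr_ge0 (_ : _ - _ = numQ%:R * numH%:R * s wtK); last by ring.
by rewrite !mulr_ge0 ?ler0n.
Qed.

Lemma column_int g : g \in G -> g != 1%g -> exists t B M : int,
  [/\ theta g = t%:~R, 1 + q%:Z * t + k%:Z * B + h%:Z * M = 0,
      [/\ forall p, prime p -> (p %| q)%N -> (p %| #[g]%g)%N -> t = 0,
       forall p, prime p -> (p %| k)%N -> (p %| #[g]%g)%N -> B = 0 &
       forall p, prime p -> (p %| h)%N -> (p %| #[g]%g)%N -> M = 0],
     numQ%:Z * (B * B) + numK%:Z * (t * t) <= numQ%:Z * numK%:Z * (#|'C_G[g]%g|%:Z - 1) &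
     numQ%:Z * (M * M) + numH%:Z * (t * t) <= numQ%:Z * numH%:Z * (#|'C_G[g]%g|%:Z - 1)].
Proof.
move=> Gg g1; have /intrP[t Dt] := Cint_theta g; have /intrP[B DB] := Cint_sumK g.
have /intrP[M DM] := Cint_sumH g.
exists t, B, M; split=> //.
- apply: (@intr_inj algC); have := column_relation Gg g1; rewrite Dt DB DM.
  by rewrite !rmorphD !rmorphM /= -!pmulrn.
- split=> p pp px pg; apply: (@intr_inj algC).
  + by rewrite -Dt /theta sum_vanish // => i; apply: vanish_r px pg.
  + by rewrite -DB /sumK sum_vanish // => i; apply: vanish_k px pg.
  + by rewrite -DM /sumH sum_vanish // => i; apply: vanish_h px pg.
- have [+ _] := column_bounds Gg; rewrite -(ler_int algC) Dt DB.
  by rewrite !rmorphD !rmorphM rmorphB /= -?pmulrn ?natrM ?expr2.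
have [_] := column_bounds Gg; rewrite -(ler_int algC) Dt DM.
by rewrite !rmorphD !rmorphM rmorphB /= -?pmulrn ?natrM ?expr2.
Qed.
End Steinberg.

(** A prime p2 dividing both |C(g)| and Y would give commuting elements of orders p and p2, whose
    product has an excluded mixed order. *)
Lemma cent_order_coprime (gT : finGroupType) (G : {group gT}) (g : gT) (p : nat) (X Y : nat) :
    #|G| = (X * Y)%N -> prime p -> (p %| #[g]%g)%N -> g \in G -> ~~ (p %| Y)%N ->
    (forall p2 x, prime p2 -> (p2 %| Y)%N -> x \in G -> (p %| #[x]%g)%N -> (p2 %| #[x]%g)%N -> False) ->
  (#|'C_G[g]%g| %| X)%N.
Proof.
move=> cG pp pg Gg pY mix.
have cY : coprime #|'C_G[g]%g| Y.
  apply/negPn/negP=> ncop.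
  have Y0 : (0 < Y)%N by have := cardG_gt0 G; rewrite cG; case: (Y) => //; rewrite muln0.
  have : (1 < gcdn #|'C_G[g]%g| Y)%N.
    by move: ncop; rewrite /coprime ltn_neqAle eq_sym => -> /=; rewrite gcdn_gt0 Y0 orbT.
  case/pdivP=> p2 p2p; rewrite dvdn_gcd => /andP[p2C p2Y].
  have [y Cy oy] := Cauchy p2p p2C; case/setIP: Cy => Gy cy.
  set u := (g ^+ (#[g]%g %/ p))%g.
  have og := order_gt0 g.
  have ou : #[u]%g = p by rewrite orderXdiv ?dvdn_div // divnA // mulKn.
  have cuy : commute u y.
    have cgy : commute y g := cent1P cy.
    by apply/commute_sym/commuteX.
  have p12 : coprime p p2.
    by rewrite prime_coprime // dvdn_prime2 //; apply: contraNneq pY => ->.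
  have ouy : #[(u * y)%g]%g = (p * p2)%N by rewrite orderM ?ou ?oy.
  have Gu : u \in G by rewrite groupX.
  have po : (p %| #[(u * y)%g]%g)%N by rewrite ouy dvdn_mulr.
  have p2o : (p2 %| #[(u * y)%g]%g)%N by rewrite ouy dvdn_mull.
  exact: (mix p2 (u * y)%g p2p p2Y (groupM Gu Gy) po p2o).
have : (#|'C_G[g]%g| %| X * Y)%N by rewrite -cG cardSg ?subsetIl.
by rewrite mulnC Gauss_dvdr.
Qed.

Section SteinbergValues.
Variables (r q k h d : nat) (e : int).
Hypothesis par : psl_params r q k h d e.
Variables (gT : finGroupType) (G : {group gT}).
Hypotheses (cardG : #|G| = (q * k * h)%N) (degG : degree_ok q k h d G).
Implicit Types (i : Iirr G) (g x : gT).

Let kge : (2 < k)%N. Proof. by case: (par_ge3 par). Qed.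
Let hge : (2 < h)%N. Proof. by case: (par_ge3 par). Qed.
Let qge : (3 < q)%N. Proof. exact: par_q_gt3 par. Qed.

Lemma neq1_order p g : prime p -> (p %| #[g]%g)%N -> g != 1%g.
Proof. by move=> pp; apply: contraTneq => ->; rewrite order1 dvdn1; case: eqP pp => // ->. Qed.

Lemma unit_eq_absurd (m : nat) (B : int) : (2 < m)%N -> 1 + m%:Z * B = 0 -> False.
Proof.
move=> m2 E; have : (m %| 1)%N.
  have -> : 1%N = absz (m%:Z * (- B))%R by lia.
  by rewrite abszM dvdn_mulr.
by rewrite dvdn1; lia.
Qed.

(** Two of the three terms of the column equation vanish, leaving 1 + mB = 0 with m at least 3. *)
Lemma no_mixed p1 p2 g : g \in G -> prime p1 -> prime p2 -> (p1 %| #[g]%g)%N -> (p2 %| #[g]%g)%N ->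
    [|| (p1 %| q) && (p2 %| k), (p1 %| q) && (p2 %| h) | (p1 %| k) && (p2 %| h)]%N -> False.
Proof.
move=> Gg pp1 pp2 pg1 pg2.
have [t [B [M [_ E [tq Bk Mh] _ _]]]] := column_int par cardG degG Gg (neq1_order pp1 pg1).
case/or3P=> /andP[d1 d2].
- rewrite (tq _ pp1 d1 pg1) (Bk _ pp2 d2 pg2) !mulr0 !addr0 in E.
  exact: unit_eq_absurd hge E.
- rewrite (tq _ pp1 d1 pg1) (Mh _ pp2 d2 pg2) !mulr0 !addr0 in E.
  exact: unit_eq_absurd kge E.
rewrite (Bk _ pp1 d1 pg1) (Mh _ pp2 d2 pg2) !mulr0 !addr0 in E.
by apply: unit_eq_absurd E; lia.
Qed.

Lemma class_prime p g : g \in G -> prime p -> (p %| #[g]%g)%N -> [|| p %| q, p %| k | p %| h]%N.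
Proof.
move=> Gg pp pg; have := dvdn_trans pg (order_dvdG Gg).
by rewrite cardG !Euclid_dvdM // -orbA.
Qed.

Lemma coprime_ndvd p a b : prime p -> coprime a b -> (p %| a)%N -> ~~ (p %| b)%N.
Proof.
move=> pp cab pa; apply/negP=> pb.
have : (p %| gcdn a b)%N by rewrite dvdn_gcd pa.
by rewrite (eqP cab) dvdn1; case: eqP pp => // ->.
Qed.

Lemma cent_q p g : g \in G -> prime p -> (p %| q)%N -> (p %| #[g]%g)%N -> (#|'C_G[g]%g| %| q)%N.
Proof.
move=> Gg pp pq pg; apply: (@cent_order_coprime _ G g p q (k * h)) => //; first by rewrite cardG mulnA.
  by apply: coprime_ndvd pp _ pq; rewrite coprimeMr (par_coprime_qk par) (par_coprime_qh par).
move=> p2 x pp2; rewrite Euclid_dvdM // => /orP[] d2 Gx px p2x; apply: (@no_mixed p p2 x) => //;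
  by rewrite pq d2 ?orbT.
Qed.

Lemma cent_k p g : g \in G -> prime p -> (p %| k)%N -> (p %| #[g]%g)%N -> (#|'C_G[g]%g| %| k)%N.
Proof.
move=> Gg pp pq pg; apply: (@cent_order_coprime _ G g p k (q * h)) => //; first by rewrite cardG; ring.
  apply: coprime_ndvd pp _ pq.
  by rewrite coprimeMr coprime_sym (par_coprime_qk par) (par_coprime_kh par).
move=> p2 x pp2; rewrite Euclid_dvdM // => /orP[] d2 Gx px p2x.
  by apply: (@no_mixed p2 p x) => //; rewrite pq d2 ?orbT.
by apply: (@no_mixed p p2 x) => //; rewrite pq d2 ?orbT.
Qed.

Lemma cent_h p g : g \in G -> prime p -> (p %| h)%N -> (p %| #[g]%g)%N -> (#|'C_G[g]%g| %| h)%N.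
Proof.
move=> Gg pp pq pg; apply: (@cent_order_coprime _ G g p h (q * k)) => //; first by rewrite cardG; ring.
  apply: coprime_ndvd pp _ pq.
  by rewrite coprimeMr coprime_sym (par_coprime_qh par) coprime_sym (par_coprime_kh par).
move=> p2 x pp2; rewrite Euclid_dvdM // => /orP[] d2 Gx px p2x; apply: (@no_mixed p2 p x) => //;
  by rewrite pq d2 ?orbT.
Qed.

Lemma exists_order p : prime p -> (p %| q * k * h)%N -> exists2 x, x \in G & #[x]%g = p.
Proof. by move=> pp; rewrite -cardG => /(Cauchy pp)[x]; exists x. Qed.

(** Otherwise the column equation at an element of prime order dividing h would be 1 + kB = 0. *)
Lemma numQ_ge1 : (0 < numQ q G)%N.
Proof.
rewrite lt0n; apply/eqP=> c0.
have w0 i : wtQ q i = 0%N.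
  have /eqP := c0; rewrite /numQ sum_nat_eq0 => /forallP/(_ i)/=.
  by rewrite expn_eq0 andbT => /eqP.
have [p pp ph] := pdivP (ltnW hge).
have [x Gx ox] := exists_order pp (dvdn_mull _ ph).
have px : (p %| #[x]%g)%N by rewrite ox.
have [t [B [M [Dt E [_ _ Mh] _ _]]]] := column_int par cardG degG Gx (neq1_order pp px).
have t0 : t = 0.
  apply: (@intr_inj algC); rewrite -Dt /theta big1 // => i _; by rewrite w0 mul0r.
rewrite t0 (Mh _ pp ph px) !mulr0 !addr0 in E; exact: unit_eq_absurd kge E.
Qed.

(** At an element of order r the term t vanishes and the centralizer has order at most q, which
    provides the norm bounds of [arith_even] and [arith_odd]. *)
Lemma count_solution :
  [/\ numQ q G = 1%N,
      d = 1%N -> 2 * (numK k G)%:Z = q%:Z /\ 2 * (numH q k h G)%:Z = q%:Z - 2 &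
      d = 2%N -> 4 * (numK k G)%:Z = q%:Z - 2 + e /\ (numH q k h G)%:Z = q%:Z - 2 - e].
Proof.
have c1 := numQ_ge1; have deq := degree_equation par cardG degG.
have rp := par_prime par; have rq := par_r_q par.
have [x Gx ox] : exists2 x, x \in G & #[x]%g = r.
  by apply: exists_order; rewrite // -mulnA dvdn_mulr.
have px : (r %| #[x]%g)%N by rewrite ox.
have [t [B [M [Dt E [tq _ _] bB bM]]]] := column_int par cardG degG Gx (neq1_order rp px).
rewrite (tq _ rp rq px) !mulr0 !addr0 in E bB bM.
have Cq : (#|'C_G[x]%g| <= q)%N by rewrite dvdn_leq ?(cent_q Gx rp rq px) // ltnW // ltnW // ltnW.
set c := numQ q G in c1 deq bB bM *; set b := numK k G in deq bB *; set a := numH q k h G in deq bM *.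
move: (#|'C_G[x]%g|) Cq bB bM => C Cq bB bM.
have {bB} bB : B * B <= b%:Z * (q%:Z - 1).
  have h1 : 0 <= b%:Z * (q%:Z - C%:Z) by rewrite mulr_ge0 // subr_ge0 lez_nat.
  have c0 : 0 < c%:Z by rewrite ltz_nat.
  have : B * B <= b%:Z * (C%:Z - 1) by rewrite -(ler_pM2l c0) mulrA; lia.
  lia.
have {bM} bM : M * M <= a%:Z * (q%:Z - 1).
  have h1 : 0 <= a%:Z * (q%:Z - C%:Z) by rewrite mulr_ge0 // subr_ge0 lez_nat.
  have c0 : 0 < c%:Z by rewrite ltz_nat.
  have : M * M <= a%:Z * (C%:Z - 1) by rewrite -(ler_pM2l c0) mulrA; lia.
  lia.
have deqz : 1 + q%:Z * q%:Z * c%:Z + k%:Z * k%:Z * b%:Z + h%:Z * h%:Z * a%:Z = q%:Z * k%:Z * h%:Z.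
  by move/(congr1 Posz): deq; rewrite !PoszD !PoszM.
clearbody c b a; have kE := par_kE par; have hE := par_hE par.
case: (par_caseE par) => [[d1 _ De] | [d2 _ /dvdnP[j Dj] De]].
  rewrite d1 De mul1n in hE; rewrite De in kE.
  have [] := @arith_even q%:Z c%:Z b%:Z a%:Z B M; rewrite ?lez_nat -?hE -?kE //; try lia.
  by move=> D1 D2 D3; split=> [|_|]; [lia| by split | rewrite d1].
rewrite d2 PoszM in hE.
have [] := @arith_odd q%:Z e c%:Z b%:Z a%:Z B M; rewrite ?lez_nat -?hE -?kE //; try lia.
- by exists j%:Z; rewrite Dj PoszM mulrC.
- by move=> D1 D2 D3; split=> [||_]; [lia | rewrite d2 | by split].
Qed.

Lemma steinberg_exists : exists i0 : Iirr G,
  [/\ degn i0 = q, forall i, degn i = q -> i = i0 & forall g, theta q G g = 'chi_i0 g].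
Proof.
have [c1 _ _] := count_solution.
have [i0 Di0] : exists i0 : Iirr G, degn i0 = q.
  have [i /eqP Di|nq] := pickP (fun i : Iirr G => degn i == q); first by exists i.
  by move: c1; rewrite /numQ big1 // => i _; rewrite /wtQ nq.
have uniq i : degn i = q -> i = i0.
  move=> Di; apply/eqP/negPn/negP=> ni0; move: c1.
  rewrite /numQ (bigD1 i0) //= (bigD1 i) //= /wtQ Di0 Di eqxx; lia.
exists i0; split=> // g; rewrite /theta (bigD1 i0) //= /wtQ Di0 eqxx mul1r.
rewrite big1 ?addr0 // => i /negPf ni; case: eqP => [/uniq Di|]; last by rewrite mul0r.
by rewrite Di eqxx in ni.
Qed.

Lemma steinberg_value_q p g : g \in G -> prime p -> (p %| q)%N -> (p %| #[g]%g)%N -> theta q G g = 0.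
Proof.
move=> Gg pp pq pg.
have [t [B [M [-> _ [tq _ _] _ _]]]] := column_int par cardG degG Gg (neq1_order pp pg).
by rewrite (tq _ pp pq pg).
Qed.

Lemma steinberg_value_h p g : g \in G -> prime p -> (p %| h)%N -> (p %| #[g]%g)%N -> theta q G g = (- e)%:~R.
Proof.
move=> Gg pp ph pg.
have [t [B [M [-> E [_ _ Mh] bB _]]]] := column_int par cardG degG Gg (neq1_order pp pg).
rewrite (Mh _ pp ph pg) mulr0 addr0 in E.
have Ch : (#|'C_G[g]%g| <= h)%N by rewrite dvdn_leq ?(cent_h Gg pp ph pg) // ltnW // ltnW.
move: (#|'C_G[g]%g|) Ch bB => C Ch bB.
have [c1 s1 s2] := count_solution; rewrite c1 !mul1r in bB; congr (_%:~R).
have kE := par_kE par; have hE := par_hE par.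
case: (par_caseE par) => [[d1 _ De] | [d2 _ /dvdnP[j Dj] De]].
  have [Db _] := s1 d1; rewrite d1 De mul1n in hE; rewrite De in kE *.
  by apply: (theta_even_h _ Db _ _ bB); lia.
have [Db _] := s2 d2; rewrite d2 PoszM in hE.
by apply: (@theta_odd_h q%:Z e _ t B C%:Z _ De Db _ _ bB); rewrite -?kE; lia.
Qed.

Lemma steinberg_value_k p g : g \in G -> prime p -> (p %| k)%N -> (p %| #[g]%g)%N -> theta q G g = e%:~R.
Proof.
move=> Gg pp ph pg.
have [t [B [M [-> E [_ Bk _] _ bM]]]] := column_int par cardG degG Gg (neq1_order pp pg).
rewrite (Bk _ pp ph pg) mulr0 addr0 in E.
have Ch : (#|'C_G[g]%g| <= k)%N by rewrite dvdn_leq ?(cent_k Gg pp ph pg) // ltnW // ltnW.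
move: (#|'C_G[g]%g|) Ch bM => C Ch bM.
have [c1 s1 s2] := count_solution; rewrite c1 !mul1r in bM; congr (_%:~R).
have kE := par_kE par; have hE := par_hE par.
case: (par_caseE par) => [[d1 _ De] | [d2 _ /dvdnP[j Dj] De]].
  have [_ Db] := s1 d1; rewrite d1 De mul1n in hE; rewrite De in kE *.
  by apply: (theta_even_k _ Db _ _ bM); lia.
have [_ Db] := s2 d2; rewrite d2 PoszM in hE.
apply: (@theta_odd_k q%:Z e _ t M C%:Z _ De _ Db _ _ bM); rewrite -?kE -?hE; try lia.
by exists j%:Z; rewrite Dj PoszM mulrC.
Qed.
End SteinbergValues.

(** * The r-singular elements: centralizers and a structure constant *)

Section RElements.
Variables (r q k h d : nat) (e : int).
Hypothesis par : psl_params r q k h d e.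
Variables (gT : finGroupType) (G : {group gT}).
Hypotheses (cardG : #|G| = (q * k * h)%N) (degG : degree_ok q k h d G).
Implicit Types (i : Iirr G) (g x : gT).

(** These r-singular elements turn out to be the nonidentity elements of the Sylow r-subgroups. *)
Definition relts : {set gT} := [set g in G | (r %| #[g]%g)%N].

Let rp : prime r := par_prime par.
Let rq : (r %| q)%N := par_r_q par.
Let q_gt0 : (0 < q)%N. Proof. by have := par_q_gt3 par; case: (q). Qed.
Let kh_gt0 : (0 < k * h)%N.
Proof. by have [k3 h3] := par_ge3 par; rewrite muln_gt0; lia. Qed.
Let e1 : e = 1 \/ e = -1 := par_e1 par.

Lemma theta_norm_other g : g \in G -> g != 1%g -> g \notin relts -> `|theta q G g| = 1.
Proof.
move=> Gg g1; rewrite inE Gg /= => nr.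
have [p pp pg] : exists2 p, prime p & (p %| #[g]%g)%N.
  have [|p pp pg] := @pdivP #[g]%g; last by exists p.
  by rewrite ltn_neqAle eq_sym order_eq1 g1 order_gt0.
have /or3P[pq|pk|ph] := class_prime cardG Gg pp pg.
- by move: nr; rewrite -(par_pq par pp pq) pg.
- by rewrite (steinberg_value_k par cardG degG Gg pp pk pg); case: e1 => ->; rewrite ?normrN ?mulr1z ?normr1 // rmorphN normrN normr1.
by rewrite (steinberg_value_h par cardG degG Gg pp ph pg); case: e1 => ->; rewrite ?opprK ?rmorphN ?normrN ?mulr1z ?normr1.
Qed.

Lemma theta_relts g : g \in relts -> theta q G g = 0.
Proof. by rewrite inE => /andP[Gg rg]; apply: (steinberg_value_q par cardG degG Gg rp rq rg). Qed.

Lemma theta1 : theta q G 1%g = q%:R.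
Proof. by have [i0 [Di0 _ ->]] := steinberg_exists par cardG degG; rewrite degnE Di0. Qed.

Lemma one_notin_relts : 1%g \notin relts.
Proof. by rewrite inE order1 dvdn1 andbC; case: eqP rp => // ->. Qed.

(** |theta|^2 is q^2 at 1, 0 on [relts] and 1 elsewhere, so sums over [relts] can be read off from
    inner products with theta times its conjugate. *)
Lemma sum_theta_sqr (F : gT -> algC) :
  \sum_(g in G) `|theta q G g| ^+ 2 * F g =
    (q ^ 2)%:R * F 1%g + (\sum_(g in G) F g - F 1%g - \sum_(g in relts) F g).
Proof.
rewrite (bigD1 1%g) //= theta1 normr_nat natrX; congr (_ + _).
rewrite [in RHS](bigD1 1%g) //= [X in _ = X - _ - _]addrC addrK.
rewrite (bigID (mem relts)) [in RHS](bigID (mem relts)) /=.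
rewrite [X in X + _ = _]big1 ?add0r => [|g /andP[_ gR]]; last by rewrite theta_relts // normr0 expr0n mul0r.
rewrite [X in _ = X + _ - _](eq_bigl (fun g => g \in relts)) => [|g]; last first.
  rewrite [in LHS]inE -andbA; case: eqP => [->|]; rewrite ?andbF /=.
    by rewrite (negPf one_notin_relts).
  by rewrite inE andbA andbb.
rewrite [X in _ = X - _]addrC addrK; apply: eq_bigr => g /andP[/andP[Gg g1] nR].
by rewrite theta_norm_other // expr1n mul1r.
Qed.

Lemma card_relts : (#|relts| + 1 = q * q)%N.
Proof.
have [i0 [Di0 _ Dth]] := steinberg_exists par cardG degG.
have := sum_theta_sqr (fun=> 1).
have -> : \sum_(g in G) `|theta q G g| ^+ 2 * 1 = #|G|%:R.
  have := cfnorm_irr i0; rewrite cfdotE => /(canRL (mulVKf (neq0CG G))).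
  by rewrite mulr1 => <-; apply: eq_bigr => g Gg; rewrite Dth mulr1 normCK.
rewrite !sumr_const mulr1 => E; apply/eqP; rewrite -(eqr_nat algC) natrD natrM.
apply/eqP; move: E; rewrite natrX expr2 => E.
have -> : q%:R * q%:R = #|G|%:R - (#|G|%:R - 1 - #|relts|%:R) :> algC by rewrite [X in X - _]E addrK.
ring.
Qed.

Lemma card_relts_dkh : #|relts| = (d * (k * h))%N.
Proof. by have := card_relts; have := par_dkh par; lia. Qed.

Lemma par_dr : (d < r)%N.
Proof.
case: (par_caseE par) => [[-> -> _]|[-> or _ _]] //.
by have := prime_gt1 rp; case: (r) or => [|[|[|]]].
Qed.

Lemma proper_dvd_q m : (m %| q)%N -> m != q -> (m * r <= q)%N.
Proof.
have [f f0 Dq] := par_qE par; rewrite {1 2}Dq => /(dvdn_pfactor _ _ rp)[a la ->].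
rewrite (eqn_exp2l _ _ (prime_gt1 rp)) => na; rewrite -expnSr Dq leq_exp2l ?prime_gt1 //.
by rewrite ltn_neqAle na.
Qed.

(** A proper divisor of q is at most q/r and would give a class of at least rkh elements inside
    [relts], which has only dkh, with d < r. *)
Lemma card_cent_relts x : x \in relts -> #|'C_G[x]%g| = q.
Proof.
move=> xR; have := xR; rewrite inE => /andP[Gx rx].
have Cq := cent_q par cardG degG Gx rp rq rx.
apply/eqP/negPn/negP=> nC; have Cr := proper_dvd_q Cq nC.
have cl : (#|(x ^: G)%g| * #|'C_G[x]%g| = q * (k * h))%N.
  by rewrite mulnA -cardG -index_cent1 mulnC Lagrange ?subsetIl.
have clR : (#|(x ^: G)%g| <= d * (k * h))%N.
  rewrite -card_relts_dkh subset_leq_card //; apply/subsetP=> y /imsetP[z Gz ->].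
  by rewrite inE groupJ // orderJ.
have C_gt0 : (0 < #|'C_G[x]%g|)%N := cardG_gt0 _.
have := par_dr; move: (#|(x ^: G)%g|) (#|'C_G[x]%g|) cl clR Cr C_gt0 => a b cl clR Cr b0 dr.
have h1 : (a * b <= d * (k * h) * b)%N by rewrite leq_mul2r clR orbT.
have h2 : (d * b * (k * h) < r * b * (k * h))%N.
  by rewrite ltn_pmul2r // ltn_pmul2r.
have h3 : (b * r * (k * h) <= q * (k * h))%N by rewrite leq_mul2r Cr orbT.
clear -h1 h2 h3 cl; lia.
Qed.

Definition relsum i : algC := \sum_(x in relts) 'chi_i x.

(** Here l is the multiplicity of ['chi_i] in theta times its conjugate; the resulting congruence
    modulo q is what matters. *)
Lemma relsum_int i : i != 0 -> exists l : nat, relsum i = (k * h)%:R * (d%:R * (degn i)%:R - q%:R * l%:R).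
Proof.
move=> i0; have [i1 [Di1 _ Dth]] := steinberg_exists par cardG degG.
have Zl : '['chi_i1 * ('chi_i1)^*%CF, 'chi_i] \in Num.nat.
  by rewrite Cnat_cfdot_char ?irr_char // rpredM ?cfConjC_char ?irr_char.
have /natrP[l Dl] := Zl; exists l.
have s0 : \sum_(g in G) ('chi_i g)^* = 0.
  have := cfdot_irr i 0; rewrite (negPf i0) cfdotE => /(canRL (mulVKf (neq0CG G))).
  rewrite mulr0 => E; rewrite -[LHS]conjCK -[RHS]conjC0; congr (_^*).
  rewrite rmorph_sum /= -[RHS]E; apply: eq_bigr => g Gg.
  by rewrite conjCK irr0 cfun1E Gg conjC1 mulr1.
have := sum_theta_sqr (fun g => ('chi_i g)^*).
have -> : \sum_(g in G) `|theta q G g| ^+ 2 * ('chi_i g)^* = #|G|%:R * l%:R.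
  rewrite -Dl cfdotE mulVKf ?neq0CG //; apply: eq_bigr => g Gg.
  by rewrite Dth normCK !cfunE.
rewrite s0 degnE conjC_nat => E.
have Ec : \sum_(g in relts) ('chi_i g)^* = (q ^ 2)%:R * (degn i)%:R - (degn i)%:R - #|G|%:R * l%:R.
  by rewrite E; ring.
rewrite /relsum -[LHS]conjCK rmorph_sum /= Ec.
have -> : (q ^ 2)%:R = (d * (k * h))%:R + 1 :> algC.
  by rewrite -mulnn -(par_dkh par) natrD.
by rewrite !rmorphB !rmorphM !rmorphD /= !conjC_nat ?rmorph1 cardG !natrM; ring.
Qed.

(* [wgt i] is the common value of [relsum i / (k * h)]; it is pinned down by its residue modulo [q]
   together with the Parseval bound. *)
Lemma relsum_sqr : \sum_i `|relsum i| ^+ 2 = (#|relts| * #|G|)%:R.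
Proof.
transitivity (\sum_(x in relts) \sum_(y in relts) \sum_i 'chi[G]_i x * ('chi_i y)^*).
  under eq_bigr => i _ do rewrite normCK /relsum rmorph_sum mulr_suml.
  rewrite exchange_big; apply: eq_bigr => x _ /=.
  under eq_bigr => i _ do rewrite mulr_sumr.
  by rewrite exchange_big.
rewrite natrM -sumr_const mulr_suml; apply: eq_bigr => x xR; rewrite mul1r.
have Gx : x \in G by move: xR; rewrite inE => /andP[].
rewrite (eq_bigr (fun y => #|'C_G[x]%g|%:R *+ (y \in x ^: G)%g)) => [|y yR]; last first.
  have Gy : y \in G by move: yR; rewrite inE => /andP[].
  by rewrite second_orthogonality_relation // class_sym.
rewrite -(Lagrange (subsetIl G 'C[x]%g)) index_cent1 natrM.
rewrite (bigID (mem (x ^: G)%g)) /= [X in _ + X]big1 ?addr0 => [|y /andP[_ /negPf->]]; last by [].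
rewrite (eq_bigl (mem (x ^: G)%g)) => [|y].
  rewrite (eq_bigr (fun=> #|'C_G[x]%g|%:R)) => [|y /= ->]; last by rewrite mulr1n.
  by rewrite sumr_const mulr_natr.
rewrite /= andb_idl // => /imsetP[z Gz ->].
by move: xR; rewrite !inE groupJ // orderJ => /andP[_ ->].
Qed.

(** The bound on w keeps, in [relsum_sqr], only the terms of the principal character and of [i]. *)
Lemma relsum_wgt i : i != 0 -> exists w : int, [/\ relsum i = (k * h)%:R * w%:~R,
   w * w <= d%:Z * q%:Z - d%:Z * d%:Z & exists l : int, w = d%:Z * (degn i)%:Z - q%:Z * l].
Proof.
move=> i0; have [l Dl] := relsum_int i0; exists (d%:Z * (degn i)%:Z - q%:Z * l%:Z).
split; last by exists l%:Z.
  by rewrite Dl rmorphB !rmorphM /= -!pmulrn.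
set w := (_ - _); have Dw : relsum i = (k * h)%:R * w%:~R.
  by rewrite Dl rmorphB !rmorphM /= -!pmulrn.
have := relsum_sqr; rewrite (bigD1 0) //= (bigD1 i) //=.
have -> : relsum 0 = #|relts|%:R.
  rewrite /relsum -sumr_const; apply: eq_bigr => x; rewrite inE => /andP[Gx _].
  by rewrite irr0 cfun1E Gx.
rewrite Dw normr_nat normrM normr_nat exprMn => E.
have le : #|relts|%:R ^+ 2 + (k * h)%:R ^+ 2 * `|w%:~R| ^+ 2 <= (#|relts| * #|G|)%:R :> algC.
  rewrite -E addrA lerDl; apply: sumr_ge0 => j _; exact: exprn_ge0.
move: le; rewrite card_relts_dkh cardG real_normK ?Rreal_int ?intr_int // => le.
have kh0 : 0 < (k * h)%:R ^+ 2 :> algC by rewrite exprn_gt0 // ltr0n.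
rewrite -(ler_int algC) rmorphM -expr2 -(ler_pM2l kh0) -(lerD2l ((d * (k * h))%:R ^+ 2)).
apply: le_trans le _; rewrite rmorphB !rmorphM /= -!pmulrn.
rewrite le_eqVlt; apply/orP; left; apply/eqP.
by rewrite ?natrM; ring.
Qed.

Lemma qge5_d2 : d = 2%N -> (5 <= q)%N.
Proof.
move=> d2; have := par_q_gt3 par; case: (par_caseE par) => [[D]|[_ or _ _]]; first by rewrite d2 in D.
have [f f0 ->] := par_qE par; have : odd (r ^ f) by rewrite oddX or orbT.
by case: (r ^ f)%N => [|[|[|[|[|]]]]].
Qed.

Lemma small_residue (u z w : int) : 4 <= q%:Z -> (d = 1%N \/ d = 2%N /\ 5 <= q%:Z) ->
  -(d%:Z) <= u <= d%:Z -> w = u + q%:Z * z ->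
  w * w <= d%:Z * q%:Z - d%:Z * d%:Z -> z = 0.
Proof.
move=> q4 dd ud -> le; apply/eqP/negPn/negP=> /eqP z0.
have h1 : (q%:Z - d%:Z) * (q%:Z - d%:Z) <= (u + q%:Z * z) * (u + q%:Z * z).
  apply: sqr_ge_abs; first by lia.
  have q0 : 0 <= q%:Z by [].
  by have [h'|h'] := mul_ge_abs q0 z0 (erefl _); lia.
case: dd => [d1|[d2 q5]]; first by rewrite d1 in le h1; nia.
rewrite d2 in le h1; nia.
Qed.

(** The base of the square is the central character of [i] on the sum of [1] and all of [relts]. As
    w is small and congruent to d chi(1) modulo q, it is -de for degree k and mu e for degree mu h,
    so the central character takes the value q or -q. *)
Lemma relsum_kernel i : i != 0 -> degn i != q ->
  (1 + relsum i / 'chi_i 1%g) ^+ 2 = (q ^ 2)%:R.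
Proof.
move=> i0 nq; have [w [-> bw [l Dw]]] := relsum_wgt i0.
have q4 : 4 <= q%:Z by rewrite lez_nat; exact: par_q_gt3 par.
have dd : d = 1%N \/ d = 2%N /\ 5 <= q%:Z.
  case: (par_caseE par) => [[-> _ _]|[d2 _ _ _]]; [by left|right].
  by split=> //; rewrite lez_nat qge5_d2.
have [k3 h3] := par_ge3 par.
have ee : e * e = 1 by case: e1 => ->.
have kE := par_kE par; have hE := par_hE par; rewrite PoszM in hE.
have qz z : z = 0 -> q%:Z * z = 0 by move->; rewrite mulr0.
rewrite degnE; case: (degG i0) => [D|D|[mu mu1 D]]; first by rewrite D eqxx in nq.
  have z0 : d%:Z - l = 0.
    apply: (small_residue q4 dd (u := - (d%:Z * e)) _ _ bw).
      by case: e1 => ->; lia.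
    by rewrite Dw D kE; ring.
  have -> : w = - (d%:Z * e) by rewrite Dw D kE; have -> : l = d%:Z by [lia]; ring.
  have -> : 1 + (k * h)%:R * (- (d%:Z * e))%:~R / (degn i)%:R = (- e * q%:Z)%:~R :> algC.
    rewrite D.
    have k0 : k%:R != 0 :> algC by rewrite pnatr_eq0; lia.
    have -> : (k * h)%:R * (- (d%:Z * e))%:~R / k%:R = (- (e * (d%:Z * h%:Z)))%:~R :> algC.
      by rewrite !rmorphN !rmorphM /= -?pmulrn ?natrM; field.
    rewrite hE -[1]/(1%:~R) -rmorphD; congr (_%:~R).
    by rewrite mulrDr ee; ring.
  by rewrite -rmorphXn /= exprMn sqrrN expr2 ee mul1r natrX rmorphXn.
have z0 : mu%:Z - l = 0.
  apply: (small_residue q4 dd (u := mu%:Z * e) _ _ bw).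
    by case: e1 => ->; lia.
  rewrite Dw D PoszM; have -> : d%:Z * (mu%:Z * h%:Z) = mu%:Z * (d%:Z * h%:Z) by ring.
  by rewrite hE; ring.
have -> : w = mu%:Z * e.
  rewrite Dw D PoszM; have -> : d%:Z * (mu%:Z * h%:Z) = mu%:Z * (d%:Z * h%:Z) by ring.
  by rewrite hE; have -> : l = mu%:Z by [lia]; ring.
have -> : 1 + (k * h)%:R * (mu%:Z * e)%:~R / (degn i)%:R = (e * q%:Z)%:~R :> algC.
  rewrite D (natrM _ mu h).
  have h0 : h%:R != 0 :> algC by rewrite pnatr_eq0; lia.
  have mu0 : mu%:R != 0 :> algC by rewrite pnatr_eq0; lia.
  have -> : (k * h)%:R * (mu%:Z * e)%:~R / (mu%:R * h%:R) = (e * k%:Z)%:~R :> algC.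
    by rewrite !rmorphM /= -?pmulrn ?natrM; field; rewrite h0 mu0.
  rewrite kE -[1]/(1%:~R) -rmorphD; congr (_%:~R).
  by rewrite mulrBr ee; ring.
by rewrite -rmorphXn /= exprMn expr2 ee mul1r natrX rmorphXn.
Qed.
Definition rset : {set gT} := 1%g |: relts.

Lemma conv_coef (a : Iirr G -> algC) (s : gT -> algC) x : x \in G ->
    (forall y, y \in G -> s y = \sum_i a i * 'chi_i y) ->
  \sum_(y in G) s y * s (y^-1 * x)%g =
    \sum_i a i ^+ 2 * (#|G|%:R / 'chi_i 1%g) * 'chi_i x.
Proof.
move=> Gx Ds.
transitivity (\sum_(y in G) \sum_i \sum_j a i * a j * ('chi_i (y^-1 * x)%g * 'chi_j y)).
  apply: eq_bigr => y Gy; rewrite Ds // Ds ?groupM ?groupV // mulrC mulr_suml.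
  apply: eq_bigr => i _; rewrite mulr_sumr; apply: eq_bigr => j _; ring.
rewrite exchange_big; apply: eq_bigr => i _ /=; rewrite exchange_big /=.
have E j : \sum_(y in G) a i * a j * ('chi_i (y^-1 * x)%g * 'chi_j y) =
   a i * a j * #|G|%:R * ((i == j)%:R * ('chi_i x / 'chi_i 1%g)).
  rewrite -generalized_orthogonality_relation -mulr_sumr -[RHS]mulrA mulVKf ?neq0CG //.
  congr (_ * _); rewrite (reindex_inj invg_inj) /=.
  by apply: eq_big => y; rewrite ?groupV // => _; rewrite invgK.
rewrite (eq_bigr _ (fun j _ => E j)) (bigD1 i) //= big1 ?addr0 => [|j /negPf nji]; last first.
  by rewrite eq_sym nji mul0r mulr0.
by rewrite eqxx mul1r expr2 -!mulrA; congr (_ * (_ * (_ * _))); rewrite mulrC.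
Qed.

Lemma rset_sub : rset \subset G.
Proof. by apply/subsetP=> x /setU1P[-> //|]; rewrite inE => /andP[]. Qed.

(** A structure constant of the group algebra. The principal character contributes q^4, the one of
    degree q vanishes at x, and all others carry the same factor q^2, so orthogonality of the
    columns of x and 1 gives (q^4 - q^2)/|G| = dq. *)
Lemma card_rset_pairs x : x \in relts ->
  #|[set y in rset | (y^-1 * x)%g \in rset]| = (d * q)%N.
Proof.
move=> xR; have Gx : x \in G by move: xR; rewrite inE => /andP[].
pose s g : algC := (g \in rset)%:R.
pose a i : algC := ('chi_i 1%g + relsum i)^* / #|G|%:R.
have Ds y : y \in G -> s y = \sum_i a i * 'chi_i y.
  move=> Gy; pose f := cfun_indicator.
  (* [rset] is a union of classes, so column orthogonality expands its indicator in irreducible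
     characters. *)
  have sc : s y = \sum_(z in rset) (#|G|%:R^-1 * (\sum_i 'chi_i y * ('chi[G]_i z)^*)).
    rewrite /s; have [yR|nyR] := boolP (y \in rset).
      pose cl := (y ^: G)%g.
      rewrite (bigID (mem cl)) /= [X in _ + X]big1 ?addr0 => [|z /andP[zR nz]]; last first.
        have Gz := subsetP rset_sub z zR.
        by rewrite second_orthogonality_relation // class_sym (negPf nz) mulr0n mulr0.
      rewrite (eq_bigl (mem cl)) => [|z]; last first.
        rewrite /= andb_idl // => /imsetP[t Gt ->]; case/setU1P: yR => [->|yR]; first by rewrite conj1g setU11.
        by apply/setU1P; right; move: yR; rewrite !inE groupJr // orderJ.
      rewrite (eq_bigr (fun=> #|G|%:R^-1 * #|'C_G[y]%g|%:R)) => [|z /= cz]; last first.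
        have Gz : z \in G by case/imsetP: cz => t Gt ->; rewrite groupJ.
        by rewrite second_orthogonality_relation // class_sym cz mulr1n.
      rewrite sumr_const -mulrnAr -mulrnA -index_cent1 Lagrange ?subsetIl //.
      by rewrite mulVf ?neq0CG.
    rewrite big1 // => z zR; have Gz := subsetP rset_sub z zR.
    rewrite second_orthogonality_relation //; case cz: (y \in (z ^: G)%g); last by rewrite mulr0n mulr0.
    case/imsetP: cz => t Gt Dy; case/negP: nyR; case/setU1P: zR Dy => [->|zR] ->.
      by rewrite conj1g setU11.
    by apply/setU1P; right; move: zR; rewrite !inE groupJr // orderJ.
  rewrite sc -mulr_sumr exchange_big mulr_sumr; apply: eq_bigr => i _ /=.
  rewrite -mulr_sumr big_setU1 ?one_notin_relts //= /a /relsum rmorphD rmorph_sum /=; ring.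
have E := conv_coef Gx Ds.
have DN : \sum_(y in G) s y * s (y^-1 * x)%g = #|[set y in rset | (y^-1 * x)%g \in rset]|%:R.
  rewrite -sumr_const [RHS](eq_bigl (fun y => (y \in G) && (y \in rset) && ((y^-1 * x)%g \in rset))).
    by rewrite big_mkcondr big_mkcondr; apply: eq_bigr => y _; rewrite /s; case: (y \in _); case: (_ \in rset); rewrite ?mul1r ?mul0r.
  move=> y; rewrite inE; case yR : (y \in rset); rewrite ?andbF //.
  by rewrite (subsetP rset_sub _ yR).
rewrite DN in E; apply/eqP; rewrite -(eqr_nat algC) E.
have nG := neq0CG G.
have [i1 [Di1 ui1 Dth]] := steinberg_exists par cardG degG.
have i10 : i1 != 0 by apply/eqP=> i0; move: Di1; rewrite i0 degn0; have := par_q_gt3 par; lia.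
have Rr i : (relsum i)^* = relsum i.
  have [->|i0] := eqVneq i 0.
    by rewrite /relsum rmorph_sum; apply: eq_bigr => z _; rewrite /= irr0 cfun1E conjC_nat.
  by have [w [-> _ _]] := relsum_wgt i0; rewrite rmorphM /= conjC_nat conj_intr ?intr_int.
have aE i : a i ^+ 2 * (#|G|%:R / 'chi_i 1%g) * 'chi_i x =
   (1 + relsum i / 'chi_i 1%g) ^+ 2 * ('chi_i 1%g * 'chi_i x) / #|G|%:R.
  rewrite /a rmorphD /= Rr degnE conjC_nat.
  have n0 : (degn i)%:R != 0 :> algC by rewrite pnatr_eq0 -lt0n degn_gt0.
  by field; rewrite nG n0.
rewrite (eq_bigr _ (fun i _ => aE i)) -mulr_suml.
have R0 : relsum 0 = #|relts|%:R.
  rewrite /relsum -sumr_const; apply: eq_bigr => y; rewrite inE => /andP[Gy _].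
  by rewrite irr0 cfun1E Gy.
have x1 : x != 1%g by apply: contraTneq xR => ->; exact: one_notin_relts.
have St0 : 'chi_i1 x = 0 by rewrite -Dth theta_relts.
rewrite (bigD1 0) //= (bigD1 i1) //= St0 !mulr0 add0r R0 irr0 !cfun1E group1 Gx !mulr1 divr1.
have -> : 1 + #|relts|%:R = (q * q)%:R :> algC by rewrite -card_relts natrD addrC.
have others : \sum_(i | (i != 0) && (i != i1)) 'chi_i 1%g * 'chi_i x = -1.
  apply/eqP; rewrite -addr_eq0 addrC.
  have := sum_degn_irr G x1; rewrite (bigD1 0) //= (bigD1 i1) //= degn0 mul1r irr0 cfun1E Gx St0 mulr0 add0r.
  by move=> E0; apply/eqP; rewrite -[RHS]E0; congr (_ + _); apply: eq_bigr => i _; rewrite degnE.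
rewrite (eq_bigr (fun i => (q ^ 2)%:R * ('chi_i 1%g * 'chi_i x))) => [|i /andP[i0 ni1]]; last first.
  by rewrite relsum_kernel //; apply: contra ni1 => /eqP/ui1->.
rewrite -mulr_sumr others mulrN1 cardG.
have q0 : q%:R != 0 :> algC by rewrite pnatr_eq0 -lt0n.
have kh0 : (k * h)%:R != 0 :> algC by rewrite pnatr_eq0 -lt0n.
have := par_dkh par => /(congr1 (fun n => n%:R : algC)); rewrite natrD !natrM.
move: kh0; rewrite natrM mulf_eq0 negb_or => /andP[k0 h0] Eq.
rewrite -(inj_eq (mulIf q0)) -subr_eq0; apply/eqP.
have -> : (q%:R * q%:R) ^+ 2 - q%:R * q%:R = q%:R * q%:R * (d%:R * (k%:R * h%:R)) :> algC.
  by rewrite expr2 -[X in _ - X]mulr1 -mulrBr -{2}Eq addrK.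
by field; rewrite q0 k0 h0.
Qed.

End RElements.

Local Open Scope group_scope.
Local Open Scope ring_scope.

(** * Sylow r-subgroups and their permutation action *)

Section SylowTI.
Variables (r q k h d : nat) (e : int).
Hypothesis par : psl_params r q k h d e.
Variables (gT : finGroupType) (G : {group gT}).
Hypotheses (cardG : #|G| = (q * k * h)%N) (degG : degree_ok q k h d G).
Implicit Types (P Q : {group gT}) (x : gT).

Let rp : prime r := par_prime par.
Let rq : (r %| q)%N := par_r_q par.
Let q_gt3 : (3 < q)%N := par_q_gt3 par.

Local Notation relts := (relts r G).

Lemma q_rnat : r.-nat q.
Proof. by have [f _ ->] := par_qE par; rewrite pnatX pnat_id. Qed.

Lemma kh_r'nat : r^'.-nat (k * h).
Proof.
have [k3 h3] := par_ge3 par.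
rewrite p'natE // -prime_coprime //; apply: coprime_dvdl rq _.
by rewrite coprimeMr (par_coprime_qk par) (par_coprime_qh par).
Qed.

Lemma part_r : (#|G|`_r = q)%N.
Proof.
have [k3 h3] := par_ge3 par.
rewrite cardG -mulnA partnM ?muln_gt0; try lia.
by rewrite part_pnat_id ?q_rnat // part_p'nat ?kh_r'nat ?muln1.
Qed.

Lemma card_Syl P : r.-Sylow(G) P -> #|P| = q.
Proof. by move/card_Hall=> ->; exact: part_r. Qed.

Lemma Sylow_card (P : {group gT}) : P \subset G -> #|P| = q -> r.-Sylow(G) P.
Proof.
move=> sPG cP; rewrite pHallE sPG cP; apply/eqP; symmetry; exact: part_r.
Qed.

Lemma Syl_relts P x : r.-Sylow(G) P -> x \in P -> x != 1%g -> x \in relts.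
Proof.
move=> sylP Px x1; rewrite inE (subsetP (pHall_sub sylP)) //=.
have px : r.-elt x := mem_p_elt (pHall_pgroup sylP) Px.
have [n] := p_natP px; case: n => [|n] Dn; last by rewrite Dn dvdn_exp.
by move/eqP: Dn; rewrite expn0 order_eq1 (negPf x1).
Qed.

Lemma Syl_rset P x : r.-Sylow(G) P -> x \in P -> x \in rset r G.
Proof.
move=> sylP Px; apply/setU1P; have [->|x1] := eqVneq x 1%g; first by left.
by right; apply: Syl_relts Px x1.
Qed.

Lemma cent_Syl x : x \in relts -> r.-Sylow(G) 'C_G[x].
Proof. by move=> xR; apply: Sylow_card (subsetIl _ _) (card_cent_relts par cardG degG xR). Qed.

Lemma Syl_norm_sub P Q : r.-Sylow(G) P -> r.-group Q -> Q \subset G -> Q \subset 'N(P)%g -> Q \subset P.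
Proof.
move=> sylP rQ sQG nPQ.
have sylP' : r.-Sylow('N_G(P)) P.
  by apply: (pHall_subl _ (subsetIl _ _) sylP); rewrite subsetI (pHall_sub sylP) normG.
have nPN : P <| 'N_G(P) by rewrite normalSG ?(pHall_sub sylP).
have sQN : Q \subset 'N_G(P) by rewrite subsetI sQG.
by rewrite (sub_normal_Hall sylP' nPN sQN).
Qed.

(** Every Sylow r-subgroup through x lies in the set [Y] of dq elements, and ['C_G[x]] is one of
    them. Distinct ones meet in at most q/r elements: for d = 1 two of them are too many for [Y],
    and for d = 2 three are. *)
Lemma cent_Sylow_eq P x : r.-Sylow(G) P -> x \in P -> x != 1%g -> 'C_G[x]%g = P.
Proof.
move=> sylP Px x1; have xR := Syl_relts sylP Px x1.
have sylC := cent_Syl xR; have cP := card_Syl sylP; have cC := card_Syl sylC.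
have Gx : x \in G := subsetP (pHall_sub sylP) x Px.
have Cx : x \in 'C_G[x]%G by rewrite inE Gx cent1id.
pose Y := [set y in rset r G | (y^-1 * x)%g \in rset r G].
have cY : #|Y| = (d * q)%N := card_rset_pairs par cardG degG xR.
have subY Q : r.-Sylow(G) Q -> x \in Q -> Q \subset Y.
  move=> sylQ Qx; apply/subsetP=> y Qy; rewrite inE (Syl_rset sylQ Qy).
  by rewrite (Syl_rset sylQ) // groupM ?groupV.
apply/eqP/negPn/negP=> nCP.
have capr (A B : {group gT}) : r.-Sylow(G) A -> r.-Sylow(G) B -> A != B :> {set gT} -> (#|A :&: B| * r <= q)%N.
  move=> sA sB nAB; apply: (proper_dvd_q par).
    by rewrite -(card_Syl sA) cardSg ?subsetIl.
  apply: contra nAB => /eqP cI.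
  have EA : A :&: B = A.
    by apply/eqP; rewrite eqEcard subsetIl cI (card_Syl sA) leqnn.
  by rewrite eqEcard -{1}EA subsetIr (card_Syl sA) (card_Syl sB) leqnn.
have capCP := capr _ _ sylC sylP nCP.
have [d1|d2] : d = 1%N \/ d = 2%N /\ (3 <= r)%N.
  case: (par_caseE par) => [[-> _ _]|[-> or _ _]]; [by left|right; split=> //].
  by have := prime_gt1 rp; case: (r) or => [|[|[|]]].
- have : (#|'C_G[x]%G :|: P| <= d * q)%N.
    by rewrite -cY subset_leq_card // subUset !subY.
  rewrite -(leq_add2r #|'C_G[x]%G :&: P|) cardsUI cC cP d1 mul1n leq_add2l.
  by have := prime_gt1 rp; move: #|_ :&: _| capCP q_gt3; clear; nia.
(* A third Sylow subgroup through x: if ['C_G[x]] normalized P, it would be contained in P. *)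
have [c Cc nPc] : exists2 c, c \in 'C_G[x]%g & (P :^ c)%g != P.
  have [/exists_inP[c Cc nc]|] := boolP [exists c in 'C_G[x]%g, (P :^ c)%g != P]; first by exists c.
  rewrite negb_exists => /forallP nn; case/negP: nCP.
  rewrite eqEcard cC cP leqnn andbT; apply: (Syl_norm_sub sylP (pHall_pgroup sylC) (subsetIl _ _)).
  apply/subsetP=> c Cc; have := nn c; rewrite Cc /= negbK => /eqP nc.
  by apply/normP.
have Gc : c \in G by case/setIP: Cc.
have sylPc : r.-Sylow(G) (P :^ c)%G by rewrite pHallJ.
have Pcx : x \in (P :^ c)%g.
  by rewrite mem_conjg; case/setIP: Cc => _ /cent1P cc; rewrite /conjg invgK mulgA cc mulgK.
have nCPc : 'C_G[x]%g != (P :^ c)%g.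
  apply: contra nCP => /eqP E; rewrite -(inj_eq (@conjsg_inj _ c)) -E.
  by rewrite (conjGid Cc).
have nPPc : P != (P :^ c)%g :> {set gT} by rewrite eq_sym.
have capCPc := capr _ _ sylC sylPc nCPc; have capPPc := capr _ _ sylP sylPc nPPc.
have : (#|'C_G[x]%G :|: P :|: (P :^ c)%g| <= d * q)%N.
  by rewrite -cY subset_leq_card // !subUset !subY.
have cPc : #|(P :^ c)%g| = q by rewrite cardJg.
have := cardsUI ('C_G[x] :|: P) (P :^ c)%g; have := cardsUI 'C_G[x]%g P.
have := cardsUI ('C_G[x] :&: (P :^ c)%g) (P :&: (P :^ c)%g).
rewrite -setIUl.
(* Pairwise intersections of at most q/3 elements leave a union of at least 2q plus the triple
   intersection; since x lies in the latter, 2q is exceeded. *)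
have : (0 < #|('C_G[x] :&: (P :^ c)%g) :&: (P :&: (P :^ c)%g)|)%N.
  by apply/card_gt0P; exists x; rewrite !in_setI Pcx Px Gx cent1id.
rewrite cC cP cPc; case: d2 => -> r3.
have cap3 n : (n * r <= q)%N -> (n * 3 <= q)%N by apply: leq_trans; rewrite leq_mul2l r3 orbT.
move: (cap3 _ capCP) (cap3 _ capCPc) (cap3 _ capPPc); clear => /=.
set a1 := #|_ :&: _|; set a2 := #|_ :&: P :^ c|; set a3 := #|P :&: P :^ c|.
set t := #|_ :&: (P :&: _)|; set u := #|(_ :|: _) :&: _|.
set w := #|_ :|: _ :|: _|; set v := #|_ :|: P|.
move: (a1) (a2) (a3) t u w v; clear; lia.
Qed.
End SylowTI.

Section SylowStructure.
Variables (r q k h d : nat) (e : int).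
Hypothesis par : psl_params r q k h d e.
Variables (gT : finGroupType) (G : {group gT}).
Hypotheses (cardG : #|G| = (q * k * h)%N) (degG : degree_ok q k h d G).
Implicit Types (P Q : {group gT}) (x : gT).

Let rp : prime r := par_prime par.
Let rq : (r %| q)%N := par_r_q par.
Let q_gt3 : (3 < q)%N := par_q_gt3 par.
Let d_gt0 : (0 < d)%N. Proof. by case/andP: (par_d_gt0 par). Qed.
Let kh_gt0 : (0 < k * h)%N.
Proof. by have [k3 h3] := par_ge3 par; rewrite muln_gt0; lia. Qed.

Local Notation relts := (relts r G).
Local Notation csyl := (cent_Sylow_eq par cardG degG).
Local Notation SylG := 'Syl_r(G).

Lemma Syl_TI P Q x : r.-Sylow(G) P -> r.-Sylow(G) Q -> x \in P -> x \in Q -> x != 1%g -> P = Q.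
Proof. by move=> sP sQ Px Qx x1; apply: val_inj; rewrite /= -(csyl sP Px x1) -(csyl sQ Qx x1). Qed.

Lemma Syl_abelian P : r.-Sylow(G) P -> abelian P.
Proof.
move=> sP; apply/centsP=> x Px y Py; have [->|x1] := eqVneq x 1%g; first exact: commute_sym (commute1 _).
by move: Py; rewrite -(csyl sP Px x1) => /setIP[_ /cent1P/commute_sym].
Qed.

Lemma Syl_norm_in P x : r.-Sylow(G) P -> x \in relts -> x \in 'N(P)%g -> x \in P.
Proof.
move=> sP xR nPx; have sC := cent_Syl par cardG degG xR.
have Gx : x \in G by move: xR; rewrite inE => /andP[].
have rx : r.-elt x by apply: mem_p_elt (pHall_pgroup sC) _; rewrite inE Gx cent1id.
by rewrite -cycle_subG; apply: (Syl_norm_sub sP) => //; rewrite cycle_subG.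
Qed.

Lemma relts_in_Syl x : x \in relts -> exists2 P : {group gT}, r.-Sylow(G) P & x \in P.
Proof.
move=> xR; exists 'C_G[x]%G; first exact: (cent_Syl par cardG degG xR).
by rewrite /= in_setI cent1id andbT; move: xR; rewrite inE => /andP[].
Qed.

(** The q^2 - 1 elements of [relts] are partitioned by the Sylow subgroups, with q - 1 in each. *)
Lemma card_SylG : #|SylG| = q.+1.
Proof.
have E : (#|relts| = \sum_(P in SylG) (q - 1))%N.
  transitivity (\sum_(x in relts) \sum_(P in SylG | x \in P) 1)%N.
    rewrite -sum1_card; apply: eq_bigr => x xR; have [P sP Px] := relts_in_Syl xR.
    have x1 : x != 1%g by apply: contraTneq xR => ->; exact: (one_notin_relts par).
    rewrite (big_pred1 P) // => Q; rewrite inE; apply/andP/eqP=> [[sQ Qx]|->//].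
    exact: Syl_TI sQ sP Qx Px x1.
  rewrite (exchange_big_dep (mem SylG)) => [|x P _ /andP[]//] /=.
  apply: eq_bigr => P; rewrite inE => sP; rewrite sum1_card -(card_Syl par cardG sP).
  rewrite (cardsD1 1%g P) group1 addKn; apply: eq_card => x.
  rewrite unfold_in /= sP /= in_setD1; apply/andP/andP => [[xR Px]|[x1 Px]].
    by split=> //; apply: contraTneq xR => ->; exact: (one_notin_relts par).
  by split=> //; exact: (Syl_relts sP Px x1).
move: E; rewrite sum_nat_const; have := card_relts par cardG degG.
move: #|relts| #|_| => a b E1 E2; rewrite E2 in E1.
have qm : q = (q - 1).+1 by move: q_gt3; clear; lia.
have m0 : (0 < q - 1)%N by move: q_gt3; clear; lia.
move: (q - 1)%N qm m0 E1 => m -> m0 E1; apply/eqP; rewrite -(eqn_pmul2r m0); apply/eqP.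
by move: E1; clear; lia.
Qed.

Lemma Syl_conj P x : r.-Sylow(G) P -> x \in G -> r.-Sylow(G) (P :^ x)%G.
Proof. by move=> sP Gx; rewrite pHallJ. Qed.

Lemma Syl_fix_inj P Q : r.-Sylow(G) P -> r.-Sylow(G) Q -> P != Q ->
  {in P &, injective (fun u => Q :^ u)%G}.
Proof.
move=> sP sQ nPQ u v Pu Pv /(congr1 val)/= E.
have nQ : (u * v^-1)%g \in 'N(Q)%g by apply/normP; rewrite conjsgM E -conjsgM mulgV conjsg1.
have [E1|n1] := eqVneq (u * v^-1)%g 1%g; first by rewrite -[u](mulgKV v) E1 mul1g.
have Puv : (u * v^-1)%g \in P by rewrite groupM ?groupV.
have xR := Syl_relts sP Puv n1.
by case/eqP: nPQ; apply: (Syl_TI sP sQ Puv (Syl_norm_in sQ xR nQ) n1).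
Qed.

(** By [Syl_fix_inj] the q elements of P give q distinct conjugates of Q, and there are only q Sylow
    subgroups other than P. *)
Lemma Syl_regular P Q Q' : r.-Sylow(G) P -> r.-Sylow(G) Q -> P != Q ->
  r.-Sylow(G) Q' -> P != Q' -> exists2 u, u \in P & Q' = (Q :^ u)%G.
Proof.
move=> sP sQ nPQ sQ' nPQ'.
have inj := Syl_fix_inj sP sQ nPQ.
have sub : [set (Q :^ u)%G | u in P] \subset SylG :\ P.
  apply/subsetP=> _ /imsetP[u Pu ->].
  have Gu := subsetP (pHall_sub sP) u Pu.
  rewrite in_setD1 inE Syl_conj // andbT; apply: contra nPQ => /eqP/(congr1 val)/= E.
  by apply/eqP/val_inj/(@conjsg_inj _ u); rewrite /= E conjGid.
have cP : #|SylG :\ P| = q.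
  have := cardsD1 P SylG; rewrite card_SylG inE sP /= add1n => -[]//.
have eqS : [set (Q :^ u)%G | u in P] = SylG :\ P.
  by apply/eqP; rewrite eqEcard sub /= cP (card_in_imset inj) (card_Syl par cardG sP) leqnn.
have : Q' \in SylG :\ P by rewrite in_setD1 eq_sym nPQ' inE.
by rewrite -eqS => /imsetP[u Pu ->]; exists u.
Qed.

Lemma Syl_norm_factor P Q : r.-Sylow(G) P -> r.-Sylow(G) Q -> P != Q ->
  (P * ('N_G(P) :&: 'N(Q)) = 'N_G(P))%g /\ (P :&: ('N_G(P) :&: 'N(Q)) = 1)%g.
Proof.
move=> sP sQ nPQ; have sPN : P \subset 'N_G(P)%g by rewrite subsetI (pHall_sub sP) normG.
split; last first.
  apply/trivgP/subsetP=> x /setIP[Px /setIP[_ nQx]]; rewrite inE; apply/negPn/negP=> x1.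
  have xR := Syl_relts sP Px x1.
  by case/eqP: nPQ; apply: Syl_TI sP sQ Px (Syl_norm_in sQ xR nQx) x1.
apply/eqP; rewrite eqEsubset mul_subG ?subsetIl //=; apply/subsetP=> g Ng.
have /setIP[Gg nPg] := Ng.
have [|u Pu E] := Syl_regular sP sQ nPQ (Syl_conj sQ (groupVr Gg)).
  apply: contra nPQ => /eqP/(congr1 val)/= E; apply/eqP/val_inj/(@conjsg_inj _ (g^-1)%g).
  by rewrite /= -E; apply/normP; rewrite groupV.
have Gu := subsetP (pHall_sub sP) u Pu.
have Nu := subsetP sPN u Pu.
rewrite -[g](mulKg u); apply: mem_mulg; first by rewrite groupV.
rewrite in_setI groupM //=; apply/normP.
by rewrite conjsgM -[(Q :^ u)%g]/(gval (Q :^ u)%G) -E /= -conjsgM mulVg conjsg1.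
Qed.

Lemma card_Syl_norm P Q : r.-Sylow(G) P -> r.-Sylow(G) Q -> P != Q ->
  (d * #|'N_G(P) :&: 'N(Q)| = q - 1)%N /\ #|'N_G(P)%g| = (q * #|'N_G(P) :&: 'N(Q)|)%N.
Proof.
move=> sP sQ nPQ; have [E1 E2] := Syl_norm_factor sP sQ nPQ.
have cN : #|'N_G(P)%g| = (q * #|'N_G(P) :&: 'N(Q)|)%N.
  by rewrite -{1}E1 TI_cardMg // (card_Syl par cardG sP).
split=> //; have := mathcomp.solvable.sylow.card_Syl sP.
rewrite card_SylG => ci.
have := Lagrange (subsetIl G 'N(P)); rewrite -ci cN cardG.
have := par_dkh par; have := kh_gt0; move: q_gt3; clear.
move: #|_ :&: _| => t; rewrite -[(q * k * h)%N]mulnA; move: (k * h)%N => kh q3 kh0 E1 E2.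
have q0 : (0 < q)%N by move: q3; clear; lia.
have E3 : (t * q.+1 = kh)%N.
  by apply/eqP; rewrite -(eqn_pmul2l q0) mulnA -E2.
have qm : q = (q - 1).+1 by move: q3; clear; lia.
rewrite -E3 in E1; clear E2 E3; move: (q - 1)%N qm E1 => m -> E1.
apply/eqP; rewrite -(@eqn_pmul2r m.+2) //; apply/eqP; move: E1; clear; lia.
Qed.

(** After conjugating P to Q by g, an element of Q, which is transitive on the other Sylow
    subgroups, brings Q^g back to P. *)
Lemma Syl_swap P Q : r.-Sylow(G) P -> r.-Sylow(G) Q -> P != Q ->
  exists2 w, w \in G & (P :^ w)%G = Q /\ (Q :^ w)%G = P.
Proof.
move=> sP sQ nPQ; have [g Gg E] := Sylow_trans sP sQ.
have EPg : (P :^ g)%G = Q by apply: val_inj.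
have sQg := Syl_conj sQ Gg.
have [||u Qu Eu] := Syl_regular sQ sQg _ sP.
- apply: contra nPQ => /eqP/(congr1 val)/= E'; apply/eqP/val_inj/(@conjsg_inj _ g).
  by rewrite /= -E' -E.
- by rewrite eq_sym.
have Gu := subsetP (pHall_sub sQ) u Qu.
exists (g * u)%g; first by rewrite groupM.
split; apply: val_inj; rewrite /= conjsgM.
  by rewrite -E conjGid.
by rewrite [in RHS]Eu.
Qed.

Definition nfix g := #|[set Q in SylG | (Q :^ g)%G == Q]|.

Lemma Ind_norm_nfix P g : r.-Sylow(G) P -> g \in G -> 'Ind[G, 'N_G(P)] 1 g = (nfix g)%:R.
Proof.
move=> sP Gg; have sNG : 'N_G(P) \subset G := subsetIl _ _.
rewrite cfIndE // (reindex_inj invg_inj) /=.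
rewrite (eq_bigr (fun y => (((P :^ y) :^ g)%G == (P :^ y)%G)%:R)) => [|y]; last first.
  rewrite groupV => Gy; rewrite cfun1E in_setI groupJ ?groupV //=; congr (_%:R : algC).
  congr (nat_of_bool _); apply/normP/eqP=> [E|/(congr1 val)/= E].
    apply: val_inj; rewrite /= -[in RHS]E; rewrite /conjg invgK !conjsgM conjsgKV //.
  by rewrite /conjg invgK !conjsgM E conjsgK.
rewrite (eq_bigl (mem G)) => [|y]; last by rewrite /= groupV.
rewrite (partition_big (fun y => (P :^ y)%G) (mem SylG)) => [|y Gy]; last by rewrite /= inE Syl_conj.
rewrite (eq_bigr (fun Q : {group gT} => #|'N_G(P)|%:R * ((Q :^ g)%G == Q)%:R)) => [|Q]; last first.
  rewrite /= inE => sQ; rewrite (eq_bigr (fun=> ((Q :^ g)%G == Q)%:R)) => [|y /andP[_ /eqP<-]//].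
  rewrite sumr_const [RHS]mulr_natl; congr (_ *+ _).
  have [z Gz Ez] := Sylow_trans sP sQ.
  rewrite -(card_rcoset _ z); apply: eq_card => y; rewrite mem_rcoset in_setI [in LHS]unfold_in /=.
  rewrite groupMr ?groupV //; apply: andb_id2l => Gy.
  apply/eqP/normP=> [/(congr1 val)/= E|E].
    by rewrite conjsgM E Ez -conjsgM mulgV conjsg1.
  apply: val_inj; rewrite /= Ez -[in RHS]E -conjsgM mulgKV //.
rewrite -mulr_sumr mulKf ?neq0CG // -natr_sum /nfix -sum1_card big_mkcond [in RHS]big_mkcond /=.
by congr (_%:R); apply: eq_bigr => Q _; rewrite !inE; case: pHall; case: eqP.
Qed.

(** The permutation character has degree q + 1 and contains 1 once, leaving qN + kA + hB = q;
    coprimality and size admit only N = 1, A = B = 0. *)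
Lemma nfix_theta g : g \in G -> (nfix g)%:R = 1 + theta q G g.
Proof.
move=> Gg; have [P sP] := Sylow_exists r G.
pose pi := 'Ind[G, 'N_G(P)] (1 : 'CF('N_G(P))).
have pi_ch : pi \is a character by rewrite cfInd_char ?cfun1_char.
have pi0 : '[pi, 'chi_0] = 1.
  by rewrite irr0 -cfdot_Res_r cfRes_cfun1 ?subsetIl // -irr0 cfnorm_irr.
have /fin_all_exists[n Dn] i : exists m : nat, '[pi, 'chi_i] = m%:R.
  by apply/natrP; apply: Cnat_cfdot_char_irr.
have Dpi : pi = \sum_i (n i)%:R *: 'chi_i.
  by rewrite {1}(cfun_sum_cfdot pi); apply: eq_bigr => i _; rewrite Dn.
have n0 : n 0 = 1%N by apply/eqP; rewrite -(eqr_nat algC) -Dn pi0.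
have c1 : nfix 1 = q.+1.
  rewrite -card_SylG; apply: eq_card => Q; rewrite !inE andb_idr // => _.
  by apply/eqP/val_inj; rewrite /= conjsg1.
have E : (\sum_i n i * degn i = q.+1)%N.
  apply/eqP; rewrite -(eqr_nat algC) -c1 -(Ind_norm_nfix sP (group1 G)) -/pi Dpi sum_cfunE natr_sum.
  by apply/eqP/eq_bigr => i _; rewrite cfunE natrM degnE.
have [k3 h3] := par_ge3 par.
pose NQ := (\sum_i n i * wtQ q i)%N; pose A := (\sum_i n i * wtK k i)%N.
pose B := (\sum_i n i * wtH q k h i)%N.
have E2 : (q * NQ + k * A + h * B = q)%N.
  apply: (@addnI 1); rewrite [RHS]add1n -E /NQ /A /B !big_distrr /=.
  have E1 : 1%N = (\sum_i n i * (i == 0%R :> Iirr G))%N.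
    by rewrite (bigD1 0%R) //= n0 big1 ?addn0 // => i /negPf->; rewrite muln0.
  rewrite [X in (X + _)%N]E1.
  rewrite -!big_split /=; apply: eq_bigr => i _; rewrite [in RHS](degn_wt par cardG degG i); ring.
have [i1 [Di1 ui1 Dth]] := steinberg_exists par cardG degG.
have NQ1 : NQ = 1%N /\ A = 0%N /\ B = 0%N.
  case: (NQ) E2 => [|[|m]]; rewrite ?muln0 ?add0n => E2; last 1 first.
  - by exfalso; move: E2 q_gt3; clear; nia.
  - exfalso; have kE := par_kE par; have e1 := par_e1 par.
    case: (A) E2 => [|[|m]] E2.
    + rewrite muln0 add0n in E2; have : (h %| gcdn q h)%N by rewrite dvdn_gcd -{1}E2 dvdn_mulr ?dvdnn.
      rewrite (eqP (par_coprime_qh par)) dvdn1; move: h3; clear; lia.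
    + case: (B) E2 => [|m] E2; first by move: E2 e1 kE; clear; lia.
      by move: E2 e1 kE h3; clear; nia.
    by move: E2 e1 kE q_gt3; clear; nia.
  split=> //; move: E2 k3 h3; rewrite muln1; clear; nia.
have i10 : i1 != 0 by apply/eqP=> i0; move: Di1; rewrite i0 degn0; move: q_gt3; clear; lia.
have n1 : n i1 = 1%N.
  case: NQ1 => + _; rewrite /NQ (bigD1 i1) //= /wtQ Di1 eqxx muln1 big1 ?addn0 // => i /negPf ni.
  by case: eqP => [/ui1 Di|]; rewrite ?muln0 //; rewrite Di eqxx in ni.
have nothers i : i != 0 -> i != i1 -> n i = 0%N.
  move=> i0 ni; move: E; rewrite (bigD1 0) //= (bigD1 i1) //= (bigD1 i) ?i0 //=.
  rewrite n0 n1 !mul1n degn0 Di1; have := degn_gt0 i; clear; nia.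
rewrite -(Ind_norm_nfix sP Gg) -/pi Dpi sum_cfunE (bigD1 0) //= (bigD1 i1) //= big1 => [|i /andP[i0 ni]].
  by rewrite n0 n1 !cfunE !mul1r addr0 Dth irr0 cfun1E Gg.
by rewrite nothers // cfunE mul0r.
Qed.
End SylowStructure.

(** * Elements interchanging two Sylow subgroups *)

Section SwapInvolution.
Variables (r q k h d : nat) (e : int).
Hypothesis par : psl_params r q k h d e.
Variables (gT : finGroupType) (G : {group gT}).
Hypotheses (cardG : #|G| = (q * k * h)%N) (degG : degree_ok q k h d G).
Implicit Types (P Q A B : {group gT}) (x g : gT).

Let rp : prime r := par_prime par.
Let rq : (r %| q)%N := par_r_q par.
Let q_gt3 : (3 < q)%N := par_q_gt3 par.
Local Notation SylG := 'Syl_r(G).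

(** For even q, r = 2, so t fixes one point and has centralizer of order at most q. For odd q, 2
    divides k, so t fixes 1 + e points and its centralizer has order at most k = q - e. *)
Lemma involution_fix_bound : exists t, [/\ t \in G, #[t] = 2%N &
  (#|'C_G[t]| + nfix r G t <= q.+1)%N].
Proof.
case: (par_caseE par) => [[d1 r2 _]|[d2 or k4 e1]].
  have pr2 : prime 2 by [].
  have q2 : (2 %| q)%N by rewrite -r2.
  have [t Gt ot] : exists2 x, x \in G & #[x] = 2%N.
    by apply: (exists_order cardG) => //; rewrite -mulnA dvdn_mulr.
  have pt : (2 %| #[t])%N by rewrite ot.
  exists t; split=> //.
  have C := cent_q par cardG degG Gt pr2 q2 pt.
  have -> : nfix r G t = 1%N.
    apply/eqP; rewrite -(eqr_nat algC) (nfix_theta par cardG degG Gt).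
    by rewrite (steinberg_value_q par cardG degG Gt pr2 q2 pt) addr0.
  by rewrite addn1 ltnS dvdn_leq // ltnW // ltnW // ltnW.
have pr2 : prime 2 by [].
have q2 : (2 %| k)%N by apply: dvdn_trans k4.
have [t Gt ot] : exists2 x, x \in G & #[x] = 2%N.
  by apply: (exists_order cardG) => //; rewrite mulnAC dvdn_mull.
have pt : (2 %| #[t])%N by rewrite ot.
exists t; split=> //.
have C := cent_k par cardG degG Gt pr2 q2 pt.
have k3 : (0 < k)%N by have [k3 _] := par_ge3 par; apply: ltn_trans k3.
have Ck := dvdn_leq k3 C.
have : (nfix r G t)%:Z = 1 + e.
  apply: (@intr_inj algC); rewrite -pmulrn (nfix_theta par cardG degG Gt).
  by rewrite (steinberg_value_k par cardG degG Gt pr2 q2 pt) rmorphD.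
have := par_kE par; move: Ck; clear; move: (nfix r G t) #|_| => a b; lia.
Qed.

Definition swaps g A : bool := ((A :^ g)%G != A) && (((A :^ g) :^ g)%G == A).

(** For an ordered pair (A, B) the elements interchanging A and B lie in one coset of the two-point
    stabilizer, of order (q - 1)/d; over the q(q + 1) pairs this adds up to |G|. *)
Lemma sum_swaps_le : (\sum_(g in G) \sum_(A in SylG) swaps g A <= #|G|)%N.
Proof.
rewrite exchange_big /=.
have bd A : A \in SylG -> (d * \sum_(g in G) swaps g A <= q * (q - 1))%N.
  rewrite inE => sA.
  have -> : (\sum_(g in G) swaps g A =
     \sum_(B in SylG :\ A) #|[set g in G | ((A :^ g)%G == B) && ((B :^ g)%G == A)]|)%N.
    rewrite (partition_big (fun g => (A :^ g)%G) (mem SylG)) => [|g Gg]; last first.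
      by rewrite /= inE Syl_conj.
    rewrite (big_setD1 A) ?inE //= [X in (X + _)%N]big1 ?add0n => [|g /andP[_ /eqP E]]; last first.
      by rewrite /swaps E eqxx.
    apply: eq_bigr => B /setD1P[nBA _]; rewrite -sum1_card [RHS]big_mkcond [LHS]big_mkcond /=.
    apply: eq_bigr => g _; rewrite inE; case: (g \in G) => //=.
    rewrite /swaps; case: eqP => [->|]; last by [].
    rewrite nBA /=.
    by case: (_ == A).
  rewrite big_distrr /=; have cS : #|SylG :\ A| = q.
    have := cardsD1 A SylG; rewrite (card_SylG par cardG degG) inE sA /= add1n => -[].
    by move->.
  rewrite -{1}cS -sum_nat_const; apply: leq_sum => B /setD1P[nBA]; rewrite inE => sB.
  have nAB : A != B by rewrite eq_sym.
  have [cN _] := card_Syl_norm par cardG degG sA sB nAB.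
  rewrite -cN leq_mul2l; apply/orP; right.
  have [->|[g0]] := set_0Vmem [set g in G | ((A :^ g)%G == B) && ((B :^ g)%G == A)].
    by rewrite cards0.
  rewrite in_set => /andP[Gg0 /andP[/eqP EA /eqP EB]].
  rewrite -[X in (_ <= X)%N](card_rcoset _ g0) subset_leq_card //; apply/subsetP=> g.
  rewrite in_set => /andP[Gg /andP[/eqP/(congr1 val)/= EA' /eqP/(congr1 val)/= EB']].
  move/(congr1 val): EA => /= EA; move/(congr1 val): EB => /= EB.
  rewrite mem_rcoset !in_setI groupMr ?groupV // Gg /=; apply/andP; split; apply/normP; rewrite conjsgM.
    by rewrite EA' -EA -conjsgM mulgV conjsg1.
  by rewrite EB' -EB -conjsgM mulgV conjsg1.
have d0 : (0 < d)%N by case/andP: (par_d_gt0 par).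
rewrite -(leq_pmul2l d0) big_distrr /= cardG.
apply: (@leq_trans (\sum_(A in SylG) (q * (q - 1)))%N); first by apply: leq_sum => A; exact: bd.
rewrite sum_nat_const (card_SylG par cardG degG); have := par_dkh par.
have -> : (d * (q * k * h) = q * (d * (k * h)))%N by ring.
move: (d * (k * h))%N => m E.
have -> : (q.+1 * (q * (q - 1)) = q * (q.+1 * (q - 1)))%N by ring.
rewrite leq_mul2l; apply/orP; right; have qm : q = (q - 1).+1 by move: q_gt3; clear; lia.
by move: (q - 1)%N qm E => u ->; clear; lia.
Qed.

(** Each conjugate of t moves q + 1 - fix(t), at least |C(t)|, points, all of them by swaps. The
    class of t thus exhausts the bound of [sum_swaps_le], and any swapping element is conjugate to
    t. *)
Theorem swap_involution P Q g : r.-Sylow(G) P -> r.-Sylow(G) Q -> P != Q -> g \in G ->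
  (P :^ g)%G = Q -> (Q :^ g)%G = P -> (g ^+ 2 = 1)%g.
Proof.
move=> sP sQ nPQ Gg EP EQ; have [t [Gt ot bt]] := involution_fix_bound.
have t2 : (t ^+ 2 = 1)%g by rewrite -ot expg_order.
have [/imsetP[z _ ->]|ngt] := boolP (g \in t ^: G); first by rewrite -conjXg t2 conj1g.
have := sum_swaps_le; rewrite leqNgt => /negP[].
rewrite (bigID (mem (t ^: G))) /= -addn1 leq_add //; last first.
  by rewrite (bigD1 g) ?Gg //= (bigD1 P) ?inE //= /swaps EP EQ eq_sym nPQ eqxx.
have nfixJ z : z \in G -> nfix r G (t ^ z) = nfix r G t.
  move=> Gz; apply/eqP; rewrite -(eqr_nat algC) !(nfix_theta par cardG degG) ?groupJ //.
  have [i0 [_ _ Dth]] := steinberg_exists par cardG degG.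
  by rewrite !Dth cfunJ.
have low x : x \in t ^: G -> (#|'C_G[t]| <= \sum_(A in SylG) swaps x A)%N.
  case/imsetP=> z Gz ->; have tz2 : ((t ^ z) * (t ^ z) = 1)%g by rewrite -conjMg -[(t * t)%g]/(t ^+ 2)%g t2 conj1g.
  have -> : (\sum_(A in SylG) swaps (t ^ z) A = #|[set A in SylG | (A :^ (t ^ z))%G != A]|)%N.
    rewrite -sum1_card big_mkcond [RHS]big_mkcond /=; apply: eq_bigr => A _.
    rewrite [in RHS]inE; case: (A \in SylG) => //=; rewrite /swaps.
    have -> : ((A :^ (t ^ z)) :^ (t ^ z))%G = A by apply: val_inj; rewrite /= -conjsgM tz2 conjsg1.
    by rewrite eqxx andbT; case: (_ == _).
  rewrite -(leq_add2r (nfix r G (t ^ z))) nfixJ //; apply: leq_trans bt _.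
  rewrite -(nfixJ _ Gz) /nfix -(card_SylG par cardG degG).
  rewrite -(cardsID [set A in SylG | (A :^ (t ^ z))%G == A] SylG) addnC leq_add // subset_leq_card //.
    by apply/subsetP=> A; rewrite !inE => /andP[]; case: pHall.
  by apply/subsetP=> A; rewrite !inE => /andP[_].
rewrite (eq_bigl (mem (t ^: G))) => [|x]; last first.
  by rewrite /= andb_idl // => /imsetP[z Gz ->]; rewrite groupJ.
apply: (@leq_trans (\sum_(x in t ^: G) #|'C_G[t]|)%N); last by apply: leq_sum => x; exact: low.
by rewrite sum_nat_const -index_cent1 mulnC Lagrange ?subsetIl.
Qed.
End SwapInvolution.

(** * A field structure on a Sylow r-subgroup *)

Section FieldCoordinates.
Variables (p n' : nat) (F : finFieldType).
Local Notation n := n'.+1.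
Hypotheses (pF : p \in [pchar F]) (cardF : #|F| = (p ^ n)%N).
Variable A : 'M['F_p]_n.
Hypothesis (irrA : forall V : 'M['F_p]_n, (V *m A <= V)%MS -> V != 0 -> row_full V).
Hypothesis (Aq : A ^+ #|F| = A).

Local Notation FR := (pPrimeCharType pF).
Local Notation phi := (map_poly (in_alg FR)).

Let p_pr : prime p. Proof. exact: pcharf_prime pF. Qed.

Lemma minpoly_root : exists g : FR, root (phi (mxminpoly A)) g.
Proof.
have dv : mxminpoly A %| 'X^#|F| - 'X.
  by apply: mxminpoly_min; rewrite rmorphB /= rmorphXn /= horner_mx_X Aq subrr.
have dvF : phi (mxminpoly A) %| \prod_(x : F) ('X - x%:P).
  rewrite -finField_genPoly.
  have -> : 'X^#|F| - 'X = phi ('X^#|F| - 'X) by rewrite rmorphB /= map_polyXn map_polyX.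
  by rewrite dvdp_map.
have [m Em] := dvdp_prod_XsubC dvF.
have : (1 < size (phi (mxminpoly A)))%N.
  by rewrite size_map_poly size_mxminpoly ltnS mxminpoly_nonconstant.
rewrite (eqp_size Em).
case: (mask m _) Em => [|g s] Em; first by rewrite big_nil size_poly1.
by exists g; rewrite (eqp_root Em) big_cons rootM root_XsubC eqxx.
Qed.

(** The minimal polynomial of A divides X^q - X, so it has a root g in F. As v0 is cyclic for the
    irreducible A, sending v0 u(A) to u(g) is well defined; it is additive and turns A into
    multiplication by g, and its kernel is an A-stable subspace missing v0. *)
Lemma field_coordinates (v0 : 'rV['F_p]_n) : v0 != 0 ->
  exists (j : 'rV['F_p]_n -> F) (g : F),
    [/\ {morph j : u v / u + v}, injective j, j v0 = 1 & forall v, j (v *m A) = g * j v].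
Proof.
move=> nz0; have [g rg] := minpoly_root.
pose lam (u : {poly 'F_p}) := v0 *m horner_mx A u.
pose kap (u : {poly 'F_p}) : FR := (phi u).[g].
have kapD u v : kap (u + v) = kap u + kap v by rewrite /kap rmorphD /= hornerD.
have kapM u v : kap (u * v) = kap u * kap v by rewrite /kap rmorphM /= hornerM.
have kapX : kap 'X = g by rewrite /kap /= map_polyX hornerX.
have lamD u v : lam (u + v) = lam u + lam v by rewrite /lam rmorphD /= mulmxDr.
have lamX u : lam (u * 'X) = lam u *m A.
  by rewrite /lam rmorphM /= horner_mx_X -mulmxA.
pose V := \matrix_(i < n) lam 'X^i.
have lam_onto v : exists u, lam u == v.
  pose W := <<V>>%MS.
  have lamV u : (lam u <= V)%MS.
    have red : lam u = lam (u %% mxminpoly A).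
      rewrite {1}(divp_eq u (mxminpoly A)) lamD /lam rmorphM /= mx_root_minpoly.
      by rewrite -[_ * 0]/(_ *m 0) !mulmx0 add0r.
    rewrite red; set w := _ %% _.
    have szw : (size w <= n)%N.
      have := size_mod_mxminpoly A u; move/leq_trans; apply.
      have := dvdp_leq (monic_neq0 (char_poly_monic A)) (mxminpoly_dvd_char A).
      by rewrite size_mxminpoly size_char_poly.
    have -> : lam w = \sum_(i < n) w`_i *: lam 'X^i.
      rewrite /lam -{1}(take_poly_id szw) /take_poly poly_def raddf_sum /= mulmx_sumr.
      by apply: eq_bigr => i _; rewrite linearZ /= -scalemxAr.
    apply: summx_sub => i _; apply: scalemx_sub.
    have <- : row i V = lam 'X^i by rewrite rowK.
    exact: row_sub.
  have VA : (V *m A <= V)%MS.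
    apply/row_subP => i; rewrite row_mul rowK -lamX; exact: lamV.
  have lam1 : lam 1 = v0 by rewrite /lam rmorph1 mulmx1.
  have nzV : V != 0.
    apply: contraNneq nz0 => V0; rewrite -lam1.
    by have := lamV 1; rewrite V0 submx0.
  have /submx_full-/(_ _ v) := irrA VA nzV => /submxP [D ->].
  exists (\sum_i D 0 i *: 'X^i); rewrite /lam raddf_sum /= mulmx_sumr mulmx_sum_row.
  by apply/eqP; apply: eq_bigr => i _; rewrite linearZ /= -scalemxAr rowK.
have ker0 u : lam u = 0 -> kap u = 0.
  move=> l0; have hu0 : horner_mx A u = 0.
    apply/row_matrixP => i; rewrite row0 rowE.
    have [w /eqP <-] := lam_onto (delta_mx 0 i).
    rewrite /lam -mulmxA -[_ *m horner_mx A u]/(horner_mx A w * horner_mx A u).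
    by rewrite -rmorphM mulrC rmorphM -[_ * _]/(_ *m _) mulmxA -/(lam u) l0 mul0mx.
  have /dvdpP [w ->] := mxminpoly_min hu0.
  by rewrite kapM [kap (mxminpoly A)](rootP rg) mulr0.
have kapB u v : kap (u - v) = kap u - kap v by rewrite /kap rmorphB /= hornerD hornerN.
have lamB u v : lam (u - v) = lam u - lam v by rewrite /lam rmorphB /= mulmxBr.
have kap_lam u v : lam u = lam v -> kap u = kap v.
  by move=> e; apply/eqP; rewrite -subr_eq0 -kapB ker0 // lamB e subrr.
have lam1 : lam 1 = v0 by rewrite /lam rmorph1 mulmx1.
have kap1 : kap 1 = 1 by rewrite /kap rmorph1 hornerC.
pose f v := xchoose (lam_onto v).
have fP v : lam (f v) = v by apply/eqP; rewrite (xchooseP (lam_onto v)).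
pose j v : FR := kap (f v).
have jlam u : j (lam u) = kap u by apply: kap_lam; rewrite fP.
have jD u v : j (u + v) = j u + j v by rewrite -{1}(fP u) -{1}(fP v) -lamD jlam kapD.
have jA v : j (v *m A) = g * j v.
  by rewrite -{1}(fP v) -lamX jlam kapM kapX mulrC.
have j0 : j 0 = 0 by apply: (addrI (j 0)); rewrite -jD !addr0.
have jZ (a : 'F_p) v : j (a *: v) = (in_alg FR a) * j v.
  rewrite -{1}(fP v); have -> : a *: lam (f v) = lam (a%:P * f v).
    by rewrite /lam mul_polyC linearZ /= -scalemxAr.
  by rewrite jlam kapM /kap map_polyC hornerC.
have jsum (I : finType) (E : I -> 'rV_n) : j (\sum_i E i) = \sum_i j (E i).
  by elim/big_rec2: _ => // i y1 y2 _ <-; rewrite jD.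
exists j, g; split=> //; last by rewrite -lam1 jlam.
(* The kernel of j as a row space, so that irreducibility of A applies to it. *)
pose K := \sum_(v : 'rV['F_p]_n | j v == 0) <<v>>%MS.
have inK v : (v <= (\sum_(v : 'rV['F_p]_n | j v == 0%R) <<v>>)%MS)%MS -> j v = 0.
  case/sub_sumsmxP => D ->.
  elim/big_rec: _ => // u y ju0 jy; rewrite jD jy addr0.
  have /sub_rVP [a ->] : (D u *m <<u>> <= u)%MS by rewrite (submx_trans (submxMl _ _)) // genmxE.
  by rewrite jZ (eqP ju0) mulr0.
clear K; set K := (\sum_(v | _) _)%MS in inK.
have KA : (K *m A <= K)%MS.
  rewrite sumsmxMr; apply/sumsmx_subP => v /eqP jv0.
  rewrite (eqmxMr _ (genmxE _)) (sumsmx_sup (v *m A)) ?genmxE //.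
  by rewrite jA jv0 mulr0.
have K0 : K = 0.
  apply/eqP; apply: contraT => nzK.
  have := inK v0 (submx_full _ (irrA KA nzK)).
  by rewrite -lam1 jlam kap1 => /eqP; rewrite oner_eq0.
move=> u v ejuv; apply/eqP; rewrite -subr_eq0 -submx0 -K0.
have juv : j (u - v) = 0 by apply: (addIr (j v)); rewrite -jD subrK add0r.
by rewrite (sumsmx_sup (u - v)) ?genmxE ?juv.
Qed.
End FieldCoordinates.

Section FiniteFieldSquares.
Variable F : finFieldType.

Definition nzsq : {set F} := [set y ^+ 2 | y in [set~ 0%R : F]].

Lemma card_nzsq_ge : (#|F| - 1 <= #|nzsq| * 2)%N.
Proof.
set S := nzsq.
have -> : (#|F| - 1)%N = #|[set~ 0%R : F]| by rewrite cardsC1 subn1.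
rewrite -sum1_card (partition_big (fun y => y ^+ 2) (mem S)) /=; last by move=> y y0; apply: imset_f.
rewrite -sum_nat_const; apply: leq_sum => s _.
rewrite sum1dep_card; set B := [set _ | _].
have [->|[y0]] := set_0Vmem B; first by rewrite cards0.
rewrite !inE => /andP[_ /eqP ey0].
suff: B \subset [set y0; - y0] by move/subset_leq_card/leq_trans; apply; rewrite cards2; case: eqP.
by apply/subsetP=> y; rewrite !inE -ey0 => /andP[_]; rewrite eqf_sqr.
Qed.

Lemma card_unity_roots_le m : (0 < m)%N -> (#|[set x : F | x ^+ m == 1%R]| <= m)%N.
Proof.
move=> m0; rewrite cardE; apply: (max_unity_roots m0); last exact: enum_uniq.
by apply/allP=> x; rewrite mem_enum inE unity_rootE.
Qed.

(** For d = 1 the order q is even and x = (x^(q/2))^2. For d = 2 there are at least m nonzero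
    squares, all roots of X^m - 1, which has at most m roots. *)
Lemma unity_root_sqrP (d m : nat) (x : F) : (d * m = #|F| - 1)%N ->
  d = 1%N /\ ~~ odd #|F| \/ d = 2%N -> x != 0 ->
  reflect (exists2 y, y != 0 & x = y ^+ 2) (x ^+ m == 1).
Proof.
move=> dm cd x0; apply: (iffP idP); last first.
  case=> y y0 ->; have y1 : y ^+ (#|F| - 1) = 1.
    by apply: (mulfI y0); rewrite mulr1 -exprS subn1 prednK ?expf_card //; apply/card_gt0P; exists 0.
  case: cd dm => [[-> _]|->] dm; first by rewrite mul1n in dm; rewrite exprAC dm y1 expr1n.
  by rewrite -exprM dm y1.
case: cd dm => [[-> ev]|->] dm; first move=> _.
  exists (x ^+ (#|F|./2)); first exact: expf_neq0.
  by rewrite -exprM muln2 halfK (negbTE ev) subn0 expf_card.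
move=> xm; have m0 : (0 < m)%N by have g1 : (1 < #|F|)%N := card_finRing_gt1 F; clear -dm g1; lia.
suff /eqP e : nzsq == [set x : F | x ^+ m == 1].
  have : x \in [set x : F | x ^+ m == 1] by rewrite inE.
  by rewrite -e => /imsetP[y]; rewrite !inE => y0 ->; exists y.
rewrite eqEcard; apply/andP; split.
  apply/subsetP=> z /imsetP[y]; rewrite !inE => y0 ->; rewrite -exprM dm.
  by apply/eqP/(mulfI y0); rewrite mulr1 -exprS subn1 prednK ?expf_card //; apply/card_gt0P; exists 0.
by apply: leq_trans (card_unity_roots_le m0) _; have := card_nzsq_ge; clear -dm; rewrite -dm; lia.
Qed.
End FiniteFieldSquares.

Section SylowCoordinates.
Variables (r q k h d : nat) (e : int).
Hypothesis par : psl_params r q k h d e.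
Variables (gT : finGroupType) (G : {group gT}).
Hypotheses (cardG : #|G| = (q * k * h)%N) (degG : degree_ok q k h d G).
Variables (P Q : {group gT}).
Hypotheses (sP : r.-Sylow(G) P) (sQ : r.-Sylow(G) Q) (nPQ : P != Q).

Let rp : prime r := par_prime par.
Let q_gt3 : (3 < q)%N := par_q_gt3 par.
Local Notation T := ('N_G(P) :&: 'N(Q))%G.

Let cP : #|P| = q. Proof. by have := @card_Syl _ _ _ _ _ _ par _ _ cardG _ sP; move=> ->. Qed.
Let cT : (d * #|T| = q - 1)%N. Proof. by have [] := card_Syl_norm par cardG degG sP sQ nPQ. Qed.
Let PT1 : (P :&: T = 1)%g. Proof. by have [] := Syl_norm_factor par cardG degG sP sQ nPQ. Qed.
Let nPT : T \subset 'N(P). Proof. by apply/subsetP=> x /setIP[/setIP[]]. Qed.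
Let sTG : T \subset G. Proof. by apply/subsetP=> x /setIP[/setIP[]]. Qed.

Lemma torus_semiregular x t : x \in P -> x != 1%g -> t \in T -> (x ^ t)%g = x -> t = 1%g.
Proof.
move=> Px x1 Tt xt; have : t \in (P :&: T)%g.
  rewrite inE Tt andbT -(cent_Sylow_eq par cardG degG sP Px x1) inE (subsetP sTG) //.
  by apply/cent1P; rewrite /commute -{1}xt -conjgC.
by rewrite PT1 => /set1P.
Qed.

(** Both w and tw interchange P and Q, so both square to 1. *)
Lemma swap_inverts w t : w \in G -> (P :^ w)%G = Q -> (Q :^ w)%G = P -> t \in T ->
  (t ^ w = t^-1)%g.
Proof.
move=> Gw Pw Qw Tt; have Gt := subsetP sTG t Tt.
have w2 := swap_involution par cardG degG sP sQ nPQ Gw Pw Qw.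
have [nPt nQt] : t \in 'N(P) /\ t \in 'N(Q) by case/setIP: Tt => /setIP[].
have : ((t * w) ^+ 2 = 1)%g.
  apply: (swap_involution par cardG degG sP sQ nPQ) => //; first exact: groupM.
    by apply/val_inj; rewrite /= conjsgM (normP nPt) -Pw.
  by apply/val_inj; rewrite /= conjsgM (normP nQt) -Qw.
rewrite !expgS !expg0 !mulg1 in w2 *.
have -> : (t ^ w = w * t * w)%g by rewrite conjgE -[w^-1%g]mulg1 -w2 mulKg mulgA.
by move=> twtw; apply: (mulgI t); rewrite mulgV -twtw !mulgA.
Qed.

(** Inversion on T is conjugation by w, hence a homomorphism. *)
Lemma torus_abelian : abelian T.
Proof.
have [w Gw [Pw Qw]] := Syl_swap par cardG degG sP sQ nPQ.
apply/centsP=> x Tx y Ty; apply: invg_inj; rewrite !invMg.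
have I := swap_inverts Gw Pw Qw; rewrite -!I // -!conjMg.
by rewrite I ?groupM // invMg -!I // -conjMg I ?groupM // invMg.
Qed.

(** A nontrivial invariant M contains a regular T-orbit of (q - 1)/d nonidentity elements, at least
    half of those of P, so its index is below 2. *)
Lemma torus_minnormal : minnormal P T.
Proof.
have P1 : P :!=: 1%g by rewrite -cardG_gt1 cP; lia.
apply/mingroupP; split; first by rewrite P1 nPT.
move=> M /andP[ntM nTM] sMP; apply/eqP; rewrite eqEcard sMP cP.
have [x Mx x1] := trivgPn _ ntM; have Px := subsetP sMP x Mx.
have tM : (#|T| <= #|M| - 1)%N.
  have inj : {in T &, injective (fun t => x ^ t)%g}.
    move=> s t Ts Tt /= es; apply/eqP; rewrite eq_mulgV1; apply/eqP.
    by apply: (torus_semiregular Px x1); rewrite ?groupM ?groupV // conjgM es conjgK.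
  rewrite -(card_in_imset inj); apply: leq_trans (subset_leq_card (B := M^#) _) _; last first.
    by rewrite (cardsD1 1%g M) group1 add1n subn1.
  apply/subsetP=> _ /imsetP[t Tt ->]; rewrite !inE conjg_eq1 x1 memJ_norm //.
  exact: (subsetP nTM).
have /dvdnP[c ec] := cardSg sMP; rewrite cP in ec.
have M0 := cardG_gt0 M.
have dT : (d * #|T| <= 2 * (#|M| - 1))%N by apply: leq_mul tM; case/andP: (par_d_gt0 par).
have cM : (0 < c * #|M|)%N by rewrite -ec; apply: leq_trans q_gt3.
have c2 : (c < 2)%N.
  by rewrite -(ltn_pmul2r M0); move: dT; rewrite cT ec; move: (c * #|M|)%N #|M| M0 cM; clear; lia.
by rewrite ec -{2}[#|M|]mul1n leq_mul2r -ltnS c2 orbT.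
Qed.

Variable F : finFieldType.
Hypothesis cardF : #|F| = q.

(** T is abelian and acts faithfully and irreducibly, so it is cyclic; a generator becomes
    multiplication by some g, and the powers of g are all the roots of X^|T| - 1, that is the
    nonzero squares. This is why multipliers have the form s^2. *)
Lemma Sylow_coordinates u0 : u0 \in P -> u0 != 1%g ->
  exists j : gT -> F,
  [/\ {in P &, injective j}, {in P &, {morph j : u v / (u * v)%g >-> u + v}}, j u0 = 1,
     (forall y, exists2 u, u \in P & j u = y)
   & (forall t, t \in T -> exists2 s, s != 0 & {in P, forall u, j (u ^ t)%g = s ^+ 2 * j u}) /\
     (forall s, s != 0 -> exists2 t, t \in T & {in P, forall u, j (u ^ t)%g = s ^+ 2 * j u})].
Proof.
move=> Pu0 u01; have mn := torus_minnormal.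
have [_ ntP abP'] := minnormal_solvable mn (subxx P) (abelian_sol (Syl_abelian par cardG degG sP)).
have abP : r.-abelem P by rewrite -is_abelem_pgroup // (pHall_pgroup sP).
set rG := abelem_repr abP ntP nPT.
have irrG : mx_irreducible rG by apply/abelem_mx_irrP.
have faithG : mx_faithful rG.
  apply: abelem_mx_faithful; apply/trivgP/subsetP=> t /setIP[Tt /centP ct].
  by apply/set1P/(torus_semiregular Pu0 u01 Tt); rewrite conjgE -(ct u0 Pu0) mulKg.
have cyT := mx_faithful_irr_abelian_cyclic faithG irrG torus_abelian.
have [tau defT] := cyclicP cyT.
have Ttau : tau \in T by rewrite /= defT cycle_id.
have otau : #[tau] = #|T| by rewrite /= defT.
have cF : #|F| = (r ^ 'dim P)%N by rewrite (dim_abelemE abP ntP) cardF -cP -(card_pgroup (pHall_pgroup sP)).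
have pF : r \in [pchar F] by apply: (card_finPcharP cF rp).
have rGX i : rG (tau ^+ i)%g = rG tau ^+ i by apply: (repr_mxX rG).
have qS : q = (#|T| * d).+1 by rewrite mulnC cT subn1 prednK // (ltn_trans _ q_gt3).
have tauq : (tau ^+ q = tau)%g by rewrite {1}qS expgS expgM -otau expg_order expg1n mulg1.
have Aq : rG tau ^+ #|F| = rG tau by rewrite -rGX cardF tauq.
have irrA (V : 'M['F_r]_('dim P)) : (V *m rG tau <= V)%MS -> V != 0 -> row_full V.
  move=> VA; apply: (iffLR (mx_irrP _) irrG).2.
  apply/mxmoduleP => t; rewrite /= defT => /cycleP[i ->]; rewrite rGX.
  elim: i => [|i IH]; first by rewrite expr0 mulmx1.
  by rewrite exprS -[_ * _]/(_ *m _) mulmxA (submx_trans (submxMr _ VA)).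
have v0 : abelem_rV abP ntP u0 != 0.
  apply: contraNneq u01 => v0; apply/eqP/(abelem_rV_inj (abelE := abP) (ntE := ntP)) => //.
  by rewrite v0 abelem_rV_1.
have [j [g [jD jinj j1 jA]]] := field_coordinates pF irrA Aq v0.
pose J u := j (abelem_rV abP ntP u).
have Jinj : {in P &, injective J} by move=> u v Pu Pv /jinj/abelem_rV_inj->.
have JM : {in P &, {morph J : u v / (u * v)%g >-> u + v}}.
  by move=> u v Pu Pv; rewrite /J abelem_rV_M // jD.
have Jonto y : exists2 u, u \in P & J u = y.
  have : y \in J @: P.
    suff -> : J @: P = setT by rewrite inE.
    by apply/eqP; rewrite eqEcard subsetT (card_in_imset Jinj) /= cP cardsT cardF leqnn.
  by case/imsetP=> u Pu ->; exists u.
have JX u i : u \in P -> J (u ^ (tau ^+ i))%g = g ^+ i * J u.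
  move=> Pu; elim: i => [|i IH]; first by rewrite conjg1 mul1r.
  have Pi : (u ^ (tau ^+ i))%g \in P by rewrite memJ_norm // (subsetP nPT) // groupX.
  by rewrite expgSr conjgM /J (abelem_rV_J abP ntP nPT Pi Ttau) jA -/(J _) IH mulrA exprS.
have m0 : (0 < #|T|)%N by exact: cardG_gt0.
have dm : (d * #|T| = #|F| - 1)%N by rewrite cardF.
have cd : d = 1%N /\ ~~ odd #|F| \/ d = 2%N.
  rewrite cardF; case: (par_caseE par) => [[-> r2 _]|[-> _ _ _]]; [left|by right].
  by split=> //; have := par_r_q par; rewrite r2 dvdn2.
have gm : g ^+ #|T| = 1.
  have := JX u0 #|T| Pu0; rewrite -otau expg_order conjg1 {1 2}/J j1 mulr1.
  by move=> <-.
have g0 : g != 0 by apply: contraTneq (oner_neq0 F) => g0; rewrite -gm g0 expr0n gtn_eqF // eqxx.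
exists J; split=> //; split=> [t|s s0].
  rewrite /= defT => /cycleP[i ->].
  have gi0 : g ^+ i != 0 by exact: expf_neq0.
  have /(unity_root_sqrP dm cd gi0)[s s0 es] : (g ^+ i) ^+ #|T| == 1 by rewrite exprAC gm expr1n.
  by exists s => // u Pu; rewrite -es JX.
have inj : injective (fun i : 'I_#|T| => g ^+ i).
  move=> i1 i2 /= eg; apply: val_inj => /=.
  have : (u0 ^ (tau ^+ i1) = u0 ^ (tau ^+ i2))%g.
    apply: Jinj; rewrite ?memJ_norm ?(subsetP nPT) ?groupX //.
    by rewrite !JX // eg.
  move=> /(congr1 (conjg^~ (tau ^- i2)%g)); rewrite conjgK -conjgM => eu.
  have : (tau ^+ i1 * tau ^- i2 = 1)%g.
    by apply: (torus_semiregular Pu0 u01); rewrite ?groupM ?groupV ?groupX.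
  move=> /eqP; rewrite -eq_mulgV1 eq_expg_mod_order otau.
  by rewrite /= !modn_small // => /eqP.
have : s ^+ 2 \in [set g ^+ (i : 'I_#|T|) | i in 'I_#|T|].
  have -> : [set g ^+ (i : 'I_#|T|) | i in 'I_#|T|] = [set x : F | x ^+ #|T| == 1].
    apply/eqP; rewrite eqEcard card_imset // card_ord card_unity_roots_le // andbT.
    by apply/subsetP=> _ /imsetP[i _ ->]; rewrite inE exprAC gm expr1n.
  by rewrite inE; apply/(unity_root_sqrP dm cd); [exact: expf_neq0 | exists s].
case/imsetP=> i _ ei; exists (tau ^+ i)%g; first by rewrite groupX.
by move=> u Pu; rewrite ei JX.
Qed.
End SylowCoordinates.

(** * Squares in a finite field and the form of the involution *)

Section Squares.
Variable F : finFieldType.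
Implicit Types (x y z s : F).

Definition sqr x := [exists y, (y != 0) && (x == y ^+ 2)].

Lemma sqrP x : reflect (exists2 y, y != 0 & x = y ^+ 2) (sqr x).
Proof.
apply: (iffP existsP) => [[y /andP[y0 /eqP->]]|[y y0 ->]]; first by exists y.
by exists y; rewrite y0 eqxx.
Qed.

Lemma sqr_neq0 x : sqr x -> x != 0.
Proof. by case/sqrP=> y y0 ->; exact: expf_neq0. Qed.

Lemma sqrX y : y != 0 -> sqr (y ^+ 2).
Proof. by move=> y0; apply/sqrP; exists y. Qed.

Lemma sqr_mul x y : sqr x -> sqr y -> sqr (x * y).
Proof. by case/sqrP=> a a0 -> /sqrP[b b0 ->]; rewrite -exprMn sqrX ?mulf_neq0. Qed.

Lemma sqr_inv x : sqr x -> sqr x^-1.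
Proof. by case/sqrP=> a a0 ->; rewrite -exprVn sqrX ?invr_eq0. Qed.

Lemma nonsqr_div x y : odd #|F| -> x != 0 -> y != 0 -> ~~ sqr x -> ~~ sqr y -> sqr (x / y).
Proof.
move=> oF x0 y0 nx ny; set m := (#|F|./2)%N.
have dm : (2 * m = #|F| - 1)%N by have := odd_double_half #|F|; rewrite oF -mul2n -/m => <-; rewrite add1n subn1.
have E z : z != 0 -> sqr z = (z ^+ m == 1).
  move=> z0; have R := unity_root_sqrP dm (or_intror erefl) z0.
  by apply/idP/idP => [/sqrP/R|/R/sqrP].
have m1 z : z != 0 -> ~~ sqr z -> z ^+ m = -1.
  move=> z0; rewrite E // => zm; apply/eqP.
  have : (z ^+ m) ^+ 2 = 1 ^+ 2.
    rewrite expr1n -exprM mulnC dm; apply: (mulfI z0).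
    rewrite mulr1 -exprS subn1 prednK ?expf_card //; apply/card_gt0P; by exists z.
  by move/eqP; rewrite eqf_sqr (negbTE zm).
by rewrite E ?mulf_neq0 ?invr_eq0 // exprMn exprVn !m1 // divff // oppr_eq0 oner_neq0.
Qed.

(** Otherwise the squares and 0 would be closed under subtraction, an additive subgroup with more
    than half of the elements, hence F; but squaring identifies 1 and -1. *)
Lemma nonsqr_succ_sqr : odd #|F| -> (1 : F) != -1 -> sqr (-1) ->
  exists x, [/\ x != 0, ~~ sqr x & sqr (x + 1)].
Proof.
move=> oF n1 sN1.
have [/existsP[x /and3P[? ? ?]]|/existsPn H] := boolP [exists x, [&& x != 0, ~~ sqr x & sqr (x + 1)]].
  by exists x.
have Hs s : sqr s -> s - 1 = 0 \/ sqr (s - 1).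
  move=> ss; have := H (s - 1); rewrite subrK ss andbT negb_and !negbK => /orP[/eqP|]; by [left|right].
have HN s : sqr s -> sqr (- s) by move=> ss; rewrite -mulN1r; exact: sqr_mul.
pose Z : {set F} := [set y ^+ 2 | y : F].
have ZE s : (s \in Z) = (s == 0) || sqr s.
  apply/imsetP/orP=> [[y _ ->]|[/eqP->|/sqrP[y _ ->]]]; last by exists y.
    by have [->|y0] := eqVneq y 0; [left; rewrite expr0n | right; exact: sqrX].
  by exists 0; rewrite // expr0n.
have ZB s t : s \in Z -> t \in Z -> s - t \in Z.
  rewrite !ZE => /orP[/eqP->|ss] /orP[/eqP->|st]; rewrite ?sub0r ?subr0 ?oppr0 ?eqxx ?ss ?HN ?orbT //.
  have t0 := sqr_neq0 st; have -> : s - t = t * (s / t - 1) by field.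
  have [->|sq] := Hs _ (sqr_mul ss (sqr_inv st)); first by rewrite mulr0 eqxx.
  by rewrite sqr_mul ?orbT.
have cZ : (#|F| < #|Z| * 2)%N.
  have -> : Z = 0 |: nzsq F.
    apply/setP=> s; rewrite ZE in_setU1; congr (_ || _); apply/sqrP/imsetP => [[y y0 ->]|[y]].
      by exists y; rewrite ?inE.
    by rewrite !inE => y0 ->; exists y.
  rewrite cardsU1; have -> /= : 0 \notin nzsq F.
    apply/imsetP=> [[y]]; rewrite !inE => y0 /esym/eqP; by rewrite sqrf_eq0 (negbTE y0).
  by have := @card_nzsq_ge F; move: #|nzsq F| #|F|; clear; lia.
(* Z and n - Z both have more than half of the elements, so they meet and n is a sum of two elements
   of Z. *)
pose W n : {set F} := [set n - z | z in Z].
have ZT n : n \in Z.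
  have : (0 < #|Z :&: W n|)%N.
    have := cardsUI Z (W n).
    rewrite [#|W n|]card_imset; last by move=> a b /addrI/oppr_inj.
    by have := max_card (mem (Z :|: W n)); move: cZ; move: #|Z :|: W n| #|Z| #|F| #|Z :&: W n|; clear; lia.
  case/card_gt0P=> s /setIP[Zs /imsetP[z Zz es]].
  have -> : n = s - (0 - z) by rewrite es; ring.
  by rewrite ZB // ZB // ZE eqxx.
have surj : [set y ^+ 2 | y : F] = setT by apply/setP=> n; rewrite inE; exact: ZT.
have /imset_injP inj : #|[set y ^+ 2 | y : F]| == #|F| by rewrite surj cardsT.
by case/eqP: n1; apply: inj; rewrite ?inE // sqrrN.
Qed.

Section Involution.
Variable om : F -> F.
Hypotheses (om0 : forall x, x != 0 -> om x != 0) (omK : forall x, x != 0 -> om (om x) = x).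
Hypothesis omS : forall s x, s != 0 -> x != 0 -> om (s ^+ 2 * x) = om x / s ^+ 2.

Let omsq x : sqr x -> om x = om 1 / x.
Proof. by case/sqrP=> y y0 ->; rewrite -{1}[y ^+ 2]mulr1 omS ?oner_neq0. Qed.

(** On nonzero squares [omS] gives om(1)/x; here every nonzero element, including -om(1), is a
    square. *)
Lemma involution_form_even : (forall x, x != 0 -> sqr x) ->
  exists2 b, b != 0 & forall x, x != 0 -> om x = - b ^+ 2 / x.
Proof.
move=> sq; have o1 : - om 1 != 0 by rewrite oppr_eq0 om0 ?oner_neq0.
have /sqrP[b b0 eb] := sq _ o1; exists b => // x x0; rewrite -eb opprK; exact: omsq (sq x x0).
Qed.

(** For a nonsquare x, om(1)/x is a square and is sent to x, so the involution sends x back to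
    om(1)/x. As -1 and om(1) are nonsquares, -om(1) is a square. *)
Lemma involution_form_minus : odd #|F| -> ~~ sqr (-1) -> ~~ sqr (om 1) ->
  exists2 b, b != 0 & forall x, x != 0 -> om x = - b ^+ 2 / x.
Proof.
move=> oF nN1 no1; have o1 : om 1 != 0 by rewrite om0 ?oner_neq0.
have : sqr (om 1 / -1) by apply: nonsqr_div => //; rewrite oppr_eq0 oner_neq0.
rewrite invrN1 mulrN1 => /sqrP[b b0 eb]; exists b => // x x0; rewrite -eb opprK.
have [sx|nx] := boolP (sqr x); first exact: omsq.
have sy : sqr (om 1 / x) by exact: nonsqr_div.
have ex : om (om 1 / x) = x by rewrite omsq // invf_div mulrC divfK.
by rewrite -{1}ex omK ?sqr_neq0.
Qed.

(** On nonsquares om(y) = D/y for a second constant D. The additive relation at a nonsquare x with x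
    + 1 a square forces D = 1, whether or not om(x) + 1 is a square. *)
Lemma involution_form_plus : odd #|F| -> (1 : F) != -1 -> sqr (-1) -> om 1 = 1 ->
  (forall x, x != 0 -> x + 1 != 0 -> om (om x + 1) + om (x + 1) = 1) ->
  exists2 b, b != 0 & forall x, x != 0 -> om x = - b ^+ 2 / x.
Proof.
move=> oF n1 sN1 o1 aff.
have [x [x0 nx sx1]] := nonsqr_succ_sqr oF n1 sN1; have x10 := sqr_neq0 sx1.
pose D := om x * x.
have omn y : y != 0 -> ~~ sqr y -> om y = D / y.
  move=> y0 ny; have /sqrP[s s0 es] := nonsqr_div oF y0 x0 ny nx.
  have ey : y = s ^+ 2 * x by rewrite -es divfK.
  by rewrite ey omS // /D; field; rewrite x0 s0.
have ox : om x = D / x by rewrite /D mulfK.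
have D1 : D = 1.
  have D0 : D != 0 by rewrite mulf_neq0 ?om0.
  have ne : om x + 1 != 0.
    apply: contraNneq x10 => ex; have : om x = -1 by rewrite -[om x](addrK 1) ex sub0r.
    by move=> ox1; rewrite -(omK x0) ox1 (omsq sN1) o1 invrN1 mul1r addrC subrr.
  have := aff x x0 x10; rewrite (omsq sx1) o1.
  have eD : om x + 1 = (D + x) / x by rewrite ox; field.
  have Dx : D + x != 0 by apply: contraNneq ne => Dx; rewrite eD Dx mul0r.
  have [sD|nD] := boolP (sqr (om x + 1)).
    rewrite (omsq sD) o1 eD => H.
    have : (x + 1 - (D + x)) = 0.
      transitivity (((x + 1) * (D + x) / x) * (1 / ((D + x) / x) + 1 / (x + 1) - 1) + (x + 1 - (D + x)) - ((x + 1) * (D + x) / x) * (1 / ((D + x) / x) + 1 / (x + 1) - 1)).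
        by ring.
      rewrite H subrr mulr0 add0r subr0.
      have : (x + 1) * (D + x) * (1 / ((D + x) / x) + 1 / (x + 1) - 1) = 0 by rewrite H subrr mulr0.
      have -> : (x + 1) * (D + x) * (1 / ((D + x) / x) + 1 / (x + 1) - 1) = x * (1 - D).
        by field; rewrite x0 Dx x10.
      by move/eqP; rewrite mulf_eq0 (negbTE x0) /= subr_eq0 => /eqP <-; ring.
    by move/eqP; rewrite subr_eq0 => /eqP E; apply: (addIr x); rewrite -E addrC.
  rewrite (omn _ ne nD) eD => H.
  have : (x + 1) * (D + x) * (D / ((D + x) / x) + 1 / (x + 1) - 1) = 0 by rewrite H subrr mulr0.
  have -> : (x + 1) * (D + x) * (D / ((D + x) / x) + 1 / (x + 1) - 1) = x ^+ 2 * (D - 1).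
    by field; rewrite x0 Dx x10.
  by move/eqP; rewrite mulf_eq0 sqrf_eq0 (negbTE x0) /= subr_eq0 => /eqP.
have /sqrP[b b0 eb] := sN1; exists b => // y y0; rewrite -eb opprK.
by have [sy|ny] := boolP (sqr y); [rewrite omsq // o1 | rewrite omn // D1].
Qed.
End Involution.
End Squares.

(** * Moebius transformations and the action of the group on the projective line *)

Section Moebius.
Variable F : fieldType.
Implicit Types (M N : 'M[F]_2).

(** The point [x : y] of the projective line, [None] being infinity. Matrices act on row vectors, so
    [moebius] is a right action, like conjugation of subgroups. *)
Definition ratio (x y : F) : option F := if y == 0 then None else Some (x / y).
Definition moebius M (a : option F) : option F :=
  if a is Some x then ratio (x * M 0 0 + M 1 0) (x * M 0 1 + M 1 1) else ratio (M 0 0) (M 0 1).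

Lemma ratio_scale c x y : c != 0 -> ratio (c * x) (c * y) = ratio x y.
Proof.
move=> c0; rewrite /ratio mulf_eq0 (negbTE c0) /=; case: eqP => // /eqP y0.
by rewrite -mulf_div divff // mul1r.
Qed.

Lemma moebius_ratio M x y : (x != 0) || (y != 0) ->
  moebius M (ratio x y) = ratio (x * M 0 0 + y * M 1 0) (x * M 0 1 + y * M 1 1).
Proof.
rewrite {1}/ratio; have [->|y0] := eqVneq y 0.
  by rewrite orbF => x0; rewrite /= !mul0r !addr0 ratio_scale.
by move=> _; rewrite /= -[LHS](ratio_scale _ _ y0); congr ratio; field.
Qed.

Definition mx4 a b c d : 'M[F]_2 := \matrix_(i, l)
  (if i == 0 then (if l == 0 then a else b) else (if l == 0 then c else d)).

Lemma mx4_eta M : M = mx4 (M 0 0) (M 0 1) (M 1 0) (M 1 1).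
Proof.
apply/matrixP=> i l; rewrite mxE.
have E (i' : 'I_2) : i' != 0 -> i' = 1 by case: i' => [[|[|]]] // *; apply: val_inj.
by case: (eqVneq i 0) (eqVneq l 0) => [->|/E->] [->|/E->].
Qed.

Lemma mx4_inj a b c d a' b' c' d' : mx4 a b c d = mx4 a' b' c' d' ->
  [/\ a = a', b = b', c = c' & d = d'].
Proof.
move=> E; have H i l : mx4 a b c d i l = mx4 a' b' c' d' i l by rewrite E.
by move: (H 0 0) (H 0 1) (H 1 0) (H 1 1); rewrite !mxE /=.
Qed.

Lemma mx4_mul a b c d a' b' c' d' : mx4 a b c d *m mx4 a' b' c' d' =
  mx4 (a * a' + b * c') (a * b' + b * d') (c * a' + d * c') (c * b' + d * d').
Proof.
apply/matrixP=> i l; rewrite !mxE !big_ord_recl big_ord0 addr0 !mxE /=.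
by case: (i == 0); case: (l == 0).
Qed.

Lemma mx4_scalar c : c%:M = mx4 c 0 0 c.
Proof. by rewrite [LHS]mx4_eta !mxE. Qed.

Lemma det2 M : \det M = M 0 0 * M 1 1 - M 0 1 * M 1 0.
Proof.
rewrite (expand_det_row M 0) !big_ord_recl big_ord0 /cofactor !det_mx11 !mxE /= addr0.
have -> : lift 0 0 = 1 :> 'I_2 by exact: val_inj.
have -> : lift 1 0 = 0 :> 'I_2 by exact: val_inj.
by rewrite addn0 expr0 addn1 expr1 mul1r mulN1r mulrN.
Qed.

Lemma det_mx4 a b c d : \det (mx4 a b c d) = a * d - b * c.
Proof. by rewrite det2 !mxE. Qed.

Lemma moebius_mul M N a : \det M != 0 -> moebius (M *m N) a = moebius N (moebius M a).
Proof.
rewrite det2 => dM; have mE i j : (M *m N) i j = M i 0 * N 0 j + M i 1 * N 1 j.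
  by rewrite mxE !big_ord_recl big_ord0 addr0 (_ : lift _ _ = 1) //; exact: val_inj.
have nzS x : (x * M 0 0 + M 1 0 != 0) || (x * M 0 1 + M 1 1 != 0).
  have [z0|//] := eqVneq (x * M 0 0 + M 1 0) 0; have [z1|//] := eqVneq (x * M 0 1 + M 1 1) 0.
  case/eqP: dM; have -> : M 1 0 = - (x * M 0 0) by apply/eqP; rewrite -addr_eq0 addrC z0.
  by have -> : M 1 1 = - (x * M 0 1) by [apply/eqP; rewrite -addr_eq0 addrC z1]; ring.
have nzN : (M 0 0 != 0) || (M 0 1 != 0).
  by apply: contraNT dM; rewrite negb_or !negbK => /andP[/eqP-> /eqP->]; rewrite !mul0r subrr.
by case: a => [x|]; rewrite /= !mE moebius_ratio //; congr ratio; ring.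
Qed.
End Moebius.

Section MoebiusAction.
Variables (r q k h d : nat) (e : int).
Hypothesis par : psl_params r q k h d e.
Variables (gT : finGroupType) (G : {group gT}).
Hypotheses (cardG : #|G| = (q * k * h)%N) (degG : degree_ok q k h d G).
Variable F : finFieldType.
Hypothesis cardF : #|F| = q.
Variables (P Q : {group gT}) (w : gT).
Hypotheses (sP : r.-Sylow(G) P) (sQ : r.-Sylow(G) Q) (nPQ : P != Q).
Hypotheses (Gw : w \in G) (Pw : (P :^ w)%G = Q) (Qw : (Q :^ w)%G = P).
Local Notation T := ('N_G(P) :&: 'N(Q))%G.

Variables (u0 : gT) (j : gT -> F).
Hypotheses (Pu0 : u0 \in P) (ju0 : j u0 = 1).
Hypothesis (jinj : {in P &, injective j}).
Hypothesis (jM : {in P &, {morph j : u v / (u * v)%g >-> u + v}}).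
Hypothesis (jonto : forall y, exists2 u, u \in P & j u = y).
Hypothesis (jT : forall t, t \in T -> exists2 s, s != 0 & {in P, forall u, j (u ^ t)%g = s ^+ 2 * j u}).
Hypothesis (jS : forall s, s != 0 -> exists2 t, t \in T & {in P, forall u, j (u ^ t)%g = s ^+ 2 * j u}).

Let sPG : P \subset G. Proof. exact: pHall_sub sP. Qed.
Let GP u : u \in P -> u \in G. Proof. exact: subsetP sPG u. Qed.
Let GT t : t \in T -> t \in G. Proof. by case/setIP=> /setIP[]. Qed.
Let nPT t : t \in T -> t \in 'N(P). Proof. by case/setIP=> /setIP[]. Qed.
Let nQT t : t \in T -> t \in 'N(Q). Proof. by case/setIP. Qed.
Let j1 : j 1%g = 0. Proof. by apply: (addrI (j 1%g)); rewrite -jM ?group1 // mulg1 addr0. Qed.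

Definition coord_elt (x : F) : gT := odflt 1%g [pick u in P | j u == x].

Let iP x : coord_elt x \in P /\ j (coord_elt x) = x.
Proof.
rewrite /coord_elt; case: pickP => [u /andP[Pu /eqP //]|no].
by have [u Pu ju] := jonto x; have := no u; rewrite Pu ju eqxx.
Qed.

Let iPj u : u \in P -> coord_elt (j u) = u.
Proof. by move=> Pu; have [Pi ji] := iP (j u); apply: jinj. Qed.

(** Labels the Sylow subgroups by the projective line: P is infinity, Q is 0 and Q^u is j(u). *)
Definition pt (a : option F) : {group gT} := if a is Some x then (Q :^ coord_elt x)%G else P.

Lemma pt_Syl a : r.-Sylow(G) (pt a).
Proof.
case: a => [x|] //=; rewrite -/(pHall _ _ _) pHallJ //.
by have [] := iP x; move/GP.
Qed.

Lemma pt_inj : injective pt.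
Proof.
have PQu u : u \in P -> P <> (Q :^ u)%G.
  move=> Pu /(congr1 val)/= PQ; case/eqP: nPQ; apply: val_inj => /=.
  by apply: (@conjsg_inj _ u); rewrite -PQ conjGid.
have fi := Syl_fix_inj par cardG degG sP sQ nPQ.
case=> [x|] [y|] //= E; last 2 first.
- by case: (PQu _ (proj1 (iP x))).
- by case: (PQu _ (proj1 (iP y))).
by congr Some; rewrite -[x](proj2 (iP x)) -[y](proj2 (iP y)); congr j; exact: fi (proj1 (iP x)) (proj1 (iP y)) E.
Qed.

Lemma pt_onto (R : {group gT}) : r.-Sylow(G) R -> exists a, R = pt a.
Proof.
move=> sR; have [<-|nPR] := eqVneq P R; first by exists None.
have [u Pu ->] := Syl_regular par cardG degG sP sQ nPQ sR nPR.
by exists (Some (j u)); rewrite /= iPj.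
Qed.

Definition sig g a := odflt None [pick b | pt b == (pt a :^ g)%G].

Let sigP g a : g \in G -> pt (sig g a) = (pt a :^ g)%G.
Proof.
move=> Gg; have sR : r.-Sylow(G) (pt a :^ g)%G by rewrite /= -/(pHall _ _ _) pHallJ // pt_Syl.
rewrite /sig; case: pickP => [b /eqP //|no].
by have [b E] := pt_onto sR; have := no b; rewrite E eqxx.
Qed.

Let sigE g a b : g \in G -> (pt a :^ g)%G = pt b -> sig g a = b.
Proof. by move=> Gg E; apply: pt_inj; rewrite sigP. Qed.

Lemma sigM g g' a : g \in G -> g' \in G -> sig (g * g') a = sig g' (sig g a).
Proof.
move=> Gg Gg'; apply: sigE; first exact: groupM.
by rewrite !sigP //; apply: val_inj; rewrite /= conjsgM.
Qed.

Lemma sig1 a : sig 1 a = a.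
Proof. by apply: sigE => //; apply: val_inj; rewrite /= conjsg1. Qed.

Lemma sigPN u : u \in P -> sig u None = None.
Proof. by move=> Pu; apply: sigE; [exact: GP | apply: val_inj; rewrite /= conjGid]. Qed.

Lemma sigPS u x : u \in P -> sig u (Some x) = Some (x + j u).
Proof.
move=> Pu; apply: sigE; first exact: GP.
have [Pi ji] := iP x; apply: val_inj => /=.
by rewrite -conjsgM -{2}ji -jM // iPj // groupM.
Qed.

Lemma sigTN t : t \in T -> sig t None = None.
Proof. by move=> Tt; apply: sigE; [exact: GT | apply: val_inj; rewrite /= (normP (nPT Tt))]. Qed.

Lemma sigTS t s x : t \in T -> {in P, forall u, j (u ^ t)%g = s ^+ 2 * j u} ->
  sig t (Some x) = Some (s ^+ 2 * x).
Proof.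
move=> Tt Es; apply: sigE; first exact: GT.
have [Pi ji] := iP x; apply: val_inj => /=.
rewrite -{2}ji -Es // iPj ?memJ_norm ?nPT //.
by rewrite -conjsgM conjgC conjsgM (normP (nQT Tt)).
Qed.

Let i0 : coord_elt 0 = 1%g. Proof. by rewrite -j1 iPj. Qed.

Lemma sigwN : sig w None = Some 0.
Proof. by apply: sigE => //; apply: val_inj; rewrite /= i0 conjsg1 -Pw. Qed.

Lemma sigw0 : sig w (Some 0) = None.
Proof. by apply: sigE => //; apply: val_inj; rewrite /= i0 conjsg1 -Qw. Qed.

Let w2 : (w * w = 1)%g.
Proof. by rewrite -[RHS](swap_involution par cardG degG sP sQ nPQ Gw Pw Qw) expgS expg1. Qed.

Let sigww a : sig w (sig w a) = a. Proof. by rewrite -sigM // w2 sig1. Qed.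

Definition om x := odflt 0 (sig w (Some x)).

Lemma sigw x : x != 0 -> sig w (Some x) = Some (om x).
Proof.
move=> x0; rewrite /om; case E : (sig w (Some x)) => [y|] //=.
by have := sigww (Some x); rewrite E sigwN => -[/eqP]; rewrite eq_sym (negbTE x0).
Qed.

Lemma om0 x : x != 0 -> om x != 0.
Proof.
move=> x0; apply: contraTneq (x0) => ox; have := sigww (Some x).
by rewrite sigw // ox sigw0.
Qed.

Lemma omK x : x != 0 -> om (om x) = x.
Proof. by move=> x0; have := sigww (Some x); rewrite sigw // sigw ?om0 // => -[]. Qed.

(** As w inverts the torus element t with multiplier s^2, t w t = w. *)
Lemma omS s x : s != 0 -> x != 0 -> om (s ^+ 2 * x) = om x / s ^+ 2.
Proof.
move=> s0 x0; have [t Tt jt] := jS s0.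
have Gt := GT Tt; have s20 : s ^+ 2 != 0 by exact: expf_neq0.
have I := swap_inverts par cardG degG sP sQ nPQ Gw Pw Qw Tt.
have E : (t * w * t = w)%g.
  by apply: (mulgI w^-1%g); rewrite mulgA mulgA -[(w^-1 * t * w)%g]mulgA -conjgE I !mulVg.
have := sigM (Some x) (groupM Gt Gw) Gt; rewrite E sigM // (sigTS _ Tt jt).
rewrite (sigw x0) sigw ?mulf_neq0 // (sigTS _ Tt jt) => -[->].
by rewrite [RHS]mulrC mulKf.
Qed.

(** The word n = w u0 w u0^-1 w fixes infinity, so it acts as y -> s^2 (y + j(u)). Its values at 0
    and -1 identify it with y -> -(y + 1); its value at x is the relation. *)
Lemma om_plus : sqr (-1 : F) -> om 1 = 1 ->
  forall x, x != 0 -> x + 1 != 0 -> om (om x + 1) + om (x + 1) = 1.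
Proof.
move=> /sqrP[i i0' ei] o1 x x0 x1.
have omN y : y != 0 -> om (- y) = - om y.
  by move=> y0; rewrite -mulN1r ei omS // -ei invrN1 mulrN1.
have oN1 : om (-1) = -1 by rewrite omN ?oner_neq0 // o1.
have GP0 := GP Pu0; have PV : (u0^-1)%g \in P by rewrite groupV.
have GV := GP PV.
have jV : j (u0^-1)%g = -1.
  by apply: (addrI (j u0)); rewrite -jM // mulgV j1 ju0 subrr.
pose n := (w * u0 * w * u0^-1 * w)%g.
have Gn : n \in G by rewrite !groupM.
have sn a : sig n a = sig w (sig u0^-1%g (sig w (sig u0 (sig w a)))).
  by rewrite /n !sigM ?groupM.
have nN : sig n None = None.
  by rewrite sn sigwN sigPS // ju0 add0r sigw ?oner_neq0 // o1 sigPS // jV subrr sigw0.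
have : n \in 'N_G(P).
  rewrite inE Gn; apply/normP; have := sigP None Gn; rewrite nN /= => E.
  by rewrite {2}E.
rewrite -(proj1 (Syl_norm_factor par cardG degG sP sQ nPQ)) => /mulsgP[u t Pu Tt En].
have [s s0 jt] := jT Tt.
have sf y : sig n (Some y) = Some (s ^+ 2 * (y + j u)).
  by rewrite En sigM; [rewrite (sigPS _ Pu) (sigTS _ Tt jt)|exact: GP|exact: GT].
have N10 : (-1 : F) != 0 by rewrite oppr_eq0 oner_neq0.
have E0 : s ^+ 2 * j u = -1.
  have := sf 0; rewrite sn sigw0 sigPN // sigwN sigPS // jV !add0r sigw // oN1.
  by case.
have EN1 : s ^+ 2 * (j u - 1) = 0.
  have := sf (-1); rewrite sn sigw // oN1 sigPS // ju0 addrC subrr sigw0 sigPN // sigwN.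
  by case=> E; rewrite [j u - 1]addrC -E.
have s2 : s ^+ 2 = -1.
  by move: EN1; rewrite mulrBr mulr1 E0 => /eqP; rewrite subr_eq0 => /eqP <-.
have ju : j u = 1.
  by move/eqP: EN1; rewrite mulf_eq0 s2 (negbTE N10) subr_eq0 => /eqP.
have ox1 : om x + 1 != 0.
  apply: contraNneq x1 => ox; have ox' : om x = -1 by rewrite -[om x](addrK 1) ox sub0r.
  by rewrite -(omK x0) ox' oN1 addrC subrr.
have Y0 : om (om x + 1) - 1 != 0.
  rewrite subr_eq0; apply: contraNneq (om0 x0) => oo; apply/eqP.
  by apply: (addIr 1); rewrite add0r -(omK ox1) oo o1.
have := sf x; rewrite sn sigw // sigPS // ju0 sigw // sigPS // jV sigw // s2 ju mulN1r => -[E].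
have : om (om x + 1) - 1 = - om (x + 1) by rewrite -[LHS]omK // E omN.
by move/eqP; rewrite subr_eq => /eqP->; ring.
Qed.

Let cF_odd : odd r -> odd #|F|.
Proof. by have [f _ qE] := par_qE par; move=> or; rewrite cardF qE oddX or orbT. Qed.

Hypothesis fix_e : e = 1 -> d = 2%N -> om 1 = 1.

(** For odd q, -1 is a square exactly when e = 1, as 4 divides q - e. If e = -1, om(1) is a
    nonsquare: otherwise some wt with t in T would be an involution fixing the point 1, while
    involutions fix 1 + e = 0 points. *)
Lemma om_form : exists2 b, b != 0 & forall x, x != 0 -> om x = - b ^+ 2 / x.
Proof.
have [f f0 qE] := par_qE par; have rp := par_prime par; have q3 := par_q_gt3 par.
have pF : r \in [pchar F] by apply: (card_finPcharP _ rp); rewrite cardF qE.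
have kE := par_kE par.
case: (par_caseE par) => [[d1 r2 e1]|[d2 or k4 ee]].
  apply: involution_form_even; [exact: om0|exact: omS|] => x x0.
  have dm : (1 * (q - 1) = #|F| - 1)%N by rewrite mul1n cardF.
  have cd : 1%N = 1%N /\ ~~ odd #|F| \/ 1%N = 2%N.
    by left; rewrite cardF qE r2 oddX orbF -lt0n f0.
  apply/sqrP/(unity_root_sqrP dm cd x0); apply/eqP/(mulfI x0).
  by rewrite mulr1 -exprS subn1 prednK -?cardF ?expf_card // cardF (ltn_trans _ q3).
have oF := cF_odd or.
have N1 : (1 : F) != -1.
  apply/eqP=> E; have : (2%:R : F) == 0 by rewrite mulr2n {2}E subrr.
  by rewrite -(dvdn_pcharf pF) dvdn_prime2 // => /eqP r2; rewrite r2 in or.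
have N10 : (-1 : F) != 0 by rewrite oppr_eq0 oner_neq0.
have oq : odd q by rewrite -cardF.
pose m := q./2.
have dm' : (2 * m = q - 1)%N by have := odd_double_half q; rewrite oq -mul2n -/m => <-; rewrite add1n subn1.
have dm : (2 * m = #|F| - 1)%N by rewrite cardF.
have sN1 : sqr (-1 : F) = ((-1 : F) ^+ m == 1).
  by have R := unity_root_sqrP dm (or_intror erefl) N10; apply/idP/idP => [/sqrP/R|/R/sqrP].
have pm : odd m = (e != 1).
  case/dvdnP: k4 => c ek; case: ee => e1; rewrite e1 ek in kE *.
    have mc : m = (c * 2)%N by clear -dm' kE q3; lia.
    by rewrite mc oddM andbF.
  have mc : m = (c * 2 - 1)%N by clear -dm' kE q3; lia.
  have c0 : (0 < c)%N by clear -kE q3; case: c kE => [|c]; lia.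
  by rewrite mc oddB ?oddM ?andbF // (leq_trans c0) // leq_pmulr.
case: ee => e1.
  have s1 : sqr (-1 : F) by rewrite sN1 -signr_odd pm e1 eqxx.
  by apply: involution_form_plus => //; [exact: om0|exact: omK|exact: omS|exact: fix_e|exact: om_plus (fix_e _ _)].
have s1 : ~~ sqr (-1 : F) by rewrite sN1 -signr_odd pm e1 /= expr1 eq_sym.
apply: involution_form_minus => //; [exact: om0|exact: omK|exact: omS|].
apply/negP=> /sqrP[s s0 es].
have [t Tt jt] : exists2 t, t \in T & {in P, forall u, j (u ^ t)%g = s^-1 ^+ 2 * j u} by apply: jS; rewrite invr_eq0.
pose g := (w * t)%g; have Gg : g \in G by exact: groupM Gw (GT Tt).
have Pg : (P :^ g)%G = Q by apply: val_inj; rewrite /= conjsgM -(normP (nQT Tt)) -Pw.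
have Qg : (Q :^ g)%G = P by apply: val_inj; rewrite /= conjsgM -[RHS](normP (nPT Tt)) -Qw.
have g2 := swap_involution par cardG degG sP sQ nPQ Gg Pg Qg.
have g1 : g != 1%g.
  by apply: contraNneq nPQ => g1; rewrite -Pg g1; apply/eqP/val_inj; rewrite /= conjsg1.
have og : #[g] = 2%N by apply: nt_prime_order.
have k2 : (2 %| k)%N by apply: dvdn_trans k4.
have := nfix_theta par cardG degG Gg.
rewrite (steinberg_value_k par cardG degG Gg _ k2) ?og // e1 subrr => /eqP.
rewrite pnatr_eq0 cards_eq0 => /eqP/setP/(_ (pt (Some 1))).
move: (pt_Syl (Some 1)) (sigP (Some 1) Gg) => sA EA; rewrite !inE sA andTb => /negP[]; apply/eqP; rewrite -EA; congr pt.
by rewrite (sigM _ Gw (GT Tt)) sigw ?oner_neq0 // (sigTS _ Tt jt) es -exprMn mulVf // expr1n.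
Qed.

(** Bruhat decomposition: an element outside N(P) lies in N(P) w P, and N(P) = PT. The generators
    act as translations, multiplications by s^2 and x -> -b^2/x; the squares are what allows
    determinant 1. *)
Lemma sig_moebius g : g \in G -> exists2 M : 'M[F]_2, \det M = 1 & sig g =1 moebius M.
Proof.
have [b b0 omE] := om_form.
pose mob g := exists2 M : 'M[F]_2, \det M = 1 & sig g =1 moebius M.
have mobM x y : x \in G -> y \in G -> mob x -> mob y -> mob (x * y)%g.
  move=> Gx Gy [M dM Mx] [N dN Ny]; exists (M *m N); first by rewrite det_mulmx dM dN mulr1.
  by move=> a; rewrite sigM // Mx Ny moebius_mul // dM oner_neq0.
pose mx4 (m00 m01 m10 m11 : F) : 'M[F]_2 := \matrix_(i, l)
  (if i == 0 then (if l == 0 then m00 else m01) else (if l == 0 then m10 else m11)).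
have mobP u : u \in P -> mob u.
  move=> Pu; exists (mx4 1 0 (j u) 1); first by rewrite det2 !mxE /= mul0r subr0 mulr1.
  case=> [x|]; rewrite /= !mxE /= /ratio.
    by rewrite sigPS // mulr1 mulr0 add0r oner_eq0 divr1.
  by rewrite eqxx sigPN.
have mobT t : t \in T -> mob t.
  move=> Tt; have [s s0 jt] := jT Tt; exists (mx4 s 0 0 s^-1).
    by rewrite det2 !mxE /= mul0r subr0 mulfV.
  case=> [x|]; rewrite /= !mxE /= /ratio ?mulr0 ?addr0 ?add0r ?eqxx ?sigTN //.
  by rewrite invr_eq0 (negbTE s0) invrK (sigTS _ Tt jt); congr Some; ring.
have mobw : mob w.
  exists (mx4 0 (- b^-1) b 0); first by rewrite det2 !mxE /= mul0r mulNr mulVf // sub0r opprK.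
  case=> [x|]; rewrite /= !mxE /= /ratio ?mulr0 ?addr0 ?add0r; last first.
    by rewrite oppr_eq0 invr_eq0 (negbTE b0) mul0r sigwN.
  rewrite mulf_eq0 oppr_eq0 invr_eq0 (negbTE b0) orbF; have [->|x0] := eqVneq x 0; first exact: sigw0.
  by rewrite sigw // omE //; congr Some; field; rewrite x0 b0 oppr_eq0 oner_neq0.
have mobN n : n \in 'N_G(P) -> mob n.
  rewrite -(proj1 (Syl_norm_factor par cardG degG sP sQ nPQ)) => /mulsgP[u t Pu Tt ->].
  by apply: (mobM); [exact: GP|exact: GT|exact: mobP|exact: mobT].
move=> Gg; have [Ng|Ng] := boolP (g \in 'N(P)); first by apply: mobN; rewrite inE Gg.
have sR : r.-Sylow(G) (P :^ g)%G by rewrite /= -/(pHall _ _ _) pHallJ.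
have nPR : P != (P :^ g)%G.
  by apply: contraNneq Ng => E; apply/normP; rewrite {2}E.
have [u Pu E] := Syl_regular par cardG degG sP sQ nPQ sR nPR.
have Gu := GP Pu; have -> : g = (g * (w * u)^-1 * w * u)%g by rewrite -!mulgA mulVg mulg1.
have Gn : (g * (w * u)^-1)%g \in G by rewrite groupM ?groupV ?groupM.
apply: (mobM) => //; [by rewrite groupM | apply: (mobM) => // | exact: mobP].
apply: mobN; rewrite inE Gn; apply/normP; rewrite conjsgM.
have -> : (P :^ g)%g = (P :^ (w * u))%g by rewrite conjsgM -[LHS]/(gval (P :^ g)%G) E -Pw.
by rewrite -conjsgM mulgV conjsg1.
Qed.

(** Fixing infinity and 0 puts g in T; fixing 1 makes its multiplier 1, and T is semiregular on
    P. *)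
Lemma sig_faithful g : g \in G -> sig g =1 id -> g = 1%g.
Proof.
move=> Gg fg; have Tg : g \in T.
  have N0 := sigP None Gg; have N1 := sigP (Some 0) Gg.
  rewrite !fg /= i0 in N0 N1; apply/setIP; split; first apply/setIP; first split=> //.
    by apply/normP; rewrite -[LHS]/(gval (P :^ g)%G) -N0.
  by apply/normP; have := congr1 (fun A : {group gT} => gval A) N1; rewrite /= conjsg1.
have [s s0 jt] := jT Tg.
have u01 : u0 != 1%g by apply: contraTneq (oner_neq0 F) => E; rewrite -ju0 E j1 eqxx.
apply: (torus_semiregular par cardG degG sP sQ nPQ Pu0 u01 Tg).
apply: jinj => //; first by rewrite memJ_norm ?nPT.
have := fg (Some 1); rewrite (sigTS _ Tg jt) => -[]; rewrite mulr1 => s2.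
by rewrite jt // s2 mul1r.
Qed.
End MoebiusAction.

(** * SL(2,q), its centre, and the recognition of PSL(2,q) *)

Section SpecialLinear.
Variable F : finFieldType.
Local Notation SL := (SL2_group F).
Implicit Types (g : {'GL_2[F]}) (a b c d x : F).

(** Total, with value 1 at singular matrices; the lemmas on it assume determinant 1. *)
Definition sl (M : 'M[F]_2) : {'GL_2[F]} := insubd (1%g : {'GL_2[F]}) M.

Lemma slK (M : 'M[F]_2) : \det M = 1 -> GLval (sl M) = M.
Proof. by move=> dM; rewrite /sl [LHS]insubdK // -topredE /= unitmxE dM unitr1. Qed.

Lemma mem_sl (M : 'M[F]_2) : \det M = 1 -> sl M \in SL.
Proof. by move=> dM; rewrite inE slK // dM. Qed.

Lemma SL_det g : g \in SL -> \det (GLval g) = 1.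
Proof. by rewrite inE => /eqP. Qed.

Lemma GLvalM g g' : GLval (g * g')%g = GLval g *m GLval g'. Proof. by []. Qed.

Lemma GLval_inj : injective (@GLval 2 F). Proof. exact: val_inj. Qed.

Lemma slM (M N : 'M[F]_2) : \det M = 1 -> \det N = 1 -> (sl M * sl N)%g = sl (M *m N).
Proof. by move=> dM dN; apply: GLval_inj; rewrite GLvalM !slK // det_mulmx dM dN mulr1. Qed.

Lemma card_SL2 : #|SL| = (#|F| * (#|F| ^ 2 - 1))%N.
Proof.
pose f (g : {'GL_2[F]}) : {unit F} := insubd (1%g : {unit F}) (\det (GLval g)).
have fE g : val (f g) = \det (GLval g).
  by rewrite /f insubdK // -topredE /= -unitmxE; exact: (valP g).
have fM : {in [set: {'GL_2[F]}] &, {morph f : x y / (x * y)%g}}.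
  by move=> x y _ _; apply: val_inj; rewrite /= fE GLvalM det_mulmx -!fE.
have := card_morphim (Morphism fM) [set: {'GL_2[F]}]%G; rewrite setTI morphimEdom.
have -> : Morphism fM @: [set: {'GL_2[F]}]%G = [set: {unit F}].
  apply/setP=> c; rewrite inE; apply/imsetP.
  have dc : \det (mx4 (val c) 0 0 1) = val c by rewrite det_mx4 mulr1 mul0r subr0.
  have uc : mx4 (val c) 0 0 1 \is a GRing.unit by rewrite -[_ \is a _]/(_ \in unitmx) unitmxE dc; exact: valP.
  exists (insubd (1%g : {'GL_2[F]}) (mx4 (val c) 0 0 1)); first by rewrite inE.
  by apply: val_inj; rewrite /= fE [GLval _]insubdK.
have kE : ('ker (Morphism fM) = SL)%g.
  apply/setP=> g; rewrite !inE /= -val_eqE /= fE; by [].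
rewrite card_finField_unit => cE.
have := Lagrange (subsetT ('ker (Morphism fM))%G); rewrite /= kE in cE *.
rewrite -cE [#|[set: _]%G|](card_GL_2 F) => E.
have q1 := card_finRing_gt1 F.
have q0 : (0 < #|F|.-1)%N by rewrite -subn1 subn_gt0.
apply/eqP; rewrite -(eqn_pmul2r q0) E; apply/eqP; rewrite -subn1.
by move: #|F| q1 {E cE q0}; clear => n n1; rewrite -[n](subnK (ltnW n1)); set t := (n - 1)%N; rewrite addnK; nia.
Qed.

(** Fixing infinity and 0 kills the off-diagonal entries, and fixing 1 equates the diagonal ones. *)
Lemma moebius_id_scalar (M : 'M[F]_2) : \det M = 1 -> moebius M =1 id ->
  exists2 c, c ^+ 2 = 1 & M = c%:M.
Proof.
rewrite det2 => dM fix_; have := fix_ None; have := fix_ (Some 0); have := fix_ (Some 1).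
rewrite /= /ratio !mul0r !mul1r !add0r; case: eqP => // _ [E1]; case: eqP => // /eqP n0 [E0].
case: eqP => // b0 _; move: E0; rewrite b0 in dM E1 *.
move/eqP; rewrite mulf_eq0 invr_eq0 (negbTE n0) orbF => /eqP c0.
rewrite c0 addr0 add0r in E1; have ad : M 0 0 = M 1 1 by rewrite -[LHS](divfK n0) E1 mul1r.
exists (M 1 1); first by rewrite -dM mul0r subr0 ad expr2.
by rewrite [LHS]mx4_eta mx4_scalar b0 c0 ad.
Qed.

Lemma SL2_centerP g : reflect (g \in SL /\ exists2 c, c ^+ 2 = 1 & GLval g = c%:M) (g \in 'Z(SL)%g).
Proof.
apply: (iffP idP) => [/setIP[Sg /centP cg]|[Sg [c _ gE]]]; last first.
  apply/setIP; split=> //; apply/centP=> y Sy; apply: GLval_inj.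
  by rewrite !GLvalM gE scalar_mxC.
split=> //; have dg := SL_det Sg.
have du : \det (mx4 1 0 1 1 : 'M[F]_2) = 1 by rewrite det_mx4; ring.
have dv : \det (mx4 1 1 0 1 : 'M[F]_2) = 1 by rewrite det_mx4; ring.
have := congr1 (@GLval 2 F) (cg _ (mem_sl du)); have := congr1 (@GLval 2 F) (cg _ (mem_sl dv)).
rewrite !GLvalM !slK // [GLval g]mx4_eta !mx4_mul => /mx4_inj[V1 V2 V3 V4] /mx4_inj[U1 U2 U3 U4].
have b0 : GLval g 0 1 = 0 by apply: (addrI (GLval g 0 0)); move: U1; rewrite !mulr1 !mul1r !mul0r !addr0 => ->.
have c0 : GLval g 1 0 = 0.
  by apply: (addrI (GLval g 0 0)); move: V1; rewrite !mulr1 !mul1r !mulr0 !addr0 => <-.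
have ad : GLval g 0 0 = GLval g 1 1 by move: U3; rewrite c0 !mulr1 !mul1r !add0r addr0 => ->.
exists (GLval g 1 1); last by rewrite mx4_scalar b0 c0 ad.
by move: dg; rewrite det2 b0 c0 mul0r subr0 ad expr2.
Qed.

Lemma card_center_SL2 : #|'Z(SL)%g| = (1 + (1%R != -1 :> F)%R)%N.
Proof.
have dc c : c ^+ 2 = 1 -> \det (c%:M : 'M[F]_2) = 1 by rewrite det_scalar.
have -> : #|'Z(SL)%g| = #|[set c : F | c ^+ 2 == 1%R]|.
  have inj : {in [set c : F | c ^+ 2 == 1%R] &, injective (fun c => sl c%:M)}.
    move=> c c'; rewrite !inE => /eqP c1 /eqP c1' /(congr1 (@GLval 2 F)).
    by rewrite !slK ?dc // !mx4_scalar => /mx4_inj[].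
  rewrite -(card_in_imset inj); apply: eq_card => g; apply/SL2_centerP/imsetP => [[Sg [c c1 gE]]|[c]].
    by exists c; rewrite ?inE ?c1 //; apply: GLval_inj; rewrite slK ?dc.
  by rewrite inE => /eqP c1 ->; split; [rewrite mem_sl ?dc | exists c; rewrite ?slK ?dc].
have E : [set c : F | c ^+ 2 == 1%R] = [set 1; -1].
  by apply/setP=> c; rewrite !inE -{1}(expr1n F 2) eqf_sqr.
by rewrite E cards2.
Qed.
End SpecialLinear.

Lemma moebius_scalar (F : fieldType) (c : F) : c != 0 -> moebius c%:M =1 id.
Proof.
move=> c0 [x|]; rewrite mx4_scalar /= !mxE /= /ratio ?eqxx //.
by rewrite mulr0 addr0 add0r (negbTE c0) mulfK.
Qed.

Lemma coset_sl_eq (F : finFieldType) (M N : 'M[F]_2) : \det M = 1 -> \det N = 1 ->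
  moebius M =1 moebius N -> coset 'Z(SL2_group F) (sl M) = coset 'Z(SL2_group F) (sl N).
Proof.
move=> dM dN E; have uN : N \in unitmx by rewrite unitmxE dN unitr1.
have dV : \det (invmx N) = 1 by rewrite det_inv dN invr1.
have dMV : \det (M *m invmx N) = 1 by rewrite det_mulmx dM dV mulr1.
have /(moebius_id_scalar dMV)[c c2 Ec] : moebius (M *m invmx N) =1 id.
  move=> a; rewrite moebius_mul ?dM ?oner_neq0 // E -moebius_mul ?dN ?oner_neq0 //.
  by rewrite mulmxV // moebius_scalar ?oner_neq0.
have dc : \det (c%:M : 'M[F]_2) = 1 by rewrite det_scalar.
have Z : sl c%:M \in 'Z(SL2_group F)%g.
  by apply/SL2_centerP; rewrite mem_sl // slK //; split=> //; exists c.
have -> : M = c%:M *m N by rewrite -Ec mulmxKV.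
by rewrite -(slM dc dN) (coset_kerl _ Z).
Qed.

Section Recognition.
Variables (r q k h d : nat) (e : int).
Hypothesis par : psl_params r q k h d e.
Variable F : finFieldType.
Hypothesis cardF : #|F| = q.
Local Notation SL := (SL2_group F).

Lemma card_center_par : #|'Z(SL)%g| = d.
Proof.
rewrite card_center_SL2.
have [f f0 qE] := par_qE par; have rp := par_prime par.
have pF : r \in [pchar F] by apply: (card_finPcharP _ rp); rewrite cardF qE.
have -> : (1 != -1 :> F) = (r != 2%N).
  have -> : (1 == -1 :> F) = ((2%:R : F) == 0) by rewrite -subr_eq0 opprK.
  by rewrite -(dvdn_pcharf pF) dvdn_prime2.
by case: (par_caseE par) => [[-> -> _]|[-> or _ _]] //; case: eqP or => // ->.
Qed.

Lemma card_PSL2 : #|PSL2 F| = (q * k * h)%N.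
Proof.
rewrite /PSL2 /= card_quotient ?normal_norm ?center_normal // -divgS ?center_sub //.
rewrite card_center_par card_SL2 cardF; have E := par_dkh par.
have d0 : (0 < d)%N by case/andP: (par_d_gt0 par).
rewrite expnS expn1 -E addnK -mulnA.
by rewrite (mulnCA q d) mulKn.
Qed.

Variables (gT : finGroupType) (G : {group gT}).
Hypotheses (cardG : #|G| = (q * k * h)%N) (degG : degree_ok q k h d G).

Lemma two_Sylows : exists PQ : {group gT} * {group gT},
  [/\ r.-Sylow(G) PQ.1, r.-Sylow(G) PQ.2 & PQ.1 != PQ.2].
Proof.
have cS := card_SylG par cardG degG.
have [P sP] := Sylow_exists r G.
have : (0 < #|'Syl_r(G) :\ P|)%N.
  have := cardsD1 P 'Syl_r(G); rewrite cS inE sP add1n => -[<-].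
  by apply: leq_trans (par_q_gt3 par).
by case/card_gt0P=> Q; rewrite !inE => /andP[nQP sQ]; exists (P, Q); rewrite eq_sym.
Qed.

(** The matrix of determinant 1 inducing g is unique modulo the centre, so its coset is
    multiplicative in g; faithfulness gives injectivity and equality of orders surjectivity. *)
Theorem isog_PSL2 : G \isog PSL2 F.
Proof.
have [[P Q] /= [sP sQ nPQ]] := two_Sylows.
have [w Gw [Pw Qw]] := Syl_swap par cardG degG sP sQ nPQ.
have w2 := swap_involution par cardG degG sP sQ nPQ Gw Pw Qw.
have w1 : w != 1%g.
  by apply: contraNneq nPQ => w1; rewrite -Pw w1; apply/eqP/val_inj; rewrite /= conjsg1.
have cP : #|P| = q by have := @card_Syl _ _ _ _ _ _ par _ _ cardG _ sP; move=> ->.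
have q3 := par_q_gt3 par.
(* For e = 1 and d = 2 the involution w fixes 1 + e = 2 Sylow subgroups; one of them is made the
   point 1, so that om(1) = 1. In the other cases any nonidentity element of P serves as unit. *)
have base : exists u0, [/\ u0 \in P, u0 != 1%g & e = 1 -> d = 2%N -> ((Q :^ u0) :^ w)%g = (Q :^ u0)%g].
  have [u Pu u1] : exists2 u, u \in P & u != 1%g.
    by apply/trivgPn; rewrite -cardG_gt1 cP (ltn_trans _ q3).
  case: (par_caseE par) => [[d1 _ _]|[d2 _ k4 [e1|e1]]]; try by exists u; split=> //; rewrite ?d1 ?e1.
  have ow : #[w] = 2%N by apply: nt_prime_order.
  have k2 : (2 %| k)%N by apply: dvdn_trans k4.
  have := nfix_theta par cardG degG Gw.
  rewrite (steinberg_value_k par cardG degG Gw _ k2) ?ow // e1 => /eqP.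
  rewrite -[1 + _]/(2%:R : algC) eqr_nat => /eqP fx.
  have : (0 < nfix r G w)%N by rewrite fx.
  case/card_gt0P=> R; rewrite !inE => /andP[sR /eqP fR].
  have nPR : P != R by apply: contraNneq nPQ => E; rewrite -Pw E fR.
  have [v Pv Rv] := Syl_regular par cardG degG sP sQ nPQ sR nPR.
  exists v; split=> // [|_ _]; last by have := congr1 (fun A : {group gT} => gval A) fR; rewrite Rv.
  apply: contraNneq nPQ => v1; have RQ : R = Q by rewrite Rv v1; apply/val_inj; rewrite /= conjsg1.
  by rewrite -Qw -RQ fR.
have [u0 [Pu0 u01 fu0]] := base.
have [j [jinj jM j1 jonto [jT jS]]] := Sylow_coordinates par cardG degG sP sQ nPQ cardF Pu0 u01.
pose sg := sig P Q j.
have GsigM := sigM par cardG degG sP sQ nPQ jinj jonto.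
have iu0 : coord_elt P j 1 = u0.
  rewrite /coord_elt; case: pickP => [u /andP[Pu /eqP ju]|/(_ u0)]; first by apply: jinj; rewrite // j1.
  by rewrite Pu0 j1 eqxx.
have fe : e = 1 -> d = 2%N -> om P Q w j 1 = 1.
  move=> e1 d2; rewrite /om.
  suff -> : sig P Q j w (Some 1) = Some 1 by [].
  have inj := pt_inj par cardG degG sP sQ nPQ jonto.
  rewrite /sig; case: pickP => [b|/(_ (Some 1))] /=.
    move/eqP=> E; apply: inj; rewrite E; apply: val_inj.
    by rewrite /= iu0; exact: fu0.
  by case/eqP; apply: val_inj; rewrite /= iu0; symmetry; exact: fu0.
have moeb := sig_moebius par cardG degG cardF sP sQ nPQ Gw Pw Qw Pu0 j1 jinj jM jonto jT jS fe.
have faith := sig_faithful par cardG degG sP sQ nPQ Pu0 j1 jinj jM jonto jT.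
pose mat g := odflt 1%:M [pick M : 'M[F]_2 | (\det M == 1) && [forall a, sg g a == moebius M a]].
have matP g : g \in G -> \det (mat g) = 1 /\ sg g =1 moebius (mat g).
  move=> Gg; rewrite /mat; case: pickP => [M /andP[/eqP dM /forallP H]|no] /=.
    by split=> // a; apply/eqP/H.
  have [M dM HM] := moeb g Gg; have := no M; rewrite dM eqxx /= => /negbT/forallPn[a].
  by rewrite -HM eqxx.
pose f g := coset 'Z(SL) (sl (mat g)).
have nZ M : \det M = 1 -> sl M \in 'N('Z(SL))%g.
  by move=> dM; apply: (subsetP (normal_norm (center_normal SL))); exact: mem_sl.
have fM : {in G &, {morph f : x y / (x * y)%g}}.
  move=> x y Gx Gy /=; have [dx mx] := matP x Gx; have [dy my] := matP y Gy.
  have [dxy mxy] := matP _ (groupM Gx Gy).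
  rewrite /f -(coset_morphM (nZ _ dx) (nZ _ dy)) (slM dx dy); apply: (coset_sl_eq dxy); first by rewrite det_mulmx dx dy mulr1.
  have dx0 : \det (mat x) != 0 by rewrite dx oner_neq0.
  by move=> a; rewrite -mxy (moebius_mul _ _ dx0) -my -mx; exact: GsigM.
have f1 : f 1%g = 1%g.
  by apply: (mulgI (f 1%g)); rewrite mulg1 -(fM _ _ (group1 G) (group1 G)) mulg1.
have finj : 'injm (Morphism fM).
  apply/injmP => x y Gx Gy /= exy; apply/eqP; rewrite eq_mulgV1; apply/eqP.
  have GV := groupVr Gy; have Gxy := groupM Gx GV.
  apply: (faith _ Gxy) => a; have [dxy mxy] := matP _ Gxy; rewrite [LHS]mxy.
  have fxy : f (x * y^-1)%g = 1%g by rewrite (fM _ _ Gx GV) exy -(fM _ _ Gy GV) mulgV.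
  have /SL2_centerP[_ [c c2]] := coset_idr (nZ _ dxy) fxy.
  have c0 : c != 0 by apply: contraTneq (oner_neq0 F) => c0; rewrite -c2 c0 expr0n eqxx.
  rewrite (slK dxy) => ->; exact: moebius_scalar.
apply/isogP; exists (Morphism fM) => //; apply/eqP; rewrite eqEcard morphimEdom; apply/andP; split.
  apply/subsetP=> _ /imsetP[x Gx ->] /=; have [dx _] := matP x Gx.
  by rewrite mem_quotient // mem_sl.
by rewrite card_PSL2 -cardG -(card_injm finj (subxx _)) morphimEdom.
Qed.
End Recognition.

(** * Quotients, permutation characters and a normality criterion *)

Section Quotients.
Variables (gT : finGroupType) (G N : {group gT}).
Hypothesis nNG : N <| G.

Lemma degn_mod (j : Iirr (G / N)) : degn (mod_Iirr j : Iirr G) = degn j.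
Proof. by apply/eqP; rewrite -(eqr_nat algC) -!degnE mod_IirrE // cfMod1. Qed.

Lemma cod_mod (j : Iirr (G / N)) : cod (mod_Iirr j : Iirr G) = cod j.
Proof.
rewrite /cod !degnE degn_mod; congr (_%:R / _); rewrite mod_IirrE //.
rewrite -(quotient_cfker_mod G 'chi_j nNG); symmetry; apply: index_quotient_eq.
- exact: subset_trans (subsetIr _ _) (cfker_mod _ nNG).
- exact: cfker_sub.
- exact: normal_norm.
Qed.

Lemma mod_Iirr_eq0 (j : Iirr (G / N)) : (mod_Iirr j == 0 :> Iirr G) = (j == 0).
Proof. by rewrite -(@mod_Iirr0 _ G N) (can_eq (mod_IirrK nNG)). Qed.

Lemma sum_degn_quo : (\sum_(i : Iirr G | N \subset cfker 'chi_i) degn i ^ 2 = #|(G / N)%g|)%N.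
Proof.
apply/eqP; rewrite -(eqr_nat algC) natr_sum -sum_degn_sqr natr_sum.
have := sum_norm_irr_quo (group1 G) nNG; rewrite coset_id ?group1 // => E; apply/eqP.
transitivity (\sum_(i : Iirr G | N \subset cfker 'chi_i) `|'chi_i 1%g| ^+ 2).
  by apply: eq_bigr => i _; rewrite degnE normr_nat natrX.
rewrite -E; apply: eq_bigr => j _.
by rewrite -[1%g]/(1%g : coset_of N) degnE normr_nat natrX.
Qed.

Lemma cod_ok_quo q k h d : cod_ok q k h d G -> cod_ok q k h d (G / N).
Proof. by move=> ok j j0; rewrite -cod_mod; apply: ok; rewrite mod_Iirr_eq0. Qed.

Lemma degree_ok_quo q k h d (i : Iirr G) : degree_ok q k h d (G / N) -> N \subset cfker 'chi_i -> i != 0 ->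
  [\/ degn i = q, degn i = k | exists2 mu, (0 < mu <= d)%N & degn i = (mu * h)%N].
Proof.
move=> dg sN i0; have E := quo_IirrK nNG sN; rewrite -E degn_mod; apply: dg.
by rewrite -mod_Iirr_eq0 E.
Qed.
End Quotients.

Section InducedTrivial.
Variables (gT : finGroupType) (G H : {group gT}).
Hypothesis sHG : H \subset G.

(** The c_i are the multiplicities in the permutation character on the cosets of H, computed by
    Frobenius reciprocity. *)
Lemma index_decomposition : exists c : Iirr G -> nat,
  [/\ c 0 = 1%N, #|G : H| = (\sum_i c i * degn i)%N
    & forall i, \sum_(x in H) 'chi_i x = 0 -> c i = 0%N].
Proof.
pose phi := 'Ind[G, H] 1; have chphi : phi \is a character by rewrite cfInd_char ?rpred1.
pose c (i : Iirr G) := Num.truncn '[phi, 'chi_i].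
have cE i : '[phi, 'chi_i] = (c i)%:R by rewrite truncnK // Cnat_cfdot_char_irr.
exists c; split.
- by apply/eqP; rewrite -(eqr_nat algC) -cE irr0 -cfdot_Res_r cfRes_cfun1 // cfnorm1.
- have := congr1 (fun f : 'CF(G) => f 1%g) (cfun_sum_cfdot phi).
  rewrite cfInd1 // cfun11 mulr1 sum_cfunE => E; apply/eqP; rewrite -(eqr_nat algC) E natr_sum.
  by apply/eqP; apply: eq_bigr => i _; rewrite cfunE cE degnE natrM.
move=> i S0; apply/eqP; rewrite -(eqr_nat algC) -cE -cfdot_Res_r cfdotE.
rewrite (eq_bigr (fun x => ('chi_i x)^*)) => [|x Hx]; last by rewrite cfun1E Hx mul1r cfResE.
by rewrite -rmorph_sum /= S0 rmorph0 mulr0.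
Qed.
End InducedTrivial.

Lemma sum_irr0 (gT : finGroupType) (G : {group gT}) (i : Iirr G) : i != 0 -> \sum_(x in G) 'chi_i x = 0.
Proof.
move=> i0; have := cfdot_irr i 0; rewrite (negbTE i0) irr0 cfdotE => /eqP.
rewrite mulf_eq0 invr_eq0 pnatr_eq0 (gtn_eqF (cardG_gt0 G)) /= => /eqP E.
by rewrite -[RHS]E; apply: eq_bigr => x Gx; rewrite cfun1E Gx rmorph1 mulr1.
Qed.

(** With H = N_G(P), Frattini gives G = NH, so no nonprincipal character of G/N occurs in the
    permutation character on G/H. Hence |G : H| is 1 modulo |N|; being at most |N|, it is 1. *)
Lemma Sylow_normal_of_degrees (gT : finGroupType) (G N P : {group gT}) p : N <| G ->
  (forall i : Iirr G, ~~ (N \subset cfker 'chi_i) -> (#|N| %| degn i)%N) ->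
  p.-Sylow(N) P -> P <| G.
Proof.
move=> nNG dv sP; have GE := Frattini_arg nNG sP; set H := 'N_G(P)%G.
have sHG : H \subset G by exact: subsetIl.
have sPG : P \subset G by apply: subset_trans (pHall_sub sP) (normal_sub nNG).
have [c [c0 ic ci]] := index_decomposition sHG.
have cN i : N \subset cfker 'chi_i -> i != 0 -> c i = 0%N.
  move=> sN i0; apply: ci; have := sum_irr0 i0.
  (* As G = NH and N lies in the kernel, the character has the same sum on every coset of H; the
     total over G is 0. *)
  rewrite (set_partition_big _ (rcosets_partition sHG)) /=.
  rewrite (eq_bigr (fun=> \sum_(x in H) 'chi_i x)) => [|X /rcosetsP[x Gx ->]]; last first.
    have /mulsgP[n y Nn Hy ->] : x \in (N * 'N_G(P))%g by rewrite GE.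
    rewrite (reindex_inj (mulIg (n * y)%g)) [RHS](reindex_inj (mulIg y)) /=.
    apply: eq_big => [u|u]; first by rewrite mem_rcoset mulgK groupMr.
    rewrite mem_rcoset mulgK => Hu.
    have -> : (u * (n * y) = n ^ u^-1 * (u * y))%g by rewrite conjgE invgK !mulgA mulgKV.
    rewrite cfkerMl // (subsetP sN) //.
    by rewrite memJ_norm // groupV (subsetP (normal_norm nNG)) // (subsetP sHG).
  rewrite big_const iter_addr_0 => /eqP; rewrite -mulr_natr mulf_eq0 pnatr_eq0 => /orP[/eqP//|].
  by rewrite -/(#|rcosets H G|) -/(indexg _ _) eqn0Ngt indexg_gt0.
have le : (#|G : H| <= #|N|)%N.
  have := mul_cardG N H; rewrite /= GE => E.
  rewrite -(leq_pmul2r (cardG_gt0 H)) mulnC Lagrange // E leq_pmulr // cardG_gt0.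
have [t it] : exists t, #|G : H| = (1 + #|N| * t)%N.
  rewrite ic (bigD1 0) //= c0 degn0 mul1n.
  have /dvdnP[t ->] : (#|N| %| \sum_(i : Iirr G | i != 0%R) c i * degn i)%N.
    apply: dvdn_sum => i i0; have [sN|nsN] := boolP (N \subset cfker 'chi_i); first by rewrite cN.
    by rewrite dvdn_mull // dv.
  by exists t; rewrite mulnC.
have N0 := cardG_gt0 N.
have i1 : #|G : H| = 1%N by move: le; rewrite it; case: t {it} => [|t]; [rewrite muln0 | rewrite mulnS]; lia.
have /eqP HG : H :==: G by rewrite eqEsubset sHG -indexg_eq1 i1.
by rewrite /normal sPG -HG subsetIr.
Qed.

Lemma sum_two_squares (I : finType) (S : pred I) (D : I -> nat) (x y : nat) :
  (forall i, S i -> D i = x \/ exists mu, D i = (mu * y)%N) ->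
  exists A C, (\sum_(i | S i) D i ^ 2 = A * x ^ 2 + C * y ^ 2)%N.
Proof.
move=> H; elim/big_rec: _ => [|i s Si [A [C ->]]]; first by exists 0%N, 0%N.
have [->|[mu ->]] := H i Si; first by exists A.+1, C; rewrite mulSn addnA.
by exists A, (mu ^ 2 + C)%N; rewrite expnMn mulnDl addnCA.
Qed.

(** Coprimality gives C = a C1. If C1 = 0, then a divides z - 1 < a. Otherwise z^2 c is at most b(z
    - 1) < 4c(z - 1), against 4(z - 1) being at most z^2. *)
Lemma central_arith (z a b c A C : nat) : (1 < z)%N -> coprime a z -> coprime a b -> coprime a c ->
  (z - 1 < a)%N -> (0 < b)%N -> (0 < c)%N -> (b < 4 * c)%N ->
  (z ^ 2 * (A * a ^ 2 + C * c ^ 2) = a * b * c * (z - 1))%N -> False.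
Proof.
move=> z1 az ab ac za b0 c0 bc E; have a0 : (0 < a)%N by apply: leq_trans za.
have : (a %| C)%N.
  have : (a %| z ^ 2 * (A * a ^ 2 + C * c ^ 2))%N by rewrite E -!mulnA dvdn_mulr.
  have aA : (a %| A * a ^ 2)%N by rewrite dvdn_mull // dvdn_exp.
  by rewrite (Gauss_dvdr _ (coprimeXr 2 az)) (dvdn_addr _ aA) (Gauss_dvdl _ (coprimeXr 2 ac)).
case/dvdnP=> C1 EC; rewrite {C}EC in E.
have E1 : (z ^ 2 * (A * a + C1 * c ^ 2) = b * c * (z - 1))%N.
  by apply/eqP; rewrite -(eqn_pmul2l a0); apply/eqP; move: E; clear; nia.
case: C1 E1 {E} => [|C1] E1.
  have : (a %| b * c * (z - 1))%N by rewrite -E1 mul0n addn0 mulnA dvdn_mull.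
  rewrite -mulnA !Gauss_dvdr //; move/dvdn_leq; rewrite subn_gt0 => /(_ z1).
  by rewrite leqNgt za.
have : (z ^ 2 * c ^ 2 <= b * c * (z - 1))%N.
  by rewrite -E1 leq_mul2l mulSn; apply/orP; right; apply: leq_trans (leq_addl _ _); exact: leq_addr.
have le4 : (4 * (z - 1) <= z ^ 2)%N.
  by rewrite -(subnK (ltnW z1)); set u := (z - 1)%N; rewrite addnK; clear; nia.
move=> le; have : (4 * (z - 1) * c ^ 2 <= b * c * (z - 1))%N by apply: leq_trans le; rewrite leq_mul2r le4 orbT.
have z10 : (0 < z - 1)%N by rewrite subn_gt0.
have -> : (4 * (z - 1) * c ^ 2 = 4 * c * (c * (z - 1)))%N by rewrite expnS expn1; ring.
by rewrite -[(b * c * (z - 1))%N]mulnA leq_pmul2r ?muln_gt0 ?c0 // leqNgt bc.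
Qed.

(** * The codegree condition forces simplicity *)

Section CodegreesForceSimplicity.
Variables (r q k h d : nat) (e : int).
Hypothesis par : psl_params r q k h d e.
Local Notation n0 := (q * k * h)%N.

Let q3 : (3 < q)%N := par_q_gt3 par.

Lemma par_bounds : [/\ (k <= q.+1)%N, (q <= k.+1)%N, (h <= q.+1)%N & (q <= (2 * h).+1)%N].
Proof.
have kE := par_kE par; have hE := par_hE par; have := par_d_gt0 par; have [_ h3] := par_ge3 par.
by case: (par_e1 par) => e1; move: kE hE h3; rewrite e1; clear -q3; case: d => [|[|[|]]] // *; split; lia.
Qed.

Lemma degree_lower (D : nat) :
  [\/ D = q, D = k | exists2 mu, (0 < mu <= d)%N & D = (mu * h)%N] -> (q <= (2 * D).+1)%N.
Proof.
have [_ b2 _ b4] := par_bounds.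
case=> [->|->|[[|mu] // _ ->]]; [by clear; lia | by move: b2; clear; lia |].
by apply: leq_trans b4 _; rewrite mulSn; clear; lia.
Qed.

Lemma simple_order (gT : finGroupType) (G : {group gT}) : simple G -> cod_ok q k h d G -> #|G| = n0.
Proof. by move=> sG ok; have [] := simple_order_degrees par sG ok. Qed.

Lemma simple_nonabelian (gT : finGroupType) (G : {group gT}) : simple G -> cod_ok q k h d G -> ~~ abelian G.
Proof.
move=> sG ok; apply/negP=> abG; have := simple_sol_prime (abelian_sol abG) sG.
rewrite (simple_order sG ok); apply: prime_mulN; last by have [_] := par_ge3 par; apply: leq_trans.
by have [k2 _] := par_ge3 par; move: q3 k2; clear; nia.
Qed.

Section MinimalNormal.
Variables (gT : finGroupType) (G N : {group gT}).
Hypotheses (ok : cod_ok q k h d G) (mN : minnormal N G) (nNG : N <| G).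
Hypothesis IH : forall K : {group gT}, K <| G -> K :!=: 1%g -> K :!=: G -> simple (G / K).
Hypothesis nN : N :!=: G.

Let ntN : N :!=: 1%g. Proof. by case/mingroupP: mN => /andP[]. Qed.

Let okQ (K : {group gT}) : K <| G -> cod_ok q k h d (G / K). Proof. by move=> nK; apply: cod_ok_quo. Qed.

Lemma normal_quo_dichotomy (K L : {group gT}) : K <| G -> simple (G / K) -> L <| G ->
  L \subset K \/ G \subset (K * L)%g.
Proof.
move=> nK /simpleP[_ sK] nL; have nKL := subset_trans (normal_sub nL) (normal_norm nK).
case: (sK (L / K)%G (quotient_normal K nL)) => /= E; [left|right].
  by rewrite -(quotient_sub1 nKL) E.
by rewrite -(quotientSK _ (normal_norm nK)) E.
Qed.

Lemma minnormal_TI (L : {group gT}) : L <| G -> ~~ (N \subset L) -> (N :&: L = 1)%g.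
Proof.
move=> nL nsN; apply/eqP; apply: contraNT nsN => nt.
have [_ /(_ (N :&: L)%G)] := mingroupP mN; rewrite nt subsetIl /=.
rewrite (normal_norm (normalI nNG nL)) => /(_ isT isT) <-; exact: subsetIr.
Qed.

Lemma TI_normal_cents (A B : {group gT}) : A <| G -> B <| G -> (A :&: B = 1)%g -> A \subset 'C(B).
Proof.
move=> nA nB AB1; apply/commG1P/trivgP; rewrite -AB1 subsetI commg_subl commg_subr.
by rewrite (subset_trans (normal_sub nB) (normal_norm nA)) (subset_trans (normal_sub nA) (normal_norm nB)).
Qed.

(** A nontrivial kernel K would give G = N x K with both factors of order n0. Some character [j] has
    neither factor in its kernel L. If L = 1, its degree and codegree are too small; otherwise L is
    central and covers the nonabelian G/N. *)
Lemma faithful_over_minnormal (i : Iirr G) : ~~ (N \subset cfker 'chi_i) -> cfker 'chi_i = 1%g.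
Proof.
move=> nsN; apply/eqP; apply: contraT => ntK; set K := cfker_group 'chi_i.
have nK : K <| G by exact: cfker_normal.
have sQN := IH nNG ntN nN; have oQN := simple_order sQN (okQ nNG).
have TI := minnormal_TI nK nsN.
have nKG : K :!=: G by apply: contraNneq nsN => KG; rewrite -[cfker _]/(gval K) KG normal_sub.
have sQK := IH nK ntK nKG; have oQK := simple_order sQK (okQ nK).
have GNK : G \subset (N * K)%g.
  case: (normal_quo_dichotomy nNG sQN nK) => // sKN.
  by case/eqP: ntK; apply/trivgP; rewrite -TI subsetI sKN subxx.
have GE : (N * K = G)%g by apply/eqP; rewrite eqEsubset GNK mul_subG // normal_sub.
have cG : (#|N| * #|K| = #|G|)%N by rewrite -TI_cardMg // GE.
have cN : #|N| = n0.
  by rewrite -oQK card_quotient ?normal_norm // -divgS ?normal_sub // -cG mulnK.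
have cK : #|K| = n0.
  by rewrite -oQN card_quotient ?normal_norm // -divgS ?normal_sub // -cG mulKn.
have n02 : (2 < n0)%N.
  by have [k2 h2] := par_ge3 par; apply: leq_trans h2 _; rewrite leq_pmull // muln_gt0; move: q3 k2; clear; lia.
(* If each character contained N or K in its kernel, the sums of squares for G/N and G/K would give
   |G| at most 2 n0, while |G| = n0^2. *)
have [j [nsNj nsKj]] : exists j : Iirr G, ~~ (N \subset cfker 'chi_j) /\ ~~ (K \subset cfker 'chi_j).
  have [/existsP[j /andP[? ?]]|/existsPn H] := boolP [exists j : Iirr G, ~~ (N \subset cfker 'chi_j) && ~~ (K \subset cfker 'chi_j)].
    by exists j.
  have : (#|G| <= n0 + n0)%N.
    rewrite -{1}oQN -{1}oQK -(sum_degn_quo nNG) -(sum_degn_quo nK) -sum_degn_sqr.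
    rewrite [X in (_ <= X + _)%N]big_mkcond [X in (_ <= _ + X)%N]big_mkcond -big_split /=.
    apply: leq_sum => j _; have := H j; rewrite negb_and !negbK.
    by case: ifP => //= _; case: ifP => // _ _; rewrite leq_addr.
  have lt : (n0 + n0 < #|G|)%N by rewrite -cG cN cK; move: n02; move: (q * k * h)%N; clear => m m2; nia.
  by rewrite leqNgt lt.
pose L := cfker_group 'chi_j; have nL : L <| G by exact: cfker_normal.
have NL := minnormal_TI nL nsNj.
have KL : (K :&: L = 1)%g.
  have nI := normalI nK nL.
  case: (normal_quo_dichotomy nNG sQN nI) => [sI|/subset_leq_card].
    by apply/trivgP; rewrite -NL subsetI sI subsetIr.
  rewrite TI_cardMg; last by apply/trivgP; rewrite -TI setIS // subsetIl.
  rewrite -cG leq_pmul2l ?cardG_gt0 // => le.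
  have /eqP E : (K :&: L)%g == K by rewrite eqEcard subsetIl.
  by case/negP: nsKj; rewrite -E subsetIr.
have GNL : G \subset (N * L)%g.
  case: (normal_quo_dichotomy nNG sQN nL) => // sLN.
  have L1 : L :=: 1%g by apply/trivgP; rewrite -NL subsetI sLN subxx.
  case: (normal_quo_dichotomy nK sQK nL) => [_|]; last first.
    rewrite L1 mulg1 => sGK; by case/eqP: nKG; apply/eqP; rewrite eqEsubset sGK normal_sub.
  have j0 : j != 0 by apply: contraNneq nsNj => ->; rewrite cfker_irr0 normal_sub.
  have [c ce cc] := ok j0; have E := faithful_cod L1 ce.
  (* A faithful [j] has degree at most n0 and codegree below n0, but their product is n0^2. *)
  have := degn_sqr_le j; rewrite -cG cN cK -mulnn leq_sqr => le1.
  have cn0 : (c < n0)%N.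
    have [[k2 h2] [b1 b2 b3 b4]] := (par_ge3 par, par_bounds).
    case: cc => [->|->|[mu /andP[mu0 _] cmu]].
    - by rewrite -mulnA -[X in (X < _)%N]mul1n ltn_pmul2r ?muln_gt0; move: q3 k2 h2; clear; lia.
    - by rewrite mulnAC -[X in (X < _)%N]muln1 ltn_pmul2l ?muln_gt0; move: q3 k2 h2; clear; lia.
    apply: (@leq_ltn_trans (q * k)); first by rewrite -cmu leq_pmulr.
    by rewrite -[X in (X < _)%N]muln1 ltn_pmul2l ?muln_gt0; move: q3 k2 h2; clear; lia.
  have : (c * degn j < n0 * n0)%N.
    by apply: (@leq_ltn_trans (c * n0)); rewrite ?leq_mul2l ?le1 ?orbT // ltn_pmul2r //; exact: leq_trans n02.
  by rewrite E -cG cN cK ltnn.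
have cLG : L \subset 'C(G).
  have s1 : L \subset 'C(N) by apply: TI_normal_cents nL nNG _; rewrite setIC.
  have s2 : L \subset 'C(K) by apply: TI_normal_cents nL nK _; rewrite setIC.
  by rewrite centsC -GE mul_subG // centsC.
have abL : abelian L by apply: subset_trans cLG (centS (normal_sub nL)).
have : abelian (G / N).
  have <- : (L / N = G / N)%g.
    apply/eqP; rewrite eqEsubset; apply/andP; split; first exact: quotientS (normal_sub nL).
    by rewrite (quotientSK _ (normal_norm nNG)).
  exact: quotient_abelian.
by rewrite (negbTE (simple_nonabelian sQN (okQ nNG))).
Qed.

Lemma degree_over_minnormal (i : Iirr G) : ~~ (N \subset cfker 'chi_i) -> exists2 D, degn i = (D * #|N|)%N &
  [\/ D = q, D = k | exists2 mu, (0 < mu <= d)%N & D = (mu * h)%N].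
Proof.
move=> nsN; have i0 : i != 0 by apply: contraNneq nsN => ->; rewrite cfker_irr0 normal_sub.
have [c ce cc] := ok i0; have E := faithful_cod (faithful_over_minnormal nsN) ce.
have cG : #|G| = (n0 * #|N|)%N.
  rewrite -(simple_order (IH nNG ntN nN) (okQ nNG)) card_quotient ?normal_norm //.
  by rewrite mulnC Lagrange ?normal_sub.
rewrite cG in E; have [k2 h2] := par_ge3 par; have z0 := cardG_gt0 N.
have q0 : (0 < q)%N by apply: leq_trans q3.
have k0 : (0 < k)%N by apply: leq_trans k2.
have h0 : (0 < h)%N by apply: leq_trans h2.
case: cc => [cE|cE|[mu mud cE]].
- exists q; last by constructor 1.
  apply/eqP; rewrite -(@eqn_pmul2l (k * h)) ?muln_gt0 ?k0 // -{1}cE E; apply/eqP; ring.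
- exists k; last by constructor 2.
  apply/eqP; rewrite -(@eqn_pmul2l (q * h)) ?muln_gt0 ?q0 // -{1}cE E; apply/eqP; ring.
exists (mu * h)%N; last by constructor 3; exists mu.
have c0 : (0 < c)%N by move: cE; case: (c) => //; rewrite mul0n => /esym/eqP; rewrite muln_eq0 !gtn_eqF.
by apply/eqP; rewrite -(eqn_pmul2l c0) E -cE; apply/eqP; ring.
Qed.

Let z := #|N|.
Let z1 : (1 < z)%N. Proof. by rewrite cardG_gt1. Qed.
Let cG : #|G| = (n0 * z)%N.
Proof.
rewrite -(simple_order (IH nNG ntN nN) (okQ nNG)) card_quotient ?normal_norm //.
by rewrite mulnC Lagrange ?normal_sub.
Qed.
Let dQN : degree_ok q k h d (G / N).
Proof. by have [] := simple_order_degrees par (IH nNG ntN nN) (okQ nNG). Qed.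

(** The degrees over N are divisible by |N|, so a Sylow subgroup of N is normal in G and, by
    minimality, equal to N. *)
Lemma minnormal_pgroup : exists2 p, prime p & p.-group N.
Proof.
have pp : prime (pdiv z) by rewrite pdiv_prime.
exists (pdiv z) => //; have [P sP] := Sylow_exists (pdiv z) N.
have nP : P <| G.
  apply: (Sylow_normal_of_degrees nNG) sP => i /degree_over_minnormal[D -> _].
  by rewrite dvdn_mull.
have P1 : P :!=: 1%g.
  by rewrite trivg_card1 (card_Hall sP) p_part_eq1 negbK pi_pdiv.
have [_ /(_ P)] := mingroupP mN; rewrite P1 (normal_norm nP) => /(_ isT (pHall_sub sP)) <-.
exact: pHall_pgroup sP.
Qed.

Lemma minnormal_abelian : abelian N.
Proof.
have [p _ pN] := minnormal_pgroup.
have nZ : 'Z(N) <| G by apply: char_normal_trans (center_char N) nNG.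
have Z1 : 'Z(N) != 1%g by apply: contraNneq ntN => /(trivg_center_pgroup pN) ->.
have [_ /(_ 'Z(N)%G)] := mingroupP mN; rewrite /= Z1 (normal_norm nZ) => /(_ isT (center_sub N)) E.
by rewrite -E center_abelian.
Qed.

Lemma sum_degn_over_minnormal :
  (\sum_(i : Iirr G | ~~ (N \subset cfker 'chi_i)) (degn i %/ z) ^ 2 * z ^ 2 = n0 * (z - 1))%N.
Proof.
have := sum_degn_sqr G; rewrite (bigID (fun i => N \subset cfker 'chi_i)) /= sum_degn_quo //.
rewrite (simple_order (IH nNG ntN nN) (okQ nNG)) cG mulnBr muln1 => <-; rewrite addKn.
apply: eq_bigr => i /degree_over_minnormal[D -> _].
by rewrite -expnMn mulnK // cardG_gt0.
Qed.

(** The squares of the degrees over N, multiples of z^2, sum to n0 (z - 1), and z is prime to z -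
    1. *)
Lemma minnormal_sqr_dvd : (z ^ 2 %| n0)%N.
Proof.
have cz : coprime (z ^ 2) (z - 1) by apply: coprimeXl; rewrite subn1 coprimenP // ltnW.
rewrite -(Gauss_dvdl _ cz) -sum_degn_over_minnormal.
by apply: dvdn_sum => i _; exact: dvdn_mull.
Qed.

Let gp : coprime q k := par_coprime_qk par.
Let gqh : coprime q h := par_coprime_qh par.
Let gkh : coprime k h := par_coprime_kh par.

Lemma minnormal_cases : [\/ [/\ coprime z k, coprime z h & (z ^ 2 %| q)%N],
  [/\ coprime z q, coprime z h & (z ^ 2 %| k)%N] | [/\ coprime z q, coprime z k & (z ^ 2 %| h)%N]].
Proof.
have [p pp pN] := minnormal_pgroup; have zE := card_pgroup pN; rewrite -/z in zE.
have cop m : coprime p m -> coprime z m by rewrite zE; exact: coprimeXl.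
have pz : (p %| z)%N.
  by have := z1; rewrite zE; case: (logn p z) => [|n] //; rewrite expnS dvdn_mulr.
have Sq := minnormal_sqr_dvd.
have pn0 : (p %| n0)%N by apply: dvdn_trans Sq; rewrite expnS dvdn_mulr.
have coph a b : coprime a b -> (p %| a)%N -> coprime p b.
  by move=> ab pa; exact: coprime_dvdl pa ab.
rewrite !Euclid_dvdM // -orbA in pn0; case/or3P: pn0 => pd.
- have [ck ch] := (cop _ (coph _ _ gp pd), cop _ (coph _ _ gqh pd)).
  by constructor 1; split=> //; move: Sq; rewrite -mulnA Gauss_dvdl // coprimeMr !coprimeXl.
- have cq : coprime z q by apply/cop/(coph k) => //; rewrite coprime_sym.
  have ch := cop _ (coph _ _ gkh pd).
  by constructor 2; split=> //; move: Sq; rewrite mulnAC Gauss_dvdr // coprimeMr !coprimeXl.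
have cq : coprime z q by apply/cop/(coph h) => //; rewrite coprime_sym.
have ck : coprime z k by apply/cop/(coph h) => //; rewrite coprime_sym.
by constructor 3; split=> //; move: Sq; rewrite Gauss_dvdr // coprimeMr !coprimeXl.
Qed.

Lemma minnormal_sqr_le : (z ^ 2 <= q.+1)%N.
Proof.
have [[k2 h2] [b1 _ b3 _]] := (par_ge3 par, par_bounds).
by case: minnormal_cases => -[_ _ /dvdn_leq le]; [apply: leqW|apply: leq_trans b1|apply: leq_trans b3];
  apply: le; move: q3 k2 h2; clear; lia.
Qed.

(** A noncentral x in N has at most z - 1 conjugates, so the permutation character on its class has
    a nonprincipal constituent of degree at most z - 2. But degrees over N are at least z, and those
    of G/N at least (q - 1)/2, with z^2 at most q + 1. *)
Lemma minnormal_central : N \subset 'Z(G).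
Proof.
apply/subsetP=> x Nx; have Gx := subsetP (normal_sub nNG) x Nx; apply: contraT => ncx.
have sCG : 'C_G[x]%g \subset G by exact: subsetIl.
have [c [c0 ic _]] := index_decomposition sCG.
have sNC : N \subset 'C_G[x] by rewrite subsetI normal_sub //; apply/subsetP=> y Ny; apply/cent1P; exact: (centsP minnormal_abelian).
have mz : (#|G : 'C_G[x]| <= z - 1)%N.
  rewrite index_cent1; have -> : (z - 1 = #|N^#|)%N by rewrite /z (cardsD1 1%g N) group1 addKn.
  apply: subset_leq_card; apply/subsetP=> _ /imsetP[y Gy ->]; rewrite !inE conjg_eq1.
  rewrite memJ_norm ?(subsetP (normal_norm nNG)) // Nx andbT.
  by apply: contraNneq ncx => ->; exact: group1.
have m1 : (1 < #|G : 'C_G[x]|)%N.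
  rewrite ltn_neqAle indexg_gt0 andbT eq_sym indexg_eq1.
  apply: contraNN ncx => sGC; apply/centerP; split=> // y Gy.
  by have /setIP[_ /cent1P] := subsetP sGC y Gy.
have [i i0 ci] : exists2 i : Iirr G, i != 0 & c i != 0%N.
  apply/exists_inP; apply: contraLR m1; rewrite negb_exists_in => /forall_inP H.
  rewrite ic (bigD1 0) //= c0 degn0 big1 // => i i0.
  by have := H i i0; rewrite negbK => /eqP ->.
have di : (degn i <= z - 2)%N.
  have : (1 + degn i <= z - 1)%N.
    apply: leq_trans mz; rewrite ic (bigD1 0) //= c0 degn0 leq_add2l (bigD1 i) //=.
    by apply: leq_trans (leq_addr _ _); rewrite leq_pmull // lt0n.
  by move: z1; clear; lia.
have [sN|/degree_over_minnormal[D eD Dq]] := boolP (N \subset cfker 'chi_i).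
  have lo := degree_lower (degree_ok_quo nNG dQN sN i0); have := minnormal_sqr_le.
  by move: lo di z1; move: (degn i) z; clear; nia.
have : (z <= degn i)%N by apply: dvdn_leq (degn_gt0 i) _; rewrite eD dvdn_mull.
by move: di z1; clear; lia.
Qed.

Lemma degree_central (i : Iirr G) : ~~ (N \subset cfker 'chi_i) -> (degn i %| n0)%N.
Proof.
move=> _; have sNZ : N \subset 'Z('chi_i)%CF.
  by apply: subset_trans minnormal_central _; rewrite -cap_cfcenter_irr; exact: bigcap_inf.
have iN : #|G : N| = n0.
  by rewrite -(simple_order (IH nNG ntN nN) (okQ nNG)) card_quotient ?normal_norm.
have := dvd_irr1_index_center i; rewrite degnE dvdC_nat => /dvdn_trans; apply.
by rewrite -iN; apply: indexgS.
Qed.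

(** z is a power of a prime dividing exactly one of q, k, h. A degree Dz over N divides n0, which
    excludes the D attached to that factor; sums of squares of the two remaining kinds contradict
    [central_arith]. *)
Lemma minnormal_absurd : False.
Proof.
have [[k2 h2] [b1 b2 b3 b4]] := (par_ge3 par, par_bounds).
have q0 : (0 < q)%N by apply: leq_trans q3.
have k0 : (0 < k)%N by apply: leq_trans k2.
have h0 : (0 < h)%N by apply: leq_trans h2.
have zle := minnormal_sqr_le; have Sm := sum_degn_over_minnormal.
pose D (i : Iirr G) := (degn i %/ z)%N.
have z0 : (0 < z)%N := cardG_gt0 N.
have DP i : ~~ (N \subset cfker 'chi_i) -> (D i * z %| n0)%N /\
    [\/ D i = q, D i = k | exists2 mu, (0 < mu <= d)%N & D i = (mu * h)%N].
  move=> nsN; have := degree_central nsN; have [E eE cE] := degree_over_minnormal nsN.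
  by rewrite /D eE mulnK.
have zq : (z - 1 < q)%N by move: zle q3 z1; clear; nia.
have zno a : coprime z a -> (z %| a)%N -> False.
  by move=> za /gcdn_idPl zE; move: za z1; rewrite /coprime zE => /eqP ->.
have noq i : ~~ (N \subset cfker 'chi_i) -> coprime z k -> coprime z h -> D i != q.
  move=> /DP[dv _] ck ch; apply/eqP=> E; move: dv; rewrite E -mulnA dvdn_pmul2l //.
  by apply: zno; rewrite coprimeMr ck.
have nok i : ~~ (N \subset cfker 'chi_i) -> coprime z q -> coprime z h -> D i != k.
  move=> /DP[dv _] cq ch; apply/eqP=> E; move: dv; rewrite E [(q * k)%N]mulnC -mulnA dvdn_pmul2l //.
  by apply: zno; rewrite coprimeMr cq.
have noh i mu : ~~ (N \subset cfker 'chi_i) -> coprime z q -> coprime z k -> D i != (mu * h)%N.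
  move=> /DP[dv _] cq ck; apply/eqP=> E; move: dv; rewrite E [(mu * h)%N]mulnC -mulnA mulnC [n0]mulnC.
  rewrite [(mu * z * h)%N]mulnC dvdn_pmul2l // => /(dvdn_trans (dvdn_mull mu (dvdnn z))).
  by apply: zno; rewrite coprimeMr cq.
have Sm2 A C x y : (\sum_(i | ~~ (N \subset cfker 'chi_i)) D i ^ 2 = A * x ^ 2 + C * y ^ 2)%N ->
   (z ^ 2 * (A * x ^ 2 + C * y ^ 2) = n0 * (z - 1))%N.
  by move=> <-; rewrite -Sm mulnC big_distrl.
have tsq := @sum_two_squares _ (fun i => ~~ (N \subset cfker 'chi_i)) D.
case: minnormal_cases => -[c1 c2 _].
- have [i nsi|A [C /Sm2 E]] := tsq k h.
    have [_ [Dq|->|[mu _ ->]]] := DP i nsi; [|by left|by right; exists mu].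
    by have := noq i nsi c1 c2; rewrite Dq eqxx.
  apply: (@central_arith z h q k C A) => //; rewrite 1?coprime_sym //.
  + by move: zle b4 z1 h2; clear; nia.
  + by move: b2 k2; clear; lia.
  + by rewrite addnC E; congr (_ * _)%N; ring.
- have [i nsi|A [C /Sm2 E]] := tsq q h.
    have [_ [->|Dk|[mu _ ->]]] := DP i nsi; [by left| |by right; exists mu].
    by have := nok i nsi c1 c2; rewrite Dk eqxx.
  apply: (@central_arith z q k h A C) => //; rewrite 1?coprime_sym //.
  by move: b1 b4 h2; clear; lia.
have [i nsi|A [C /Sm2 E]] := tsq q k.
  have [_ [->|->|[mu _ Dh]]] := DP i nsi; [by left|by right; exists 1%N; rewrite mul1n|].
  by have := noh i mu nsi c1 c2; rewrite Dh eqxx.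
apply: (@central_arith z q h k A C) => //; rewrite 1?coprime_sym //.
  by move: b3 b2 k2; clear; lia.
by rewrite E; congr (_ * _)%N; ring.
Qed.
End MinimalNormal.

Theorem cod_ok_simple (gT : finGroupType) (G : {group gT}) :
  G :!=: 1%g -> cod_ok q k h d G -> simple G.
Proof.
have [n] := ubnP #|G|; elim: n gT G => // n IHn gT G leGn ntG ok.
apply: contraT => /simpleP nsG.
have [H [nH ntH nHG]] : exists H : {group gT}, [/\ H <| G, H :!=: 1%g & H :!=: G].
  have [/existsP[H /and3P[? ? ?]]|/existsPn no] := boolP [exists H : {group gT}, [&& H <| G, H :!=: 1%g & H :!=: G]].
    by exists H.
  case: nsG; split=> // H nH; have := no H; rewrite nH /= negb_and !negbK.
  by case/orP=> /eqP ->; [left | right].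
have [N mN sNH] := minnormal_exists ntH (normal_norm nH).
have [ntN nGN] : N :!=: 1%g /\ G \subset 'N(N) by case/mingroupP: mN => /andP[].
have nNG : N <| G by rewrite /normal (subset_trans sNH (normal_sub nH)).
have nN : N :!=: G.
  by apply: contraNneq nHG => E; rewrite eqEsubset normal_sub // -E sNH.
have IH (K : {group gT}) : K <| G -> K :!=: 1%g -> K :!=: G -> simple (G / K).
  move=> nK ntK nKG; apply: IHn; last exact: cod_ok_quo.
    by apply: leq_trans (ltn_quotient ntK (normal_sub nK)) _; rewrite -ltnS.
  by rewrite -subG1 quotient_sub1 ?normal_norm //; apply: contra nKG => sGK; rewrite eqEsubset normal_sub.
by case: (minnormal_absurd ok mN nNG IH nN).
Qed.
End CodegreesForceSimplicity.

(** * Commuting 2 x 2 matrices and centralizers in SL(2,q) *)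

Section CommutingMatrices.
Variable F : fieldType.
Implicit Types (M N L : 'M[F]_2).

Lemma eq_of_sub (a b c d : F) : a = b -> c - d = a - b -> c = d.
Proof. by move=> ->; rewrite subrr => /eqP; rewrite subr_eq0 => /eqP. Qed.

(** Modulo scalars a matrix is the vector (M01, M10, M00 - M11); the equations are the minors
    expressing that two such vectors are parallel. *)
Lemma comm2P M N : M *m N = N *m M <->
  [/\ M 0 1 * N 1 0 = N 0 1 * M 1 0, M 0 1 * (N 0 0 - N 1 1) = N 0 1 * (M 0 0 - M 1 1)
    & M 1 0 * (N 0 0 - N 1 1) = N 1 0 * (M 0 0 - M 1 1)].
Proof.
rewrite {1 2}[M]mx4_eta {1 2}[N]mx4_eta !mx4_mul; split=> [/mx4_inj[E1 E2 E3 E4]|[E1 E2 E3]].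
  by split; [apply: eq_of_sub E1 _ | apply: eq_of_sub (esym E2) _ | apply: eq_of_sub E3 _]; ring.
by congr mx4; [apply: eq_of_sub E1 _ | apply: eq_of_sub (esym E2) _ | apply: eq_of_sub E3 _ | apply: eq_of_sub (esym E1) _]; ring.
Qed.

Lemma parallel_trans (m1 m2 m3 n1 n2 n3 l1 l2 l3 : F) :
  [|| m1 != 0, m2 != 0 | m3 != 0] ->
  m1 * n2 = n1 * m2 -> m1 * n3 = n1 * m3 -> m2 * n3 = n2 * m3 ->
  m1 * l2 = l1 * m2 -> m1 * l3 = l1 * m3 -> m2 * l3 = l2 * m3 -> n1 * l2 = l1 * n2.
Proof.
move=> nz a1 a2 a3 b1 b2 b3.
have z1 : m1 * n2 - n1 * m2 = 0 by rewrite a1 subrr.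
have z2 : m1 * n3 - n1 * m3 = 0 by rewrite a2 subrr.
have z3 : m2 * n3 - n2 * m3 = 0 by rewrite a3 subrr.
have w1 : m1 * l2 - l1 * m2 = 0 by rewrite b1 subrr.
apply/eqP; rewrite -subr_eq0; case/or3P: nz => /mulfI inj; apply/eqP/inj; rewrite mulr0.
- by transitivity (n1 * (m1 * l2 - l1 * m2) - l1 * (m1 * n2 - n1 * m2)); [ring | rewrite z1 w1 !mulr0 subrr].
- transitivity (n2 * (m1 * l2 - l1 * m2) - l2 * (m1 * n2 - n1 * m2)); first by ring.
  by rewrite z1 w1 !mulr0 subrr.
transitivity (n3 * (m1 * l2 - l1 * m2) - l2 * (m1 * n3 - n1 * m3) + l1 * (m2 * n3 - n2 * m3)); first by ring.
by rewrite z2 z3 w1 !mulr0 subrr add0r.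
Qed.

Definition nonscalar M := [|| M 0 1 != 0, M 1 0 != 0 | M 0 0 - M 1 1 != 0].

Lemma nonscalarPn M : ~~ nonscalar M -> M = (M 1 1)%:M.
Proof.
rewrite /nonscalar !negb_or !negbK => /and3P[/eqP b0 /eqP c0]; rewrite subr_eq0 => /eqP ad.
by rewrite {1}[M]mx4_eta mx4_scalar b0 c0 ad.
Qed.

(** Two vectors parallel to the same nonzero vector are parallel. Hence centralizers of noncentral
    elements are abelian, and they coincide or meet in the centre. *)
Lemma comm2_trans M N L : nonscalar M -> M *m N = N *m M -> M *m L = L *m M -> N *m L = L *m N.
Proof.
move=> ns /comm2P[a1 a2 a3] /comm2P[b1 b2 b3]; apply/comm2P; split.
- exact: parallel_trans ns a1 a2 a3 b1 b2 b3.
- apply: (@parallel_trans (M 0 1) (M 0 0 - M 1 1) (M 1 0) _ _ (N 1 0) _ _ (L 1 0));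
    first (by move: ns; rewrite /nonscalar; do 3!case: (_ != 0));
    first [by apply: eq_of_sub a1 _; ring | by apply: eq_of_sub (esym a1) _; ring | by apply: eq_of_sub a2 _; ring | by apply: eq_of_sub (esym a2) _; ring | by apply: eq_of_sub a3 _; ring | by apply: eq_of_sub (esym a3) _; ring | by apply: eq_of_sub b1 _; ring | by apply: eq_of_sub (esym b1) _; ring | by apply: eq_of_sub b2 _; ring | by apply: eq_of_sub (esym b2) _; ring | by apply: eq_of_sub b3 _; ring | by apply: eq_of_sub (esym b3) _; ring].
apply: (@parallel_trans (M 1 0) (M 0 0 - M 1 1) (M 0 1) _ _ (N 0 1) _ _ (L 0 1));
  first (by move: ns; rewrite /nonscalar; do 3!case: (_ != 0));
  first [by apply: eq_of_sub a1 _; ring | by apply: eq_of_sub (esym a1) _; ring | by apply: eq_of_sub a2 _; ring | by apply: eq_of_sub (esym a2) _; ring | by apply: eq_of_sub a3 _; ring | by apply: eq_of_sub (esym a3) _; ring | by apply: eq_of_sub b1 _; ring | by apply: eq_of_sub (esym b1) _; ring | by apply: eq_of_sub b2 _; ring | by apply: eq_of_sub (esym b2) _; ring | by apply: eq_of_sub b3 _; ring | by apply: eq_of_sub (esym b3) _; ring].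
Qed.
End CommutingMatrices.

Section CentralizersSL2.
Variable F : finFieldType.
Local Notation SL := (SL2_group F).
Local Notation q := #|F|.
Implicit Types (x y g : {'GL_2[F]}).

Lemma centSLP x y : reflect (y \in SL /\ GLval x *m GLval y = GLval y *m GLval x) (y \in 'C_SL[x]%g).
Proof.
apply: (iffP setIP) => -[Sy].
  by move/cent1P => c; split=> //; rewrite -!GLvalM c.
by move=> c; split=> //; apply/cent1P; apply: GLval_inj; rewrite !GLvalM.
Qed.

Lemma nonscalar_SL x : x \in SL -> x \notin 'Z(SL)%g -> nonscalar (GLval x).
Proof.
move=> Sx; apply: contraR => /nonscalarPn E; apply/SL2_centerP; split=> //.
exists (GLval x 1 1) => //; by have := SL_det Sx; rewrite {1}E det_scalar.
Qed.

Lemma cent_SL_trans x y : x \in SL -> x \notin 'Z(SL)%g -> y \in 'C_SL[x]%g -> y \notin 'Z(SL)%g ->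
  ('C_SL[y] = 'C_SL[x])%g.
Proof.
move=> Sx nx /centSLP[Sy cxy] ny; have nsx := nonscalar_SL Sx nx; have nsy := nonscalar_SL Sy ny.
apply/setP=> g; apply/centSLP/centSLP => -[Sg cg]; split=> //.
  by apply: (comm2_trans nsy) => //.
by apply: (comm2_trans nsx).
Qed.

Definition sl_u (x : F) := sl (mx4 1 0 x 1).
Definition sl_t (s : F) := sl (mx4 s 0 0 s^-1).

Lemma det_u (x : F) : \det (mx4 1 0 x 1) = 1. Proof. by rewrite det_mx4; ring. Qed.
Lemma det_t (s : F) : s != 0 -> \det (mx4 s 0 0 s^-1) = 1.
Proof. by move=> s0; rewrite det_mx4 mulfV // mul0r subr0. Qed.
Lemma val_u (x : F) : GLval (sl_u x) = mx4 1 0 x 1. Proof. exact: slK (det_u x). Qed.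
Lemma val_t (s : F) : s != 0 -> GLval (sl_t s) = mx4 s 0 0 s^-1. Proof. by move=> s0; exact: slK (det_t s0). Qed.
Lemma mem_u (x : F) : sl_u x \in SL. Proof. exact: mem_sl (det_u x). Qed.
Lemma mem_t (s : F) : s != 0 -> sl_t s \in SL. Proof. by move=> s0; exact: mem_sl (det_t s0). Qed.

Lemma sl_u_inj : injective sl_u.
Proof. by move=> x y /(congr1 (@GLval 2 F)); rewrite !val_u => /mx4_inj[]. Qed.

Lemma sl_uM (x y : F) : sl_u (x + y) = (sl_u x * sl_u y)%g.
Proof.
apply: GLval_inj; rewrite GLvalM !val_u mx4_mul; congr mx4; by ring.
Qed.

Lemma sl_tJ (s x : F) : s != 0 -> (sl_u x ^ sl_t s)%g = sl_u (s ^+ 2 * x).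
Proof.
move=> s0; apply: (mulgI (sl_t s)); rewrite -conjgC; apply: GLval_inj.
by rewrite !GLvalM !val_u !val_t // !mx4_mul; congr mx4; field.
Qed.

Lemma sl_u_noncentral (x : F) : x != 0 -> sl_u x \notin 'Z(SL)%g.
Proof.
move=> x0; apply/negP=> /SL2_centerP[_ [c _]]; rewrite val_u mx4_scalar => /mx4_inj[_ _ E _].
by rewrite E eqxx in x0.
Qed.

Lemma cent_u_inj : {in setX 'Z(SL)%g (setT : {set F}) &, injective (fun p => p.1 * sl_u p.2)%g}.
Proof.
  move=> [z a] [z' a'] /= /setXP[/SL2_centerP[_ [c _ Ez]] _] /setXP[/SL2_centerP[_ [c' _ Ez']] _].
  move=> E; have := congr1 (@GLval 2 F) E; rewrite !GLvalM Ez Ez' !val_u !mx4_scalar !mx4_mul => /mx4_inj[E1 _ _ _].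
  have cc : c = c' by move: E1; rewrite !mulr1 !mul0r !addr0.
  have zz : z = z' by apply: GLval_inj; rewrite Ez Ez' cc.
  by rewrite zz in E *; move/mulgI/sl_u_inj: E => ->.
Qed.

Lemma cent_uE : 'C_SL[sl_u 1%R]%g = [set (p.1 * sl_u p.2)%g | p in setX 'Z(SL)%g (setT : {set F})].
Proof.
apply/setP=> y.
apply/centSLP/imsetP => [[Sy]|[[z a] /setXP[/SL2_centerP[Sz [c c2 Ez]] _] ->]].
  rewrite val_u => /comm2P; rewrite !mxE /= => -[b0 _ ad].
  rewrite mul0r mulr1 in b0; rewrite subrr mulr0 mul1r in ad; move/esym: b0 => b0.
  move/eqP: ad; rewrite subr_eq0 => /eqP ad.
  have := SL_det Sy; rewrite det2 b0 mul0r subr0 ad -expr2 => a2.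
  have a0 : GLval y 1 1 != 0 by apply: contraTneq (oner_neq0 F) => a0; rewrite -a2 a0 expr0n eqxx.
  have dz : \det ((GLval y 1 1)%:M : 'M[F]_2) = 1 by rewrite det_scalar.
  exists (sl (GLval y 1 1)%:M, GLval y 1 0 / GLval y 1 1).
    by apply/setXP; split=> //; apply/SL2_centerP; split; [exact: mem_sl | exists (GLval y 1 1); rewrite ?slK].
  apply: GLval_inj; rewrite GLvalM slK // val_u mx4_scalar mx4_mul [LHS]mx4_eta b0 ad.
  by congr mx4 => /=; field.
split; first exact: groupM Sz (mem_u a).
by rewrite !GLvalM Ez !val_u mx4_scalar !mx4_mul; congr mx4; ring.
Qed.

Lemma card_cent_u : #|'C_SL[sl_u 1%R]%g| = (#|'Z(SL)%g| * q)%N.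
Proof. by rewrite cent_uE (card_in_imset cent_u_inj) cardsX cardsT. Qed.

Lemma card_cent_t (s : F) : s != 0 -> s ^+ 2 != 1 -> #|'C_SL[sl_t s]%g| = (q - 1)%N.
Proof.
move=> s0 s2; have inj : {in [set~ 0 : F] &, injective sl_t}.
  by move=> a b; rewrite !inE => a0 b0 /(congr1 (@GLval 2 F)); rewrite !val_t // => /mx4_inj[].
have -> : (q - 1)%N = #|[set~ 0 : F]| by rewrite cardsC1 subn1.
rewrite -(card_in_imset inj); apply: eq_card => y.
have ns : s - s^-1 != 0.
  by apply: contraNneq s2 => /eqP; rewrite subr_eq0 => /eqP e; rewrite expr2 {2}e mulfV.
apply/centSLP/imsetP => [[Sy]|[a]]; last first.
  rewrite in_setC1 => a0 ->; split; first exact: mem_t.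
  by rewrite !val_t // !mx4_mul; congr mx4; ring.
rewrite val_t // => /comm2P; rewrite !mxE /= => -[_]; rewrite !mul0r => /esym/eqP + /esym/eqP.
rewrite !mulf_eq0 (negbTE ns) !orbF => /eqP b0 /eqP c0.
have := SL_det Sy; rewrite det2 b0 mul0r subr0 => ad.
have a0 : GLval y 0 0 != 0 by apply: contraTneq (oner_neq0 F) => a0; rewrite -ad a0 mul0r eqxx.
exists (GLval y 0 0); first by rewrite !inE.
apply: GLval_inj; rewrite val_t // [LHS]mx4_eta b0 c0; congr mx4.
by apply: (mulfI a0); rewrite ad mulfV.
Qed.

Definition tr2 (M : 'M[F]_2) : F := M 0 0 + M 1 1.

Lemma SL_inv x : x \in SL -> GLval x^-1%g = (tr2 (GLval x))%:M - GLval x.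
Proof.
move=> Sx; have dx := SL_det Sx; rewrite det2 in dx.
have ux : GLval x \in unitmx by rewrite unitmxE (SL_det Sx) unitr1.
have -> : GLval x^-1%g = invmx (GLval x) by [].
have -> : (tr2 (GLval x))%:M - GLval x = mx4 (GLval x 1 1) (- GLval x 0 1) (- GLval x 1 0) (GLval x 0 0).
  rewrite {2}[GLval x]mx4_eta mx4_scalar; apply/matrixP=> i l; rewrite !mxE /tr2.
  by case: (i == 0); case: (l == 0); ring.
apply: (can_inj (mulKmx ux)); rewrite mulmxV // {1}[GLval x]mx4_eta mx4_mul mx4_scalar.
by congr mx4; rewrite -?dx; ring.
Qed.

(* Cayley-Hamilton: two elements of equal trace satisfy (y - x)(y - x^-1) = y^2 - (tr y) y + 1 = 0. *)
Lemma same_trace_split x y : x \in SL -> y \in SL -> tr2 (GLval y) = tr2 (GLval x) ->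
  GLval x *m GLval y = GLval y *m GLval x ->
  (GLval y - GLval x) *m (GLval y - GLval x^-1%g) = 0.
Proof.
move=> Sx Sy e c; rewrite (SL_inv Sx) -e.
have ch M : \det M = 1 -> M *m M - tr2 M *: M + 1%:M = 0.
  rewrite det2 => dM; rewrite -dM {1 2 4}[M]mx4_eta mx4_mul mx4_scalar /tr2; apply/matrixP=> i l; rewrite !mxE.
  by case: (i == 0); case: (l == 0); ring.
have := ch _ (SL_det Sx); have := ch _ (SL_det Sy); rewrite -e.
set Y := GLval y; set X := GLval x; set t := tr2 Y => hy hx.
have -> : (Y - X) *m (Y - (t%:M - X)) = (Y *m Y - t *: Y + 1%:M) - (X *m X - t *: X + 1%:M).
  rewrite opprB addrA !mulmxDr !mulmxDl !mulmxN !mulNmx !mul_mx_scalar -[Y *m X]c -/X -/Y.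
  move: (Y *m Y) (X *m Y) (X *m X) (t *: Y) (t *: X) (1%:M : 'M[F]_2) => a b c' u v w.
  by apply/matrixP=> i l; rewrite !mxE; ring.
by rewrite hy hx subrr.
Qed.

Lemma trace_conj x g : tr2 (GLval (x ^ g)%g) = tr2 (GLval x).
Proof.
have trE (M : 'M[F]_2) : tr2 M = \tr M.
  by rewrite /mxtrace !big_ord_recl big_ord0 addr0 /tr2; congr (_ + M _ _); exact: val_inj.
by rewrite !trE conjgE GLvalM mxtrace_mulC -GLvalM mulgK.
Qed.

Variable al : F.
Hypothesis al_irr : forall s, s != 0 -> al != s + s^-1.
Definition sl_n := sl (mx4 0 1 (-1) al).

Let det_n : \det (mx4 0 1 (-1) al : 'M[F]_2) = 1. Proof. by rewrite det_mx4; ring. Qed.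
Let val_n : GLval sl_n = mx4 0 1 (-1) al. Proof. exact: slK. Qed.

Lemma mem_n : sl_n \in SL. Proof. exact: mem_sl. Qed.
Lemma tr_n : tr2 (GLval sl_n) = al. Proof. by rewrite val_n /tr2 !mxE /= add0r. Qed.

(** The algebra F[n], a quadratic extension field: a zero of its norm a^2 + ab al + b^2 would give
    al = s + 1/s with s = -a/b. *)
Let lin (a b : F) : 'M[F]_2 := a%:M + b *: GLval sl_n.

Let linE a b : lin a b = mx4 a b (- b) (a + b * al).
Proof.
rewrite /lin val_n mx4_scalar; apply/matrixP=> i l; rewrite !mxE.
by case: (i == 0); case: (l == 0); ring.
Qed.

Let det_lin a b : \det (lin a b) = a ^+ 2 + a * b * al + b ^+ 2.
Proof. by rewrite linE det_mx4; ring. Qed.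

Let lin_unit a b : (a != 0) || (b != 0) -> \det (lin a b) != 0.
Proof.
rewrite det_lin; have [->|b0] := eqVneq b 0.
  by rewrite orbF => a0; rewrite mulr0 mul0r !addr0 expr0n addr0 expf_neq0.
move=> _; have [->|a0] := eqVneq a 0; first by rewrite mul0r mul0r expr0n !add0r expf_neq0.
have sn : - (a / b) != 0 by rewrite oppr_eq0 mulf_neq0 ?invr_eq0.
apply: contra (al_irr sn) => /eqP E; apply/eqP.
have : (a * b) * (al - (- (a / b) + (- (a / b))^-1)) = 0 by rewrite -[RHS]E invrN invf_div; field; rewrite ?a0 ?b0.
by move/eqP; rewrite mulf_eq0 (negbTE (mulf_neq0 a0 b0)) subr_eq0 => /eqP.
Qed.

Let comm_lin (M : 'M[F]_2) : GLval sl_n *m M = M *m GLval sl_n -> exists a b, M = lin a b.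
Proof.
move/comm2P; rewrite val_n !mxE /= => -[E1 E2 _]; exists (M 0 0), (M 0 1).
rewrite linE {1}[M]mx4_eta; congr mx4.
  by apply: eq_of_sub E1 _; ring.
by apply: eq_of_sub (esym E2) _; ring.
Qed.

Lemma n_noncentral : sl_n \notin 'Z(SL)%g.
Proof.
apply/negP=> /SL2_centerP[_ [c _]]; rewrite val_n mx4_scalar => /mx4_inj[_ /eqP].
by rewrite oner_eq0.
Qed.

Lemma same_trace_n x y : x \in 'C_SL[sl_n]%g -> y \in 'C_SL[sl_n]%g ->
  tr2 (GLval y) = tr2 (GLval x) -> y = x \/ y = (x^-1)%g.
Proof.
case/centSLP=> Sx cx /centSLP[Sy cy] ty.
have nsn := nonscalar_SL mem_n n_noncentral; have cxy := comm2_trans nsn cx cy.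
have := same_trace_split Sx Sy ty cxy.
have [|nz E] := eqVneq (GLval y - GLval x) 0.
  by move=> /eqP; rewrite subr_eq0 => /eqP /GLval_inj; left.
right; apply: GLval_inj; apply/eqP; rewrite -subr_eq0; apply/eqP.
have [a [b Eab]] : exists a b, GLval y - GLval x = lin a b.
  by apply: comm_lin; rewrite mulmxBr mulmxBl cy cx.
have ab : (a != 0) || (b != 0).
  apply: contraNT nz; rewrite negb_or !negbK => /andP[/eqP a0 /eqP b0].
  by rewrite Eab linE a0 b0 mul0r addr0 oppr0 -mx4_scalar raddf0.
have u : lin a b \in unitmx by rewrite unitmxE unitfE lin_unit.
by rewrite -(mulKmx u (GLval y - GLval x^-1%g)) -Eab E mulmx0.
Qed.

(** The norm maps the q^2 - 1 nonzero elements of F[n] to q - 1 values, and each fibre is a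
    translate of a subset of the centralizer. *)
Lemma card_cent_n : (q + 1 <= #|'C_SL[sl_n]%g|)%N.
Proof.
pose D : {set F * F} := [set~ (0, 0)]; pose dt (p : F * F) := \det (lin p.1 p.2).
have Dnz (p : F * F) : p \in D -> dt p != 0.
  by case: p => a b; rewrite in_setC1 xpair_eqE negb_and => /lin_unit.
have fib c : (#|[set p in D | dt p == c]| <= #|'C_SL[sl_n]%g|)%N.
  have [->|[p0]] := set_0Vmem [set p in D | dt p == c]; first by rewrite cards0.
  rewrite in_set => /andP[Dp0 /eqP dp0]; have u0 : lin p0.1 p0.2 \in unitmx by rewrite unitmxE unitfE Dnz.
  pose f (p : F * F) := sl (invmx (lin p0.1 p0.2) *m lin p.1 p.2).
  have df p : dt p = c -> \det (invmx (lin p0.1 p0.2) *m lin p.1 p.2) = 1.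
    by move=> dp; rewrite det_mulmx det_inv -/(dt p0) -/(dt p) dp0 dp mulVf // -dp0 Dnz.
  have inj : {in [set p in D | dt p == c] &, injective f}.
    move=> p p'; rewrite !in_set => /andP[_ /eqP dp] /andP[_ /eqP dp'] /(congr1 (@GLval 2 F)).
    rewrite !slK ?df // => /(can_inj (mulKVmx u0)).
    by rewrite !linE => /mx4_inj[]; case: (p) (p') => [? ?] [? ?] /= -> ->.
  rewrite -(card_in_imset inj); apply: subset_leq_card; apply/subsetP=> z /imsetP[p].
  rewrite in_set => /andP[_ /eqP dp] ->; have d1 := df p dp; apply/centSLP; split; first exact: mem_sl.
  rewrite /f (slK d1); have cl a b : GLval sl_n *m lin a b = lin a b *m GLval sl_n.
    by rewrite /lin mulmxDr mulmxDl mul_scalar_mx mul_mx_scalar -scalemxAr -scalemxAl.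
  rewrite -mulmxA -cl !mulmxA; congr (_ *m _).
  by apply: (can_inj (mulKmx u0)); rewrite !mulmxA mulmxV // mul1mx -cl -mulmxA mulmxV // mulmx1.
have : (#|D| <= #|[set~ 0%R : F]| * #|'C_SL[sl_n]%g|)%N.
  rewrite -sum1_card (partition_big dt (mem [set~ 0%R : F])) /=; last first.
    by move=> p /Dnz; rewrite in_setC1.
  rewrite -sum_nat_const; apply: leq_sum => c _; rewrite sum1dep_card.
  by apply: leq_trans (fib c); apply: subset_leq_card; apply/subsetP=> p; rewrite !in_set.
rewrite !cardsC1 card_prod -!subn1; have := card_finRing_gt1 F.
move: #|F| #|'C_SL[sl_n]%g|; clear => m c m1 le.
rewrite -(leq_pmul2l (_ : 0 < m - 1)%N) ?subn_gt0 //; apply: leq_trans le.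
by rewrite -[m](subnK (ltnW m1)); set w := (m - 1)%N; rewrite !addnK; nia.
Qed.
End CentralizersSL2.

(** * Summation over the group by classes of centralizers *)

Section ClassSums.
Variables (gT : finGroupType) (G : {group gT}).

Lemma sum_class_support (A : {set gT}) (f : gT -> algC) : A != set0 -> trivIset (A :^: G) ->
  (forall x g, g \in G -> f (x ^ g)%g = f x) ->
  \sum_(x in class_support A G) f x = #|A :^: G|%:R * \sum_(x in A) f x.
Proof.
move=> nzA tiA fJ; rewrite (set_partition_big _ (partition_class_support nzA tiA)) /=.
rewrite (eq_bigr (fun=> \sum_(x in A) f x)) => [|B /imsetP[g Gg ->]]; last first.
  rewrite (reindex_inj (conjg_inj g)) /=; apply: eq_big => [x|x _]; first by rewrite memJ_conjg.
  exact: fJ.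
by rewrite sumr_const mulr_natl.
Qed.

Hypothesis trans : forall x y, x \in G -> x \notin 'Z(G)%g -> y \in 'C_G[x]%g -> y \notin 'Z(G)%g ->
  ('C_G[y] = 'C_G[x])%g.

(** By [trans], for noncentral x these sets are equal or disjoint, so their conjugates can be
    counted as a partition. *)
Definition ncent x := ('C_G[x] :\: 'Z(G))%g.

Lemma ncentJ x g : g \in G -> (ncent x :^ g)%g = ncent (x ^ g)%g.
Proof.
move=> Gg; rewrite /ncent conjDg conjIg (conjGid Gg).
have -> : ('C[x] :^ g = 'C[x ^ g])%g by rewrite -!cent_set1 -centJ conjg_set1.
by rewrite (normP (subsetP (normal_norm (center_normal G)) g Gg)).
Qed.

Lemma ncent_eq x y z : x \in G -> x \notin 'Z(G)%g -> y \in G -> y \notin 'Z(G)%g ->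
  z \in ncent x -> z \in ncent y -> ncent x = ncent y.
Proof.
move=> Gx nx Gy ny /setDP[zx nz] /setDP[zy _].
by rewrite /ncent -(trans Gx nx zx nz) -(trans Gy ny zy nz).
Qed.

Lemma noncentralJ x g : g \in G -> x \notin 'Z(G)%g -> (x ^ g)%g \notin 'Z(G)%g.
Proof. by move=> Gg; rewrite memJ_norm // (subsetP (normal_norm (center_normal G))). Qed.

Lemma ncent_TI x : x \in G -> x \notin 'Z(G)%g -> trivIset (ncent x :^: G).
Proof.
move=> Gx nx; apply/trivIsetP=> _ _ /imsetP[g Gg ->] /imsetP[k Gk ->] ne.
rewrite -setI_eq0; apply: contraR ne => /set0Pn[z /setIP[]].
by rewrite !ncentJ // => z1 z2; apply/eqP; exact: ncent_eq (groupJ Gx Gg) (noncentralJ Gg nx) (groupJ Gx Gk) (noncentralJ Gk nx) z1 z2.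
Qed.

Lemma ncent_neq0 x : x \in G -> x \notin 'Z(G)%g -> ncent x != set0.
Proof. by move=> Gx nx; apply/set0Pn; exists x; rewrite in_setD nx in_setI Gx cent1id. Qed.

Lemma ncent_disjoint x y : x \in G -> x \notin 'Z(G)%g -> y \in G -> y \notin 'Z(G)%g ->
  (forall g, g \in G -> (x ^ g)%g \notin 'C_G[y]%g) ->
  class_support (ncent x) G :&: class_support (ncent y) G = set0.
Proof.
move=> Gx nx Gy ny H; apply/eqP; apply: contraT => /set0Pn[z /setIP[]].
rewrite !class_supportEr => /bigcupP[g Gg zg] /bigcupP[k Gk zk].
rewrite ncentJ // in zg; rewrite ncentJ // in zk.
have E := ncent_eq (groupJ Gx Gg) (noncentralJ Gg nx) (groupJ Gy Gk) (noncentralJ Gk ny) zg zk.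
have Gkg : (g * k^-1)%g \in G by rewrite groupM ?groupV.
have : (x ^ g)%g \in ncent (x ^ g)%g by rewrite in_setD noncentralJ // in_setI groupJ // cent1id.
rewrite E -ncentJ // mem_conjg -conjgM => /setDP[C _].
by have := H _ Gkg; rewrite C.
Qed.

Lemma card_ncent x : x \in G -> #|ncent x| = (#|'C_G[x]%g| - #|'Z(G)%g|)%N.
Proof.
move=> Gx; have sZ : 'Z(G)%g \subset 'C_G[x]%g.
  apply/subsetP=> z /setIP[Gz /centP cz]; rewrite in_setI Gz /=; apply/cent1P.
  by rewrite /commute cz.
by rewrite cardsD (setIidPr sZ).
Qed.

Lemma conj_bound x b : x \in G -> (#|'N_G(ncent x)%g| <= b)%N -> (#|G| <= #|ncent x :^: G| * b)%N.
Proof.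
by move=> Gx le; rewrite card_conjugates -(Lagrange (subsetIl G 'N(ncent x))) mulnC leq_mul2l le orbT.
Qed.

Variables (q dl : nat) (x1 x2 x3 : gT).
Hypotheses (q3 : (3 < q)%N) (dl2 : (0 < dl <= 2)%N).
Hypotheses (cG : #|G| = (q * (q ^ 2 - 1))%N) (cZ : #|'Z(G)%g| = dl).
Hypotheses (G1 : x1 \in G) (n1 : x1 \notin 'Z(G)%g) (G2 : x2 \in G) (n2 : x2 \notin 'Z(G)%g)
  (G3 : x3 \in G) (n3 : x3 \notin 'Z(G)%g).
Hypotheses (c1 : #|'C_G[x1]%g| = (dl * q)%N) (c2 : #|'C_G[x2]%g| = (q - 1)%N)
  (c3 : (q + 1 <= #|'C_G[x3]%g|)%N).
Hypotheses (D12 : forall g, g \in G -> (x2 ^ g)%g \notin 'C_G[x1]%g)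
  (D13 : forall g, g \in G -> (x3 ^ g)%g \notin 'C_G[x1]%g)
  (D23 : forall g, g \in G -> (x3 ^ g)%g \notin 'C_G[x2]%g).
Hypotheses (N1 : (#|'N_G(ncent x1)%g| <= q * (q - 1))%N) (N2 : (#|'N_G(ncent x2)%g| <= 2 * (q - 1))%N)
  (N3 : (#|'N_G(ncent x3)%g| <= 2 * #|'C_G[x3]%g|)%N).

Local Notation S1 := (class_support (ncent x1) G).
Local Notation S2 := (class_support (ncent x2) G).
Local Notation S3 := (class_support (ncent x3) G).
Local Notation m1 := #|ncent x1 :^: G|.
Local Notation m2 := #|ncent x2 :^: G|.
Local Notation m3 := #|ncent x3 :^: G|.

Lemma card_class_support_ncent x : x \in G -> x \notin 'Z(G)%g ->
  #|class_support (ncent x) G| = (#|ncent x :^: G| * (#|'C_G[x]%g| - #|'Z(G)%g|))%N.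
Proof.
move=> Gx nx; apply/eqP; rewrite -(eqr_nat algC) -card_ncent // natrM -!sum1_card !natr_sum.
rewrite (sum_class_support (f := fun=> 1)) ?ncent_neq0 ?ncent_TI //.
by rewrite -natr_sum sum1_card.
Qed.

Let I12 : S1 :&: S2 = set0. Proof. by rewrite setIC; apply: ncent_disjoint. Qed.
Let I13 : S1 :&: S3 = set0. Proof. by rewrite setIC; apply: ncent_disjoint. Qed.
Let I23 : S2 :&: S3 = set0. Proof. by rewrite setIC; apply: ncent_disjoint. Qed.

Let sub x : x \in G -> x \notin 'Z(G)%g -> class_support (ncent x) G \subset G :\: 'Z(G)%g.
Proof.
move=> Gx nx; apply/subsetP=> z; rewrite class_supportEr => /bigcupP[g Gg].
by rewrite ncentJ // => /setDP[/setIP[Gz _] nz]; rewrite in_setD nz.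
Qed.

Let U123 : #|S1 :|: S2 :|: S3| = (#|S1| + #|S2| + #|S3|)%N.
Proof. by rewrite cardsU cardsU I12 cards0 subn0 setIUl I13 I23 setU0 cards0 subn0. Qed.

Let cardGZ : #|G :\: 'Z(G)%g| = (q * (q ^ 2 - 1) - dl)%N.
Proof. by rewrite cardsD (setIidPr (center_sub G)) cG cZ. Qed.

Let total : (m1 * (dl * q - dl) + m2 * (q - 1 - dl) + m3 * (#|'C_G[x3]%g| - dl) <= q * (q ^ 2 - 1) - dl)%N.
Proof.
rewrite -cardGZ; apply: leq_trans (subset_leq_card (_ : S1 :|: S2 :|: S3 \subset _)); last first.
  by rewrite !subUset !sub.
by rewrite U123 !card_class_support_ncent // c1 c2 cZ.
Qed.

(* The lower bounds for the numbers of conjugates already add up to |G \ Z|, hence they are all attained. *)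
Lemma counting_arith (a b c A : nat) : (q * (q ^ 2 - 1) <= a * (q * (q - 1)))%N ->
  (q * (q ^ 2 - 1) <= b * (2 * (q - 1)))%N -> (q * (q ^ 2 - 1) <= c * (2 * A))%N -> (q + 1 <= A)%N ->
  (a * (dl * q - dl) + b * (q - 1 - dl) + c * (A - dl) <= q * (q ^ 2 - 1) - dl)%N ->
  [/\ a = (q + 1)%N, (2 * b = q * (q + 1))%N, (2 * c = q * (q - 1))%N & A = (q + 1)%N].
Proof.
clear -q3 dl2; have [w qE] : exists w, q = w.+4 by exists (q - 4)%N; move: q3; clear; lia.
have -> : (q ^ 2 - 1 = (w + 3) * (w + 5))%N by rewrite qE expnS expn1; clear; nia.
move=> ha hb hc hA tot.
have a1 : (w + 5 <= a)%N.
  have := ha; rewrite (_ : q * ((w + 3) * (w + 5)) = (w + 5) * (q * (q - 1)))%N; last by rewrite qE; clear; lia.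
  by rewrite leq_pmul2r // qE; clear; lia.
have b1 : ((w + 4) * (w + 5) <= 2 * b)%N.
  have := hb; rewrite (_ : q * ((w + 3) * (w + 5)) = (w + 4) * (w + 5) * (w + 3))%N; last by rewrite qE; clear; lia.
  rewrite (_ : b * (2 * (q - 1)) = 2 * b * (w + 3))%N; last by rewrite qE; clear; lia.
  by rewrite leq_pmul2r // addn3.
have [v AE] : exists v, A = (w + 5 + v)%N by exists (A - (w + 5))%N; move: hA; rewrite qE; clear; lia.
have [y aE] : exists y, a = (w + 5 + y)%N by exists (a - (w + 5))%N; rewrite subnKC.
have [p pE] : exists p, (2 * b = (w + 4) * (w + 5) + p)%N by exists (2 * b - (w + 4) * (w + 5))%N; rewrite subnKC.
set Q := ((w + 4) * (w + 3))%N; have Q0 : (0 < Q)%N by rewrite /Q addn4 addn3.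
have cA : (Q * (w + 5) <= 2 * c * (w + 5 + v))%N by move: hc; rewrite /Q AE qE; clear; lia.
have [g [gd dE]] : exists g, (0 < g)%N /\ (w + 5 = dl + g)%N.
  by exists (w + 5 - dl)%N; move: dl2; clear; lia.
have [k [kd kE]] : exists k, (0 < k)%N /\ (w + 3 = dl + k)%N.
  by exists (w + 3 - dl)%N; move: dl2; clear; lia.
have H : (2 * y * (dl * (w + 3)) + p * k + 2 * c * (g + v) <= Q * g)%N.
  have e1 : (dl * q - dl = dl * (w + 3))%N by rewrite qE -[X in (_ - X)%N]muln1 -mulnBr; congr (_ * _)%N; clear; lia.
  have e2 : (q - 1 - dl = k)%N by rewrite qE; move: kE; clear; lia.
  have e3 : (A - dl = g + v)%N by rewrite AE dE; clear; lia.
  have t2 : (2 * (a * (dl * (w + 3)) + b * k + c * (g + v)) + 2 * dl <= 2 * (q * ((w + 3) * (w + 5))))%N.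
    move: tot; rewrite e1 e2 e3; have : (dl <= q * ((w + 3) * (w + 5)))%N.
      apply: (@leq_trans 2); first by case/andP: dl2.
      by apply: (@leq_trans (4 * (3 * 5))%N) => //; rewrite qE; do 2!(apply: leq_mul; rewrite ?leq_addl //).
    by move: (_ + _ + _)%N (q * _)%N; clear; lia.
  have t3 : (2 * ((w + 5 + y) * (dl * (w + 3))) + ((w + 4) * (w + 5) + p) * k + 2 * c * (g + v) + 2 * dl <= 2 * ((w + 4) * ((w + 3) * (w + 5))))%N.
    by move: t2; rewrite -pE aE qE; clear; lia.
  have gk : g = k.+2 by move: dE kE; clear; lia.
  have w5 : w = (dl + k - 3)%N by move: kE; clear; lia.
  have E : (2 * ((w + 5) * (dl * (w + 3))) + (w + 4) * (w + 5) * k + 2 * dl + Q * g = 2 * ((w + 4) * ((w + 3) * (w + 5))))%N.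
    rewrite gk /Q; case/andP: dl2 kE; case: (dl) => [|[|[|]]] // _ _ kE.
      by have -> : k = (w + 2)%N; [move: kE; clear; lia | clear; lia].
    by have -> : k = (w + 1)%N; [move: kE; clear; lia | clear; lia].
  by move: t3; rewrite -E; clear; lia.
have QP : (Q <= 2 * c)%N.
  rewrite leqNgt; apply/negP=> lt.
  have h1 : (2 * c * (g + v) <= Q * g)%N by apply: leq_trans H; rewrite leq_addl.
  have h2 : (Q * g + Q * dl <= 2 * c * (g + v) + 2 * c * dl)%N by move: cA; rewrite dE; clear; lia.
  have h3 : (2 * c * dl < Q * dl)%N by rewrite ltn_pmul2r //; case/andP: dl2.
  by move: h1 h2 h3; clear; lia.
have [u uE] : exists u, (2 * c = Q + u)%N by exists (2 * c - Q)%N; rewrite subnKC.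
have H2 : (2 * y * (dl * (w + 3)) + p * k + Q * v + u * g + u * v <= 0)%N by move: H; rewrite uE; clear; lia.
have d0 : (0 < dl)%N by case/andP: dl2.
move: H2; rewrite leqn0 !addn_eq0 !muln_eq0 => /andP[/andP[/andP[/andP[hy hp] hv] hu] _].
have y0 : y = 0%N by move: hy d0; clear; case: y => // y; case: (dl) => // ?; rewrite addn3.
have p0 : p = 0%N by move: hp kd; clear; case: p => // p; case: k.
have v0 : v = 0%N by move: hv; rewrite ?(gtn_eqF Q0) /Q ?muln_eq0 ?addn4 ?addn3 /= => /eqP.
have u0 : u = 0%N by move: hu gd; clear; case: u => // u; case: g.
rewrite aE y0 pE p0 uE u0 AE v0 /Q qE !addn0; clear; split; lia.
Qed.

Lemma conj_counts : [/\ m1 = (q + 1)%N, (2 * m2 = q * (q + 1))%N, (2 * m3 = q * (q - 1))%N & #|'C_G[x3]%g| = (q + 1)%N].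
Proof. by apply: counting_arith c3 total; rewrite -cG; exact: conj_bound. Qed.

Lemma cover_arith (b c : nat) : (2 * b = q * (q + 1))%N -> (2 * c = q * (q - 1))%N ->
  (q * (q ^ 2 - 1) - dl <= (q + 1) * (dl * q - dl) + b * (q - 1 - dl) + c * (q + 1 - dl))%N.
Proof.
clear -q3 dl2; have [w qE] : exists w, q = w.+4 by exists (q - 4)%N; move: q3; clear; lia.
have -> : (q ^ 2 - 1 = (w + 3) * (w + 5))%N by rewrite qE expnS expn1; clear; nia.
have key k x y : (2 * x = y)%N -> (2 * (x * k) = y * k)%N by rewrite mulnA => ->.
move ex : (dl * q - dl)%N => x; move ey : (q - 1 - dl)%N => y; move ez : (q + 1 - dl)%N => z hb hc.
have := key y _ _ hb; have := key z _ _ hc; move: (b * y)%N (c * z)%N => B C.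
case/andP: dl2 ex ey ez => _; case: (dl) => [|[|[|]]] // _; rewrite qE => ex ey ez.
- have -> : x = 0%N by move: ex; clear; lia.
  have -> : y = (w + 3)%N by move: ey; clear; lia.
  have -> : z = (w + 5)%N by move: ez; clear; lia.
  by clear; lia.
- have -> : x = (w + 3)%N by move: ex; clear; lia.
  have -> : y = (w + 2)%N by move: ey; clear; lia.
  have -> : z = (w + 4)%N by move: ez; clear; lia.
  by clear; lia.
have -> : x = (2 * w + 6)%N by move: ex; clear; lia.
have -> : y = (w + 1)%N by move: ey; clear; lia.
have -> : z = (w + 3)%N by move: ez; clear; lia.
by clear; lia.
Qed.

Lemma noncentral_cover : S1 :|: S2 :|: S3 = G :\: 'Z(G)%g.
Proof.
have [e1 e2 e3 e4] := conj_counts.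
apply/eqP; rewrite eqEcard !subUset !sub //= U123 !card_class_support_ncent // c1 c2 e4 cZ cardGZ e1.
exact: cover_arith.
Qed.

Lemma sum_setU (A B : {set gT}) (f : gT -> algC) : A :&: B = set0 ->
  \sum_(x in A :|: B) f x = \sum_(x in A) f x + \sum_(x in B) f x.
Proof.
move=> AB; rewrite [LHS]big_mkcond [X in _ = X + _]big_mkcond [X in _ = _ + X]big_mkcond -big_split /=.
apply: eq_bigr => x _; have := congr1 (fun C : {set gT} => x \in C) AB; rewrite in_setU in_setI in_set0.
by case: (x \in A); case: (x \in B) => //; rewrite ?addr0 ?add0r.
Qed.

(** The coefficients are twice the numbers q + 1, q(q + 1)/2 and q(q - 1)/2 of conjugates of the
    three centralizers; the factor 2 avoids halves. *)
Lemma sum_by_centralizers (f : gT -> algC) : (forall x g, g \in G -> f (x ^ g)%g = f x) ->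
  2%:R * \sum_(x in G) f x = 2%:R * \sum_(x in 'Z(G)%g) f x + (2 * (q + 1))%:R * \sum_(x in ncent x1) f x
    + (q * (q + 1))%:R * \sum_(x in ncent x2) f x + (q * (q - 1))%:R * \sum_(x in ncent x3) f x.
Proof.
move=> fJ; have [e1 e2 e3 e4] := conj_counts.
have ZU : 'Z(G)%g :&: (S1 :|: S2 :|: S3) = set0.
  by rewrite noncentral_cover; apply/setP=> z; rewrite in_setI in_setD in_set0; case: (z \in 'Z(G)%g).
have GE : G :=: 'Z(G)%g :|: (S1 :|: S2 :|: S3).
  rewrite noncentral_cover; apply/setP=> z; rewrite in_setU in_setD; case: (boolP (z \in 'Z(G)%g)) => //.
  by move/(subsetP (center_sub G)).
rewrite {1}GE !sum_setU //; last by rewrite setIUl I13 I23 setU0.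
rewrite !sum_class_support ?ncent_neq0 ?ncent_TI // !mulrDr !mulrA -!natrM e1 e2 e3.
by rewrite !addrA.
Qed.

(** The q(q - 1)/2 conjugates give a normalizer twice the size of the centralizer; such an n will
    invert the nonsplit torus. *)
Lemma normalizer3_larger : exists2 n, n \in 'N_G(ncent x3)%g & n \notin 'C_G[x3]%g.
Proof.
have [e1 e2 e3 e4] := conj_counts.
have E : (m3 * #|'N_G(ncent x3)%g| = #|G|)%N by rewrite card_conjugates mulnC Lagrange // subsetIl.
have [sNC|/subsetPn[n Nn nn]] := boolP ('N_G(ncent x3)%g \subset 'C_G[x3]%g); last by exists n.
have := subset_leq_card sNC; rewrite e4 => le.
have [w qE] : exists w, q = w.+4 by exists (q - 4)%N; move: q3; clear; lia.
have : (2 * #|G| <= q * (q - 1) * (q + 1))%N by rewrite -E mulnA e3 leq_mul2l le orbT.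
by rewrite cG qE expnS expn1; clear; nia.
Qed.
End ClassSums.

(** * Small virtual characters on the tori and the possible degrees *)

Section AbelianVirtualCharacters.
Variables (gT : finGroupType) (A : {group gT}).
Hypothesis abA : abelian A.

(** All irreducible characters being linear, n is the sum of the multiplicities and N the sum of
    their squares; size and parity compare term by term. *)
Lemma vchar_abelian_norm (phi : 'CF(A)) : phi \in 'Z[irr A] -> exists (n : int) (N : nat),
  [/\ phi 1%g = n%:~R, '[phi] = N%:R, (`|n| <= N)%N, odd N = odd `|n|%N &
    (N = 0%N -> phi = 0) /\ (N = 1%N -> exists i : Iirr A, phi = n%:~R *: 'chi_i)].
Proof.
move=> Zphi; have cI i : '[phi, 'chi_i] \in Num.int by apply: Cint_cfdot_vchar_irr.
pose c i : int := Num.floor '[phi, 'chi_i].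
have cE i : '[phi, 'chi_i] = (c i)%:~R by rewrite floorK.
have phiE : phi = \sum_i (c i)%:~R *: 'chi_i.
  by rewrite {1}(cfun_sum_cfdot phi); apply: eq_bigr => i _; rewrite cE.
exists (\sum_i c i), (\sum_i `|c i| ^ 2)%N; split.
- rewrite phiE sum_cfunE rmorph_sum /=; apply: eq_bigr => i _.
  by rewrite cfunE lin_char1 ?mulr1 //; exact: char_abelianP.
- rewrite {1}phiE cfdot_suml natr_sum; apply: eq_bigr => i _.
  transitivity ((c i * c i)%:~R : algC); first by rewrite cfdotZl cfdotC cE rmorph_int rmorphM.
  have -> : c i * c i = ((`|c i| ^ 2)%N)%:Z by rewrite -mulnn PoszM !abszE -normrM -expr2 ger0_norm ?sqr_ge0.
  by [].
- elim/big_ind2: _ => [//|n1 N1 n2 N2 h1 h2|i _].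
    by apply: leq_trans (leq_add h1 h2); clear; lia.
  by rewrite expnS expn1; case: `|c i|%N => // u; rewrite leq_pmull.
- elim/big_ind2: _ => [//|N1 n1 N2 n2 h1 h2|i _]; last by rewrite oddX.
  by rewrite oddD h1 h2; clear; lia.
split=> [N0|N1].
  rewrite phiE big1 // => i _; have : (`|c i| ^ 2 <= \sum_j `|c j| ^ 2)%N by rewrite [leqRHS](bigD1 i) //= leq_addr.
  by rewrite N0 leqn0 expn_eq0 andbT absz_eq0 => /eqP ->; rewrite scale0r.
have [i ci] : exists i, c i != 0.
  apply/existsP; apply: contraT; rewrite negb_exists => /forallP H; move: N1; rewrite big1 // => i _.
  by have := H i; rewrite negbK => /eqP ->.
have c0 j : j != i -> c j = 0.
  move=> ji; move: N1; rewrite (bigD1 i) //= (bigD1 j) //=.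
  by have := ci; rewrite -absz_gt0 => a0 N1; apply/eqP; rewrite -absz_eq0; move: N1; rewrite -!mulnn; clear -a0; nia.
exists i; rewrite phiE (bigD1 i) //= big1 => [|j ji]; last by rewrite c0 // scale0r.
by rewrite (bigD1 i) //= big1 ?addr0 // => j; exact: c0.
Qed.

(* A real linear character has values +1 or -1, and a^n lies in Z. *)
Lemma real_lin_odd_eq1 (Z : {group gT}) (i : Iirr A) (n : nat) : Z <| A -> #|(A / Z)%g| = n -> odd n ->
  (forall z, z \in Z -> 'chi_i z = 1) -> (forall a, a \in A -> 'chi_i (a^-1)%g = 'chi_i a) -> 'chi_i = 1.
Proof.
move=> nZ cn on trivZ rl; have lin : 'chi_i \is a linear_char by apply: char_abelianP.
apply/cfun_inP=> a Aa; rewrite cfun1E Aa.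
have sq : 'chi_i a ^+ 2 = 1.
  have nz := lin_char_neq0 lin Aa; have := lin_charV lin Aa; rewrite rl // => E.
  by rewrite expr2 {2}E mulfV.
have Zan : (a ^+ n)%g \in Z.
  have Na := subsetP (normal_norm nZ) a Aa.
  apply: coset_idr; first exact: groupX.
  by rewrite morphX // -cn expg_cardG // mem_quotient.
have := trivZ _ Zan; rewrite lin_charX // -(odd_double_half n) on -mul2n exprD exprM sq expr1n mulr1 expr1.
by [].
Qed.
End AbelianVirtualCharacters.

Section ModifiedRestriction.
Variables (gT : finGroupType) (G A : {group gT}).
Hypotheses (sAG : A \subset G) (sZA : 'Z(G)%g \subset A) (abA : abelian A).
Local Notation Z := 'Z(G)%G.

Lemma Ind_center x : x \in A -> 'Ind[A, Z] 1 x = (x \in Z)%:R * #|A : Z|%:R.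
Proof.
move=> Ax; rewrite cfIndE // (eq_bigr (fun=> (x \in Z)%:R)) => [|y Ay]; last first.
  by rewrite conjgE -(centsP abA _ Ay _ Ax) || rewrite conjgE (centsP abA _ Ax _ Ay); rewrite mulKg cfun1E.
rewrite sumr_const -[_ *+ #|A|]mulr_natr -(Lagrange sZA) natrM.
by field; rewrite pnatr_eq0 -lt0n cardG_gt0.
Qed.

Variable i : Iirr G.
Hypothesis kerZ : 'Z(G)%g \subset cfker 'chi_i.
Variable s : int.

(** The induced character vanishes off Z, so the restriction changes only on Z, where it takes the
    constant value w; a suitable s makes the norm small. *)
Definition vres := 'Res[A] 'chi_i - s%:~R *: 'Ind[A, Z] 1.
Let w : algC := (degn i)%:R - s%:~R * #|A : Z|%:R.

Lemma vres_vchar : vres \in 'Z[irr A].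
Proof.
apply: rpredB; first exact: char_vchar (cfRes_char _ (irr_char i)).
apply: scale_zchar; first exact: intr_int.
by apply: char_vchar; apply: cfInd_char; exact: rpred1.
Qed.

Lemma vresE x : x \in A -> vres x = if x \in Z then w else 'chi_i x.
Proof.
move=> Ax; rewrite !cfunE cfResE // Ind_center //; case: ifP => [Zx|_]; last by rewrite mul0r mulr0 subr0.
by rewrite mul1r (cfker1 (subsetP kerZ x Zx)) degnE.
Qed.

Lemma vres1 : vres 1%g = w.
Proof. by rewrite vresE ?group1. Qed.

Lemma vres_sum (g : algC -> algC) : \sum_(x in A) g (vres x) =
  #|Z|%:R * g w + \sum_(x in A :\: Z) g ('chi_i x).
Proof.
rewrite (big_setID Z) /= (setIidPr sZA); congr (_ + _).
  rewrite (eq_bigr (fun=> g w)) => [|x Zx]; last by rewrite vresE ?Zx ?(subsetP sZA).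
  by rewrite sumr_const mulr_natl.
by apply: eq_bigr => x /setDP[Ax nx]; rewrite vresE // (negbTE nx).
Qed.

Lemma vres_norm : #|A|%:R * '[vres] = #|Z|%:R * (w * w^*) + \sum_(x in A :\: Z) ('chi_i x * ('chi_i x)^*).
Proof.
rewrite cfdotE mulrA mulfV ?pnatr_eq0 -?lt0n ?cardG_gt0 // mul1r.
exact: (vres_sum (fun u => u * u^*)).
Qed.

Lemma vres_dot1 : #|A|%:R * '[vres, 1] = #|Z|%:R * w + \sum_(x in A :\: Z) 'chi_i x.
Proof.
rewrite cfdotE mulrA mulfV ?pnatr_eq0 -?lt0n ?cardG_gt0 // mul1r -(vres_sum id).
by apply: eq_bigr => x Ax; rewrite cfun1E Ax rmorph1 mulr1.
Qed.
End ModifiedRestriction.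

Section DegreesFromTori.
Variables (gT : finGroupType) (G A1 A2 A3 : {group gT}) (q dl : nat).
Local Notation Z := 'Z(G)%G.
Hypotheses (q3 : (3 < q)%N) (dl2 : (0 < dl <= 2)%N) (cG : #|G| = (q * (q ^ 2 - 1))%N) (cZ : #|Z| = dl).
Hypotheses (s1 : A1 \subset G) (s2 : A2 \subset G) (s3 : A3 \subset G).
Hypotheses (z1 : Z \subset A1) (z2 : Z \subset A2) (z3 : Z \subset A3).
Hypotheses (ab2 : abelian A2) (ab3 : abelian A3).
Hypotheses (c1 : #|A1| = (dl * q)%N) (c2 : #|A2| = (q - 1)%N) (c3 : #|A3| = (q + 1)%N).
Hypothesis sumG : forall f : gT -> algC, (forall x g, g \in G -> f (x ^ g)%g = f x) ->
  2%:R * \sum_(x in G) f x = 2%:R * \sum_(x in Z) f x + (2 * (q + 1))%:R * \sum_(x in A1 :\: Z) f x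
    + (q * (q + 1))%:R * \sum_(x in A2 :\: Z) f x + (q * (q - 1))%:R * \sum_(x in A3 :\: Z) f x.
Hypothesis sumA1 : forall i : Iirr G, Z \subset cfker 'chi_i ->
  exists2 sg, sg \in Aint & \sum_(x in A1 :\: Z) 'chi_i x = (q - 1)%:R * sg.
Hypothesis real2 : forall i : Iirr G, {in A2, forall a, 'chi_i (a^-1)%g = 'chi_i a}.
Hypothesis real3 : forall i : Iirr G, {in A3, forall a, 'chi_i (a^-1)%g = 'chi_i a}.

Variable i : Iirr G.
Hypotheses (i0 : i != 0) (kerZ : Z \subset cfker 'chi_i).
Local Notation c := (degn i).

Let dl0 : (0 < dl)%N. Proof. by case/andP: dl2. Qed.
Let q1_neq0 : (q%:R - 1 : algC) != 0.
Proof. by rewrite subr_eq0 pnatr_eq1 gtn_eqF // (ltn_trans _ q3). Qed.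

Let m : nat := Num.truncn '['Res[A1] 'chi_i, 1].

Let mE : (dl * q)%:R * m%:R = dl%:R * c%:R + \sum_(x in A1 :\: Z) 'chi_i x.
Proof.
have -> : m%:R = '['Res[A1] 'chi_i, 1].
  by rewrite truncnK // -irr0 Cnat_cfdot_char_irr // cfRes_char // irr_char.
rewrite -c1 cfdotE mulrA mulfV ?pnatr_eq0 -?lt0n ?cardG_gt0 // mul1r.
rewrite (eq_bigr (fun x => 'chi_i x)) => [|x Ax]; last by rewrite cfResE // cfun1E Ax rmorph1 mulr1.
rewrite (big_setID Z) /= (setIidPr z1); congr (_ + _).
rewrite (eq_bigr (fun=> c%:R)) => [|x Zx]; last by rewrite (cfker1 (subsetP kerZ x Zx)) degnE.
by rewrite sumr_const -cZ mulr_natl.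
Qed.

(** The character sum over A1 minus Z is q - 1 times a rational algebraic integer u; then s = dl m -
    u. *)
Let exists_s : exists s : int, (dl * c)%N%:Z = (dl * m)%N%:Z + s * (q%:Z - 1).
Proof.
have [sg Asg E] := sumA1 kerZ.
have q11 : (q - 1)%:R = q%:R - 1 :> algC by rewrite natrB // (ltn_trans _ q3).
have sgE : sg = (dl%:R * q%:R * m%:R - dl%:R * c%:R) / (q%:R - 1).
  by apply: (mulfI q1_neq0); rewrite -q11 -E mulrC q11 divfK // -natrM mE addrAC subrr add0r.
have /intrP[u uE] : sg \in Num.int.
  apply: Cint_rat_Aint Asg.
  by rewrite sgE rpred_div ?rpredB ?rpredM ?rpred_nat ?rpred1.
exists ((dl * m)%N%:Z - u); apply/eqP; rewrite -(eqr_int algC); apply/eqP.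
rewrite rmorphD rmorphM !rmorphB /= rmorph1 -uE -![(_%:Z)%:~R]/(_%:R) !natrM.
move: mE; rewrite E q11 natrM => e; apply/eqP; rewrite -subr_eq0; apply/eqP.
transitivity (dl%:R * c%:R + (q%:R - 1) * sg - dl%:R * q%:R * m%:R); first by ring.
by rewrite -e subrr.
Qed.

(* [s] is [dl * t / 2]; the modified restrictions have degree [m] on the split torus and [m - t] on the
   non-split one, and the squared norms [X], [Y] satisfy [X + Y <= 2]. *)
Lemma torus_invariants : exists (X Y : nat) (t : int),
  [/\ (2 * c)%N%:Z = (2 * m)%N%:Z + t * (q%:Z - 1), (X + Y <= 2)%N, (m <= X)%N /\ odd X = odd m,
      (`|m%:Z - t| <= Y)%N /\ odd Y = odd `|m%:Z - t|%N
    & ((X == 1%N) && (Y == 0%N) -> m = 1%N -> ~~ odd (#|(A2 / Z)%g|)) /\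
      ((X == 0%N) && (Y == 1%N) -> m%:Z - t = - 1 -> ~~ odd (#|(A3 / Z)%g|))].
Proof.
have [s sE] := exists_s.
have [t tE] : exists t : int, dl%:Z * t = 2 * s.
  by case/andP: dl2; case: (dl) => [|[|[|]]] // _ _; [exists (2 * s) | exists s]; rewrite ?mul1r.
have dlZ : (dl%:Z : int) != 0 by rewrite -lt0n_neq0 // || (by case: (dl) dl0).
have cE : (2 * c)%N%:Z = (2 * m)%N%:Z + t * (q%:Z - 1).
  apply: (mulfI dlZ); move: sE; rewrite !PoszM => sE'.
  transitivity (2 * (dl%:Z * c%:Z)); first by ring.
  by rewrite sE'; transitivity (2 * (dl%:Z * m%:Z) + (2 * s) * (q%:Z - 1)); [ring | rewrite -tE; ring].
have dlC : (dl%:R : algC) != 0 by rewrite pnatr_eq0 -lt0n.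
have q11 : (q - 1)%:R = q%:R - 1 :> algC by rewrite natrB // (ltn_trans _ q3).
have tC : dl%:R * t%:~R = 2%:R * s%:~R :> algC.
  by have := congr1 (fun n : int => n%:~R : algC) tE; rewrite /= !rmorphM.
have cC : 2%:R * c%:R = 2%:R * m%:R + t%:~R * (q%:R - 1) :> algC.
  transitivity (((2 * c)%N%:Z)%:~R : algC); first by rewrite -[RHS]/((2 * c)%N%:R) natrM.
  by rewrite cE rmorphD rmorphM rmorphB /= rmorph1 -![(_%:Z)%:~R]/(_%:R) natrM.
have two0 : (2%:R : algC) != 0 by rewrite pnatr_eq0.
have iA (A : {group gT}) n : Z \subset A -> #|A| = n -> dl%:R * #|A : Z|%:R = n%:R :> algC.
  by move=> zA <-; rewrite -natrM -cZ Lagrange.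
have i2 := iA _ _ z2 c2; have i3 := iA _ _ z3 c3.
have w2 : c%:R - s%:~R * #|A2 : Z|%:R = m%:R :> algC.
  apply: (mulfI two0); apply: (mulfI dlC).
  transitivity (dl%:R * (2%:R * c%:R) - (2%:R * s%:~R) * (dl%:R * #|A2 : Z|%:R) : algC); first by ring.
  by rewrite i2 q11 cC -tC; ring.
have w3 : c%:R - s%:~R * #|A3 : Z|%:R = (m%:Z - t)%:~R :> algC.
  apply: (mulfI two0); apply: (mulfI dlC); rewrite rmorphB /=.
  transitivity (dl%:R * (2%:R * c%:R) - (2%:R * s%:~R) * (dl%:R * #|A3 : Z|%:R) : algC); first by ring.
  by rewrite i3 natrD cC -tC -[(m%:Z)%:~R]/(m%:R); ring.
have [n2 [X [v2 X2 le2 od2 [_ lin2]]]] := vchar_abelian_norm ab2 (vres_vchar A2 i s).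
have [n3 [Y [v3 Y3 le3 od3 [zero3 lin3]]]] := vchar_abelian_norm ab3 (vres_vchar A3 i s).
have n2E : n2 = m%:Z.
  by apply/eqP; rewrite -(eqr_int algC) -v2 (vres1 s2 z2 ab2 kerZ) w2.
have n3E : n3 = m%:Z - t.
  by apply/eqP; rewrite -(eqr_int algC) -v3 (vres1 s3 z3 ab3 kerZ) w3.
rewrite n2E in v2 le2 od2 lin2; rewrite n3E in v3 le3 od3 lin3.
have N2 := vres_norm s2 z2 ab2 kerZ s; have N3 := vres_norm s3 z3 ab3 kerZ s.
have E2 := vres_dot1 s2 z2 ab2 kerZ s; have E3 := vres_dot1 s3 z3 ab3 kerZ s.
rewrite w2 X2 c2 cZ q11 conjC_nat in N2; rewrite w3 Y3 c3 cZ natrD rmorph_int in N3.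
rewrite w2 c2 cZ q11 in E2; rewrite w3 c3 cZ natrD in E3.
set S2 := \sum_(x in A2 :\: Z) _ in N2; set S3 := \sum_(x in A3 :\: Z) _ in N3.
set T2 := \sum_(x in A2 :\: Z) _ in E2; set T3 := \sum_(x in A3 :\: Z) _ in E3.
pose S1 := \sum_(x in A1 :\: Z) 'chi_i x * ('chi_i x)^*.
have chiJ x g : g \in G -> 'chi_i (x ^ g)%g = 'chi_i x by move=> Gg; rewrite cfunJ.
have sumZ (f : algC -> algC) : \sum_(x in Z) f ('chi_i x) = dl%:R * f c%:R.
  rewrite (eq_bigr (fun=> f c%:R)) => [|x Zx]; last by rewrite (cfker1 (subsetP kerZ x Zx)) degnE.
  by rewrite sumr_const -cZ mulr_natl.
have := sumG (fun x g Gg => congr1 (fun u => u * u^*) (chiJ x g Gg)).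
rewrite (sumZ (fun u => u * u^*)) -/S1 -/S2 -/S3 conjC_nat.
have -> : \sum_(x in G) 'chi_i x * ('chi_i x)^* = (q%:R * (q%:R ^+ 2 - 1)).
  have := cfnorm_irr i; rewrite cfdotE => H.
  have g0 : #|G|%:R != 0 :> algC by rewrite pnatr_eq0 -lt0n cardG_gt0.
  rewrite -[LHS](mulVKf g0) H mulr1 cG natrM natrB ?natrX // expn_gt0; by rewrite (ltn_trans _ q3).
have := sumG chiJ; rewrite (sumZ id) (sum_irr0 i0) mulr0 -/T2 -/T3.
have -> : \sum_(x in A1 :\: Z) 'chi_i x = dl%:R * (q%:R * m%:R - c%:R).
  by apply: (addrI (dl%:R * c%:R)); rewrite -mE natrM; ring.
have CS : dl%:R * (q%:R * m%:R - c%:R) ^+ 2 <= (q%:R - 1) * S1.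
  have := @sum_weighted_sqr_le gT (fun x => nat_of_bool (x \in A1 :\: Z)) 'chi_i (dl%:R * (q%:R * m%:R - c%:R)).
  rewrite rpredM ?rpredB ?rpredM ?realn // => /(_ isT).
  have -> : \sum_x (x \in A1 :\: Z)%:R * 'chi_i x = dl%:R * (q%:R * m%:R - c%:R).
    transitivity (\sum_(x in A1 :\: Z) 'chi_i x).
      by rewrite [RHS]big_mkcond; apply: eq_bigr => x _; case: ifP; rewrite ?mul1r ?mul0r.
    by apply: (addrI (dl%:R * c%:R)); rewrite -mE natrM; ring.
  move=> /(_ erefl).
  have -> : (\sum_x (x \in A1 :\: Z) ^ 2)%N = (dl * (q - 1))%N.
    transitivity (#|A1 :\: Z|); last by rewrite cardsD (setIidPr z1) c1 cZ mulnBr muln1.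
    by rewrite -sum1_card [RHS]big_mkcond; apply: eq_bigr => x _; case: ifP.
  have -> : \sum_(x | nat_of_bool (x \in A1 :\: Z) != 0%N) `|'chi_i x| ^+ 2 = S1.
    apply: eq_big => [x|x _]; first by case: (x \in A1 :\: Z).
    by rewrite normCK.
  rewrite exprMn natrM q11 expr2 -!mulrA ler_pM2l //.
  by rewrite ltr0n.
rewrite !natrM q11 !natrD => eq1 eq2.
pose u : algC := t%:~R / 2%:R; have tu : t%:~R = 2%:R * u by rewrite /u mulrC divfK.
have cu : c%:R = m%:R + u * (q%:R - 1) by apply: (mulfI two0); rewrite cC tu; ring.
rewrite rmorphB /= -[(m%:Z)%:~R]/(m%:R) tu in N3 E3.
(* Orthogonality of the character to 1, rewritten by the summation formula over the three
   centralizers. *)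
have xy : '[vres A2 i s, 1] + '[vres A3 i s, 1] = 0.
  have nz : (q%:R * (q%:R - 1) * (q%:R + 1) : algC) != 0.
    apply: mulf_neq0; last by rewrite natr1 pnatr_eq0.
    by apply: mulf_neq0; [rewrite pnatr_eq0 -lt0n (ltn_trans _ q3) | exact: q1_neq0].
  apply: (mulfI nz); rewrite mulr0.
  transitivity (q%:R * (q%:R + 1) * ((q%:R - 1) * '[vres A2 i s, 1]) + q%:R * (q%:R - 1) * ((q%:R + 1) * '[vres A3 i s, 1]) : algC); first by ring.
  rewrite E2 E3; transitivity (2%:R * (dl%:R * c%:R) + 2%:R * (q%:R + 1) * (dl%:R * (q%:R * m%:R - c%:R)) + q%:R * (q%:R + 1) * T2 + q%:R * (q%:R - 1) * T3 : algC); last by rewrite -eq1.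
  by rewrite cu; ring.
exists X, Y, t; split=> //.
- have S2E : S2 = (q%:R - 1) * X%:R - dl%:R * (m%:R * m%:R) by rewrite N2; ring.
  have S3E : S3 = (q%:R + 1) * Y%:R - dl%:R * ((m%:R - 2%:R * u) * (m%:R - 2%:R * u)) by rewrite N3; ring.
  have pos : (0 : algC) < q%:R * (q%:R - 1) * (q%:R + 1) * (q%:R - 1).
    have q0 : (0 : algC) < q%:R by rewrite ltr0n (ltn_trans _ q3).
    have q1 : (0 : algC) < q%:R - 1 by rewrite subr_gt0 ltr1n (ltn_trans _ q3).
    by rewrite !mulr_gt0 // addr_gt0.
  (* After substitution of the two torus norms in the norm equation of the character, the slack of
     Cauchy-Schwarz on A1 minus Z is a positive multiple of 2 - (X + Y). *)
  have : 0 <= (q%:R * (q%:R - 1) * (q%:R + 1) * (q%:R - 1)) * (2%:R - (X + Y)%:R) :> algC.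
    have -> : (q%:R * (q%:R - 1) * (q%:R + 1) * (q%:R - 1)) * (2%:R - (X + Y)%:R) =
       2%:R * (q%:R + 1) * ((q%:R - 1) * S1 - dl%:R * (q%:R * m%:R - c%:R) ^+ 2) :> algC.
      have -> : 2%:R * (q%:R + 1) * ((q%:R - 1) * S1 - dl%:R * (q%:R * m%:R - c%:R) ^+ 2) =
        (q%:R - 1) * (2%:R * (q%:R + 1) * S1) - 2%:R * (q%:R + 1) * (dl%:R * (q%:R * m%:R - c%:R) ^+ 2) :> algC by ring.
      have -> : 2%:R * (q%:R + 1) * S1 = 2%:R * (q%:R * (q%:R ^+ 2 - 1)) - 2%:R * (dl%:R * (c%:R * c%:R))
          - q%:R * (q%:R + 1) * S2 - q%:R * (q%:R - 1) * S3 :> algC by rewrite eq2; ring.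
      by rewrite S2E S3E cu natrD; ring.
    by rewrite mulr_ge0 ?subr_ge0 // mulr_ge0 ?ler0n // addr_ge0 ?ler0n.
  by rewrite pmulr_rge0 // subr_ge0 ler_nat.
(* With norms 1 and 0, the nonzero virtual character is up to sign a real linear character trivial
   on Z. If the torus modulo Z had odd order it would be principal, against [xy]. *)
- split.
    move=> /andP[/eqP X1 /eqP Y0] m1; apply/negP=> on.
    have [j Ej] := lin2 X1; rewrite m1 scale1r in Ej.
    have yz : '[vres A3 i s, 1] = 0 by rewrite zero3 // cfdot0l.
    have j1 : 'chi_j = 1.
      have nZ : Z <| A2 by rewrite /normal z2 (sub_abelian_norm ab2).
      apply: (real_lin_odd_eq1 ab2 nZ erefl on) => [z Zz|a Aa]; rewrite -Ej.
        by rewrite (vresE s2 z2 ab2 kerZ) ?(subsetP z2) // Zz w2 m1.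
      by rewrite !(vresE s2 z2 ab2 kerZ) ?groupV // real2.
    by move: xy; rewrite yz addr0 Ej j1 cfnorm1 => /eqP; rewrite oner_eq0.
  move=> /andP[/eqP X0 /eqP Y1] mt; apply/negP=> on.
  have [j Ej] := lin3 Y1; rewrite mt in Ej.
  have Ej' : 'chi_j = - vres A3 i s by rewrite Ej rmorphN1 scaleN1r opprK.
  have v20 : vres A2 i s = 0 by apply/eqP; rewrite -cfnorm_eq0 X2 X0.
  have xz : '[vres A2 i s, 1] = 0 by rewrite v20 cfdot0l.
  have vj a : 'chi_j a = - vres A3 i s a by rewrite Ej' cfunE.
  have j1 : 'chi_j = 1.
    have nZ : Z <| A3 by rewrite /normal z3 (sub_abelian_norm ab3).
    apply: (real_lin_odd_eq1 ab3 nZ erefl on) => [z Zz|a Aa]; rewrite !vj.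
      by rewrite (vresE s3 z3 ab3 kerZ) ?(subsetP z3) // Zz w3 mt rmorphN1 opprK.
    by rewrite !(vresE s3 z3 ab3 kerZ) ?groupV // real3.
  have : '[vres A3 i s, 1] = -1 by rewrite -[vres _ _ _]opprK -Ej' j1 cfdotNl cfnorm1.
  by move=> yE; move: xy; rewrite xz add0r yE => /eqP; rewrite oppr_eq0 oner_eq0.
Qed.

(** The bounds leave finitely many (X, Y, m, t), and 2c = 2m + t(q - 1) gives the degree; the half
    degrees come from the norms (1, 0) and (0, 1). *)
Lemma degree_cases : c != 1%N ->
  c = q \/ c = (q + 1)%N \/ c = (q - 1)%N \/ ((2 * c)%N = (q + 1)%N /\ ~~ odd #|(A2 / Z)%g|) \/
    ((2 * c)%N = (q - 1)%N /\ ~~ odd #|(A3 / Z)%g|).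
Proof.
have [X [Y [t [cE XY [mX oX] [mY oY] [h1 h2]]]]] := torus_invariants.
have c0 : (0 < c)%N := degn_gt0 i; move=> c1'.
move: c m cE XY mX oX mY oY h1 h2 c0 c1' => cc M cE XY mX oX mY oY h1 h2 c0 c1'.
have tb : t = -2 \/ t = -1 \/ t = 0 \/ t = 1 \/ t = 2 \/ t = 3 \/ t = 4.
  by move: XY mX mY; clear; lia.
move: XY mX oX mY oY h1 h2 cE.
case: X => [|[|[|X]]]; case: Y => [|[|[|Y]]]; case: M => [|[|[|M]]] => XY mX oX mY oY h1 h2 cE;
  try (exfalso; move: XY mX; clear; lia); try (exfalso; by move: oX);
  (case: tb => [tE|[tE|[tE|[tE|[tE|[tE|tE]]]]]]; rewrite {}tE in mY oY h1 h2 cE;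
   try (exfalso; by move: mY); try (exfalso; by move: oY);
   first [ by exfalso; move: cE c0 c1' q3; clear; lia
         | by left; move: cE q3; clear; lia
         | by right; left; move: cE q3; clear; lia
         | by right; right; left; move: cE q3; clear; lia
         | by right; right; right; left; split; [move: cE q3; clear; lia | apply: h1]
         | by right; right; right; right; split; [move: cE q3; clear; lia | apply: h2] ]).
Qed.
End DegreesFromTori.

Lemma lin_char_commutator (gT : finGroupType) (G : {group gT}) (xi : 'CF(G)) a b :
  xi \is a linear_char -> a \in G -> b \in G -> xi (a^-1 * a ^ b)%g = 1.
Proof.
move=> lin Ga Gb; rewrite (lin_charM lin (groupVr Ga) (groupJ Ga Gb)) cfunJ //.
by rewrite -(lin_charM lin (groupVr Ga) Ga) mulVg lin_char1.
Qed.

(** * Generation and normal subgroups of SL(2,q) *)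

Section SplitGeneration.
Variable F : finFieldType.
Local Notation SL := (SL2_group F).
Local Notation q := #|F|.
Implicit Types (y g : {'GL_2[F]}) (x : F).

Definition sl_v (x : F) := sl (mx4 1 x 0 1).
Definition sl_w : {'GL_2[F]} := sl (mx4 0 1 (-1) 0).

Lemma det_v (x : F) : \det (mx4 1 x 0 1) = 1. Proof. by rewrite det_mx4; ring. Qed.
Lemma det_w : \det (mx4 0 1 (-1) 0 : 'M[F]_2) = 1. Proof. by rewrite det_mx4; ring. Qed.
Lemma val_v (x : F) : GLval (sl_v x) = mx4 1 x 0 1. Proof. exact: slK (det_v x). Qed.
Lemma val_w : GLval sl_w = mx4 0 1 (-1) 0. Proof. exact: slK det_w. Qed.
Lemma mem_v (x : F) : sl_v x \in SL. Proof. exact: mem_sl (det_v x). Qed.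
Lemma mem_w : sl_w \in SL. Proof. exact: mem_sl det_w. Qed.

Lemma sl_uJw (x : F) : (sl_u x ^ sl_w)%g = sl_v (- x).
Proof.
apply: (mulgI sl_w); rewrite -conjgC; apply: GLval_inj.
by rewrite !GLvalM val_u val_v val_w !mx4_mul; congr mx4; ring.
Qed.

(** A matrix with nonzero upper right entry is a product of lower, upper and lower unipotents;
    multiplication by [sl_v 1] reaches this case from the other. *)
Lemma SL_generated (H : {group {'GL_2[F]}}) : (forall x, sl_u x \in H) -> (forall x, sl_v x \in H) ->
  SL \subset H.
Proof.
move=> Hu Hv; have main g : g \in SL -> GLval g 0 1 != 0 -> g \in H.
  move=> Sg b0; have dg := SL_det Sg; rewrite det2 in dg.
  set a := GLval g 0 0 in dg *; set b := GLval g 0 1 in b0 dg *; set c := GLval g 1 0 in dg *; set d := GLval g 1 1 in dg *.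
  pose r1 : F := (d - 1) / b; pose r2 : F := (a - 1) / b.
  have -> : g = (sl_u r1 * sl_v b * sl_u r2)%g.
    apply: GLval_inj; rewrite [_ (_ * _)%g]GLvalM [GLval (_ * sl_v b)%g]GLvalM !val_u val_v !mx4_mul.
    rewrite [LHS]mx4_eta -/a -/b -/c -/d /r1 /r2; congr mx4; try by field.
    by apply: (mulfI b0); rewrite (_ : b * c = a * d - 1); [field | rewrite -dg; ring].
  exact: groupM (groupM (Hu _) (Hv _)) (Hu _).
apply/subsetP=> g Sg; have [b0|] := eqVneq (GLval g 0 1) 0; last exact: main.
have dg := SL_det Sg; rewrite det2 b0 mul0r subr0 in dg.
have a0 : GLval g 0 0 != 0 by apply: contraTneq (oner_neq0 F) => a0; rewrite -dg a0 mul0r eqxx.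
rewrite -(groupMr g (Hv 1)); apply: main; first exact: groupM Sg (mem_v 1).
by rewrite GLvalM val_v {1}[GLval g]mx4_eta mx4_mul !mxE /= b0 mulr1 mul0r addr0.
Qed.

Hypothesis q3 : (3 < q)%N.

Lemma exists_nonroot : exists2 s : F, s != 0 & s ^+ 2 != 1.
Proof.
pose R : {set F} := [set 0; 1; -1].
have le : (#|R| <= 3)%N.
  by apply: leq_trans (leq_card_setU _ _) _; rewrite cards1 addn1 ltnS cards2; case: eqP.
have /subsetPn[s _] : ~~ ([set: F] \subset R).
  by apply/negP=> /subset_leq_card; rewrite cardsT leqNgt (leq_ltn_trans le q3).
rewrite !in_setU !in_set1 !negb_or => /andP[/andP[s0 s1] sN].
by exists s => //; rewrite -[X in _ != X](expr1n F 2) eqf_sqr negb_or s1.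
Qed.

Lemma exists_irr_trace : exists al : F, forall s, s != 0 -> al != s + s^-1.
Proof.
pose R : {set F} := [set s + s^-1 | s in [set~ 0 : F]].
have le : (#|R| <= q - 1)%N.
  by apply: leq_trans (leq_imset_card _ _) _; rewrite cardsC1 subn1.
have /subsetPn[al _ nal] : ~~ ([set: F] \subset R).
  by apply/negP=> /subset_leq_card; rewrite cardsT => h; have := leq_trans h le; move: q3; move: #|F|; clear; lia.
by exists al => s s0; apply: contraNneq nal => ->; apply/imsetP; exists s; rewrite ?in_setC1.
Qed.

(** Each [sl_u x] is a commutator with a diagonal element [sl_t s], s^2 != 1, available as q > 3;
    conjugation by [sl_w] handles the [sl_v x]. *)
Lemma lin_char_SL_trivial (i : Iirr SL) : 'chi_i \is a linear_char -> i = 0.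
Proof.
move=> lin; have [s s0 s2] := exists_nonroot.
have s21 : s ^+ 2 - 1 != 0 by rewrite subr_eq0.
have ku x : sl_u x \in cfker 'chi_i.
  pose r : F := x / (s ^+ 2 - 1).
  have Su := mem_u r; have St := mem_t s0.
  have E : sl_u x = ((sl_u r)^-1 * (sl_u r ^ sl_t s))%g.
    apply: (mulgI (sl_u r)); rewrite mulKVg sl_tJ // -sl_uM; congr sl_u; rewrite /r; field; exact: s21.
  rewrite cfkerEchar ?irr_char // in_set mem_u /= (lin_char1 lin) E.
  by apply/eqP; exact: lin_char_commutator lin Su St.
have kv x : sl_v x \in cfker 'chi_i.
  have nw := subsetP (normal_norm (cfker_normal 'chi_i)) _ mem_w.
  have := ku (- x); rewrite -(memJ_norm _ nw) sl_uJw opprK; exact: id.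
by apply/eqP; rewrite -subGcfker; exact: (@SL_generated (cfker_group 'chi_i)).
Qed.

(** If y and its conjugate by [sl_w] both fix the line, y is diagonal and not scalar, and its
    conjugate by [sl_v 1] moves the line. *)
Lemma moved_line (K : {group {'GL_2[F]}}) : K <| SL -> ~~ (K \subset 'Z(SL)%g) ->
  exists2 y, y \in K & GLval y 0 1 != 0.
Proof.
move=> nK /subsetPn[y Ky nZ]; have Sy := subsetP (normal_sub nK) y Ky.
have Kj z g : z \in K -> g \in SL -> (z ^ g)%g \in K.
  by move=> Kz Sg; rewrite memJ_norm // (subsetP (normal_norm nK)).
have [b0|] := eqVneq (GLval y 0 1) 0; last by exists y.
have Ew : GLval (y ^ sl_w)%g = mx4 (GLval y 1 1) (- GLval y 1 0) (- GLval y 0 1) (GLval y 0 0).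
  have h : (sl_w * (y ^ sl_w) = y * sl_w)%g by rewrite -conjgC.
  have uw : GLval sl_w \in unitmx by rewrite unitmxE (SL_det mem_w) unitr1.
  apply: (can_inj (mulKmx uw)); rewrite -GLvalM h GLvalM val_w {1}[GLval y]mx4_eta !mx4_mul.
  by congr mx4; ring.
have [c0|c0] := eqVneq (GLval y 1 0) 0; last first.
  by exists (y ^ sl_w)%g; [exact: Kj Ky mem_w | rewrite Ew mxE /= oppr_eq0].
have ad : GLval y 0 0 != GLval y 1 1.
  apply: contraNneq nZ => ad; apply/SL2_centerP; split=> //; exists (GLval y 1 1).
    by have := SL_det Sy; rewrite det2 b0 mul0r subr0 ad expr2.
  by rewrite [LHS]mx4_eta b0 c0 ad mx4_scalar.
exists (y ^ sl_v 1%R)%g; first exact: Kj Ky (mem_v 1).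
have h : (sl_v 1%R * (y ^ sl_v 1%R) = y * sl_v 1%R)%g by rewrite -conjgC.
have uv : GLval (sl_v 1) \in unitmx by rewrite unitmxE (SL_det (mem_v 1)) unitr1.
have -> : GLval (y ^ sl_v 1%R)%g = mx4 (GLval y 0 0) (GLval y 0 0 - GLval y 1 1) 0 (GLval y 1 1).
  apply: (can_inj (mulKmx uv)); rewrite -GLvalM h GLvalM val_v {1}[GLval y]mx4_eta !mx4_mul b0 c0.
  by congr mx4; ring.
by rewrite mxE /= subr_eq0.
Qed.

(* Iwasawa: K moves the line fixed by U, hence acts transitively on lines, so that every conjugate of U
   lies in UK and SL2/K is abelian. *)
Lemma quotient_abelian_SL (K : {group {'GL_2[F]}}) : K <| SL -> ~~ (K \subset 'Z(SL)%g) ->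
  abelian (SL / K).
Proof.
move=> nK nZ; have [y Ky b0] := moved_line nK nZ; have nKS := normal_norm nK.
have Sy := subsetP (normal_sub nK) y Ky.
have vK x : exists z, coset K (sl_v x) = coset K (sl_u z).
  pose r := - GLval y 0 0 / GLval y 0 1.
  have [kp Kkp h] : exists2 kp, kp \in K & (sl_u r * kp = y * sl_u r)%g.
    exists (y ^ sl_u r)%g; last by rewrite -conjgC.
    by rewrite memJ_norm // (subsetP nKS) // mem_u.
  have k00 : GLval kp 0 0 = 0.
    have h' : GLval (sl_u r) *m GLval kp = GLval y *m GLval (sl_u r) by rewrite -!GLvalM h.
    rewrite val_u [GLval kp]mx4_eta [GLval y]mx4_eta !mx4_mul in h'.
    case/mx4_inj: h' => e1 _ _ _; move: e1; rewrite mul1r mul0r addr0 mulr1 => ->; rewrite /r; field; exact: b0.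
  have Skp := subsetP (normal_sub nK) _ Kkp.
  have dk := SL_det Skp; rewrite det2 k00 mul0r sub0r in dk.
  set b := GLval kp 0 1 in dk *; set c := GLval kp 1 0 in dk *.
  have cE : c = - b^-1.
    have bz : b != 0 by apply: contraTneq (oner_neq0 F) => bz; rewrite -dk bz mul0r oppr0 eqxx.
    by apply: (mulfI bz); rewrite mulrN mulfV // -dk opprK.
  have bz : b != 0 by apply: contraTneq (oner_neq0 F) => bz; rewrite -dk bz mul0r oppr0 eqxx.
  pose r2 : F := - x / b ^+ 2; exists r2.
  have E2 : (sl_u r2 ^ kp)%g = sl_v x.
    apply: (mulgI kp); rewrite -conjgC; apply: GLval_inj.
    rewrite !GLvalM val_u val_v [GLval kp]mx4_eta k00 -/b -/c cE !mx4_mul /r2; congr mx4; (try by field); by field; rewrite ?bz.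
  rewrite -E2.
  have nu := subsetP nKS _ (mem_u r2); have nk := subsetP nKS _ Skp.
  by rewrite conjgE coset_kerl ?groupV // coset_kerr.
have nKu x := subsetP nKS _ (mem_u x); have nKv x := subsetP nKS _ (mem_v x).
have cuu x z : commute (coset K (sl_u x)) (coset K (sl_u z)).
  by rewrite /commute -!(coset_morphM (nKu _) (nKu _)) -!sl_uM addrC.
pose H1 := (coset K @*^-1 'C([set coset K (sl_u x) | x : F]))%G.
have s1 : SL \subset H1.
  apply: SL_generated => x; rewrite mem_morphpre ?nKu ?nKv //; apply/centP=> _ /imsetP[z _ ->]; first exact: cuu.
  by have [x' E] := vK x; have := cuu x' z; rewrite -E.
have cu x g : g \in SL -> commute (coset K (sl_u x)) (coset K g).
  move=> Sg; have := subsetP s1 g Sg; case/morphpreP=> _ /centP c.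
  by apply: commute_sym; apply: c; apply/imsetP; exists x.
pose H2 := (coset K @*^-1 'C(SL / K))%G.
have s2 : SL \subset H2.
  have H x : sl_u x \in H2.
    rewrite mem_morphpre ?nKu //; apply/centP=> _ /morphimP[g ng Sg ->]; exact: cu.
  apply: SL_generated => x //; rewrite mem_morphpre ?nKv //.
  by apply/centP=> _ /morphimP[g ng Sg ->]; have [x' E] := vK x; have := cu x' g Sg; rewrite -E.
by rewrite /abelian; apply/subsetP=> _ /morphimP[g ng Sg ->]; have := subsetP s2 g Sg; case/morphpreP.
Qed.

(** A noncentral kernel has abelian quotient, so the character would be linear, hence principal. *)
Lemma cfker_SL_central (i : Iirr SL) : i != 0 -> cfker 'chi_i \subset 'Z(SL)%g.
Proof.
move=> i0; apply: contraT => nZ; have ab := quotient_abelian_SL (cfker_normal 'chi_i : cfker_group _ <| SL) nZ.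
case/eqP: i0; apply: lin_char_SL_trivial.
rewrite lin_irr_der1; apply: der1_min; [exact: normal_norm (cfker_normal _) | exact: ab].
Qed.
End SplitGeneration.

(** * Normalizers of the centralizers and the degrees for SL(2,q) *)

(** The normalizer moves x within its own centralizer, so only to x or its inverse; the stabilizer
    of x has index at most 2. *)
Lemma normalizer_bound (gT : finGroupType) (G : {group gT}) (x : gT) : x \in G -> x \notin 'Z(G)%g ->
  (forall y, y \in 'C_G[x]%g -> forall g, g \in G -> y = (x ^ g)%g -> y = x \/ y = (x^-1)%g) ->
  (#|'N_G(ncent G x)%g| <= 2 * #|'C_G[x]%g|)%N.
Proof.
move=> Gx nx H; set N := 'N_G(ncent G x)%G.
have cl : (#|x ^: N| <= 2)%N.
  apply: leq_trans (_ : #|[set x; (x^-1)%g]| <= 2)%N; last by rewrite cards2; case: eqP.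
  apply: subset_leq_card; apply/subsetP=> z /imsetP[g /setIP[Gg Ng] ->].
  have : (x ^ g)%g \in ncent G x by rewrite memJ_norm // in_setD nx in_setI Gx cent1id.
  by case/setDP=> Cz _; rewrite !inE; case: (H _ Cz g Gg erefl) => ->; rewrite eqxx ?orbT.
rewrite -(Lagrange (subsetIl N 'C[x])) index_cent1 mulnC leq_mul //.
by apply: subset_leq_card; apply: setSI; exact: subsetIl.
Qed.

Section SL2Degrees.
Variable F : finFieldType.
Local Notation SL := (SL2_group F).
Local Notation q := #|F|.
Hypothesis q3 : (3 < q)%N.

Lemma tr_cent_u y : y \in 'C_SL[sl_u (1%R : F)]%g -> exists2 a : F, a ^+ 2 = 1 & [/\ GLval y 0 1 = 0, GLval y 0 0 = a & GLval y 1 1 = a].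
Proof.
rewrite cent_uE => /imsetP[[z x] /setXP[/SL2_centerP[_ [a a2 Ez]] _] ->]; exists a => //.
by rewrite GLvalM Ez val_u mx4_scalar mx4_mul !mxE /=; split; ring.
Qed.

Lemma cent_tE (s : F) y : s != 0 -> s ^+ 2 != 1 -> y \in 'C_SL[sl_t s]%g -> exists2 a : F, a != 0 & y = sl_t a.
Proof.
move=> s0 s2 /centSLP[Sy]; rewrite val_t // => /comm2P; rewrite !mxE /= => -[_ E1 E2].
have ns : s - s^-1 != 0.
  by apply: contraNneq s2 => /eqP; rewrite subr_eq0 => /eqP e; rewrite expr2 {2}e mulfV.
have b0 : GLval y 0 1 = 0 by move/esym/eqP: E1; rewrite mul0r mulf_eq0 (negbTE ns) orbF => /eqP.
have c0 : GLval y 1 0 = 0 by move/esym/eqP: E2; rewrite mul0r mulf_eq0 (negbTE ns) orbF => /eqP.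
have := SL_det Sy; rewrite det2 b0 mul0r subr0 => ad.
have a0 : GLval y 0 0 != 0 by apply: contraTneq (oner_neq0 F) => a0; rewrite -ad a0 mul0r eqxx.
exists (GLval y 0 0) => //; apply: GLval_inj; rewrite val_t // [LHS]mx4_eta b0 c0; congr mx4.
by apply: (mulfI a0); rewrite ad mulfV.
Qed.

Lemma tr_t (a : F) : a != 0 -> tr2 (GLval (sl_t a)) = a + a^-1.
Proof. by move=> a0; rewrite val_t // /tr2 !mxE. Qed.

Lemma t_noncentral (s : F) : s != 0 -> s ^+ 2 != 1 -> sl_t s \notin 'Z(SL)%g.
Proof.
move=> s0 s2; apply/negP=> /SL2_centerP[_ [c _]]; rewrite val_t // mx4_scalar => /mx4_inj[e1 _ _ e2].
by case/eqP: s2; rewrite expr2 {2}e1 -e2 mulfV.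
Qed.

Lemma sl_tV (s : F) : s != 0 -> (sl_t s)^-1%g = sl_t s^-1.
Proof.
move=> s0; apply: (mulgI (sl_t s)); rewrite mulgV; apply: GLval_inj.
have s0' : s^-1 != 0 by rewrite invr_eq0.
rewrite GLvalM !val_t // mx4_mul invrK mulfV // mulVf // !mulr0 !mul0r !addr0 add0r.
by rewrite -mx4_scalar; symmetry; exact: GL_1E.
Qed.

Lemma sl_tJw (s : F) : s != 0 -> (sl_t s ^ sl_w F)%g = (sl_t s)^-1%g.
Proof.
move=> s0; rewrite sl_tV //; apply: (mulgI (sl_w F)); rewrite -conjgC; apply: GLval_inj.
have s0' : s^-1 != 0 by rewrite invr_eq0.
by rewrite !GLvalM val_w !val_t // !mx4_mul invrK; congr mx4; ring.
Qed.

(** A normalizing element preserves the line fixed by the unipotents, so it is lower triangular. *)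
Lemma card_normalizer_u : (#|'N_SL(ncent SL (sl_u (1%R : F)))%g| <= q * (q - 1))%N.
Proof.
pose f (p : F * F) := sl (mx4 p.1 0 p.2 p.1^-1).
have sub : 'N_SL(ncent SL (sl_u (1%R : F)))%g \subset f @: setX [set~ 0 : F] setT.
  apply/subsetP=> n /setIP[Sn Nn].
  have un : sl_u (1%R : F) \in ncent SL (sl_u (1%R : F)) by rewrite in_setD sl_u_noncentral ?oner_neq0 // in_setI mem_u cent1id.
  have [y Ey Cy] : exists2 y, (n * y = sl_u (1%R : F) * n)%g & y \in 'C_SL[sl_u (1%R : F)]%g.
    exists (sl_u (1%R : F) ^ n)%g; first by rewrite -conjgC.
    by have : (sl_u (1%R : F) ^ n)%g \in ncent SL (sl_u (1%R : F)); [rewrite memJ_norm | case/setDP].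
  have [a a2 [y01 y00 y11]] := tr_cent_u Cy.
  have := congr1 (@GLval 2 F) Ey; rewrite !GLvalM val_u [GLval n]mx4_eta [GLval y]mx4_eta y01 y00 y11 !mx4_mul.
  move=> /mx4_inj[e1 e2 _ _].
  have b0 : GLval n 0 1 = 0.
    apply: contraTeq isT => nb /=; apply/negP => _; move: e2; rewrite mulr0 add0r mul1r mul0r addr0 => e2.
    have a1 : a = 1 by apply: (mulfI nb); rewrite e2 mulr1.
    move: e1; rewrite a1 mulr1 mul1r mul0r => /addrI /eqP; rewrite mulf_eq0 (negbTE nb) /= => /eqP y10.
    have y1 : y = 1%g by apply: GLval_inj; rewrite [LHS]mx4_eta y01 y00 y11 y10 a1 -mx4_scalar; symmetry; exact: GL_1E.
    have : sl_u (1%R : F) = 1%g by apply: (mulIg n); rewrite -Ey y1 mulg1 mul1g.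
    by move=> u1; have := sl_u_noncentral (oner_neq0 F); rewrite u1 group1.
  have := SL_det Sn; rewrite det2 b0 mul0r subr0 => dn.
  have n0 : GLval n 0 0 != 0 by apply: contraTneq (oner_neq0 F) => a0; rewrite -dn a0 mul0r eqxx.
  apply/imsetP; exists (GLval n 0 0, GLval n 1 0); first by apply/setXP; rewrite in_setC1.
  apply: GLval_inj; rewrite /f slK /=; last by rewrite det_mx4 mulfV // mul0r subr0.
  by rewrite [LHS]mx4_eta b0; congr mx4; apply: (mulfI n0); rewrite dn mulfV.
apply: leq_trans (subset_leq_card sub) _; apply: leq_trans (leq_imset_card _ _) _.
by rewrite cardsX cardsC1 cardsT subn1 mulnC.
Qed.

(** f is constant on nonzero squares and on nonsquares. In characteristic 2 the latter are absent
    and |Z| = 1; otherwise both classes have (q - 1)/2 elements and |Z| = 2. So sg is f(1) or f(1) +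
    f(n), n a nonsquare. *)
Lemma sum_square_invariant (f : F -> algC) : (forall s x, s != 0 -> f (s ^+ 2 * x) = f x) -> (forall x, f x \in Aint) ->
  exists2 sg, sg \in Aint & #|'Z(SL)%g|%:R * \sum_(x in [set~ 0 : F]) f x = (q - 1)%:R * sg.
Proof.
move=> fs fA; rewrite card_center_SL2; pose Sq := [set x : F | sqr x]; pose Nq := [set x : F | (x != 0) && ~~ sqr x].
have SN : [set~ 0 : F] = Sq :|: Nq.
  apply/setP=> x; rewrite !inE; case: (boolP (sqr x)) => [/sqr_neq0 -> //|_]; by rewrite andbT.
have dis : Sq :&: Nq = set0 by apply/setP=> x; rewrite !inE; case: (sqr x); rewrite ?andbF.
have sumS : \sum_(x in Sq) f x = #|Sq|%:R * f 1.
  rewrite (eq_bigr (fun=> f 1)) => [|x]; first by rewrite sumr_const mulr_natl.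
  by rewrite inE => /sqrP[s s0 ->]; rewrite -[s ^+ 2]mulr1 fs.
rewrite SN sum_setU // sumS; case: (boolP (1 == -1 :> F)) => [/eqP N1|N1].
  have Nq0 : Nq = set0.
    have inj : injective (fun s : F => s ^+ 2).
      by move=> a b /eqP; rewrite eqf_sqr -[- b]mulN1r -N1 mul1r orbb => /eqP.
    have surj x : exists s : F, x = s ^+ 2 by have [g _ gK] := injF_bij inj; exists (g x); rewrite gK.
    apply/setP=> x; rewrite !inE; apply/negP=> /andP[x0]; case: (surj x) => s es; rewrite es in x0 *.
    by rewrite sqrX // -sqrf_eq0.
  have cS : #|Sq| = (q - 1)%N.
    by rewrite subn1 -(cardsC1 (0 : F)) SN Nq0 setU0.
  by exists (f 1); rewrite ?fA // Nq0 big_set0 addr0 addn0 mul1r cS.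
have oF : odd q.
  have uN : (-1 : F) \is a GRing.unit by rewrite unitrN1.
  pose m1 : {unit F} := FinRing.unit F uN.
  have om : #[m1]%g = 2%N.
    apply: nt_prime_order => //.
      by rewrite expgS expg1; apply: val_inj; rewrite /= mulrNN mulr1.
    by apply: contra N1 => /eqP/(congr1 val) /= ->.
  have := order_dvdG (in_setT m1); rewrite om card_finField_unit.
  have := card_finRing_gt1 F; case: (#|F|) => // n _ /=; rewrite dvdn2 /=.
  by [].
have [n /andP[n0 nn]] : exists n : F, (n != 0) && ~~ sqr n.
  apply/existsP; apply: contraT; rewrite negb_exists => /forallP H.
  have surj : [set s ^+ 2 | s : F] = setT.
    apply/setP=> x; rewrite inE; apply/imsetP; have := H x; rewrite negb_and !negbK.
    by case/orP=> [/eqP ->|/sqrP[s _ ->]]; [exists 0; rewrite ?expr0n | exists s].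
  have /imset_injP inj : #|[set s ^+ 2 | s : F]| == #|F| by rewrite surj cardsT.
  by case/eqP: N1; apply: (inj 1 (-1)); rewrite ?inE // sqrrN.
have sumN : \sum_(x in Nq) f x = #|Sq|%:R * f n.
  rewrite (reindex_inj (mulIf n0)) /= (eq_bigl (mem Sq)); last first.
    move=> x; rewrite !inE mulf_eq0 (negbTE n0) orbF; apply/idP/idP => [/andP[x0 nxn]|sx].
      by have := nonsqr_div oF (mulf_neq0 x0 n0) n0 nxn nn; rewrite mulfK.
    rewrite (sqr_neq0 sx); apply: contra nn => sxn.
    by have := sqr_mul (sqr_inv sx) sxn; rewrite mulKf ?sqr_neq0.
  rewrite (eq_bigr (fun=> f n)) => [|x]; first by rewrite sumr_const mulr_natl.
  move=> Sx; have /sqrP[s s0 ->] : sqr x by have Sx' : x \in Sq := Sx; rewrite in_set in Sx'.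
  by rewrite fs.
have cN : #|Nq| = #|Sq|.
  rewrite -(card_imset (mem Sq) (mulIf n0)); apply: eq_card => x; rewrite !inE; apply/idP/imsetP => [/andP[x0 nx]|[y]].
    by exists (x / n); rewrite ?divfK // inE nonsqr_div.
  rewrite inE => sy ->; rewrite (mulf_neq0 (sqr_neq0 sy) n0) /=; apply: contra nn => sxn.
  by have := sqr_mul (sqr_inv sy) sxn; rewrite mulKf ?sqr_neq0.
have cS : (q - 1 = 2 * #|Sq|)%N.
  by rewrite subn1 -(cardsC1 (0 : F)) SN cardsU dis cards0 subn0 cN addnn mul2n.
exists (f 1 + f n); first by rewrite rpredD ?fA.
by rewrite sumN cS natrM -[(1 + _)%N]/2%N; ring.
Qed.
End SL2Degrees.

Section SL2DegreeTheorem.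
Variable F : finFieldType.
Local Notation SL := (SL2_group F).
Local Notation Z := 'Z(SL)%G.
Local Notation q := #|F|.
Hypothesis q3 : (3 < q)%N.
Hypothesis dl2 : (0 < #|Z| <= 2)%N.

Lemma cent_SL_abelian x : x \in SL -> x \notin 'Z(SL)%g -> abelian 'C_SL[x].
Proof.
move=> Sx nx; have ns := nonscalar_SL Sx nx.
apply/centsP=> y /centSLP[Sy cy] z /centSLP[Sz cz]; apply: GLval_inj.
by rewrite !GLvalM (comm2_trans ns cy cz).
Qed.

Lemma center_sub_cent x : x \in SL -> Z \subset 'C_SL[x].
Proof.
move=> Sx; apply/subsetP=> z /setIP[Sz /centP cz]; rewrite in_setI Sz; apply/cent1P.
by have c := cz x Sx; rewrite /commute c.
Qed.

Lemma sl_u0 : sl_u (0 : F) = 1%g.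
Proof. by apply: (mulgI (sl_u 0)); rewrite -sl_uM addr0 mulg1. Qed.

Lemma ncent_uE : ncent SL (sl_u (1%R : F)) = [set (p.1 * sl_u p.2)%g | p in setX 'Z(SL)%g [set~ 0 : F]].
Proof.
rewrite /ncent cent_uE; apply/setP=> y; apply/setDP/imsetP => [[/imsetP[[z x] /setXP[Zz _] ->] nZ]|[[z x] /setXP[Zz x0] ->]].
  exists (z, x) => //; apply/setXP; split=> //; rewrite in_setC1; apply: contraNneq nZ => /= ->.
  by rewrite sl_u0 mulg1.
split; first by apply/imsetP; exists (z, x) => //; apply/setXP; rewrite in_setT.
by rewrite /= groupMl // sl_u_noncentral // -in_setC1.
Qed.

Lemma sum_ncent_u (i : Iirr SL) : Z \subset cfker 'chi_i ->
  exists2 sg, sg \in Aint & \sum_(x in ncent SL (sl_u (1%R : F))) 'chi_i x = (q - 1)%:R * sg.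
Proof.
move=> kerZ; have [s x s0|x|sg Asg E] := @sum_square_invariant F (fun x => 'chi_i (sl_u x)).
- by rewrite -sl_tJ // cfunJ // mem_t.
- exact: Aint_irr.
exists sg; rewrite // -E ncent_uE big_imset; last first.
  by move=> p p' Dp Dp'; apply: cent_u_inj; [case: p Dp {Dp'}|case: p' Dp' {Dp}] => a b /setXP[Za _]; apply/setXP; rewrite in_setT.
rewrite (eq_bigr (fun p => 'chi_i (sl_u p.2))) => [|[z x] /setXP[Zz _]]; last first.
  by rewrite /= cfkerMl // (subsetP kerZ).
rewrite (eq_bigl (fun p => (p.1 \in 'Z(SL)%g) && (p.2 \in [set~ 0 : F]))) => [|[z x]]; last by rewrite in_setX.
rewrite -(pair_big (mem 'Z(SL)%g) (mem [set~ 0 : F]) (fun _ x => 'chi_i (sl_u x))) /=.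
by rewrite sumr_const mulr_natl.
Qed.

(** The three centralizers are those of a unipotent, a split and a nonsplit element; traces show
    that their noncentral parts have no conjugates in common. *)
Lemma SL2_degrees (i : Iirr SL) : i != 0 -> Z \subset cfker 'chi_i ->
  degn i = q \/ degn i = (q + 1)%N \/ degn i = (q - 1)%N \/
  ((2 * degn i)%N = (q + 1)%N /\ exists2 n, (n * #|Z| = q - 1)%N & ~~ odd n) \/
  ((2 * degn i)%N = (q - 1)%N /\ exists2 n, (n * #|Z| = q + 1)%N & ~~ odd n).
Proof.
move=> i0 kerZ; have [s s0 s2] := exists_nonroot q3; have [al al_irr] := exists_irr_trace q3.
have o0 := oner_neq0 F.
have G1 := mem_u (1 : F); have n1 := sl_u_noncentral o0.
have G2 := mem_t s0; have n2 := t_noncentral s0 s2.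
have G3 := mem_n al; have n3 := n_noncentral al.
have c1 : #|'C_SL[sl_u (1%R : F)]%g| = (#|Z| * q)%N by exact: card_cent_u.
have c2 := card_cent_t s0 s2; have c3 := card_cent_n al_irr.
have trx (x g : {'GL_2[F]}) : tr2 (GLval (x ^ g)%g) = tr2 (GLval x) by exact: trace_conj.
have D12 g : g \in SL -> (sl_t s ^ g)%g \notin 'C_SL[sl_u (1%R : F)]%g.
  move=> Sg; apply/negP=> /tr_cent_u[a a2 [_ e0 e1]].
  have := trx (sl_t s) g; rewrite /tr2 e0 e1 -/(tr2 _) tr_t // => E.
  have : (s - a) ^+ 2 = 0.
    transitivity (s ^+ 2 - s * (a + a) + a ^+ 2); first by ring.
    by rewrite E a2; field.
  by move/eqP; rewrite sqrf_eq0 subr_eq0 => /eqP sa; rewrite sa a2 eqxx in s2.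
have D13 g : g \in SL -> (sl_n al ^ g)%g \notin 'C_SL[sl_u (1%R : F)]%g.
  move=> Sg; apply/negP=> /tr_cent_u[a a2 [_ e0 e1]].
  have a0 : a != 0 by apply: contraTneq o0 => a0; rewrite -a2 a0 expr0n eqxx.
  have := trx (sl_n al) g; rewrite tr_n /tr2 e0 e1 => E; have := al_irr a a0.
  by rewrite -E (_ : a^-1 = a) ?eqxx //; apply: (mulfI a0); rewrite mulfV // -expr2 a2.
have D23 g : g \in SL -> (sl_n al ^ g)%g \notin 'C_SL[sl_t s]%g.
  move=> Sg; apply/negP=> /(cent_tE s0 s2)[a a0 E]; have := trx (sl_n al) g.
  by rewrite tr_n E tr_t // => E'; have := al_irr a a0; rewrite E' eqxx.
have N1 := @card_normalizer_u F.
have N2 : (#|'N_SL(ncent SL (sl_t s))%g| <= 2 * (q - 1))%N.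
  rewrite -c2; apply: normalizer_bound => // y /(cent_tE s0 s2)[a a0 ->] g Sg E.
  have := trx (sl_t s) g; rewrite -E !tr_t // => E'.
  have : (a - s) * (a - s^-1) = 0.
    transitivity (a ^+ 2 - a * (s + s^-1) + s * s^-1); first by ring.
    by rewrite -E' mulfV //; field.
  move/eqP; rewrite mulf_eq0 !subr_eq0 => /orP[/eqP ->|/eqP ->]; first by left.
  by right; rewrite sl_tV.
have N3 : (#|'N_SL(ncent SL (sl_n al))%g| <= 2 * #|'C_SL[sl_n al]%g|)%N.
  apply: normalizer_bound => // y Cy g Sg E; apply: (same_trace_n al_irr) => //.
    by rewrite in_setI G3 cent1id.
  by rewrite E trx.
have sumG := sum_by_centralizers (@cent_SL_trans F) q3 dl2 (card_SL2 F) (erefl _) G1 n1 G2 n2 G3 n3 c1 c2 c3 D12 D13 D23 N1 N2 N3.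
have [_ _ _ c3'] := conj_counts (@cent_SL_trans F) q3 dl2 (card_SL2 F) (erefl _) G1 n1 G2 n2 G3 n3 c1 c2 c3 D12 D13 D23 N1 N2 N3.
have [n Nn nn] := normalizer3_larger (@cent_SL_trans F) q3 dl2 (card_SL2 F) (erefl _) G1 n1 G2 n2 G3 n3 c1 c2 c3 D12 D13 D23 N1 N2 N3.
have real2 (j : Iirr SL) : {in 'C_SL[sl_t s]%G, forall a, 'chi_j (a^-1)%g = 'chi_j a}.
  by move=> a /(cent_tE s0 s2)[b b0 ->]; rewrite -sl_tJw // cfunJ // mem_w.
(* The element n normalizes without centralizing, so it cannot fix a noncentral a; having the same
   trace, the conjugate of a is its inverse. *)
have real3 (j : Iirr SL) : {in 'C_SL[sl_n al]%G, forall a, 'chi_j (a^-1)%g = 'chi_j a}.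
  move=> a Ca; have Sa : a \in SL by case/setIP: Ca.
  have [Za|nZa] := boolP (a \in 'Z(SL)%g).
    case/SL2_centerP: Za => _ [b b2 Eb]; congr ('chi_j _); apply: (mulgI a); rewrite mulgV.
    apply: GLval_inj; rewrite GLvalM Eb -scalar_mxM -expr2 b2; exact: GL_1E.
  have Sn : n \in SL by case/setIP: Nn.
  have : (a ^ n)%g \in ncent SL (sl_n al) by case/setIP: Nn => _ Nn; rewrite memJ_norm // in_setD nZa.
  case/setDP=> Cb _; case: (same_trace_n al_irr Ca Cb (trx a n)) => E; last by rewrite -E cfunJ.
  case/negP: nn; rewrite -(cent_SL_trans G3 n3 Ca nZa) in_setI Sn; apply/cent1P.
  have c : (a * n = n * a)%g by rewrite conjgC E.
  by rewrite /commute c.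
have cl : degn i != 1%N by apply: contra i0 => /eqP/lin_nat_eq1/(lin_char_SL_trivial q3)/eqP.
have quo (A : {group {'GL_2[F]}}) : Z \subset A -> A \subset SL -> (#|(A / Z)%g| * #|Z| = #|A|)%N.
  move=> ZA AS; rewrite card_quotient ?(subset_trans AS (normal_norm (center_normal SL))) //.
  by rewrite mulnC Lagrange.
have := @degree_cases _ SL 'C_SL[sl_u (1%R : F)]%G 'C_SL[sl_t s]%G 'C_SL[sl_n al]%G q #|Z| q3 dl2 (card_SL2 F) (erefl _)
  (subsetIl _ _) (subsetIl _ _) (subsetIl _ _) (center_sub_cent G1) (center_sub_cent G2) (center_sub_cent G3)
  (cent_SL_abelian G2 n2) (cent_SL_abelian G3 n3) c1 c2 c3' sumG sum_ncent_u real2 real3 i i0 kerZ cl.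
move=> [->|[->|[->|[[E o]|[E o]]]]]; [by left|by right; left|by right; right; left| |].
  right; right; right; left; split=> //; exists #|('C_SL[sl_t s] / Z)%g| => //.
  by rewrite (quo 'C_SL[sl_t s]%G (center_sub_cent G2) (subsetIl _ _)).
right; right; right; right; split=> //; exists #|('C_SL[sl_n al] / Z)%g| => //.
by rewrite (quo 'C_SL[sl_n al]%G (center_sub_cent G3) (subsetIl _ _)).
Qed.
End SL2DegreeTheorem.

(** * Codegrees of PSL(2,q) and the conclusion *)

Section CodegreesPSL2.
Variables (r q k h d : nat) (e : int).
Hypothesis par : psl_params r q k h d e.
Variable F : finFieldType.
Hypothesis cardF : #|F| = q.
Local Notation SL := (SL2_group F).

(** A half degree requires q odd, and the evenness of the opposite torus quotient makes q - 1,
    respectively q + 1, divisible by 4, hence equal to k; so (q + 1)/2, respectively (q - 1)/2, is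
    h. *)
Lemma degree_arith (c n1 n2 : nat) :
  c = q \/ c = (q + 1)%N \/ c = (q - 1)%N \/
  ((2 * c)%N = (q + 1)%N /\ exists2 n, (n * d = q - 1)%N & ~~ odd n) \/
  ((2 * c)%N = (q - 1)%N /\ exists2 n, (n * d = q + 1)%N & ~~ odd n) ->
  [\/ c = q, c = k | exists2 mu, (0 < mu <= d)%N & c = (mu * h)%N].
Proof.
have kE := par_kE par; have hE := par_hE par; have q3 := par_q_gt3 par; have d2 := par_d_gt0 par.
have ev := par_even_q par.
case=> [->|[->|[->|[[E [n nE on]]|[E [n nE on]]]]]]; first by constructor 1.
- case: (par_e1 par) => e1; rewrite e1 in kE hE.
    by constructor 3; exists d; [move: d2; clear; lia | move: hE; clear; lia].
  by constructor 2; move: kE; clear; lia.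
- case: (par_e1 par) => e1; rewrite e1 in kE hE.
    by constructor 2; move: kE q3; clear; lia.
  by constructor 3; exists d; [move: d2; clear; lia | move: hE q3; clear; lia].
- case: (par_caseE par) => [[d1 _ _]|[dd _ /dvdnP[w kw] ee]].
    by have := ev d1; move: E; clear; lia.
  constructor 3; exists 1%N; first by rewrite dd.
  rewrite dd in hE nE; case: ee => e1; rewrite e1 in kE hE; first by move: hE E; clear; lia.
  by exfalso; move: kE kw nE on q3; clear; lia.
case: (par_caseE par) => [[d1 _ _]|[dd _ /dvdnP[w kw] ee]].
  by have := ev d1; move: E q3; clear; lia.
constructor 3; exists 1%N; first by rewrite dd.
rewrite dd in hE nE; case: ee => e1; rewrite e1 in kE hE; last by move: hE E q3; clear; lia.
by exfalso; move: kE kw nE on q3; clear; lia.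
Qed.

(** Lifted to SL(2,q), a nonprincipal character has the centre as its kernel, so its codegree is qkh
    over its degree. *)
Lemma cod_ok_PSL2 : cod_ok q k h d (PSL2 F).
Proof.
move=> j j0; have nZ : 'Z(SL)%G <| SL by exact: center_normal.
pose i : Iirr SL := mod_Iirr j.
have i0 : i != 0 by rewrite /i mod_Iirr_eq0.
have q3 : (3 < #|F|)%N by rewrite cardF (par_q_gt3 par).
have cz := card_center_par par cardF.
have kerZ : 'Z(SL)%G \subset cfker 'chi_i by rewrite /i mod_IirrE // cfker_mod.
have kerE : cfker 'chi_i = 'Z(SL)%g by apply/eqP; rewrite eqEsubset kerZ cfker_SL_central.
have dl2 : (0 < #|'Z(SL)%G| <= 2)%N by rewrite cz (par_d_gt0 par).
have dg : [\/ degn i = q, degn i = k | exists2 mu, (0 < mu <= d)%N & degn i = (mu * h)%N].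
  by apply: (degree_arith 0 0); have := SL2_degrees q3 dl2 i0 kerZ; rewrite cardF cz.
have cE : cod j = (q * k * h)%:R / (degn i)%:R.
  rewrite -(cod_mod nZ) -/i /cod degnE kerE; congr (_%:R / _).
  by rewrite -(card_PSL2 par cardF) /PSL2 /= card_quotient // normal_norm.
have di0 : ((degn i)%:R : algC) != 0 by rewrite pnatr_eq0 -lt0n degn_gt0.
have fin c : (c * degn i = q * k * h)%N -> cod j = c%:R by move=> E; rewrite cE -E natrM mulfK.
have [k3 h3] := par_ge3 par.
case: dg => [E|E|[mu mud E]].
- by exists (k * h)%N; [apply: fin; rewrite E; ring | constructor 1].
- by exists (q * h)%N; [apply: fin; rewrite E; ring | constructor 2].
have [c cmu] : exists c, (c * mu = q * k)%N.
  have mu12 : mu = 1%N \/ (mu = 2%N /\ d = 2%N).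
    by move: mud (par_d_gt0 par); clear; lia.
  case: mu12 => [->|[-> dd]]; first by exists (q * k)%N; rewrite muln1.
  case: (par_caseE par) => [[d1 _ _]|[_ _ /dvdnP[w kw] _]]; first by rewrite d1 in dd.
  by exists (q * (w * 2))%N; rewrite kw; ring.
exists c; last by constructor 3; exists mu.
by apply: fin; rewrite E mulnA cmu.
Qed.

Lemma PSL2_nonprincipal : exists j : Iirr (PSL2 F), j != 0.
Proof.
apply/existsP; apply: contraT; rewrite negb_exists => /forallP H.
have := sum_degn_sqr (PSL2 F); rewrite (bigD1 0) //= big1 => [|i i0]; last by have := H i; rewrite i0.
rewrite degn0 addn0 (card_PSL2 par cardF) => E; have [k3 h3] := par_ge3 par; have q3 := par_q_gt3 par.
by exfalso; move: E; apply/eqP; rewrite eq_sym !muln_eq1; move: q3; clear; case: q => [|[|]].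
Qed.
End CodegreesPSL2.

(** Codegree 1 means |G : ker chi| = chi(1), while chi(1)^2 is at most this index. Equal codegree
    sets thus match nonprincipal characters with nonprincipal ones. *)
Lemma cod_eq1 (gT : finGroupType) (G : {group gT}) (i : Iirr G) : (cod i == 1) = (i == 0).
Proof.
apply/eqP/eqP=> [|->]; last by rewrite /cod cfker_irr0 indexgg irr0 cfun11 divr1.
move=> E; have nK : cfker_group 'chi_i <| G by exact: cfker_normal.
have di0 : ((degn i)%:R : algC) != 0 by rewrite pnatr_eq0 -lt0n degn_gt0.
have iE : #|G : cfker 'chi_i| = degn i.
  by apply/eqP; rewrite -(eqr_nat algC); move: E; rewrite /cod degnE => E; rewrite -[X in X == _](divfK di0) E mul1r.
have := degn_sqr_le (quo_Iirr (cfker_group 'chi_i) i).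
rewrite -(degn_mod nK) quo_IirrK // card_quotient ?normal_norm // iE -mulnn => le.
have d1 : degn i = 1%N by have := degn_gt0 i; move: le; move: (degn i); clear => n; nia.
apply/eqP; rewrite -cfker_irr_eqG eqEsubset cfker_sub /= -indexg_eq1; apply/eqP; exact: etrans iE d1.
Qed.

Lemma psl_params_exist (r f : nat) : prime r -> (0 < f)%N -> (3 < r ^ f)%N ->
  exists k h d e, psl_params r (r ^ f) k h d e.
Proof.
move=> rp f0 q3; have [w qE] : exists w, (r ^ f = w.+4)%N by exists (r ^ f - 4)%N; rewrite -addn4 subnK.
have qX : exists2 f' : nat, (0 < f')%N & (r ^ f)%N = (r ^ f')%N by exists f.
have [or|er] := boolP (odd r); last first.
  have r2 : r = 2%N by case/even_prime: rp er => // ->.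
  exists (w + 3)%N, (w + 5)%N, 1%N, (1 : int); apply: PslParams => //; try (rewrite qE; clear; lia).
  by left.
have oq : odd w by have := oddX r f; rewrite or orbT qE /= !negbK => ->.
have hw : (w = (w./2).*2.+1)%N by rewrite -{1}[w]odd_double_half oq.
have [k4|k4] := boolP (4 %| w + 3)%N.
  exists (w + 3)%N, (w./2 + 3)%N, 2%N, (1 : int); apply: PslParams => //.
  - by rewrite qE; clear; lia.
  - by rewrite qE {2}hw -muln2; clear; lia.
  by right; split=> //; left.
exists (w + 5)%N, (w./2 + 2)%N, 2%N, (-1 : int); apply: PslParams => //.
- by rewrite qE; clear; lia.
- by rewrite qE {2}hw -muln2; clear; lia.
right; split=> //; last by right.
by move: k4 oq; clear; lia.
Qed.

Theorem mainTheorem1 (r f : nat) (F : finFieldType)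
  (gT : finGroupType) (G : {group gT}) :
  prime r -> (0 < f)%N -> #|F| = (r ^ f)%N -> (3 < r ^ f)%N ->
  codset G =i codset (PSL2 F) ->
  G \isog PSL2 F.
Proof.
move=> rp f0 cardF q3 eqcod; have [k [h [d [e par]]]] := psl_params_exist rp f0 q3.
have okP := cod_ok_PSL2 par cardF.
have okG : cod_ok (r ^ f) k h d G.
  move=> i i0; have : cod i \in codset G by apply/existsP; exists i.
  rewrite eqcod => /existsP[j /eqP Ej]; rewrite -Ej; apply: okP.
  by rewrite -cod_eq1 Ej cod_eq1.
have ntG : G :!=: 1%g.
  have [j j0] := PSL2_nonprincipal par cardF.
  have : cod j \in codset (PSL2 F) by apply/existsP; exists j.
  rewrite -eqcod => /existsP[i /eqP Ei]; have i0 : i != 0 by rewrite -cod_eq1 Ei cod_eq1.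
  apply: contraNneq i0 => G1; rewrite -cfker_irr_eqG eqEsubset cfker_sub /=.
  by rewrite {1}G1 sub1G.
have simG := cod_ok_simple par ntG okG.
have [cardG degG] := simple_order_degrees par simG okG.
have H := isog_PSL2 par cardF cardG degG.
exact: H.
Qed.
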